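(* Assume the standing setting below and the condition (SS$_\kappa$) below for some $\kappa\ge C_{2C}$ (the constant of the Lipschitz assumption on $H_\theta$ with $R=2C$). Assume moreover that one of the following two sets of hypotheses holds: (A) $p\mapsto H_\theta(x,p)$ is convex for all $x\in\mathbb T^N$, $\theta\in\Theta$, and for all $x\in\Sigma$, $0<\lambda<1$, $p\ne q$: $\inf_{\theta}\{\lambda H_\theta(x,p)+(1-\lambda)H_\theta(x,q)-H_\theta(x,\lambda p+(1-\lambda)q)\}>0$; (B) there exists $\mu_0>1$ such that, with $c$ the ergodic constant, $H_\theta(x,\mu p)-\mu H_\theta(x,p)\ge(1-\mu)c$ for all $(x,p)$, $\theta$, $1<\mu<\mu_0$; and there is a (possibly empty) compact $K\subset\Sigma$ with $H_\theta(x,p)\ge c$ on $K\times\mathbb R^N$ for all $\theta$, and $\inf_\theta\{H_\theta(x,\mu p)-\mu H_\theta(x,p)\}>(1-\mu)c$ for all $x\in\Sigma$ with $\operatorname{dist}(x,K)\neq0$, all $p\ne0$, all $1<\mu\le\mu_0$. Then $u(\cdot,t)+ct$ converges uniformly on $\mathbb T^N$, as $t\to+\infty$, to a viscosity solution of (S).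
   Context: Standing setting. $\mathbb T^N=\mathbb R^N/\mathbb Z^N$ is the flat torus, $\Theta$ is a metric space and $C>0$ is a fixed constant. For every $\theta\in\Theta$: $\sigma_\theta\in W^{1,\infty}(\mathbb T^N;\mathcal M_N)$ with $|\sigma_\theta|,|D\sigma_\theta|\le C$, and $A_\theta=\sigma_\theta\sigma_\theta^T$; $H_\theta\in W^{1,\infty}_{\rm loc}(\mathbb T^N\times\mathbb R^N)$ with $|H_\theta(x,0)|\le C$, and for every $R>0$ there is $C_R>0$ independent of $\theta$ with $|H_\theta(x,p)-H_\theta(y,q)|\le C_R(|x-y|+|p-q|)$ for $x,y\in\mathbb T^N$, $|p|,|q|\le R$. Consider (E) $u_t+\sup_{\theta\in\Theta}\{-\mathrm{tr}(A_\theta(x)D^2u)+H_\theta(x,Du)\}=0$ in $\mathbb T^N\times(0,\infty)$, $u(x,0)=u_0(x)$; (E$_\lambda$) $\lambda v_\lambda+\sup_{\theta}\{-\mathrm{tr}(A_\theta(x)D^2v_\lambda)+H_\theta(x,Dv_\lambda)\}=0$ in $\mathbb T^N$, $\lambda>0$; (S) $\sup_{\theta}\{-\mathrm{tr}(A_\theta(x)D^2v)+H_\theta(x,Dv)\}=c$ in $\mathbb T^N$. It is assumed that there exist viscosity solutions $u\in C(\mathbb T^N\times[0,\infty))$ of (E) and $v_\lambda\in C(\mathbb T^N)$ of (E$_\lambda$) for all $\lambda>0$ with $|u(x,t)-u(y,t)|,|v_\lambda(x)-v_\lambda(y)|\le C|x-y|$ for all $x,y,t,\lambda$. Under this assumption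 a comparison principle holds, there is a unique constant $c\in\mathbb R$ (the ergodic constant) for which (S) has a solution $v\in W^{1,\infty}(\mathbb T^N)$ (with Lipschitz constant at most $C$), and $u+ct$ is bounded. All solutions are viscosity solutions. $\Sigma:=\{x\in\mathbb T^N: A_\theta(x)=0\text{ for all }\theta\in\Theta\}$. Lifts: $\pi:\mathbb R^N\to\mathbb T^N$ is the projection; $\tilde\Sigma=\pi^{-1}(\Sigma)$, $\tilde\sigma_\theta=\sigma_\theta\circ\pi$, $\tilde A_\theta=\tilde\sigma_\theta\tilde\sigma_\theta^T$, $\tilde\Sigma_\delta=\{\tilde x\in\mathbb R^N:\operatorname{dist}(\tilde x,\tilde\Sigma)\le\delta\}$. Condition (SS$_\kappa$): for every $\delta>0$ there exist $\tilde\psi_\delta\in C^2(\mathbb R^N)$ and a bounded open set $\Omega_\delta\subset\mathbb R^N$ with $[0,1]^N\subset\Omega_\delta$, $\tilde\psi_\delta\le0$ in $\Omega_\delta$, $\tilde\psi_\delta\ge0$ in $\mathbb R^N\setminus\Omega_\delta$, and $\inf_{\theta\in\Theta}\{-\mathrm{tr}(\tilde A_\theta(\tilde x)D^2\tilde\psi_\delta(\tilde x))\}-\kappa|D\tilde\psi_\delta(\tilde x)|>0$ for all $\tilde x\in\tilde\Sigma_\delta^C\cap\Omega_\delta$. *)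

(* Defs.v *)
From Stdlib Require Import Reals ZArith.
From mathcomp Require Import ssreflect ssrfun ssrbool eqtype ssrnat seq fintype bigop.
Set Implicit Arguments.
Unset Strict Implicit.
Open Scope R_scope.

(* points of R^N (lifts of points of the torus) and N x N matrices *)
Definition pt (N : nat) := 'I_N -> R.
Definition mat (N : nat) := 'I_N -> 'I_N -> R.

Definition rsum (N : nat) (f : 'I_N -> R) : R := \big[Rplus/0]_(i < N) f i.
Definition vadd N (x y : pt N) : pt N := fun i => x i + y i.
Definition vsub N (x y : pt N) : pt N := fun i => x i - y i.
Definition vscal N (a : R) (x : pt N) : pt N := fun i => a * x i.
Definition vzero N : pt N := fun _ => 0.
Definition dot N (x y : pt N) : R := rsum (fun i => x i * y i).
Definition vnorm N (x : pt N) : R := sqrt (dot x x).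
Definition mnorm N (M : mat N) : R := sqrt (rsum (fun i => rsum (fun j => M i j * M i j))).
Definition msub N (M P : mat N) : mat N := fun i j => M i j - P i j.

(* Z^N-periodicity: functions on T^N are identified with periodic functions on R^N *)
Definition periodic N (T : Type) (f : pt N -> T) : Prop :=
  forall (x : pt N) (k : 'I_N -> Z), f (fun i => x i + IZR (k i)) = f x.

(* Z^N-periodic subset of R^N (lift of a subset of T^N) *)
Definition periodic_set N (S : pt N -> Prop) : Prop :=
  forall (x : pt N) (k : 'I_N -> Z), S (fun i => x i + IZR (k i)) <-> S x.

Definition rcont N (f : pt N -> R) : Prop :=
  forall x eps, 0 < eps -> exists d, 0 < d /\
    forall y, vnorm (vsub y x) < d -> Rabs (f y - f x) < eps.

Definition rcont2 N (g : pt N -> R -> R) : Prop :=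
  forall x t eps, 0 < eps -> exists d, 0 < d /\
    forall y s, vnorm (vsub y x) < d -> Rabs (s - t) < d -> Rabs (g y s - g x t) < eps.

Definition rcont2_nonneg N (u : pt N -> R -> R) : Prop :=
  forall x t eps, 0 <= t -> 0 < eps -> exists d, 0 < d /\
    forall y s, 0 <= s -> vnorm (vsub y x) < d -> Rabs (s - t) < d ->
      Rabs (u y s - u x t) < eps.

Definition has_grad N (f : pt N -> R) (x g : pt N) : Prop :=
  forall eps, 0 < eps -> exists d, 0 < d /\
    forall h : pt N, vnorm h < d ->
      Rabs (f (vadd x h) - f x - dot g h) <= eps * vnorm h.

Definition C2 N (f : pt N -> R) (Df : pt N -> pt N) (D2f : pt N -> mat N) : Prop :=
  (forall x, has_grad f x (Df x)) /\
  (forall x i, has_grad (fun y => Df y i) x (fun j => D2f x i j)) /\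
  (forall i j, rcont (fun x => D2f x i j)).

Definition C21 N (phi : pt N -> R -> R) (phit : pt N -> R -> R)
    (Dphi : pt N -> R -> pt N) (D2phi : pt N -> R -> mat N) : Prop :=
  (forall x t, derivable_pt_lim (fun s => phi x s) t (phit x t)) /\
  (forall x t, has_grad (fun y => phi y t) x (Dphi x t)) /\
  (forall x t i, has_grad (fun y => Dphi y t i) x (fun j => D2phi x t i j)) /\
  rcont2 phi /\ rcont2 phit /\
  (forall i, rcont2 (fun x t => Dphi x t i)) /\
  (forall i j, rcont2 (fun x t => D2phi x t i j)).

Section Operator.
Variables (N : nat) (Theta : Type) (sigma : Theta -> pt N -> mat N)
          (H : Theta -> pt N -> pt N -> R).

Definition Amat (th : Theta) (x : pt N) : mat N :=
  fun i j => rsum (fun k => sigma th x i k * sigma th x j k).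

Definition trAX (th : Theta) (x : pt N) (X : mat N) : R :=
  rsum (fun i => rsum (fun j => Amat th x i j * X j i)).

Definition opterm (th : Theta) (x p : pt N) (X : mat N) : R :=
  - trAX th x X + H th x p.

Definition Sigma (x : pt N) : Prop := forall th i j, Amat th x i j = 0.

(* Viscosity solution of  u_t + sup_theta {...} = 0  in T^N x (0,oo),
   continuous on T^N x [0,oo).  "sup_theta F_theta <= a" is written
   "forall theta, F_theta <= a" and "sup_theta F_theta >= a" is written
   "forall eps > 0, exists theta, F_theta >= a - eps". *)
Definition par_visc_sol (u : pt N -> R -> R) : Prop :=
  rcont2_nonneg u /\
  (forall phi phit Dphi D2phi, C21 phi phit Dphi D2phi ->
    forall x0 t0, 0 < t0 ->
    (exists r, 0 < r /\ forall y s, 0 < s -> vnorm (vsub y x0) < r -> Rabs (s - t0) < r ->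
        u y s - phi y s <= u x0 t0 - phi x0 t0) ->
    forall th, phit x0 t0 + opterm th x0 (Dphi x0 t0) (D2phi x0 t0) <= 0) /\
  (forall phi phit Dphi D2phi, C21 phi phit Dphi D2phi ->
    forall x0 t0, 0 < t0 ->
    (exists r, 0 < r /\ forall y s, 0 < s -> vnorm (vsub y x0) < r -> Rabs (s - t0) < r ->
        u y s - phi y s >= u x0 t0 - phi x0 t0) ->
    forall eps, 0 < eps -> exists th,
      phit x0 t0 + opterm th x0 (Dphi x0 t0) (D2phi x0 t0) >= - eps).

(* Continuous viscosity solution of  lam v + sup_theta {...} = c  in T^N.
   (E_lam) is  stat_visc_sol lam 0 v ; (S) is  stat_visc_sol 0 c v. *)
Definition stat_visc_sol (lam c : R) (v : pt N -> R) : Prop :=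
  rcont v /\
  (forall phi Dphi D2phi, C2 phi Dphi D2phi -> forall x0,
    (exists r, 0 < r /\ forall y, vnorm (vsub y x0) < r -> v y - phi y <= v x0 - phi x0) ->
    forall th, lam * v x0 + opterm th x0 (Dphi x0) (D2phi x0) <= c) /\
  (forall phi Dphi D2phi, C2 phi Dphi D2phi -> forall x0,
    (exists r, 0 < r /\ forall y, vnorm (vsub y x0) < r -> v y - phi y >= v x0 - phi x0) ->
    forall eps, 0 < eps -> exists th,
      lam * v x0 + opterm th x0 (Dphi x0) (D2phi x0) >= c - eps).

Definition ergodic_constant (c : R) : Prop :=
  exists v : pt N -> R, periodic v /\
    (exists L, forall x y, Rabs (v x - v y) <= L * vnorm (vsub x y)) /\
    stat_visc_sol 0 c v.

Definition dist_le (S : pt N -> Prop) (x : pt N) (delta : R) : Prop :=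
  forall eps, 0 < eps -> exists y, S y /\ vnorm (vsub x y) < delta + eps.

Definition dist_neq0 (S : pt N -> Prop) (x : pt N) : Prop :=
  ~ (forall eps, 0 < eps -> exists y, S y /\ vnorm (vsub x y) < eps).

Definition open_set (O : pt N -> Prop) : Prop :=
  forall x, O x -> exists r, 0 < r /\ forall y, vnorm (vsub y x) < r -> O y.

Definition bounded_set (O : pt N -> Prop) : Prop :=
  exists M, forall x, O x -> vnorm x <= M.

Definition closed_set (K : pt N -> Prop) : Prop :=
  forall x, (forall eps, 0 < eps -> exists y, K y /\ vnorm (vsub x y) < eps) -> K x.

Definition SS (kappa : R) : Prop :=
  forall delta, 0 < delta ->
  exists (psi : pt N -> R) (Dpsi : pt N -> pt N) (D2psi : pt N -> mat N)
         (Om : pt N -> Prop),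
    C2 psi Dpsi D2psi /\ open_set Om /\ bounded_set Om /\
    (forall x : pt N, (forall i, 0 <= x i <= 1) -> Om x) /\
    (forall x, Om x -> psi x <= 0) /\
    (forall x, ~ Om x -> psi x >= 0) /\
    (forall x, Om x -> ~ dist_le Sigma x delta ->
       exists eta, 0 < eta /\ forall th,
         - trAX th x (D2psi x) - kappa * vnorm (Dpsi x) >= eta).

Definition hypA : Prop :=
  (forall th x p q l, 0 <= l <= 1 ->
     H th x (vadd (vscal l p) (vscal (1 - l) q)) <= l * H th x p + (1 - l) * H th x q) /\
  (forall x p q l, Sigma x -> 0 < l < 1 -> p <> q ->
     exists eta, 0 < eta /\ forall th,
       l * H th x p + (1 - l) * H th x q - H th x (vadd (vscal l p) (vscal (1 - l) q)) >= eta).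

(* Hypothesis set (B); c is the ergodic constant. The compact K of T^N is
   represented by its periodic, closed lift to R^N. *)
Definition hypB (c : R) : Prop :=
  exists mu0, 1 < mu0 /\
  (forall th x p mu, 1 < mu < mu0 -> H th x (vscal mu p) - mu * H th x p >= (1 - mu) * c) /\
  exists K : pt N -> Prop,
    periodic_set K /\ closed_set K /\ (forall x, K x -> Sigma x) /\
    (forall th x p, K x -> H th x p >= c) /\
    (forall x p mu, Sigma x -> dist_neq0 K x -> p <> (@vzero N) -> 1 < mu <= mu0 ->
       exists eta, 0 < eta /\ forall th,
         H th x (vscal mu p) - mu * H th x p >= (1 - mu) * c + eta).

End Operator.

(* Main.v *)
(** Let [w = u + c t] and consider, for [0 < lam < 1] and [eta > 0], the increments
    [lam w(x, t + h) + (1 - lam) v0(x) - w(x, t) - eta h], where [v0] is an ergodic solution in case (A)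
    and [v0 = 0] in case (B).  By convexity (resp. the scaling condition), by [kappa >= C_(2C)] and since
    [|D w| <= C], their relaxed upper limit [Fb(x)] as [t -> oo], with [sup] over [h >= 0], is a subsolution
    of the linear inequality [inf_theta (- tr(A_theta D^2 F)) - kappa |D F| <= 0], tested with small
    gradients.  A small multiple of [psi_delta] is a strict supersolution away from [Sigma], so the
    maximum of [Fb] is attained on [Sigma].  There [A_theta = 0], doubling the variables gives first order
    inequalities for all [theta], and the strict convexity (resp. strict scaling) excludes a maximum
    larger than [O(1 - lam)].  (On [K] in case (B), [w] is nonincreasing in time.)  Letting [lam -> 1] and
    [eta -> 0], [w] is asymptotically nonincreasing in time; hence it approaches a stationary solution
    along some times, and the comparison principle gives convergence.

    The theorem on sums is avoided: for a sum of subsolutions minus a supersolution, sup-convolutions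
    are blown up at the maximum, which reduces the problem to constant coefficient operators, where
    mollified sup-convolutions of the subsolutions are smooth test functions for the supersolution.
    The mean value property needed for mollification is obtained by iterating a random walk, and
    limits along a fixed nonprincipal ultrafilter [W] replace the extraction of subsequences. *)

(* The supremum over [Theta] is what makes a substitute for the theorem on sums possible: a
   subsolution satisfies a linear inequality for every index, so it can be averaged and mollified,
   and only the supersolution selects an index, which it does last. The matrix inequality is
   replaced by a coupling: two walks with direction matrices [a] and [b], driven by the same random
   choices, see their mean squared distance grow by [2 |a - b|^2] per unit of time, and the
   quadratic penalty of the sup-convolution weights this by [B]. In the increments, [h = 0] gives
   [(1 - lam) (v0 - w)], the origin of the bound [O(1 - lam)]. A larger maximum keeps [h] away from
   [0], so that the two times vary independently, with time slopes [eta / lam] on the subsolution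
   side and [eta] on the supersolution side. As [eta / lam > eta], equal momenta are excluded at
   once, which is why strictness of the Hamiltonian is asked for distinct momenta only. The
   gradients at which the Hamiltonian is compared with itself have norm at most [2 C], whence
   [C_(2C)]. *)
Require Import Defs.
From Stdlib Require Import Reals ZArith.
From HB Require Import structures.
From mathcomp Require Import ssreflect ssrfun ssrbool eqtype ssrnat seq fintype bigop.
From mathcomp Require filter classical_sets.
From Stdlib Require Import Lra Lia FunctionalExtensionality ClassicalEpsilon.
From Coquelicot Require Import Coquelicot.
Import Defs.
Open Scope R_scope.
(** Introducing first lets facts pushed onto the goal by [have := ...] serve as hypotheses of the
    decision procedure. *)
Ltac lra := intros; Lra.lra.
Ltac nra := intros; Lra.nra.
Set Implicit Arguments.
Unset Strict Implicit.

(** * Vectors and limits along an ultrafilter *)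

Notation "x +^ y" := (vadd x y) (at level 50, left associativity).
Notation "x -^ y" := (vsub x y) (at level 50, left associativity).
Notation "a *^ x" := (vscal a x) (at level 40, left associativity).

Ltac vunf := rewrite ?/vadd ?/vsub ?/vscal ?/vzero.
Ltac vring := apply: functional_extensionality => ?; vunf; ring.
Ltac vfield := apply: functional_extensionality => ?; vunf; field.

HB.instance Definition _ := Monoid.isComLaw.Build R 0 Rplus
  (fun x y z => esym (Rplus_assoc x y z)) Rplus_comm Rplus_0_l.

Section Rsum.
Variable n : nat.
Implicit Types f g : 'I_n -> R.

Lemma rsum_ext f g : (forall i, f i = g i) -> rsum f = rsum g.
Proof. by move=> fg; apply: eq_bigr => i _. Qed.

Lemma rsum_add f g : rsum (fun i => f i + g i) = rsum f + rsum g.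
Proof. exact: big_split. Qed.

Lemma rsum_scal c f : rsum (fun i => c * f i) = c * rsum f.
Proof.
rewrite /rsum; elim/big_rec2: _ => [|i x y _ ->]; ring.
Qed.

Lemma rsum_sub f g : rsum (fun i => f i - g i) = rsum f - rsum g.
Proof.
rewrite (_ : rsum f - rsum g = rsum f + (-1) * rsum g); last by ring.
by rewrite -rsum_scal -rsum_add; apply: rsum_ext => i; ring.
Qed.

Lemma rsum_le f g : (forall i, f i <= g i) -> rsum f <= rsum g.
Proof.
move=> fg; rewrite /rsum; elim/big_rec2: _ => [|i x y _ xy]; first lra.
by apply: Rplus_le_compat.
Qed.

Lemma rsum_0 : rsum (fun _ : 'I_n => 0) = 0.
Proof. exact: big1_eq. Qed.

Lemma rsum_ge0 f : (forall i, 0 <= f i) -> 0 <= rsum f.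
Proof. by move=> f0; rewrite -rsum_0; apply: rsum_le. Qed.

Lemma rsum_const c : rsum (fun _ : 'I_n => c) = INR n * c.
Proof.
rewrite /rsum big_const_ord; elim: n => [|k IH] /=; first ring.
by rewrite IH; case: k {IH} => [|k] /=; ring.
Qed.

Lemma rsum_abs f : Rabs (rsum f) <= rsum (fun i => Rabs (f i)).
Proof.
rewrite /rsum; elim/big_rec2: _ => [|i x y _ xy]; first by rewrite Rabs_R0; lra.
by apply: Rle_trans (Rabs_triang _ _) _; apply: Rplus_le_compat => //; lra.
Qed.

Lemma rsum_ge1 f j : (forall i, 0 <= f i) -> f j <= rsum f.
Proof.
have -> : rsum f = f j + \big[Rplus/0]_(i < n | i != j) f i by exact: bigD1.
move=> f0; have h : 0 <= \big[Rplus/0]_(i < n | i != j) f i; last lra.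
elim/big_rec: _ => [|i x _ x0]; first lra.
by have := f0 i; lra.
Qed.

Lemma rsum_delta f j : rsum (fun i => if i == j then f i else 0) = f j.
Proof.
set F := fun i : 'I_n => _.
have -> : rsum F = F j + \big[Rplus/0]_(i < n | i != j) F i by exact: bigD1.
by rewrite big1 /F ?eqxx ?Rplus_0_r // => i /negbTE ->.
Qed.
End Rsum.

Lemma rsum_exch m n (f : 'I_m -> 'I_n -> R) :
  rsum (fun i => rsum (fun j => f i j)) = rsum (fun j => rsum (fun i => f i j)).
Proof. exact: exchange_big. Qed.

Lemma rsum_recl n (f : 'I_n.+1 -> R) : rsum f = f ord0 + rsum (fun i => f (lift ord0 i)).
Proof. exact: big_ord_recl. Qed.

Section Vectors.
Variable m : nat.
Implicit Types (x y z v w : pt m) (a b c : R).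

Lemma dotC x y : dot x y = dot y x.
Proof. by apply: rsum_ext => i; ring. Qed.
Lemma dot_addl x y z : dot (x +^ y) z = dot x z + dot y z.
Proof. by rewrite /dot -rsum_add; apply: rsum_ext => i; rewrite /vadd; ring. Qed.
Lemma dot_subl x y z : dot (x -^ y) z = dot x z - dot y z.
Proof. by rewrite /dot -rsum_sub; apply: rsum_ext => i; rewrite /vsub; ring. Qed.
Lemma dot_scall a x z : dot (a *^ x) z = a * dot x z.
Proof. by rewrite /dot -rsum_scal; apply: rsum_ext => i; rewrite /vscal; ring. Qed.
Lemma dot_0l z : dot (@vzero m) z = 0.
Proof. by rewrite /dot -[RHS](rsum_0 m); apply: rsum_ext => i; rewrite /vzero; ring. Qed.
Lemma dot_addr x y z : dot z (x +^ y) = dot z x + dot z y.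
Proof. by rewrite dotC dot_addl !(dotC z). Qed.
Lemma dot_subr x y z : dot z (x -^ y) = dot z x - dot z y.
Proof. by rewrite dotC dot_subl !(dotC z). Qed.
Lemma dot_scalr a x z : dot z (a *^ x) = a * dot z x.
Proof. by rewrite dotC dot_scall (dotC z). Qed.
Lemma dot_0r z : dot z (@vzero m) = 0.
Proof. by rewrite dotC dot_0l. Qed.

Definition dotE := (dot_addl, dot_subl, dot_scall, dot_addr, dot_subr, dot_scalr, dot_0l, dot_0r).

Lemma dot_ge0 x : 0 <= dot x x.
Proof. by apply: rsum_ge0 => i; nra. Qed.

Lemma vnorm_ge0 x : 0 <= vnorm x.
Proof. exact: sqrt_pos. Qed.

Lemma vnorm_sq x : vnorm x * vnorm x = dot x x.
Proof. by apply: sqrt_sqrt; exact: dot_ge0. Qed.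

(** The polynomial [|x + t y|^2] in [t] is nonnegative. It is evaluated at its minimum when
    [dot y y <> 0]; otherwise it is affine in [t], and the chosen [t] would give it the value [-1]
    unless [dot x y = 0]. *)
Lemma CS_sq x y : dot x y * dot x y <= dot x x * dot y y.
Proof.
have H t : 0 <= dot x x + 2 * t * dot x y + t * t * dot y y.
  by have := dot_ge0 (x +^ t *^ y); rewrite !dotE (dotC y x); lra.
have y0 := dot_ge0 y; have x0 := dot_ge0 x.
case: (Req_dec (dot y y) 0) => [e|ne].
  have := H (- (dot x x + 1) / (2 * dot x y)); rewrite e.
  case: (Req_dec (dot x y) 0) => [-> _|ne2]; first nra.
  rewrite (_ : 2 * _ * dot x y = - (dot x x + 1)); last by field.
  lra.
have := H (- dot x y / dot y y).
rewrite (_ : _ + _ + _ = (dot x x * dot y y - dot x y * dot x y) / dot y y); last by field.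
move=> /(Rmult_le_compat_r (dot y y) _ _ y0).
rewrite Rmult_0_l /Rdiv Rmult_assoc Rinv_l //; lra.
Qed.

Lemma CS x y : Rabs (dot x y) <= vnorm x * vnorm y.
Proof.
apply: Rsqr_incr_0_var; last by apply: Rmult_le_pos; exact: vnorm_ge0.
rewrite -Rsqr_abs /Rsqr.
rewrite (_ : vnorm x * vnorm y * (vnorm x * vnorm y) = (vnorm x * vnorm x) * (vnorm y * vnorm y)); last by ring.
by rewrite !vnorm_sq; exact: CS_sq.
Qed.

Lemma CS_le x y : dot x y <= vnorm x * vnorm y.
Proof. by apply: Rle_trans (CS x y); exact: Rle_abs. Qed.

Lemma CS_ge x y : - (vnorm x * vnorm y) <= dot x y.
Proof. by have := CS x y; split_Rabs; lra. Qed.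

Lemma vnorm_le_sq x a : 0 <= a -> dot x x <= a * a -> vnorm x <= a.
Proof. by move=> a0 H; apply: Rsqr_incr_0_var => //; rewrite /Rsqr vnorm_sq. Qed.

Lemma vnorm_lt_sq x a : 0 <= a -> dot x x < a * a -> vnorm x < a.
Proof. by move=> a0 H; have := vnorm_ge0 x; have := vnorm_sq x; nra. Qed.

Lemma vnorm_tri x y : vnorm (x +^ y) <= vnorm x + vnorm y.
Proof.
apply: vnorm_le_sq; first by move: (vnorm_ge0 x) (vnorm_ge0 y); lra.
by rewrite !dotE (dotC y x) -!vnorm_sq; move: (CS_le x y); nra.
Qed.

Lemma vnorm_scal a x : vnorm (a *^ x) = Rabs a * vnorm x.
Proof.
rewrite /vnorm !dotE -Rmult_assoc sqrt_mult_alt; last by nra.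
by rewrite -/(Rsqr a) sqrt_Rsqr_abs.
Qed.

Lemma vnorm_0 : vnorm (@vzero m) = 0.
Proof. by rewrite /vnorm dot_0l sqrt_0. Qed.

Lemma vnorm_subC x y : vnorm (x -^ y) = vnorm (y -^ x).
Proof. by rewrite (_ : x -^ y = (-1) *^ (y -^ x)); [rewrite vnorm_scal Rabs_Ropp Rabs_R1; ring | vring]. Qed.

Lemma vnorm_subxx x : vnorm (x -^ x) = 0.
Proof. by rewrite (_ : x -^ x = @vzero m) ?vnorm_0 //; vring. Qed.

Lemma vdist_tri y x z : vnorm (x -^ z) <= vnorm (x -^ y) + vnorm (y -^ z).
Proof. by apply: Rle_trans (vnorm_tri _ _); right; congr vnorm; vring. Qed.

Lemma vnorm_le_dist x y : vnorm x <= vnorm y + vnorm (x -^ y).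
Proof. by apply: Rle_trans (vnorm_tri _ _); right; congr vnorm; vring. Qed.

Lemma vnorm_sub_le x y : vnorm (x -^ y) <= vnorm x + vnorm y.
Proof.
rewrite (_ : x -^ y = x +^ (-1) *^ y); last by vring.
by apply: Rle_trans (vnorm_tri _ _) _; rewrite vnorm_scal Rabs_Ropp Rabs_R1; lra.
Qed.

Lemma coord_le x i : Rabs (x i) <= vnorm x.
Proof.
apply: Rsqr_incr_0_var; last exact: vnorm_ge0.
rewrite -Rsqr_abs /Rsqr vnorm_sq; apply: (rsum_ge1 (f := fun i => x i * x i)) => j; nra.
Qed.

Lemma vnorm_le_sum x : vnorm x <= rsum (fun i => Rabs (x i)).
Proof.
set s := rsum _.
have s0 : 0 <= s by apply: rsum_ge0 => i; exact: Rabs_pos.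
apply: vnorm_le_sq => //; rewrite /dot {1}/s Rmult_comm -rsum_scal; apply: rsum_le => i.
have := rsum_ge1 (f := fun i => Rabs (x i)) i (fun i => Rabs_pos _); rewrite -/s => h.
have -> : x i * x i = Rabs (x i) * Rabs (x i) by split_Rabs; ring.
by have := Rabs_pos (x i); nra.
Qed.

Lemma vnorm_eq0 x : vnorm x = 0 -> x = @vzero m.
Proof.
move=> e; apply: functional_extensionality => i.
have := coord_le x i; rewrite e => h1; rewrite /vzero.
by move: h1; split_Rabs; lra.
Qed.

Lemma vnorm_coord_bound x a : (forall i, Rabs (x i) <= a) -> vnorm x <= INR m * a.
Proof.
by move=> H; apply: Rle_trans (vnorm_le_sum x) _; rewrite -rsum_const; apply: rsum_le.
Qed.
End Vectors.

Section Ultrafilter.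

(** An ultrafilter finer than the cofinite filter, stated with plain predicates so that only these
    five rules are used afterwards. *)
Lemma exists_ultrafilter : exists W : (nat -> Prop) -> Prop,
  [/\ forall A B : nat -> Prop, (forall n, A n -> B n) -> W A -> W B,
      forall A B : nat -> Prop, W A -> W B -> W (fun n => A n /\ B n),
      forall A : nat -> Prop, W A -> exists n, A n,
      forall A : nat -> Prop, W A \/ W (fun n => ~ A n) &
      forall k, W (fun n => le k n)].
Proof.
pose F (A : nat -> Prop) := exists k, forall n, le k n -> A n.
have FF : @filter.ProperFilter nat F.
  apply: filter.Build_ProperFilter; first by case=> k /(_ k (le_n k)).
  split.
  - by exists O.
  - move=> A B [k Ak] [l Bl]; exists (Nat.max k l) => n kl; split.
      by apply: Ak; lia.
    by apply: Bl; lia.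
  - by move=> A B AB [k Ak]; exists k => n /Ak /AB.
have [G [GU FG]] := filter.ultraFilterLemma FF.
have GP := @filter.ultra_proper _ _ GU.
have GF := @filter.filter_filter _ _ GP.
exists G; split.
- by move=> A B AB; apply: (@filter.filterS _ _ GF).
- by move=> A B; apply: (@filter.filterI _ _ GF).
- by move=> A GA; apply: (@filter.filter_ex _ _ GP A GA).
- by move=> A; apply: (@filter.in_ultra_setVsetC _ G A GU).
- by move=> k; apply: FG; exists k.
Qed.

(** A single global choice: limits of different sequences, at different points, are taken along the
    same indices, so finitely many of them can be combined at a common [n] by [W_and] and [W_ex]. *)
Definition W : (nat -> Prop) -> Prop :=
  proj1_sig (constructive_indefinite_description _ exists_ultrafilter).

Let Wspec := proj2_sig (constructive_indefinite_description _ exists_ultrafilter).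

Lemma W_mono (A B : nat -> Prop) : (forall n, A n -> B n) -> W A -> W B.
Proof. by rewrite /W; case: Wspec => + _ _ _ _; apply. Qed.
Lemma W_and (A B : nat -> Prop) : W A -> W B -> W (fun n => A n /\ B n).
Proof. by rewrite /W; case: Wspec => _ + _ _ _; apply. Qed.
Lemma W_ex (A : nat -> Prop) : W A -> exists n, A n.
Proof. by rewrite /W; case: Wspec => _ _ + _ _; apply. Qed.
Lemma W_or (A : nat -> Prop) : W A \/ W (fun n => ~ A n).
Proof. by rewrite /W; case: Wspec => _ _ _ + _; apply. Qed.
Lemma W_ge k : W (fun n => le k n).
Proof. by rewrite /W; case: Wspec => _ _ _ _; apply. Qed.
Lemma W_all (A : nat -> Prop) : (forall n, A n) -> W A.
Proof. by move=> H; apply: W_mono (W_ge O). Qed.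
Lemma W_contra (A : nat -> Prop) : (W (fun n => ~ A n) -> False) -> W A.
Proof. by move=> H; case: (W_or A). Qed.

Lemma inv_small eps : 0 < eps -> exists k, forall n, le k n -> / INR n.+1 < eps.
Proof.
move=> e0; have [k [k1 k2]] := archimed_cor1 _ e0; exists k => n kn.
apply: Rle_lt_trans k1; apply: Rinv_le_contravar; first by apply: lt_0_INR; lia.
by apply: le_INR; lia.
Qed.

Lemma W_inv eps : 0 < eps -> W (fun n => / INR n.+1 < eps).
Proof. by move=> /inv_small [k H]; apply: W_mono (W_ge k). Qed.

Lemma invS_gt0 n : 0 < / INR n.+1.
Proof. by apply: Rinv_0_lt_compat; apply: lt_0_INR; lia. Qed.

Definition wlim (x : nat -> R) (l : R) := forall eps, 0 < eps -> W (fun n => Rabs (x n - l) < eps).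

(** The limit is the supremum of the [a] lying below the sequence on a [W]-large set; by [W_or] the
    failure of such a bound also holds on a [W]-large set. *)
Lemma wlim_ex (x : nat -> R) M : W (fun n => Rabs (x n) <= M) -> exists l, wlim x l.
Proof.
move=> HM; pose E a := W (fun n => a <= x n).
have bE : bound E.
  exists M => a Ea; have [n [h1 h2]] := W_ex (W_and HM Ea).
  by move: h1; split_Rabs; lra.
have nE : exists a, E a.
  by exists (- M); apply: W_mono HM => n; split_Rabs; lra.
have [l [ub lb]] := completeness E bE nE.
exists l => eps e0.
have A1 : W (fun n => l - eps / 2 <= x n).
  apply: W_contra => h.
  have : is_upper_bound E (l - eps / 2).
    move=> a Ea; have [n [h1 h2]] := W_ex (W_and h Ea); lra.
  by move/lb; lra.
have A2 : W (fun n => ~ (l + eps / 2 <= x n)).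
  case: (W_or (fun n => l + eps / 2 <= x n)) => // h.
  by have := ub _ h; lra.
by apply: W_mono (W_and A1 A2) => n [h1 h2]; split_Rabs; lra.
Qed.

Lemma wlim_le (x : nat -> R) l c : wlim x l -> W (fun n => x n <= c) -> l <= c.
Proof.
move=> xl H; apply: Rnot_lt_le => cl.
have e0 : 0 < l - c by lra.
have [n [h1 h2]] := W_ex (W_and H (xl _ e0)).
by move: h2; split_Rabs; lra.
Qed.

Lemma wlim_ge (x : nat -> R) l c : wlim x l -> W (fun n => c <= x n) -> c <= l.
Proof.
move=> xl H; apply: Rnot_lt_le => cl.
have e0 : 0 < c - l by lra.
have [n [h1 h2]] := W_ex (W_and H (xl _ e0)).
by move: h2; split_Rabs; lra.
Qed.

Lemma W_Iall m (A : 'I_m -> nat -> Prop) : (forall i, W (A i)) -> W (fun n => forall i, A i n).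
Proof.
move=> H.
have : W (fun n => forall i, i \in enum 'I_m -> A i n).
  elim: (enum 'I_m) => [|j l IH]; first by apply: W_all.
  apply: W_mono (W_and (H j) IH) => n [h1 h2] i; rewrite in_cons => /orP[/eqP -> //|]; exact: h2.
by apply: W_mono => n h i; apply: h; rewrite mem_enum.
Qed.

Definition vlim m (x : nat -> pt m) (l : pt m) :=
  forall eps, 0 < eps -> W (fun n => vnorm (x n -^ l) < eps).

Lemma vlim_ex m (x : nat -> pt m) M : W (fun n => vnorm (x n) <= M) -> exists l, vlim x l.
Proof.
move=> HM.
have H i : exists l, wlim (fun n => x n i) l.
  apply: (wlim_ex (M := M)); apply: W_mono HM => n h; apply: Rle_trans h; exact: coord_le.
pose l i := proj1_sig (constructive_indefinite_description _ (H i)).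
have Hl i : wlim (fun n => x n i) (l i) by exact: (proj2_sig (constructive_indefinite_description _ (H i))).
exists l => eps e0.
have d0 : 0 < eps / (INR m + 1) by apply: Rdiv_lt_0_compat => //; have := pos_INR m; lra.
apply: W_mono (W_Iall (fun i => Hl i _ d0)) => n h.
have := @vnorm_coord_bound m (x n -^ l) (eps / (INR m + 1)) (fun i => Rlt_le _ _ (h i)).
move=> h2; apply: Rle_lt_trans h2 _.
have := pos_INR m => m0; have -> : INR m * (eps / (INR m + 1)) = eps - eps / (INR m + 1) by field; lra.
lra.
Qed.
End Ultrafilter.

Section Compactness.
Variable m : nat.
Implicit Types (f : pt m -> R) (A : pt m -> Prop).

Lemma vlim_closed A (x : nat -> pt m) l :
  closed_set A -> vlim x l -> W (fun n => A (x n)) -> A l.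
Proof.
move=> cA xl H; apply: cA => eps e0.
by have [n [h1 h2]] := W_ex (W_and H (xl _ e0)); exists (x n); rewrite vnorm_subC.
Qed.

Lemma rcont_vlim f (x : nat -> pt m) l : rcont f -> vlim x l -> wlim (fun n => f (x n)) (f l).
Proof.
move=> cf xl eps e0; have [d [d0 H]] := cf l eps e0.
by apply: W_mono (xl _ d0) => n; apply: H.
Qed.

(* [F] need only be continuous relatively to [A]. *)
Lemma extreme_value A (F : pt m -> R) x0 M :
  A x0 -> closed_set A -> (forall x, A x -> vnorm x <= M) ->
  (forall x, A x -> forall eps, 0 < eps -> exists d, 0 < d /\
     forall y, A y -> vnorm (y -^ x) < d -> Rabs (F y - F x) < eps) ->
  exists x, A x /\ forall y, A y -> F y <= F x.
Proof.
move=> A0 cA bA cF.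
(* A [W]-limit of any sequence in [A] dominates it in value. This is used first for a sequence along
   which [F] would be unbounded, then for a maximizing one. *)
have seqmax (y : nat -> pt m) : (forall n, A (y n)) -> exists x, A x /\ forall eps, 0 < eps -> W (fun n => F (y n) < F x + eps).
  move=> Ay; have [l yl] : exists l, vlim y l.
    by apply: (vlim_ex (M := M)); apply: W_all => n; apply: bA.
  have Al : A l by apply: (vlim_closed cA yl); apply: W_all.
  exists l; split=> // eps e0; have [d [d0 H]] := cF l Al eps e0.
  apply: W_mono (yl _ d0) => n /(H _ (Ay n)); split_Rabs; lra.
pose E r := exists y, A y /\ F y = r.
have bE : bound E.
  apply: Classical_Prop.NNPP => nb.
  have H n : exists y, A y /\ INR n < F y.
    apply: Classical_Prop.NNPP => h; apply: nb; exists (INR n) => r [y [Ay <-]].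
    by apply: Rnot_lt_le => h2; apply: h; exists y.
  pose y n := proj1_sig (constructive_indefinite_description _ (H n)).
  have Hy n : A (y n) /\ INR n < F (y n) by exact: (proj2_sig (constructive_indefinite_description _ (H n))).
  have [x [Ax Fx]] := seqmax y (fun n => proj1 (Hy n)).
  have [k Hk] := INR_unbounded (F x + 1).
  have [n [h1 h2]] := W_ex (W_and (W_ge k) (Fx 1 Rlt_0_1)).
  by have := le_INR _ _ h1; have := proj2 (Hy n); lra.
have [s [ub lb]] := completeness E bE (ex_intro _ _ (ex_intro _ x0 (conj A0 erefl))).
have H n : exists y, A y /\ s - / INR n.+1 < F y.
  apply: Classical_Prop.NNPP => h.
  have : is_upper_bound E (s - / INR n.+1).
    by move=> r [y [Ay <-]]; apply: Rnot_lt_le => h2; apply: h; exists y.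
  by move/lb; have := invS_gt0 n; lra.
pose y n := proj1_sig (constructive_indefinite_description _ (H n)).
have Hy n : A (y n) /\ s - / INR n.+1 < F (y n) by exact: (proj2_sig (constructive_indefinite_description _ (H n))).
have [x [Ax Fx]] := seqmax y (fun n => proj1 (Hy n)).
exists x; split=> // z Az.
apply: Rle_trans (_ : s <= _); first by apply: ub; exists z.
apply: Rnot_lt_le => h.
have e0 : 0 < (s - F x) / 2 by lra.
have [n [h1 h2]] := W_ex (W_and (W_inv e0) (Fx _ e0)).
by have := proj2 (Hy n); lra.
Qed.

Lemma closed_ball_closed (c : pt m) r : closed_set (fun x => vnorm (x -^ c) <= r).
Proof.
move=> x H; apply: Rnot_lt_le => h.
have e0 : 0 < vnorm (x -^ c) - r by lra.
have [y [h1 h2]] := H _ e0.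
by have := vdist_tri y x c; lra.
Qed.

Lemma extreme_value_ball (F : pt m -> R) c r : 0 <= r -> rcont F ->
  exists x, vnorm (x -^ c) <= r /\ forall y, vnorm (y -^ c) <= r -> F y <= F x.
Proof.
move=> r0 cF; apply: (extreme_value (x0 := c) (M := vnorm c + r)).
- by rewrite vnorm_subxx.
- exact: closed_ball_closed.
- by move=> x h; have := vnorm_le_dist x c; lra.
- by move=> x _ eps e0; have [d [d0 H]] := cF x eps e0; exists d; split=> // y _; apply: H.
Qed.

(** Only [x] is confined to the ball. If uniformity failed along a sequence of pairs, the first
    components would have a [W]-limit, which is also the limit of the second ones. *)
Lemma heine f : rcont f -> forall R0 eps, 0 < eps -> exists d, 0 < d /\
  forall x y, vnorm x <= R0 -> vnorm (y -^ x) < d -> Rabs (f y - f x) < eps.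
Proof.
move=> cf R0 eps e0; apply: Classical_Prop.NNPP => nb.
have H n : exists p : pt m * pt m, [/\ vnorm p.1 <= R0, vnorm (p.2 -^ p.1) < / INR n.+1 & eps <= Rabs (f p.2 - f p.1)].
  apply: Classical_Prop.NNPP => h; apply: nb; exists (/ INR n.+1); split; first exact: invS_gt0.
  move=> x y hx hy; apply: Rnot_le_lt => h2; apply: h; exists (x, y); split=> //.
pose p n := proj1_sig (constructive_indefinite_description _ (H n)).
have Hp n : [/\ vnorm (p n).1 <= R0, vnorm ((p n).2 -^ (p n).1) < / INR n.+1 & eps <= Rabs (f (p n).2 - f (p n).1)] by exact: (proj2_sig (constructive_indefinite_description _ (H n))).
have [l xl] : exists l, vlim (fun n => (p n).1) l.
  by apply: (vlim_ex (M := R0)); apply: W_all => n; case: (Hp n).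
have [d [d0 Hd]] := cf l (eps / 2) ltac:(lra).
have d20 : 0 < d / 2 by lra.
have [n [h1 h2]] := W_ex (W_and (xl _ d20) (W_inv d20)).
have [_ h3 h4] := Hp n.
have h5 : vnorm ((p n).1 -^ l) < d by lra.
have g1 := Hd _ h5.
have g2 : vnorm ((p n).2 -^ l) < d.
  have := vdist_tri (p n).1 (p n).2 l; lra.
have := Hd _ g2; move: g1 h4; split_Rabs; lra.
Qed.

Lemma rcont_bounded f : rcont f -> forall R0, exists M, 0 <= M /\ forall x, vnorm x <= R0 -> Rabs (f x) <= M.
Proof.
move=> cf R0.
case: (Rlt_le_dec R0 0) => [h|r0].
  exists 0; split; first lra.
  by move=> x hx; have := vnorm_ge0 x; lra.
have caf : rcont (fun x => Rabs (f x)).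
  move=> x eps e0; have [d [d0 H]] := cf x eps e0; exists d; split=> // y /H.
  by have := Rabs_triang_inv2 (f y) (f x); lra.
have [x [_ H]] := extreme_value_ball (@vzero m) r0 caf.
exists (Rabs (f x)); split; first exact: Rabs_pos.
move=> y hy; apply: H; rewrite (_ : y -^ @vzero m = y) //; vring.
Qed.
End Compactness.

(** * Twice differentiable functions *)

Lemma fun_choice (A B : Type) (P : A -> B -> Prop) :
  (forall a, exists b, P a b) -> exists f, forall a, P a (f a).
Proof.
move=> H; exists (fun a => proj1_sig (constructive_indefinite_description _ (H a))) => a.
exact: (proj2_sig (constructive_indefinite_description _ (H a))).
Qed.

Lemma eps_le (a b : R) : (forall eps, 0 < eps -> a <= b + eps) -> a <= b.
Proof.
move=> H; apply: Rnot_lt_le => h.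
have e0 : 0 < (a - b) / 2 by lra.
by have := H _ e0; lra.
Qed.

Lemma fin_delta n (P : 'I_n -> R -> Prop) :
  (forall i d d', 0 < d' -> d' <= d -> P i d -> P i d') ->
  (forall i, exists d, 0 < d /\ P i d) -> exists d, 0 < d /\ forall i, P i d.
Proof.
move=> mono H.
have [d [d0 Hd]] : exists d, 0 < d /\ forall i, i \in enum 'I_n -> P i d.
  elim: (enum 'I_n) => [|j l [d [d0 IH]]]; first by exists 1; split=> //; lra.
  have [d' [d'0 Hj]] := H j.
  have m0 : 0 < Rmin d d' by apply: Rmin_pos.
  exists (Rmin d d'); split=> // i; rewrite in_cons => /orP[/eqP ->|/IH Hi].
    by apply: mono Hj => //; exact: Rmin_r.
  by apply: mono Hi => //; exact: Rmin_l.
by exists d; split=> // i; apply: Hd; rewrite mem_enum.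
Qed.

Section Matrices.
Variable m : nat.
Implicit Types (X Y : mat m) (v w : pt m).

Definition mulmv X w : pt m := fun i => rsum (fun j => X i j * w j).
Definition qf X v := dot v (mulmv X v).
Definition madd X Y : mat m := fun i j => X i j + Y i j.
Definition mscal a X : mat m := fun i j => a * X i j.
Definition mtr X : mat m := fun i j => X j i.
Definition mid : mat m := fun i j => if j == i then 1 else 0.
Definition msum X := rsum (fun i => rsum (fun j => Rabs (X i j))).

Lemma mulmv_add X v w : mulmv X (v +^ w) = mulmv X v +^ mulmv X w.
Proof.
apply: functional_extensionality => i; rewrite /mulmv /vadd -rsum_add.
by apply: rsum_ext => j; ring.
Qed.
Lemma mulmv_scal X a v : mulmv X (a *^ v) = a *^ mulmv X v.
Proof.
apply: functional_extensionality => i; rewrite /mulmv /vscal -rsum_scal.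
by apply: rsum_ext => j; ring.
Qed.
Lemma mulmv_sub X v w : mulmv X (v -^ w) = mulmv X v -^ mulmv X w.
Proof.
apply: functional_extensionality => i; rewrite /mulmv /vsub -rsum_sub.
by apply: rsum_ext => j; ring.
Qed.
Lemma mulmv_madd X Y v : mulmv (madd X Y) v = mulmv X v +^ mulmv Y v.
Proof.
apply: functional_extensionality => i; rewrite /mulmv /vadd -rsum_add.
by apply: rsum_ext => j; rewrite /madd; ring.
Qed.
Lemma mulmv_mscal a X v : mulmv (mscal a X) v = a *^ mulmv X v.
Proof.
apply: functional_extensionality => i; rewrite /mulmv /vscal -rsum_scal.
by apply: rsum_ext => j; rewrite /mscal; ring.
Qed.
Lemma mulmv_id v : mulmv mid v = v.
Proof.
apply: functional_extensionality => i; rewrite /mulmv /mid -[RHS](rsum_delta v i).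
by apply: rsum_ext => j; case: eqP => _; ring.
Qed.
Lemma dot_mtr X v w : dot v (mulmv (mtr X) w) = dot w (mulmv X v).
Proof.
rewrite /dot /mulmv /mtr.
rewrite (rsum_ext (g := fun i => rsum (fun j => v i * (X j i * w j)))); last by move=> i; rewrite rsum_scal.
rewrite rsum_exch; apply: rsum_ext => j; rewrite -rsum_scal; apply: rsum_ext => i; ring.
Qed.

Lemma qf_madd X Y v : qf (madd X Y) v = qf X v + qf Y v.
Proof. by rewrite /qf mulmv_madd dot_addr. Qed.
Lemma qf_mscal a X v : qf (mscal a X) v = a * qf X v.
Proof. by rewrite /qf mulmv_mscal dot_scalr. Qed.
Lemma qf_id v : qf mid v = dot v v.
Proof. by rewrite /qf mulmv_id. Qed.
Lemma qf_mtr X v : qf (mtr X) v = qf X v.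
Proof. exact: dot_mtr. Qed.
Lemma qf_scalv X a v : qf X (a *^ v) = a * a * qf X v.
Proof. by rewrite /qf mulmv_scal !dotE; ring. Qed.

Lemma msum_ge0 X : 0 <= msum X.
Proof. by apply: rsum_ge0 => i; apply: rsum_ge0 => j; exact: Rabs_pos. Qed.

Lemma mulmv_bound X w : vnorm (mulmv X w) <= msum X * vnorm w.
Proof.
apply: Rle_trans (vnorm_le_sum _) _; rewrite Rmult_comm -rsum_scal; apply: rsum_le => i.
apply: Rle_trans (rsum_abs _) _; rewrite -rsum_scal; apply: rsum_le => j.
by rewrite Rabs_mult Rmult_comm; apply: Rmult_le_compat_r; [exact: Rabs_pos | exact: coord_le].
Qed.

Lemma bf_bound X v w : Rabs (dot v (mulmv X w)) <= msum X * (vnorm v * vnorm w).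
Proof.
apply: Rle_trans (CS _ _) _.
by have := mulmv_bound X w; have := vnorm_ge0 v; nra.
Qed.

Lemma qf_bound X v : Rabs (qf X v) <= msum X * dot v v.
Proof. by rewrite -vnorm_sq; exact: bf_bound. Qed.

Lemma msum_entry X e : (forall i j, Rabs (X i j) <= e) -> msum X <= INR m * (INR m * e).
Proof.
by move=> H; rewrite -!rsum_const; apply: rsum_le => i; apply: rsum_le.
Qed.

Lemma qf_diff_mat X Y v e : (forall i j, Rabs (X i j - Y i j) <= e) ->
  Rabs (qf X v - qf Y v) <= INR m * (INR m * e) * dot v v.
Proof.
move=> H.
have -> : qf X v - qf Y v = qf (madd X (mscal (-1) Y)) v by rewrite qf_madd qf_mscal; ring.
apply: Rle_trans (qf_bound _ _) _; apply: Rmult_le_compat_r; first exact: dot_ge0.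
apply: msum_entry => i j; rewrite /madd /mscal (_ : X i j + -1 * Y i j = X i j - Y i j) //; ring.
Qed.

Lemma qf_diff_vec X v w :
  Rabs (qf X v - qf X w) <= msum X * (vnorm (v -^ w) * (vnorm v + vnorm w)).
Proof.
have -> : qf X v - qf X w = dot (v -^ w) (mulmv X v) + dot w (mulmv X (v -^ w)).
  by rewrite /qf mulmv_sub !dotE; ring.
apply: Rle_trans (Rabs_triang _ _) _.
by have := bf_bound X (v -^ w) v; have := bf_bound X w (v -^ w); lra.
Qed.
End Matrices.

Section Continuity.
Variable m : nat.
Implicit Types (f g : pt m -> R).

Lemma rcont_const c : rcont (fun _ : pt m => c).
Proof. by move=> x eps e0; exists 1; split; [lra | move=> y _; rewrite Rminus_diag Rabs_R0]. Qed.

Lemma rcont_add f g : rcont f -> rcont g -> rcont (fun x => f x + g x).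
Proof.
move=> cf cg x eps e0.
have [d [d0 H]] := cf x (eps / 2) ltac:(lra); have [d' [d'0 H']] := cg x (eps / 2) ltac:(lra).
exists (Rmin d d'); split; first exact: Rmin_pos.
move=> y hy; have h1 := H y (Rlt_le_trans _ _ _ hy (Rmin_l _ _)).
have h2 := H' y (Rlt_le_trans _ _ _ hy (Rmin_r _ _)).
by move: h1 h2; split_Rabs; lra.
Qed.

Lemma rcont_scal c f : rcont f -> rcont (fun x => c * f x).
Proof.
move=> cf x eps e0.
have c0 : 0 < Rabs c + 1 by have := Rabs_pos c; lra.
have [d [d0 H]] := cf x (eps / (Rabs c + 1)) ltac:(apply: Rdiv_lt_0_compat => //).
exists d; split=> // y /H h; rewrite -Rmult_minus_distr_l Rabs_mult.
have h2 : eps / (Rabs c + 1) * (Rabs c + 1) = eps by field; lra.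
by have := Rabs_pos c; have := Rabs_pos (f y - f x); nra.
Qed.

Lemma rcont_ext f g : (forall x, f x = g x) -> rcont f -> rcont g.
Proof. by move=> /functional_extensionality ->. Qed.

Lemma rcont_sub f g : rcont f -> rcont g -> rcont (fun x => f x - g x).
Proof.
move=> cf cg; apply: rcont_ext (rcont_add cf (rcont_scal (-1) cg)) => x; ring.
Qed.

Lemma rcont_affine f a x0 : rcont f -> rcont (fun x => f (x0 +^ a *^ x)).
Proof.
move=> cf x eps e0; have [d [d0 H]] := cf (x0 +^ a *^ x) eps e0.
have a0 : 0 < Rabs a + 1 by have := Rabs_pos a; lra.
exists (d / (Rabs a + 1)); split; first exact: Rdiv_lt_0_compat.
move=> y hy; apply: H.
have -> : x0 +^ a *^ y -^ (x0 +^ a *^ x) = a *^ (y -^ x) by vring.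
rewrite vnorm_scal.
have h2 : d / (Rabs a + 1) * (Rabs a + 1) = d by field; lra.
by have := Rabs_pos a; have := vnorm_ge0 (y -^ x); nra.
Qed.

Lemma rcont_lip f L : (forall x y, Rabs (f x - f y) <= L * vnorm (x -^ y)) -> rcont f.
Proof.
move=> H x eps e0.
have L0 : 0 < Rabs L + 1 by have := Rabs_pos L; lra.
exists (eps / (Rabs L + 1)); split; first exact: Rdiv_lt_0_compat.
move=> y hy; apply: Rle_lt_trans (H y x) _.
have h2 : eps / (Rabs L + 1) * (Rabs L + 1) = eps by field; lra.
by have := Rle_abs L; have := vnorm_ge0 (y -^ x); nra.
Qed.
End Continuity.

Section Gradients.
Variable m : nat.
Implicit Types (f g : pt m -> R) (x p q : pt m).

Lemma has_grad_cont f x p : has_grad f x p ->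
  forall eps, 0 < eps -> exists d, 0 < d /\ forall y, vnorm (y -^ x) < d -> Rabs (f y - f x) < eps.
Proof.
move=> H eps e0; have [d [d0 Hd]] := H 1 Rlt_0_1.
have p0 : 0 < vnorm p + 2 by have := vnorm_ge0 p; lra.
exists (Rmin d (eps / (vnorm p + 2))); split.
  by apply: Rmin_pos => //; exact: Rdiv_lt_0_compat.
move=> y hy.
have h1 := Rlt_le_trans _ _ _ hy (Rmin_l _ _); have h2 := Rlt_le_trans _ _ _ hy (Rmin_r _ _).
have := Hd _ h1; have -> : x +^ (y -^ x) = y by vring.
have := CS p (y -^ x); have h3 : eps / (vnorm p + 2) * (vnorm p + 2) = eps by field; lra.
have := vnorm_ge0 (y -^ x); have := vnorm_ge0 p.
move=> ? ? h4 h5.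
have h6 : Rabs (f y - f x) <= (vnorm p + 1) * vnorm (y -^ x) by move: h4 h5; split_Rabs; lra.
nra.
Qed.

Lemma has_grad_rcont f Df : (forall x, has_grad f x (Df x)) -> rcont f.
Proof. by move=> H x eps e0; exact: has_grad_cont (H x) _ e0. Qed.

Lemma has_grad_add f g x p q : has_grad f x p -> has_grad g x q ->
  has_grad (fun y => f y + g y) x (p +^ q).
Proof.
move=> Hf Hg eps e0.
have [d [d0 H]] := Hf (eps / 2) ltac:(lra); have [d' [d'0 H']] := Hg (eps / 2) ltac:(lra).
exists (Rmin d d'); split; first exact: Rmin_pos.
move=> h hh; have h1 := H h (Rlt_le_trans _ _ _ hh (Rmin_l _ _)).
have h2 := H' h (Rlt_le_trans _ _ _ hh (Rmin_r _ _)).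
by rewrite dot_addl; move: h1 h2; split_Rabs; lra.
Qed.

Lemma has_grad_scal c f x p : has_grad f x p -> has_grad (fun y => c * f y) x (c *^ p).
Proof.
move=> Hf eps e0.
have c0 : 0 < Rabs c + 1 by have := Rabs_pos c; lra.
have [d [d0 H]] := Hf (eps / (Rabs c + 1)) ltac:(apply: Rdiv_lt_0_compat => //).
exists d; split=> // h /H hh; rewrite dot_scall.
have -> : c * f (x +^ h) - c * f x - c * dot p h = c * (f (x +^ h) - f x - dot p h) by ring.
rewrite Rabs_mult.
have h2 : eps / (Rabs c + 1) * (Rabs c + 1) = eps by field; lra.
have := Rabs_pos c; have := vnorm_ge0 h; have e1 : 0 < eps / (Rabs c + 1) by apply: Rdiv_lt_0_compat.
move: hh; set A := Rabs (_ - _ - _); set E := eps / _ in h2 e1 *; move=> hh ? ?.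
have : Rabs c * A <= Rabs c * (E * vnorm h) by apply: Rmult_le_compat_l.
by rewrite -h2; nra.
Qed.

Lemma has_grad_ext f g x p q : (forall y, f y = g y) -> (forall i, p i = q i) ->
  has_grad f x p -> has_grad g x q.
Proof. by move=> /functional_extensionality -> /functional_extensionality ->. Qed.

Lemma has_grad_affine f a x0 x p : has_grad f (a *^ (x -^ x0)) p ->
  has_grad (fun y => f (a *^ (y -^ x0))) x (a *^ p).
Proof.
move=> Hf eps e0.
have a0 : 0 < Rabs a + 1 by have := Rabs_pos a; lra.
have [d [d0 H]] := Hf (eps / (Rabs a + 1)) ltac:(apply: Rdiv_lt_0_compat => //).
exists (d / (Rabs a + 1)); split; first exact: Rdiv_lt_0_compat.
move=> h hh; have -> : a *^ (x +^ h -^ x0) = a *^ (x -^ x0) +^ a *^ h by vring.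
have h2 : d / (Rabs a + 1) * (Rabs a + 1) = d by field; lra.
have h3 : eps / (Rabs a + 1) * (Rabs a + 1) = eps by field; lra.
have := Rabs_pos a; have hn := vnorm_ge0 h; have e1 : 0 < eps / (Rabs a + 1) by apply: Rdiv_lt_0_compat.
move=> ap; have := H (a *^ h); rewrite vnorm_scal dot_scalr dot_scall => H1.
apply: Rle_trans (H1 _) _; first nra.
move: h3 e1; set E := eps / _; move=> <- e1; nra.
Qed.

Lemma has_grad_lin p x : has_grad (fun y => dot p y) x p.
Proof.
move=> eps e0; exists 1; split; first lra.
move=> h _; rewrite dot_addr (_ : _ - _ - _ = 0); last by ring.
by rewrite Rabs_R0; have := vnorm_ge0 h; nra.
Qed.

Lemma has_grad_const c x : has_grad (fun _ : pt m => c) x (@vzero m).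
Proof.
move=> eps e0; exists 1; split; first lra.
move=> h _; rewrite dot_0l (_ : _ - _ - _ = 0); last by ring.
by rewrite Rabs_R0; have := vnorm_ge0 h; nra.
Qed.

Lemma has_grad_line f x v t p : has_grad f (x +^ t *^ v) p ->
  derivable_pt_lim (fun s => f (x +^ s *^ v)) t (dot p v).
Proof.
move=> Hf eps e0.
have v0 : 0 < vnorm v + 1 by have := vnorm_ge0 v; lra.
have [d [d0 H]] := Hf (eps / (2 * (vnorm v + 1))) ltac:(apply: Rdiv_lt_0_compat => //; lra).
have dd : 0 < d / (vnorm v + 1) by exact: Rdiv_lt_0_compat.
exists (mkposreal _ dd) => h hne /= hh.
have h2 : d / (vnorm v + 1) * (vnorm v + 1) = d by field; lra.
have := H (h *^ v); rewrite vnorm_scal dot_scalr => H1.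
have := H1; have -> : x +^ t *^ v +^ h *^ v = x +^ (t + h) *^ v by vring.
move=> {}H1.
have hp : 0 < Rabs h by exact: Rabs_pos_lt.
have hv := vnorm_ge0 v.
have := H1 ltac:(nra).
have h3 : eps / (2 * (vnorm v + 1)) * (vnorm v + 1) = eps / 2 by field; lra.
have -> : f (x +^ (t + h) *^ v) - f (x +^ t *^ v) - h * dot p v =
  h * ((f (x +^ (t + h) *^ v) - f (x +^ t *^ v)) / h - dot p v) by field.
rewrite Rabs_mult; set A := Rabs (_ / _ - _).
have e1 : 0 < eps / (2 * (vnorm v + 1)) by apply: Rdiv_lt_0_compat => //; lra.
move: h3 e1; set E := eps / _ => h3 e1 h4.
have : A <= E * vnorm v by apply: (Rmult_le_reg_l (Rabs h)) => //; nra.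
nra.
Qed.

(* A function all of whose partial derivatives exist and are continuous is differentiable. *)
Lemma has_grad_partial f (G : pt m -> pt m) :
  (forall x i, derivable_pt_lim (fun a => f (x +^ a *^ (fun j => if j == i then 1 else 0))) 0 (G x i)) ->
  (forall i, rcont (fun x => G x i)) -> forall x, has_grad f x (G x).
Proof.
move=> HP HC x.
pose e i : pt m := fun j => if j == i then 1 else 0.
have HPt y i t : derivable_pt_lim (fun a => f (y +^ a *^ e i)) t (G (y +^ t *^ e i) i).
  have := HP (y +^ t *^ e i) i => H eps e0; have [d Hd] := H eps e0; exists d => h hn hh.
  have := Hd h hn hh; rewrite Rplus_0_l.
  have -> : y +^ t *^ e i +^ h *^ (fun j => if j == i then 1 else 0) = y +^ (t + h) *^ e i by vunf; rewrite /e; vring.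
  by have -> : y +^ t *^ e i +^ 0 *^ (fun j => if j == i then 1 else 0) = y +^ t *^ e i by vring.
move=> eps e0.
pose M := INR (size (enum 'I_m)) + 1.
have M0 : 0 < M by rewrite /M; have := pos_INR (size (enum 'I_m)); lra.
have [d [d0 Hd]] : exists d, 0 < d /\ forall i, forall y, vnorm (y -^ x) < d -> Rabs (G y i - G x i) < eps / M.
  apply: fin_delta => [i d d' _ dd H y hy|i]; first by apply: H; lra.
  by apply: HC; apply: Rdiv_lt_0_compat.
exists d; split=> // h hh.
(* [hl l] keeps the coordinates of [h] listed in [l]. They are added one at a time, and each
   increment of [f] is treated by the mean value theorem in one variable. *)
pose hl (l : seq 'I_m) : pt m := fun j => if j \in l then h j else 0.
have hln l : vnorm (hl l) <= vnorm h.
  apply: vnorm_le_sq; first exact: vnorm_ge0.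
  rewrite vnorm_sq; apply: rsum_le => j; rewrite /hl; case: (j \in l); nra.
have main l : uniq l -> Rabs (f (x +^ hl l) - f x - dot (G x) (hl l)) <= INR (size l) * (eps / M * vnorm h).
  elim: l => [_|j l IH /= /andP[jl ul]].
    have -> : hl [::] = @vzero m by [].
    have -> : x +^ @vzero m = x by vring.
    by rewrite dot_0r /= (_ : _ - _ - _ = 0) ?Rabs_R0; [lra|ring].
  have {}IH := IH ul.
  have E : hl (j :: l) = hl l +^ h j *^ e j.
    apply: functional_extensionality => k; rewrite /hl /vadd /vscal /e in_cons.
    case: eqP => [->|_] /=; last by ring.
    by rewrite (negbTE jl); ring.
  have [t [t1 t2]] : exists t, Rabs t <= Rabs (h j) /\ f (x +^ hl (j :: l)) - f (x +^ hl l) = G (x +^ hl l +^ t *^ e j) j * h j.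
    have -> : x +^ hl (j :: l) = x +^ hl l +^ h j *^ e j by rewrite E; vring.
    have F0 : f (x +^ hl l) = f (x +^ hl l +^ 0 *^ e j) by congr f; vring.
    case: (Rtotal_order (h j) 0) => [lt|[eq|gt]].
    - have [c [c1 c2]] := MVT_cor2 _ _ _ _ lt (fun c _ => HPt (x +^ hl l) j c).
      exists c; split; first by split_Rabs; lra.
      rewrite F0; lra.
    - by exists 0; rewrite eq Rabs_R0; split; [lra | rewrite -F0; ring].
    - have [c [c1 c2]] := MVT_cor2 _ _ _ _ gt (fun c _ => HPt (x +^ hl l) j c).
      exists c; split; first by split_Rabs; lra.
      rewrite F0; lra.
  have near : vnorm (x +^ hl l +^ t *^ e j -^ x) < d.
    apply: Rle_lt_trans hh.
    have -> : x +^ hl l +^ t *^ e j -^ x = hl l +^ t *^ e j by vring.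
    apply: vnorm_le_sq; first exact: vnorm_ge0.
    rewrite vnorm_sq; apply: rsum_le => k; rewrite /hl /vadd /vscal /e.
    case: eqP => [->|_]; last by case: (k \in l); nra.
    rewrite (negbTE jl).
    move: t1; split_Rabs; nra.
  have := Hd j _ near => Gn.
  have D : dot (G x) (hl (j :: l)) = dot (G x) (hl l) + G x j * h j.
    rewrite E !dotE; congr (_ + _).
    have -> : dot (G x) (e j) = G x j; last by ring.
    by rewrite -[RHS](rsum_delta (G x) j); apply: rsum_ext => k; rewrite /e; case: eqP => _; ring.
  have -> : f (x +^ hl (j :: l)) - f x - dot (G x) (hl (j :: l)) =
    (f (x +^ hl l) - f x - dot (G x) (hl l)) + (G (x +^ hl l +^ t *^ e j) j - G x j) * h j.
    by rewrite D; lra.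
  apply: Rle_trans (Rabs_triang _ _) _; rewrite Rabs_mult -/(INR (size l).+1) S_INR.
  have K : Rabs (G (x +^ hl l +^ t *^ e j) j - G x j) * Rabs (h j) <= eps / M * vnorm h.
    by apply: Rmult_le_compat; [exact: Rabs_pos | exact: Rabs_pos | lra | exact: coord_le].
  by lra.
have := main (enum 'I_m) (enum_uniq _); have -> : hl (enum 'I_m) = h by apply: functional_extensionality => j; rewrite /hl mem_enum.
move=> H; apply: Rle_trans H _.
have := vnorm_ge0 h => h0; rewrite -Rmult_assoc; apply: Rmult_le_compat_r => //.
have e1 : 0 < eps / M by exact: Rdiv_lt_0_compat.
have e2 : M * (eps / M) = eps by field; lra.
have -> : INR (size (enum 'I_m)) = M - 1 by rewrite /M; ring.
nra.
Qed.
End Gradients.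

Section C2functions.
Variable m : nat.
Implicit Types (f g : pt m -> R) (x p : pt m).

Lemma C2_rcont f Df D2f : @C2 m f Df D2f -> rcont f.
Proof. by case=> H _; exact: has_grad_rcont H. Qed.

Lemma C2_rcontD f Df D2f : @C2 m f Df D2f -> forall i, rcont (fun x => Df x i).
Proof. by case=> _ [H _] i; apply: (has_grad_rcont (Df := fun x j => D2f x i j)) => x; exact: H. Qed.

Lemma C2_add f Df D2f g Dg D2g : @C2 m f Df D2f -> @C2 m g Dg D2g ->
  C2 (fun x => f x + g x) (fun x => Df x +^ Dg x) (fun x => madd (D2f x) (D2g x)).
Proof.
move=> [f1 [f2 f3]] [g1 [g2 g3]]; split; [|split].
- by move=> x; apply: has_grad_add.
- by move=> x i; apply: has_grad_add (f2 x i) (g2 x i).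
- by move=> i j; apply: rcont_add (f3 i j) (g3 i j).
Qed.

Lemma C2_scal c f Df D2f : @C2 m f Df D2f ->
  C2 (fun x => c * f x) (fun x => c *^ Df x) (fun x => mscal c (D2f x)).
Proof.
move=> [f1 [f2 f3]]; split; [|split].
- by move=> x; apply: has_grad_scal.
- by move=> x i; apply: has_grad_scal (f2 x i).
- by move=> i j; apply: rcont_scal (f3 i j).
Qed.

Lemma C2_affine a x0 f Df D2f : @C2 m f Df D2f ->
  C2 (fun x => f (a *^ (x -^ x0))) (fun x => a *^ Df (a *^ (x -^ x0)))
     (fun x => mscal (a * a) (D2f (a *^ (x -^ x0)))).
Proof.
move=> [f1 [f2 f3]]; split; [|split].
- by move=> x; apply: has_grad_affine.
- move=> x i; have := has_grad_scal a (has_grad_affine (f2 (a *^ (x -^ x0)) i)).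
  by apply: has_grad_ext => // j; rewrite /vscal /mscal; ring.
- move=> i j; apply: rcont_scal.
  apply: rcont_ext (rcont_affine a ((-a) *^ x0) (f3 i j)) => x.
  by congr (D2f _ i j); vring.
Qed.

Lemma C2_ext f Df D2f g Dg D2g : (forall x, f x = g x) -> (forall x i, Df x i = Dg x i) ->
  (forall x i j, D2f x i j = D2g x i j) -> @C2 m f Df D2f -> C2 g Dg D2g.
Proof.
move=> /functional_extensionality -> h1 h2.
have -> : Df = Dg by apply: functional_extensionality => x; apply: functional_extensionality => i.
suff -> : D2f = D2g by [].
by do 3! apply: functional_extensionality => ?.
Qed.

Lemma C2_lin p c : C2 (fun x => dot p x + c) (fun _ => p) (fun _ _ _ => 0).
Proof.
split; [|split].
- move=> x; have := has_grad_add (has_grad_lin p x) (has_grad_const c x).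
  by apply: has_grad_ext => // i; rewrite /vadd /vzero; ring.
- by move=> x i; exact: has_grad_const.
- by move=> i j; exact: rcont_const.
Qed.

(** A quadratic form only sees this part of its matrix, which is the actual Hessian of [qf X / 2]; a
    given [X] need not be symmetric. *)
Definition msym (X : mat m) : mat m := fun i j => (X i j + X j i) / 2.

Lemma qf_msym X v : qf (msym X) v = qf X v.
Proof.
have -> : msym X = mscal (/2) (madd X (mtr X)).
  by apply: functional_extensionality => i; apply: functional_extensionality => j; rewrite /msym /mscal /madd /mtr; field.
rewrite qf_mscal qf_madd qf_mtr; field.
Qed.

Lemma dot_msym X v w : dot v (mulmv (msym X) w) = dot w (mulmv (msym X) v).
Proof.
have {1}<- : mtr (msym X) = msym X; last exact: dot_mtr.
by apply: functional_extensionality => i; apply: functional_extensionality => j; rewrite /mtr /msym; field.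
Qed.

Lemma C2_quad (X : mat m) x0 :
  C2 (fun x => / 2 * qf X (x -^ x0)) (fun x => mulmv (msym X) (x -^ x0)) (fun _ => msym X).
Proof.
split; [|split].
- move=> x eps e0.
  have X0 : 0 < msum X + 1 by have := msum_ge0 X; lra.
  exists (eps / (msum X + 1)); split; first exact: Rdiv_lt_0_compat.
  move=> h hh.
  have -> : / 2 * qf X (x +^ h -^ x0) - / 2 * qf X (x -^ x0) - dot (mulmv (msym X) (x -^ x0)) h = / 2 * qf X h.
    rewrite -!(qf_msym X).
    have -> : x +^ h -^ x0 = (x -^ x0) +^ h by vring.
    move: (x -^ x0) => v; rewrite /qf mulmv_add !dotE.
    rewrite (dotC (mulmv (msym X) v)) (dot_msym X h v).
    field.
  rewrite Rabs_mult (Rabs_pos_eq (/2)); last lra.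
  have := qf_bound X h; rewrite -vnorm_sq.
  have h2 : eps / (msum X + 1) * (msum X + 1) = eps by field; lra.
  have := vnorm_ge0 h; have := msum_ge0 X => s0 hn h3.
  have : msum X * vnorm h <= eps by nra.
  by nra.
- move=> x i; have H := has_grad_lin (fun j => msym X i j) x.
  have := has_grad_add H (has_grad_const (- dot (fun j => msym X i j) x0) x).
  apply: has_grad_ext => [y|j]; last by rewrite /vadd /vzero; ring.
  rewrite /mulmv -/(dot (fun j => msym X i j) (y -^ x0)) dot_subr; ring.
- by move=> i j; exact: rcont_const.
Qed.

Lemma C2_sqdist b x0 :
  C2 (fun x => b * dot (x -^ x0) (x -^ x0)) (fun x => (2 * b) *^ (x -^ x0)) (fun _ => mscal (2 * b) (@mid m)).
Proof.
have := C2_quad (mscal (2 * b) (@mid m)) x0.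
have E : msym (mscal (2 * b) (@mid m)) = mscal (2 * b) (@mid m).
  apply: functional_extensionality => i; apply: functional_extensionality => j; rewrite /msym /mscal /mid.
  by rewrite (eq_sym i j); case: eqP => _; field.
rewrite E; apply: C2_ext => // [x|x i].
  by rewrite qf_mscal qf_id; field.
by rewrite mulmv_mscal mulmv_id.
Qed.

Lemma C2_line f Df D2f x v : @C2 m f Df D2f ->
  forall t, derivable_pt_lim (fun s => dot (Df (x +^ s *^ v)) v) t (qf (D2f (x +^ t *^ v)) v).
Proof.
move=> [_ [H _]] t.
(* The chain rule yields the transpose of the Hessian, which has the same quadratic form. *)
have G : has_grad (fun y => dot (Df y) v) (x +^ t *^ v) (mulmv (mtr (D2f (x +^ t *^ v))) v).
  move: (x +^ t *^ v) => y eps e0.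
  have M0 : 0 < INR m * vnorm v + 1 by have := pos_INR m; have := vnorm_ge0 v; nra.
  have [d [d0 Hd]] : exists d, 0 < d /\ forall i, forall h, vnorm h < d -> Rabs (Df (y +^ h) i - Df y i - dot (fun j => D2f y i j) h) <= eps / (INR m * vnorm v + 1) * vnorm h.
    apply: fin_delta => [i d d' _ dd K h hh|i]; first by apply: K; lra.
    by apply: H; apply: Rdiv_lt_0_compat.
  exists d; split=> // h hh.
  have -> : dot (Df (y +^ h)) v - dot (Df y) v - dot (mulmv (mtr (D2f y)) v) h =
     rsum (fun i => (Df (y +^ h) i - Df y i - dot (fun j => D2f y i j) h) * v i).
    rewrite (dotC _ h) dot_mtr /dot -!rsum_sub; apply: rsum_ext => i; rewrite /mulmv; ring.
  apply: Rle_trans (rsum_abs _) _.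
  apply: Rle_trans (_ : rsum (fun _ : 'I_m => eps / (INR m * vnorm v + 1) * vnorm h * vnorm v) <= _).
    apply: rsum_le => i; rewrite Rabs_mult; apply: Rmult_le_compat; try exact: Rabs_pos; last exact: coord_le.
    exact: Hd.
  rewrite rsum_const.
  have h2 : eps / (INR m * vnorm v + 1) * (INR m * vnorm v + 1) = eps by field; lra.
  have := vnorm_ge0 h; have e1 : 0 < eps / (INR m * vnorm v + 1) by exact: Rdiv_lt_0_compat.
  move: h2 e1; set E := eps / _ => h2 e1 hn; nra.
have := has_grad_line G; rewrite /qf dotC dot_mtr; apply.
Qed.

(** [A] is any number close to the second derivative along the segment. The mean value theorem is
    applied to [g] minus its quadratic model, then to the derivative of that difference. *)
Lemma taylor2 f Df D2f x v A e : @C2 m f Df D2f ->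
  (forall s, 0 <= s <= 1 -> Rabs (qf (D2f (x +^ s *^ v)) v - A) <= e) ->
  Rabs (f (x +^ v) - f x - dot (Df x) v - A / 2) <= e.
Proof.
move=> C H.
pose g s := f (x +^ s *^ v); pose g1 s := dot (Df (x +^ s *^ v)) v.
have dg t : derivable_pt_lim g t (g1 t) by apply: has_grad_line; case: C.
have dg1 t : derivable_pt_lim g1 t (qf (D2f (x +^ t *^ v)) v) by exact: C2_line C t.
have D1 t : derivable_pt_lim (fun s => g s - (g1 0 * s + A / 2 * (s * s))) t (g1 t - (g1 0 + A * t)).
  apply: derivable_pt_lim_minus => //.
  apply/is_derive_Reals; auto_derive => //; field.
have D2 t : derivable_pt_lim (fun s => g1 s - A * s) t (qf (D2f (x +^ t *^ v)) v - A).
  apply: derivable_pt_lim_minus => //.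
  apply/is_derive_Reals; auto_derive => //; field.
have [c [c1 c2]] := MVT_cor2 _ _ _ _ Rlt_0_1 (fun c _ => D1 c).
have [c' [c'1 c'2]] := MVT_cor2 _ _ _ _ (proj1 c2) (fun c _ => D2 c).
have := H c' ltac:(lra).
have -> : f (x +^ v) = g 1 by congr f; vring.
have -> : f x = g 0 by congr f; vring.
have -> : dot (Df x) v = g1 0 by congr (dot (Df _) v); vring.
have -> : g 1 - g 0 - g1 0 - A / 2 = (qf (D2f (x +^ c' *^ v)) v - A) * c by lra.
rewrite Rabs_mult (Rabs_pos_eq c); last lra.
by have := Rabs_pos (qf (D2f (x +^ c' *^ v)) v - A); nra.
Qed.

Lemma second_difference f Df D2f x v A e : @C2 m f Df D2f ->
  (forall s, -1 <= s <= 1 -> Rabs (qf (D2f (x +^ s *^ v)) v - A) <= e) ->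
  Rabs (f (x +^ v) + f (x -^ v) - 2 * f x - A) <= 2 * e.
Proof.
move=> C H.
have h1 := taylor2 (x := x) (v := v) (A := A) (e := e) C (fun s hs => H s ltac:(lra)).
have h2 : Rabs (f (x +^ (-1) *^ v) - f x - dot (Df x) ((-1) *^ v) - A / 2) <= e.
  apply: taylor2 C _ => s hs; rewrite qf_scalv.
  have -> : s *^ ((-1) *^ v) = (-s) *^ v by vring.
  have := H (-s) ltac:(lra).
  by rewrite (_ : -1 * -1 * qf (D2f (x +^ - s *^ v)) v = qf (D2f (x +^ - s *^ v)) v) //; ring.
have E : x -^ v = x +^ (-1) *^ v by vring.
move: h2; rewrite -E dot_scalr => h2.
by move: h1 h2; split_Rabs; lra.
Qed.

(** One predicate serves both notions: [locmax f phi] is contact from above for a subsolution [f],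
    and [locmax phi g] is contact from below for a supersolution [g]. *)
Definition locmax f g x := exists r, 0 < r /\ forall y, vnorm (y -^ x) < r -> f y - g y <= f x - g x.

(** The centre is within [e] of the upper bound, whereas on the sphere of radius [rho] the penalty
    exceeds [e]; hence the penalized maximum is interior. *)
Lemma penalized_max (F : pt m -> R) x0 b rho e M : rcont F -> 0 < rho -> 0 < b ->
  (forall y, vnorm (y -^ x0) <= rho -> F y <= M) -> M - e <= F x0 -> e < b * (rho * rho) ->
  exists x, [/\ vnorm (x -^ x0) < rho, b * dot (x -^ x0) (x -^ x0) <= e &
   forall y, vnorm (y -^ x0) <= rho -> F y - b * dot (y -^ x0) (y -^ x0) <= F x - b * dot (x -^ x0) (x -^ x0)].
Proof.
move=> cF r0 b0 HM H0 he.
have cq : rcont (fun y : pt m => b * dot (y -^ x0) (y -^ x0)) by exact: C2_rcont (C2_sqdist b x0).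
have [x [hx Hx]] := extreme_value_ball x0 (Rlt_le _ _ r0) (rcont_sub cF cq).
have x0b : vnorm (x0 -^ x0) <= rho by rewrite vnorm_subxx; lra.
have := Hx x0 x0b; rewrite (_ : dot (x0 -^ x0) (x0 -^ x0) = 0); last by rewrite -vnorm_sq vnorm_subxx; ring.
have := HM x hx => h1 h2.
have h5 : b * dot (x -^ x0) (x -^ x0) <= e by lra.
exists x; split=> //.
apply: vnorm_lt_sq; first lra.
by apply: (Rmult_lt_reg_l b) => //; lra.
Qed.

(** Stability of contacts under uniform approximation: replacing [f] by [fn] costs [e] at the centre
    and [e] at the competitor, whence [2 * e]. For small [b] the penalty hardly changes the
    derivatives of the test function. *)
Lemma perturbed_max f fn phi x0 b rho e :
  rcont fn -> rcont phi -> 0 < rho -> 0 < b ->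
  (forall y, vnorm (y -^ x0) <= rho -> f y - phi y <= f x0 - phi x0) ->
  (forall y, vnorm (y -^ x0) <= rho -> Rabs (fn y - f y) <= e) -> 2 * e < b * (rho * rho) ->
  exists x, [/\ vnorm (x -^ x0) < rho, b * dot (x -^ x0) (x -^ x0) <= 2 * e &
    locmax fn (fun y => phi y + b * dot (y -^ x0) (y -^ x0)) x].
Proof.
move=> cfn cphi r0 b0 Hmax Hcl He.
have HM y : vnorm (y -^ x0) <= rho -> fn y - phi y <= f x0 - phi x0 + e.
  by move=> hy; have := Hmax y hy; have := Hcl y hy; split_Rabs; lra.
have H0 : f x0 - phi x0 + e - 2 * e <= fn x0 - phi x0.
  by have := Hcl x0 ltac:(rewrite vnorm_subxx; lra); split_Rabs; lra.
have [x [x1 x2 x3]] := penalized_max (rcont_sub cfn cphi) r0 b0 HM H0 He.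
exists x; split=> //; exists (rho - vnorm (x -^ x0)); split; first lra.
by move=> y hy; have := x3 y ltac:(have := vdist_tri x y x0; lra); lra.
Qed.
End C2functions.

(** * Mollification *)

(** Equations under [RInt] are stated in the carrier of a normed module; they are retyped in [R]
    before [ring] is called. *)
Ltac rring := match goal with |- @eq _ ?a ?b => change (@eq R a b); ring end.

Section Kernel.

Let pos (y : R) := Rmax 0 y.

Lemma pos_cases y : (0 <= y /\ Rmax 0 y = y) \/ (y <= 0 /\ Rmax 0 y = 0).
Proof.
case: (Rle_dec 0 y) => h; [left|right]; split; try lra.
  by rewrite Rmax_right.
by rewrite Rmax_left; lra.
Qed.

Lemma sqr_pos_derive y : derivable_pt_lim (fun y => Rmax 0 y * Rmax 0 y) y (2 * Rmax 0 y).
Proof.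
move=> eps e0; exists (mkposreal _ e0) => h hn /= hh.
have hp : 0 < Rabs h by exact: Rabs_pos_lt.
have -> : (Rmax 0 (y + h) * Rmax 0 (y + h) - Rmax 0 y * Rmax 0 y) / h - 2 * Rmax 0 y
  = (Rmax 0 (y + h) * Rmax 0 (y + h) - Rmax 0 y * Rmax 0 y - 2 * Rmax 0 y * h) / h by field.
rewrite Rabs_div //; apply: (Rmult_lt_reg_r (Rabs h)) => //.
rewrite /Rdiv Rmult_assoc Rinv_l; last lra.
rewrite Rmult_1_r; apply: (Rle_lt_trans _ (h * h)).
  have [[h1 ->]|[h1 ->]] := pos_cases (y + h); have [[h2 ->]|[h2 ->]] := pos_cases y;
  apply: Rabs_le; split; nra.
by split_Rabs; nra.
Qed.

(** The mollification kernel is the cube of [bump]: it is twice continuously differentiable and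
    polynomial on its support, which keeps all bounds elementary. At [|s| = 1], [bump] itself is
    only Lipschitz, but its square is differentiable. *)
Definition bump (s : R) := Rmax 0 (1 - s * s).

Lemma bump_derive s : derivable_pt_lim (fun s => bump s * bump s) s (- 4 * s * bump s).
Proof.
have := derivable_pt_lim_comp (fun s => 1 - s * s) _ s (- (2 * s)) _ _ (sqr_pos_derive (1 - s * s)).
rewrite (_ : 2 * Rmax 0 (1 - s * s) * - (2 * s) = - 4 * s * bump s); last by rewrite /bump; ring.
apply.
apply/is_derive_Reals; auto_derive => //; ring.
Qed.

Lemma bump01 s : 0 <= bump s <= 1.
Proof. by rewrite /bump; have [[h1 ->]|[h1 ->]] := pos_cases (1 - s * s); nra. Qed.

Lemma bump_sq s : (1 - s * s) * bump s = bump s * bump s.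
Proof. by rewrite /bump; have [[h1 ->]|[h1 ->]] := pos_cases (1 - s * s); ring. Qed.

Lemma bump_out s : 1 <= Rabs s -> bump s = 0.
Proof. by move=> h; rewrite /bump Rmax_left //; move: h; split_Rabs; nra. Qed.

Lemma bump_lip s t : Rabs s <= 3 -> Rabs t <= 3 -> Rabs (bump s - bump t) <= 6 * Rabs (s - t).
Proof.
move=> hs ht.
have h : Rabs (bump s - bump t) <= Rabs (s * s - t * t).
  rewrite /bump; have [[h1 ->]|[h1 ->]] := pos_cases (1 - s * s);
  have [[h2 ->]|[h2 ->]] := pos_cases (1 - t * t); split_Rabs; nra.
apply: Rle_trans h _; rewrite (_ : s * s - t * t = (s + t) * (s - t)); last by ring.
rewrite Rabs_mult; apply: Rmult_le_compat_r; first exact: Rabs_pos.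
by move: hs ht; split_Rabs; lra.
Qed.

(* [ker n] is [(-1)^n] times the [n]-th derivative of [ker 0] for [n <= 2]. *)
Definition ker (n : nat) (s : R) : R :=
  match n with
  | O => (1 - s * s) * (bump s * bump s)
  | 1%nat => 6 * s * (bump s * bump s)
  | _ => - 6 * (bump s * bump s) + 24 * (s * s) * bump s
  end.

Lemma ker_derive n s : (n < 2)%N -> derivable_pt_lim (ker n) s (- ker n.+1 s).
Proof.
case: n => [|[|//]] _.
- rewrite (_ : - _ = (- (2 * s)) * (bump s * bump s) + (1 - s * s) * (- 4 * s * bump s)); last first.
    rewrite (_ : (1 - s * s) * (-4 * s * bump s) = - 4 * s * ((1 - s * s) * bump s)); last by ring.
    by rewrite bump_sq /ker; ring.
  apply: (derivable_pt_lim_mult (fun s => 1 - s * s) (fun s => bump s * bump s)); last exact: bump_derive.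
  by apply/is_derive_Reals; auto_derive => //; ring.
- rewrite (_ : - _ = 6 * (bump s * bump s) + (6 * s) * (- 4 * s * bump s)); last first.
    by rewrite /ker; ring.
  apply: (derivable_pt_lim_mult (fun s => 6 * s) (fun s => bump s * bump s)); last exact: bump_derive.
  by apply/is_derive_Reals; auto_derive => //; ring.
Qed.

Lemma ker_out n s : 1 <= Rabs s -> ker n s = 0.
Proof. by move=> h; case: n => [|[|n]]; rewrite /ker bump_out //; ring. Qed.

Lemma ker0_ge0 s : 0 <= ker 0 s.
Proof.
have h := bump_sq s; have b := bump01 s.
have -> : ker 0 s = bump s * (bump s * bump s) by rewrite /ker -Rmult_assoc h; ring.
by nra.
Qed.

Lemma sq_le9 s : Rabs s <= 3 -> 0 <= s * s <= 9.
Proof. by split_Rabs; nra. Qed.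

(** The range is [3 = 2 + 1]: integrals run over [[-2, 2]] and kernels are shifted by at most [1].
    The constants here and below are crude. *)
Lemma ker_bound n s : Rabs s <= 3 -> Rabs (ker n s) <= 300.
Proof.
move=> hs; have b := bump01 s; have s9 := sq_le9 hs.
have b2 : 0 <= bump s * bump s <= 1 by nra.
have b3 : 0 <= s * s * bump s <= 9 by nra.
have s3 : -3 <= s <= 3 by move: hs; split_Rabs; lra.
case: n => [|[|n]]; rewrite /ker; apply: Rabs_le; split; nra.
Qed.

Lemma ker2_lip s t : Rabs s <= 3 -> Rabs t <= 3 ->
  Rabs (ker 2 s - ker 2 t) <= 2000 * Rabs (s - t).
Proof.
move=> hs ht; have L := bump_lip hs ht.
have b := bump01 s; have b' := bump01 t; have s9 := sq_le9 hs.
have st : Rabs (s * s - t * t) <= 6 * Rabs (s - t).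
  rewrite (_ : s * s - t * t = (s + t) * (s - t)); last by ring.
  rewrite Rabs_mult; apply: Rmult_le_compat_r; first exact: Rabs_pos.
  by move: hs ht; split_Rabs; lra.
rewrite /ker (_ : _ - _ = ((- 6 * (bump s + bump t)) + 24 * (s * s)) * (bump s - bump t) + 24 * bump t * (s * s - t * t)); last by ring.
apply: Rle_trans (Rabs_triang _ _) _; rewrite (Rabs_mult (_ + _)) (Rabs_mult (24 * bump t)).
have h1 : Rabs (- 6 * (bump s + bump t) + 24 * (s * s)) <= 228 by apply: Rabs_le; lra.
have h2 : Rabs (24 * bump t) <= 24 by apply: Rabs_le; lra.
have h3 := Rabs_pos (bump s - bump t); have h4 := Rabs_pos (s * s - t * t); have h5 := Rabs_pos (s - t).
have h6 : Rabs (- 6 * (bump s + bump t) + 24 * (s * s)) * Rabs (bump s - bump t) <= 228 * (6 * Rabs (s - t)).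
  by apply: Rmult_le_compat => //; exact: Rabs_pos.
have h7 : Rabs (24 * bump t) * Rabs (s * s - t * t) <= 24 * (6 * Rabs (s - t)).
  by apply: Rmult_le_compat => //; exact: Rabs_pos.
lra.
Qed.

Lemma mvt_abs (f f' : R -> R) a b L : (forall c, derivable_pt_lim f c (f' c)) ->
  (forall c, Rmin a b <= c <= Rmax a b -> Rabs (f' c) <= L) -> Rabs (f b - f a) <= L * Rabs (b - a).
Proof.
move=> D H; case: (Rtotal_order a b) => [lt|[->|gt]].
- have [c [c1 c2]] := MVT_cor2 _ _ _ _ lt (fun c _ => D c).
  rewrite c1 Rabs_mult; apply: Rmult_le_compat_r; first exact: Rabs_pos.
  by apply: H; rewrite Rmin_left ?Rmax_right; lra.
- rewrite !Rminus_diag Rabs_R0; lra.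
- have [c [c1 c2]] := MVT_cor2 _ _ _ _ gt (fun c _ => D c).
  rewrite Rabs_minus_sym c1 Rabs_mult (Rabs_minus_sym b); apply: Rmult_le_compat_r; first exact: Rabs_pos.
  by apply: H; rewrite Rmin_right ?Rmax_left; lra.
Qed.

Lemma between_bound a b c r : Rabs a <= r -> Rabs b <= r -> Rmin a b <= c <= Rmax a b -> Rabs c <= r.
Proof.
move=> ha hb; case: (Rle_dec a b) => h.
  by rewrite Rmin_left // Rmax_right //; move: ha hb; split_Rabs; lra.
by rewrite Rmin_right ?Rmax_left; try lra; move: ha hb; split_Rabs; lra.
Qed.

Lemma ker_lip n s t : (n <= 2)%N -> Rabs s <= 3 -> Rabs t <= 3 ->
  Rabs (ker n s - ker n t) <= 2000 * Rabs (s - t).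
Proof.
move=> n2 hs ht.
have n2' : (n < 2)%N \/ n = 2%N by move: n2; rewrite leq_eqVlt => /orP[/eqP ->|]; [right|left].
case: n2' => [{}n2|->]; last exact: ker2_lip.
apply: (mvt_abs (f' := fun s => - ker n.+1 s)) => [c|c hc]; first exact: ker_derive.
have := @ker_bound n.+1 c (between_bound ht hs hc).
by rewrite Rabs_Ropp; lra.
Qed.

(** The function [ker n t + ker n.+1 s * t] has at [t] the derivative [ker n.+1 s - ker n.+1 t],
    which is of order [|b|] between [s] and [s - b] by the Lipschitz bound on [ker n.+1]. *)
Lemma ker_taylor n s b : (n < 2)%N -> Rabs s <= 2 -> Rabs b <= 1 ->
  Rabs (ker n (s - b) - ker n s - b * ker n.+1 s) <= 2000 * (b * b).
Proof.
move=> n2 hs hb.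
pose f t := ker n t + ker n.+1 s * t.
have D t : derivable_pt_lim f t (- ker n.+1 t + ker n.+1 s).
  apply: derivable_pt_lim_plus; first exact: ker_derive.
  by move: (ker n.+1 s) => c; apply/is_derive_Reals; auto_derive => //; ring.
have hs3 : Rabs s <= 3 by lra.
have hsb : Rabs (s - b) <= 3 by move: hs hb; split_Rabs; lra.
have := mvt_abs (a := s) (b := s - b) (L := 2000 * Rabs b) D.
have -> : f (s - b) - f s = ker n (s - b) - ker n s - b * ker n.+1 s by rewrite /f; ring.
have -> : s - b - s = - b by ring.
rewrite Rabs_Ropp Rmult_assoc (_ : Rabs b * Rabs b = b * b); last by split_Rabs; ring.
apply => c hc; have c3 := between_bound hs3 hsb hc.
rewrite (_ : - _ + _ = ker n.+1 s - ker n.+1 c); last by ring.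
apply: Rle_trans (ker_lip _ hs3 c3) _ => //.
apply: Rmult_le_compat_l; first lra.
move: hc; case: (Rle_dec s (s - b)) => h.
  by rewrite Rmin_left // Rmax_right //; split_Rabs; lra.
by rewrite Rmin_right ?Rmax_left; try lra; split_Rabs; lra.
Qed.

Lemma ker_continuous n s : continuous (ker n) s.
Proof.
have cb t : continuous bump t.
  apply/continuity_pt_filterlim => eps e0.
  exists (Rmin 1 (eps / (2 * Rabs t + 2))); split.
    apply: Rmin_pos; first lra.
    by apply: Rdiv_lt_0_compat => //; have := Rabs_pos t; lra.
  move=> x [_ /= hx]; rewrite /R_dist /= in hx *.
  have h1 := Rlt_le_trans _ _ _ hx (Rmin_l _ _); have h2 := Rlt_le_trans _ _ _ hx (Rmin_r _ _).
  have h : Rabs (bump x - bump t) <= Rabs (x * x - t * t).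
    rewrite /bump; have [[k1 ->]|[k1 ->]] := pos_cases (1 - x * x);
    have [[k2 ->]|[k2 ->]] := pos_cases (1 - t * t); split_Rabs; nra.
  apply: Rle_lt_trans h _; rewrite (_ : x * x - t * t = (x + t) * (x - t)); last by ring.
  rewrite Rabs_mult.
  have k : Rabs (x + t) <= 2 * Rabs t + 1 by move: h1; split_Rabs; lra.
  have e2 : eps / (2 * Rabs t + 2) * (2 * Rabs t + 2) = eps by field; have := Rabs_pos t; lra.
  by have := Rabs_pos t; have := Rabs_pos (x - t); have := Rabs_pos (x + t); nra.
have cid t : continuous (fun s : R => s) t by exact: continuous_id.
have cc (c : R) t : continuous (fun _ : R => c) t by exact: continuous_const.
have cm (f g : R -> R) t : continuous f t -> continuous g t -> continuous (fun s => f s * g s) t by exact: (continuous_mult f g).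
have ca (f g : R -> R) t : continuous f t -> continuous g t -> continuous (fun s => f s + g s) t by exact: (continuous_plus f g).
have cs (f g : R -> R) t : continuous f t -> continuous g t -> continuous (fun s => f s - g s) t by exact: (continuous_minus f g).
have c2 t : continuous (fun s => bump s * bump s) t by apply: cm.
have c3 t : continuous (fun s : R => s * s) t by apply: cm.
case: n => [|[|n]].
- by apply: (cm (fun s => 1 - s * s) (fun s => bump s * bump s)) => //; apply: (cs (fun _ => 1) (fun s => s * s)).
- by apply: (cm (fun s => 6 * s) (fun s => bump s * bump s)) => //; apply: (cm (fun _ => 6) (fun s => s)).
- apply: (ca (fun s => -6 * (bump s * bump s)) (fun s => 24 * (s * s) * bump s)).
    by apply: (cm (fun _ => -6) (fun s => bump s * bump s)).
  apply: (cm (fun s => 24 * (s * s)) bump) => //.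
  by apply: (cm (fun _ => 24) (fun s => s * s)).
Qed.

Definition kmass := RInt (ker 0) (-2) 2.

Lemma ker_ex_RInt n a b : ex_RInt (ker n) a b.
Proof. by apply: ex_RInt_continuous => z _; exact: ker_continuous. Qed.

Lemma kmass_gt0 : 0 < kmass.
Proof.
rewrite /kmass.
have <- := RInt_Chasles (ker 0) (-2) (-1) 2 (ker_ex_RInt _ _ _) (ker_ex_RInt _ _ _).
have <- := RInt_Chasles (ker 0) (-1) 1 2 (ker_ex_RInt _ _ _) (ker_ex_RInt _ _ _).
have h1 : 0 <= RInt (ker 0) (-2) (-1).
  by apply: RInt_ge_0; [lra | exact: ker_ex_RInt | move=> x _; exact: ker0_ge0].
have h2 : 0 <= RInt (ker 0) 1 2.
  by apply: RInt_ge_0; [lra | exact: ker_ex_RInt | move=> x _; exact: ker0_ge0].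
have h3 : 0 < RInt (ker 0) (-1) 1.
  apply: RInt_gt_0; [lra | | by move=> x _; exact: ker_continuous].
  move=> x hx; have p : 0 < 1 - x * x by nra.
  rewrite /ker /bump Rmax_right; last lra.
  by apply: Rmult_lt_0_compat => //; nra.
rewrite /plus /=; lra.
Qed.
End Kernel.

Section Mollifier.
Variables (m : nat) (rho : R).
Hypothesis rho0 : 0 < rho.
Implicit Types (f g : pt m -> R) (x y z : pt m) (i j : 'I_m).

Definition unitv i : pt m := fun j => if j == i then 1 else 0.

Lemma unitv_norm i : vnorm (unitv i) <= 1.
Proof.
apply: vnorm_le_sq; first lra.
rewrite Rmult_1_l -[X in _ <= X](rsum_delta (fun _ => 1) i); right; apply: rsum_ext => j.
by rewrite /unitv; case: eqP => _; ring.
Qed.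

(** Convolution in the single direction [i] at scale [rho]; composing over all coordinates gives a
    mollifier built from one-dimensional integrals only. The kernels live on [[-1, 1]], and the
    wider window [[-2, 2]] leaves room for shifting them. *)
Definition cint (k : R -> R) i f x := RInt (fun s => k s * f (x +^ (rho * s) *^ unitv i)) (-2) 2.

Definition kern (k : R -> R) := forall s, continuous k s.

Lemma line_continuous f x i : rcont f -> forall s : R, continuous (fun s => f (x +^ (rho * s) *^ unitv i)) s.
Proof.
move=> cf s; apply/continuity_pt_filterlim => eps e0.
have [d [d0 H]] := cf (x +^ (rho * s) *^ unitv i) eps e0.
exists (d / rho); split; first exact: Rdiv_lt_0_compat.
move=> t [_ /=]; rewrite /R_dist => ht; apply: H.
have -> : x +^ (rho * t) *^ unitv i -^ (x +^ (rho * s) *^ unitv i) = (rho * (t - s)) *^ unitv i by vring.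
rewrite vnorm_scal Rabs_mult (Rabs_pos_eq rho); last lra.
have h : d / rho * rho = d by field; lra.
have := unitv_norm i; have := vnorm_ge0 (unitv i); have := Rabs_pos (t - s).
move=> a b c; apply: (Rle_lt_trans _ (rho * Rabs (t - s))); last by nra.
by rewrite -[X in _ <= X]Rmult_1_r; apply: Rmult_le_compat_l => //; nra.
Qed.

Lemma cint_ex k i f x : kern k -> rcont f ->
  ex_RInt (fun s => k s * f (x +^ (rho * s) *^ unitv i)) (-2) 2.
Proof.
move=> ck cf; apply: ex_RInt_continuous => z _.
apply: (continuous_mult k (fun s => f (x +^ (rho * s) *^ unitv i))); first exact: ck.
exact: line_continuous.
Qed.

Lemma win x i s : -2 <= s <= 2 -> vnorm (x +^ (rho * s) *^ unitv i -^ x) <= 2 * rho.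
Proof.
move=> hs; have -> : x +^ (rho * s) *^ unitv i -^ x = (rho * s) *^ unitv i by vring.
rewrite vnorm_scal Rabs_mult (Rabs_pos_eq rho); last lra.
have h : Rabs s <= 2 by split_Rabs; lra.
have := unitv_norm i; have := vnorm_ge0 (unitv i); have := Rabs_pos s.
move=> a b c; apply: (Rle_trans _ (rho * 2 * 1)); last lra.
by apply: Rmult_le_compat => //; nra.
Qed.

Lemma cint_bound k i f x k0 M : kern k -> rcont f ->
  (forall s, -2 <= s <= 2 -> Rabs (k s) <= k0) ->
  (forall z, vnorm (z -^ x) <= 2 * rho -> Rabs (f z) <= M) ->
  Rabs (cint k i f x) <= 4 * k0 * M.
Proof.
move=> ck cf hk hf; have -> : 4 * k0 * M = (2 - -2) * (k0 * M) by ring.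
apply: abs_RInt_le_const; [lra | exact: cint_ex |].
move=> t ht; rewrite Rabs_mult; apply: Rmult_le_compat; try exact: Rabs_pos.
  exact: hk.
by apply: hf; exact: win.
Qed.

Lemma cint_add k i f g x : kern k -> rcont f -> rcont g ->
  cint k i (fun z => f z + g z) x = cint k i f x + cint k i g x.
Proof.
move=> ck cf cg; rewrite /cint.
have := RInt_plus _ _ _ _ (cint_ex i x ck cf) (cint_ex i x ck cg); rewrite /plus /= => <-.
by apply: RInt_ext => s _; rring.
Qed.

Lemma cint_scal k i c f x : kern k -> rcont f ->
  cint k i (fun z => c * f z) x = c * cint k i f x.
Proof.
move=> ck cf; rewrite /cint.
have := RInt_scal _ _ _ c (cint_ex i x ck cf); rewrite /scal /= /mult /= => <-.
by apply: RInt_ext => s _; rring.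
Qed.

Lemma cint_kadd k k' i f x : kern k -> kern k' -> rcont f ->
  cint (fun s => k s + k' s) i f x = cint k i f x + cint k' i f x.
Proof.
move=> ck ck' cf; rewrite /cint.
have := RInt_plus _ _ _ _ (cint_ex i x ck cf) (cint_ex i x ck' cf); rewrite /plus /= => <-.
by apply: RInt_ext => s _; rring.
Qed.

Lemma cint_kscal k c i f x : kern k -> rcont f ->
  cint (fun s => c * k s) i f x = c * cint k i f x.
Proof.
move=> ck cf; rewrite /cint.
have := RInt_scal _ _ _ c (cint_ex i x ck cf); rewrite /scal /= /mult /= => <-.
by apply: RInt_ext => s _; rring.
Qed.

Lemma cint_shift k i f v x : cint k i (fun z => f (z +^ v)) x = cint k i f (x +^ v).
Proof. by apply: RInt_ext => s _; congr (_ * f _); vring. Qed.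

(** After a change of variables, moving the point amounts to moving the kernel; the pieces between
    the shifted window and [[-2, 2]] contribute nothing since the shifted kernel vanishes there.
    Derivatives thus fall on the kernel, and [f] need only be continuous. *)
Lemma cint_kshift n i f x b : Rabs b <= 1 -> rcont f ->
  cint (ker n) i f (x +^ (rho * b) *^ unitv i) = cint (fun s => ker n (s - b)) i f x.
Proof.
move=> hb cf.
pose F s := ker n (s - b) * f (x +^ (rho * s) *^ unitv i).
have cF s : continuous F s.
  apply: (continuous_mult (fun s => ker n (s - b)) (fun s => f (x +^ (rho * s) *^ unitv i))); last exact: line_continuous.
  apply: (continuous_comp (fun s => s - b) (ker n)); last exact: ker_continuous.
  by apply: (continuous_minus (fun s : R => s) (fun _ => b)); [exact: continuous_id | exact: continuous_const].
have iF a c : ex_RInt F a c by apply: ex_RInt_continuous => z _.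
have := RInt_comp_lin F 1 b (-2) 2 (iF _ _).
rewrite (RInt_ext _ (fun s => ker n s * f (x +^ (rho * b) *^ unitv i +^ (rho * s) *^ unitv i))); last first.
  move=> s _; rewrite /F /scal /= /mult /= (_ : 1 * s + b - b = s); last by ring.
  by rewrite Rmult_1_l; congr (_ * f _); vring.
rewrite /cint => ->.
have zero a c : (forall s, Rmin a c < s < Rmax a c -> 1 <= Rabs (s - b)) -> RInt F a c = 0.
  move=> h; rewrite (RInt_ext F (fun _ => 0)); last by move=> s /h hs; rewrite /F ker_out //; rring.
  by rewrite RInt_const /scal /= /mult /=; rring.
have z1 : RInt F (1 * -2 + b) (-2) = 0.
  by apply: zero => s; rewrite /Rmin /Rmax; case: Rle_dec => _; move: hb; split_Rabs; lra.
have z2 : RInt F 2 (1 * 2 + b) = 0.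
  by apply: zero => s; rewrite /Rmin /Rmax; case: Rle_dec => _; move: hb; split_Rabs; lra.
rewrite -(RInt_Chasles F _ (-2) _ (iF _ _) (iF _ _)) -(RInt_Chasles F (-2) 2 _ (iF _ _) (iF _ _)) z1 z2.
by rewrite /plus /= Rplus_0_l Rplus_0_r.
Qed.

Lemma cint_rcont k i f k0 : kern k -> (forall s, -2 <= s <= 2 -> Rabs (k s) <= k0) ->
  rcont f -> rcont (cint k i f).
Proof.
move=> ck hk cf x eps e0.
have k00 : 0 <= k0 by have := hk 0 ltac:(lra); have := Rabs_pos (k 0); lra.
have e1 : 0 < eps / (4 * k0 + 1) by apply: Rdiv_lt_0_compat; lra.
have [d [d0 H]] := heine cf (vnorm x + 2 * rho) e1.
exists d; split=> // y hy.
have -> : y = x +^ (y -^ x) by vring.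
rewrite -cint_shift.
have cf' : rcont (fun z => f (z +^ (y -^ x))).
  by apply: rcont_ext (rcont_affine 1 (y -^ x) cf) => z; congr f; vring.
have -> : cint k i (fun z => f (z +^ (y -^ x))) x - cint k i f x = cint k i (fun z => f (z +^ (y -^ x)) + (-1) * f z) x.
  by rewrite cint_add ?cint_scal //; [ring | exact: rcont_scal].
have h : Rabs (cint k i (fun z => f (z +^ (y -^ x)) + -1 * f z) x) <= 4 * k0 * (eps / (4 * k0 + 1)).
  apply: cint_bound => //; first by apply: rcont_add => //; exact: rcont_scal.
  move=> z hz; left; rewrite (_ : _ + _ = f (z +^ (y -^ x)) - f z); last by ring.
  apply: H; first by have := vnorm_le_dist z x; lra.
  by have -> : z +^ (y -^ x) -^ z = y -^ x by vring.
have h2 : eps / (4 * k0 + 1) * (4 * k0 + 1) = eps by field; lra.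
by apply: Rle_lt_trans h _; nra.
Qed.

(* [o i] is the order of differentiation of the kernel used in the [i]-th coordinate. *)
Definition jconv (l : seq 'I_m) (o : 'I_m -> nat) f : pt m -> R :=
  foldr (fun i g => cint (ker (o i)) i g) f l.

Lemma ker_kern n : kern (ker n).
Proof. by move=> s; exact: ker_continuous. Qed.

Lemma ker_bound2 n s : -2 <= s <= 2 -> Rabs (ker n s) <= 2000.
Proof. by move=> h; apply: Rle_trans (@ker_bound n s _) _; [split_Rabs; lra | lra]. Qed.

Lemma jconv_rcont l o f : rcont f -> rcont (jconv l o f).
Proof.
by move=> cf; elim: l => //= i l IH; apply: cint_rcont IH; [exact: ker_kern | exact: ker_bound2].
Qed.

Lemma jconv_add l o f g x : rcont f -> rcont g ->
  jconv l o (fun z => f z + g z) x = jconv l o f x + jconv l o g x.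
Proof.
move=> cf cg; elim: l x => //= i l IH x; rewrite -cint_add; try exact: jconv_rcont; last exact: ker_kern.
by congr cint; apply: functional_extensionality.
Qed.

Lemma jconv_scal l o c f x : rcont f ->
  jconv l o (fun z => c * f z) x = c * jconv l o f x.
Proof.
move=> cf; elim: l x => //= i l IH x; rewrite -cint_scal; try exact: jconv_rcont; last exact: ker_kern.
by congr cint; apply: functional_extensionality.
Qed.

Lemma jconv_shift l o f v x : jconv l o (fun z => f (z +^ v)) x = jconv l o f (x +^ v).
Proof.
elim: l x => //= i l IH x; rewrite -cint_shift.
by congr cint; apply: functional_extensionality.
Qed.

Lemma jconv_bound l o f x M : rcont f ->
  (forall z, vnorm (z -^ x) <= 2 * rho * INR (size l) -> Rabs (f z) <= M) ->
  Rabs (jconv l o f x) <= 8000 ^ size l * M.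
Proof.
move=> cf; elim: l x => [|i l IH] x H.
  by rewrite /= Rmult_1_l; apply: H; rewrite vnorm_subxx /=; lra.
have -> : 8000 ^ size (i :: l) * M = 4 * 2000 * (8000 ^ size l * M) by rewrite /=; ring.
apply: cint_bound; [exact: ker_kern | exact: jconv_rcont | exact: ker_bound2 |].
move=> z hz; apply: IH => y hy; apply: H; rewrite [size (_ :: _)]/= S_INR.
by have := vdist_tri z y x; lra.
Qed.

Lemma jconv_ext_ord l o o' f : (forall i, i \in l -> o i = o' i) -> jconv l o f = jconv l o' f.
Proof.
elim: l => //= i l IH H; rewrite H ?mem_head // IH // => j hj.
by apply: H; rewrite in_cons hj orbT.
Qed.

Definition oinc i (o : 'I_m -> nat) : 'I_m -> nat := fun j => if j == i then (o j).+1 else o j.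

(** The factor of coordinate [i] expands by [ker_taylor], with an error quadratic in [b]; the other
    factors are linear integrals through which the expansion passes. As the coordinates in [l] are
    distinct, a single factor carries the derivative. Each [8000] is the window length [4] times the
    kernel bound [2000]. *)
Lemma jconv_partial l o i f x M b : rcont f -> uniq l -> i \in l -> (o i < 2)%N -> Rabs b <= 1 ->
  (forall z, vnorm (z -^ x) <= 2 * rho * INR (size l) -> Rabs (f z) <= M) ->
  Rabs (jconv l o f (x +^ (rho * b) *^ unitv i) - jconv l o f x - b * jconv l (oinc i o) f x)
    <= 8000 ^ size l * (b * b) * M.
Proof.
move=> cf + + oi hb; elim: l x => // j l IH x /= /andP[jl ul] il H.
have Hz z y : vnorm (z -^ x) <= 2 * rho -> vnorm (y -^ z) <= 2 * rho * INR (size l) -> Rabs (f y) <= M.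
  move=> hz hy; apply: H; rewrite -/(INR (size l).+1) S_INR; have := vdist_tri z y x; lra.
have cg := jconv_rcont l o cf.
case: (eqVneq j i) => [e|ne].
- move: jl il; rewrite {}e => jl _.
  have oi' : oinc i o i = (o i).+1 by rewrite /oinc eqxx.
  rewrite cint_kshift // oi'.
  have -> : jconv l (oinc i o) f = jconv l o f.
    by apply: jconv_ext_ord => k hk; rewrite /oinc; case: eqP => // e; move: jl; rewrite -e hk.
  have ks : kern (fun s => ker (o i) (s - b)).
    move=> s; apply: (continuous_comp (fun s => s - b) (ker (o i))); last exact: ker_continuous.
    by apply: (continuous_minus (fun s : R => s) (fun _ => b)); [exact: continuous_id | exact: continuous_const].
  have kc c n : kern (fun s => c * ker n s).
    by move=> s; apply: (continuous_mult (fun _ : R => c) (ker n)); [exact: continuous_const | exact: ker_continuous].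
  have ka k k' : kern k -> kern k' -> kern (fun s => k s + k' s).
    by move=> h h' s; apply: (continuous_plus k k'); [exact: h | exact: h'].
  rewrite (_ : _ - _ - _ = cint (fun s => ker (o i) (s - b) + ((-1) * ker (o i) s + (- b) * ker (o i).+1 s)) i (jconv l o f) x); last first.
    by rewrite !cint_kadd ?cint_kscal //; try exact: ker_kern; try exact: kc; [ring | exact: ka].
  have -> : 8000 * 8000 ^ size l * (b * b) * M = 4 * (2000 * (b * b)) * (8000 ^ size l * M) by ring.
  apply: cint_bound => //; first by apply: (ka) => //; exact: ka.
    move=> s hs; rewrite (_ : _ + _ = ker (o i) (s - b) - ker (o i) s - b * ker (o i).+1 s); last by ring.
    by apply: ker_taylor => //; split_Rabs; lra.
  by move=> z hz; apply: jconv_bound => // y; exact: Hz.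
- have il' : i \in l by move: il; rewrite in_cons eq_sym (negbTE ne).
  have oj : oinc i o j = o j by rewrite /oinc (negbTE ne).
  rewrite oj -cint_shift.
  have cg' := jconv_rcont l (oinc i o) cf.
  have cgs : rcont (fun z => jconv l o f (z +^ (rho * b) *^ unitv i)).
    by apply: rcont_ext (rcont_affine 1 ((rho * b) *^ unitv i) cg) => z; congr (jconv l o f _); vring.
  rewrite (_ : _ - _ - _ = cint (ker (o j)) j (fun z => jconv l o f (z +^ (rho * b) *^ unitv i) + ((-1) * jconv l o f z + (- b) * jconv l (oinc i o) f z)) x); last first.
    rewrite !cint_add ?cint_scal //; try exact: ker_kern; try exact: rcont_scal; first ring.
    by apply: rcont_add; exact: rcont_scal.
  have -> : 8000 * 8000 ^ size l * (b * b) * M = 4 * 2000 * (8000 ^ size l * (b * b) * M) by ring.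
  apply: cint_bound; [exact: ker_kern | | exact: ker_bound2 |].
    by apply: rcont_add => //; apply: rcont_add; exact: rcont_scal.
  move=> z hz; rewrite (_ : _ + _ = jconv l o f (z +^ (rho * b) *^ unitv i) - jconv l o f z - b * jconv l (oinc i o) f z); last by ring.
  by apply: IH => // y; exact: Hz.
Qed.

Let l0 := enum 'I_m.
(** Each of the one-dimensional convolutions moves the point by at most [2 * rho], so values of [f]
    beyond this radius do not enter. *)
Definition jrad := 2 * rho * INR (size l0).

Definition moll f x := / kmass ^ size l0 * jconv l0 (fun _ => 0%N) f x.
Definition Dmoll f x : pt m := fun i => / kmass ^ size l0 * (/ rho * jconv l0 (oinc i (fun _ => 0%N)) f x).
Definition D2moll f x : mat m := fun i j =>
  / kmass ^ size l0 * (/ rho * (/ rho * jconv l0 (oinc j (oinc i (fun _ => 0%N))) f x)).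

Let km : 0 < / kmass ^ size l0.
Proof. by apply: Rinv_0_lt_compat; apply: pow_lt; exact: kmass_gt0. Qed.

Lemma jrad_ge0 : 0 <= jrad.
Proof. by rewrite /jrad; have := pos_INR (size l0); nra. Qed.

Lemma jconv_derive o i f x : rcont f -> (o i < 2)%N ->
  derivable_pt_lim (fun a => jconv l0 o f (x +^ a *^ unitv i)) 0 (/ rho * jconv l0 (oinc i o) f x).
Proof.
move=> cf oi.
have [M [M0 HM]] := rcont_bounded cf (vnorm x + jrad).
move=> eps e0.
pose B := 8000 ^ size l0 * M + 1.
have B0 : 0 < B.
  have p0 : 0 < 8000 ^ size l0 by apply: pow_lt; lra.
  by rewrite /B; nra.
pose d := Rmin rho (eps * (rho * rho) / B).
have d0 : 0 < d.
  by apply: Rmin_pos => //; apply: Rdiv_lt_0_compat => //; apply: Rmult_lt_0_compat => //; nra.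
exists (mkposreal _ d0) => h hn /= hh.
have h1 : Rabs h < rho := Rlt_le_trans _ _ _ hh (Rmin_l _ _).
have h2 : Rabs h < eps * (rho * rho) / B := Rlt_le_trans _ _ _ hh (Rmin_r _ _).
have hb : Rabs (h / rho) <= 1.
  rewrite Rabs_div; last lra.
  rewrite (Rabs_pos_eq rho); last lra.
  by apply: (Rmult_le_reg_r rho) => //; rewrite /Rdiv Rmult_assoc Rinv_l; lra.
have := @jconv_partial l0 o i f x M (h / rho) cf (enum_uniq _) (mem_enum _ _) oi hb.
rewrite -/jrad => H; have {}H := H (fun z hz => HM z ltac:(have := vnorm_le_dist z x; lra)).
move: H; have -> : rho * (h / rho) = h by field; lra.
rewrite Rplus_0_l (_ : x +^ 0 *^ unitv i = x); last by vring.
move=> H.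
have hp : 0 < Rabs h by exact: Rabs_pos_lt.
have -> : (jconv l0 o f (x +^ h *^ unitv i) - jconv l0 o f x) / h - / rho * jconv l0 (oinc i o) f x =
  (jconv l0 o f (x +^ h *^ unitv i) - jconv l0 o f x - h / rho * jconv l0 (oinc i o) f x) / h by field; lra.
rewrite Rabs_div //; apply: (Rmult_lt_reg_r (Rabs h)) => //.
rewrite /Rdiv Rmult_assoc Rinv_l; last lra.
rewrite Rmult_1_r; apply: Rle_lt_trans H _.
have -> : h / rho * (h / rho) = Rabs h * Rabs h / (rho * rho) by split_Rabs; field; lra.
have r2 : 0 < rho * rho by nra.
have h3 : Rabs h * B < eps * (rho * rho).
  have : eps * (rho * rho) / B * B = eps * (rho * rho) by field; lra.
  by nra.
apply: (Rmult_lt_reg_r (rho * rho)) => //.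
have -> : 8000 ^ size l0 * (Rabs h * Rabs h / (rho * rho)) * M * (rho * rho) = 8000 ^ size l0 * M * (Rabs h * Rabs h) by field; lra.
have -> : 8000 ^ size l0 * M = B - 1 by rewrite /B; ring.
nra.
Qed.

Lemma moll_C2 f : rcont f -> C2 (moll f) (Dmoll f) (D2moll f).
Proof.
move=> cf.
have sc c (F : R -> R) l : derivable_pt_lim F 0 l -> derivable_pt_lim (fun a => c * F a) 0 (c * l).
  by move=> H; apply: derivable_pt_lim_scal.
split; [|split].
- apply: has_grad_partial => [x i|i].
    by apply: sc; apply: jconv_derive.
  by apply: rcont_scal; apply: rcont_scal; exact: jconv_rcont.
- move=> x i; move: x; apply: has_grad_partial => [x j|j].
    by apply: (sc); apply: (sc); apply: jconv_derive => //; rewrite /oinc; case: eqP.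
  by apply: rcont_scal; apply: rcont_scal; apply: rcont_scal; exact: jconv_rcont.
- by move=> i j; apply: rcont_scal; apply: rcont_scal; apply: rcont_scal; exact: jconv_rcont.
Qed.

Lemma moll_rcont f : rcont f -> rcont (moll f).
Proof. by move=> cf; exact: C2_rcont (moll_C2 cf). Qed.

Lemma moll_add f g x : rcont f -> rcont g -> moll (fun z => f z + g z) x = moll f x + moll g x.
Proof. by move=> cf cg; rewrite /moll jconv_add //; ring. Qed.

Lemma moll_scal c f x : rcont f -> moll (fun z => c * f z) x = c * moll f x.
Proof. by move=> cf; rewrite /moll jconv_scal //; ring. Qed.

Lemma moll_shift f v x : moll (fun z => f (z +^ v)) x = moll f (x +^ v).
Proof. by rewrite /moll jconv_shift. Qed.

Lemma moll_const c x : moll (fun _ => c) x = c.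
Proof.
have H (l : seq 'I_m) y : jconv l (fun _ => 0%N) (fun _ => c) y = kmass ^ size l * c.
  elim: l y => [|i l IH] y /=; first by ring.
  have -> : jconv l (fun _ => 0%N) (fun _ => c) = fun _ => kmass ^ size l * c by apply: functional_extensionality.
  rewrite /cint (RInt_ext _ (fun s => scal (kmass ^ size l * c) (ker 0 s))); last first.
    by move=> s _; rewrite /scal /= /mult /=; rring.
  by rewrite RInt_scal; [rewrite /scal /= /mult /= -/kmass; ring | exact: ker_ex_RInt].
rewrite /moll H -Rmult_assoc Rinv_l ?Rmult_1_l //; apply: pow_nonzero; have := kmass_gt0; lra.
Qed.

Lemma moll_mono f g x : rcont f -> rcont g ->
  (forall z, vnorm (z -^ x) <= jrad -> f z <= g z) -> moll f x <= moll g x.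
Proof.
move=> cf cg; rewrite /jrad => H; apply: Rmult_le_compat_l; first lra.
have main (l : seq 'I_m) y : (forall z, vnorm (z -^ y) <= 2 * rho * INR (size l) -> f z <= g z) ->
    jconv l (fun _ => 0%N) f y <= jconv l (fun _ => 0%N) g y; last exact: main.
elim: l y => [|i l IH] y Hy.
  by apply: Hy; rewrite vnorm_subxx /=; lra.
rewrite /=; apply: RInt_le; try (apply: cint_ex; [exact: ker_kern | exact: jconv_rcont]); first lra.
move=> s hs; apply: Rmult_le_compat_l; first exact: ker0_ge0.
apply: IH => z hz; apply: Hy; rewrite [size (_ :: _)]/= S_INR.
have h2 : -2 <= s <= 2 by lra.
by have := win y i h2; have := vdist_tri (y +^ (rho * s) *^ unitv i) z y; lra.
Qed.

Lemma D2moll_shift f v x : D2moll (fun z => f (z +^ v)) x = D2moll f (x +^ v).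
Proof.
by apply: functional_extensionality => i; apply: functional_extensionality => j; rewrite /D2moll jconv_shift.
Qed.

(** Bounds the norm of [f -> D2moll f x i j] for the sup norm. It blows up like [rho^-2], so [rho]
    is kept fixed when uniform errors are sent to zero. *)
Definition jcst := / kmass ^ size l0 * (/ rho * (/ rho * 8000 ^ size l0)).

Lemma jcst_gt0 : 0 < jcst.
Proof.
have r0 : 0 < / rho by exact: Rinv_0_lt_compat.
have p0 : 0 < 8000 ^ size l0 by apply: pow_lt; lra.
by apply: Rmult_lt_0_compat => //; apply: Rmult_lt_0_compat => //; exact: Rmult_lt_0_compat.
Qed.

Lemma D2moll_diff f g x e i j : rcont f -> rcont g ->
  (forall z, vnorm (z -^ x) <= jrad -> Rabs (f z - g z) <= e) ->
  Rabs (D2moll f x i j - D2moll g x i j) <= jcst * e.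
Proof.
move=> cf cg H; set o := oinc j (oinc i (fun _ => 0%N)).
have cfg : rcont (fun z => f z + (-1) * g z) by apply: rcont_add => //; exact: rcont_scal.
have E : jconv l0 o f x - jconv l0 o g x = jconv l0 o (fun z => f z + (-1) * g z) x.
  by rewrite jconv_add ?jconv_scal //; [ring | exact: rcont_scal].
rewrite /D2moll -/o -!Rmult_minus_distr_l E.
have r0 : 0 < / rho by exact: Rinv_0_lt_compat.
rewrite !Rabs_mult (Rabs_pos_eq (/ rho)) ?(Rabs_pos_eq (/ kmass ^ _)); try lra.
rewrite /jcst !Rmult_assoc; do 3! (apply: Rmult_le_compat_l; first lra).
apply: jconv_bound => // z hz; rewrite (_ : _ + _ = f z - g z); last by ring.
exact: H.
Qed.
End Mollifier.

(** * Random walks *)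

Section Walk.
Variables (m n : nat).
Implicit Types (a b : 'I_n -> pt m) (f g : pt m -> R) (h z v : pt m) (tau : R).

(** Equal weights on [n + 1] outcomes: staying, or one of [n] directions. The first outcome keeps
    the denominator positive for every [n]. *)
Definition avg (v0 : R) (vs : 'I_n -> R) := (v0 + rsum vs) / (INR n + 1).

Let n1 : 0 < INR n + 1.
Proof. by have := pos_INR n; lra. Qed.

Lemma avg_le (v0 w0 : R) (vs ws : 'I_n -> R) : v0 <= w0 -> (forall k, vs k <= ws k) -> avg v0 vs <= avg w0 ws.
Proof.
move=> h0 h; apply: Rmult_le_compat_r; first by left; apply: Rinv_0_lt_compat.
by have := rsum_le h; lra.
Qed.

Lemma avg_shift (v0 : R) (vs : 'I_n -> R) c (d : 'I_n -> R) :
  avg (v0 + c) (fun k => vs k + c + d k) = avg v0 vs + c + rsum d / (INR n + 1).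
Proof. by rewrite /avg !rsum_add rsum_const; field; lra. Qed.

Lemma avg_bound (v0 : R) (vs : 'I_n -> R) c d : 0 <= d -> Rabs (v0 - c) <= d -> (forall k, Rabs (vs k - c) <= d) ->
  Rabs (avg v0 vs - c) <= d.
Proof.
move=> d0 h0 h; have r0 : rsum (fun _ : 'I_n => 0) / (INR n + 1) = 0 by rewrite rsum_0 /Rdiv Rmult_0_l.
have E x : avg (0 + x) (fun k => 0 + x + 0) = x.
  by rewrite avg_shift r0 /avg rsum_0; field; lra.
have h1 : avg v0 vs <= avg (0 + (c + d)) (fun k => 0 + (c + d) + 0).
  by apply: avg_le => [|k]; [move: h0 | move: (h k)]; split_Rabs; lra.
have h2 : avg (0 + (c - d)) (fun k => 0 + (c - d) + 0) <= avg v0 vs.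
  by apply: avg_le => [|k]; [move: h0 | move: (h k)]; split_Rabs; lra.
by move: h1 h2; rewrite !E; split_Rabs; lra.
Qed.

(* One step of the symmetric random walk with step [tau] along a random direction [a k]
   (or no move), whose generator is [tau ^ 2 / (2 (n + 1)) * sum_k D^2 f (a k, a k)]. *)
Definition walk a tau f h :=
  avg (f h) (fun k => (f (h +^ tau *^ a k) + f (h -^ tau *^ a k)) / 2).

Definition trsq a := rsum (fun k => dot (a k) (a k)).
(** This is [tr (A X)] for [A] the sum of the matrices [a_k a_k^T]; when [a] consists of the columns
    of [sigma] it is the diffusion term. *)
Definition lop a (X : mat m) := rsum (fun k => qf X (a k)).
(** The time of one step, normalized so that [walk f - f] is [dt * lop a (D2 f)] up to higher
    order. *)
Definition dt tau := tau * tau / (2 * (INR n + 1)).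

Lemma trsq_ge0 a : 0 <= trsq a.
Proof. by apply: rsum_ge0 => k; exact: dot_ge0. Qed.

Lemma trsq_norm a k : vnorm (a k) <= trsq a + 1.
Proof.
have := rsum_ge1 (f := fun k => dot (a k) (a k)) k (fun k => dot_ge0 _); rewrite -/(trsq a) -vnorm_sq.
by have := vnorm_ge0 (a k); nra.
Qed.

Lemma dt_ge0 tau : 0 <= dt tau.
Proof. by rewrite /dt; apply: Rmult_le_pos; [nra | left; apply: Rinv_0_lt_compat; lra]. Qed.

Lemma walk_mono a tau f g h : (forall z, f z <= g z) -> walk a tau f h <= walk a tau g h.
Proof.
move=> fg; apply: avg_le => // k.
by have := fg (h +^ tau *^ a k); have := fg (h -^ tau *^ a k); lra.
Qed.

Lemma walk_add a tau f g h : walk a tau (fun z => f z + g z) h = walk a tau f h + walk a tau g h.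
Proof.
rewrite /walk /avg (rsum_ext (g := fun k => (f (h +^ tau *^ a k) + f (h -^ tau *^ a k)) / 2 + (g (h +^ tau *^ a k) + g (h -^ tau *^ a k)) / 2)).
  by rewrite rsum_add; field; lra.
by move=> k; field.
Qed.

Lemma walk_scal a tau c f h : walk a tau (fun z => c * f z) h = c * walk a tau f h.
Proof.
rewrite /walk /avg (rsum_ext (g := fun k => c * ((f (h +^ tau *^ a k) + f (h -^ tau *^ a k)) / 2))).
  by rewrite rsum_scal; field; lra.
by move=> k; field.
Qed.

Lemma walk_const a tau c h : walk a tau (fun _ => c) h = c.
Proof.
rewrite /walk /avg (rsum_ext (g := fun _ => c)); last by move=> k; field.
by rewrite rsum_const; field; lra.
Qed.

Lemma walk_shift a tau f v h : walk a tau (fun z => f (z +^ v)) h = walk a tau f (h +^ v).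
Proof.
by congr avg; apply: functional_extensionality => k; congr ((f _ + f _) / 2); vring.
Qed.

Lemma walk_rcont a tau f : rcont f -> rcont (walk a tau f).
Proof.
move=> cf x eps e0.
have tr v : rcont (fun z => f (z +^ v)).
  by apply: rcont_ext (rcont_affine 1 v cf) => z; congr f; vring.
have [d [d0 Hd]] : exists d, 0 < d /\ forall k, forall y, vnorm (y -^ x) < d ->
   Rabs (f (y +^ tau *^ a k) - f (x +^ tau *^ a k)) < eps / 2 /\ Rabs (f (y -^ tau *^ a k) - f (x -^ tau *^ a k)) < eps / 2.
  apply: fin_delta => [k d d' _ dd H y hy|k]; first by apply: H; lra.
  have [d [d0 H]] := tr (tau *^ a k) x (eps / 2) ltac:(lra).
  have [d' [d'0 H']] := tr ((- tau) *^ a k) x (eps / 2) ltac:(lra).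
  exists (Rmin d d'); split; first exact: Rmin_pos.
  move=> y hy; split; first by apply: H; apply: Rlt_le_trans hy (Rmin_l _ _).
  have := H' y (Rlt_le_trans _ _ _ hy (Rmin_r _ _)).
  have -> : y +^ (- tau) *^ a k = y -^ tau *^ a k by vring.
  by have -> : x +^ (- tau) *^ a k = x -^ tau *^ a k by vring.
have [d' [d'0 H']] := cf x (eps / 2) ltac:(lra).
exists (Rmin d d'); split; first exact: Rmin_pos.
move=> y hy; apply: (Rle_lt_trans _ (eps / 2)); last lra.
have -> : walk a tau f y - walk a tau f x = avg (f y - f x) (fun k => (f (y +^ tau *^ a k) + f (y -^ tau *^ a k)) / 2 - (f (x +^ tau *^ a k) + f (x -^ tau *^ a k)) / 2) - 0.
  by rewrite /walk /avg rsum_sub; field; lra.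
apply: avg_bound; first lra.
  by rewrite Rminus_0_r; left; apply: H'; apply: Rlt_le_trans hy (Rmin_r _ _).
move=> k; have [] := Hd k y (Rlt_le_trans _ _ _ hy (Rmin_l _ _)).
by split_Rabs; lra.
Qed.

Lemma walk_sqdist a tau k0 h :
  walk a tau (fun z => dot (z -^ k0) (z -^ k0)) h = dot (h -^ k0) (h -^ k0) + 2 * dt tau * trsq a.
Proof.
have -> : walk a tau (fun z => dot (z -^ k0) (z -^ k0)) h =
  avg (0 + dot (h -^ k0) (h -^ k0)) (fun k => 0 + dot (h -^ k0) (h -^ k0) + tau * tau * dot (a k) (a k)).
  congr avg; first ring.
  apply: functional_extensionality => k.
  have -> : h +^ tau *^ a k -^ k0 = (h -^ k0) +^ tau *^ a k by vring.
  have -> : h -^ tau *^ a k -^ k0 = (h -^ k0) -^ tau *^ a k by vring.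
  by move: (h -^ k0) => v; rewrite !dotE; field.
rewrite avg_shift rsum_scal /avg rsum_0 /dt /trsq; field; lra.
Qed.

Lemma walk_semiconvex a tau f K h :
  (forall h s, - K * dot s s <= f (h +^ s) + f (h -^ s) - 2 * f h) ->
  f h - K * dt tau * trsq a <= walk a tau f h.
Proof.
move=> sf.
apply: (Rle_trans _ (avg (0 + f h) (fun k => 0 + f h + (- K * (tau * tau) / 2) * dot (a k) (a k)))).
  rewrite avg_shift rsum_scal /avg rsum_0 /dt -/(trsq a); right; field; lra.
apply: avg_le; first lra.
move=> k; have := sf h (tau *^ a k); rewrite !dotE; lra.
Qed.

(** Synchronous coupling: both walks draw the same direction index and the same sign. Terms linear
    in [tau] cancel between the two signs, so on average [B |h - k|^2] grows by [2 B |a - b|^2] per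
    unit of [dt], and [|h|^2] by [2 trsq a]. *)
Lemma walk_compare a b tau f g B c0 c1 : 0 <= c1 ->
  (forall h k, f h <= g k + B * dot (h -^ k) (h -^ k) + c0 + c1 * dot h h) ->
  forall h k, walk a tau f h <= walk b tau g k + B * dot (h -^ k) (h -^ k)
     + dt tau * (2 * B * rsum (fun i => dot (a i -^ b i) (a i -^ b i))) + c0 + c1 * (dot h h + 2 * dt tau * trsq a).
Proof.
move=> c10 H h k.
pose c := B * dot (h -^ k) (h -^ k) + c0 + c1 * dot h h.
apply: (Rle_trans _ (avg (g k + c) (fun i => (g (k +^ tau *^ b i) + g (k -^ tau *^ b i)) / 2 + c +
   (B * (tau * tau) * dot (a i -^ b i) (a i -^ b i) + c1 * (tau * tau) * dot (a i) (a i))))).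
  apply: avg_le; first by have := H h k; rewrite /c; lra.
  move=> i; have := H (h +^ tau *^ a i) (k +^ tau *^ b i); have := H (h -^ tau *^ a i) (k -^ tau *^ b i).
  have -> : h +^ tau *^ a i -^ (k +^ tau *^ b i) = (h -^ k) +^ tau *^ (a i -^ b i) by vring.
  have -> : h -^ tau *^ a i -^ (k -^ tau *^ b i) = (h -^ k) -^ tau *^ (a i -^ b i) by vring.
  rewrite /c; move: (h -^ k) (a i -^ b i) => v w; rewrite !dotE (dotC w v) (dotC (a i) h); lra.
rewrite avg_shift rsum_add !rsum_scal -/(trsq a) -/(walk b tau g k) /c /dt; right; field; lra.
Qed.

Lemma iter_walk_compare a b tau f g B c0 c1 : 0 <= c1 ->
  (forall h k, f h <= g k + B * dot (h -^ k) (h -^ k) + c0 + c1 * dot h h) ->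
  forall N h k, iter N (walk a tau) f h <= iter N (walk b tau) g k + B * dot (h -^ k) (h -^ k)
     + INR N * dt tau * (2 * B * rsum (fun i => dot (a i -^ b i) (a i -^ b i))) + c0 + c1 * (dot h h + 2 * (INR N * dt tau) * trsq a).
Proof.
move=> c10 H; elim=> [|N IH] h k.
  by have := H h k; rewrite /=; lra.
rewrite S_INR /=.
have {}IH h' k' : iter N (walk a tau) f h' <= iter N (walk b tau) g k' + B * dot (h' -^ k') (h' -^ k')
  + (INR N * dt tau * (2 * B * rsum (fun i => dot (a i -^ b i) (a i -^ b i))) + c0 + c1 * (2 * (INR N * dt tau) * trsq a)) + c1 * dot h' h'.
  by have := IH h' k'; lra.
by have := walk_compare a b tau c10 IH h k; lra.
Qed.

Lemma has_grad_rsum p (F : 'I_p -> pt m -> R) (G : 'I_p -> pt m) x :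
  (forall i, has_grad (F i) x (G i)) -> has_grad (fun y => rsum (fun i => F i y)) x (fun j => rsum (fun i => G i j)).
Proof.
elim: p F G => [|p IH] F G H.
  apply: (has_grad_ext (f := fun _ => 0) (p := @vzero m)); last exact: has_grad_const.
    by move=> y; rewrite /rsum big_ord0.
  by move=> j; rewrite /rsum big_ord0.
have := has_grad_add (H ord0) (IH _ _ (fun i => H (lift ord0 i))).
by apply: has_grad_ext => [y|j]; rewrite rsum_recl.
Qed.

Lemma C2_shift v f Df D2f : @C2 m f Df D2f ->
  C2 (fun x => f (x +^ v)) (fun x => Df (x +^ v)) (fun x => D2f (x +^ v)).
Proof.
move=> C; have E x : 1 *^ (x -^ (-1) *^ v) = x +^ v by vring.
have := C2_affine 1 ((-1) *^ v) C; apply: C2_ext => [x|x i|x i j].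
- by rewrite E.
- by rewrite E /vscal Rmult_1_l.
- by rewrite E /mscal !Rmult_1_l.
Qed.

Lemma walk_has_grad a tau f Df : (forall x, has_grad f x (Df x)) ->
  forall x, has_grad (walk a tau f) x (fun i => walk a tau (fun z => Df z i) x).
Proof.
move=> H x.
have tr v : has_grad (fun z => f (z +^ v)) x (Df (x +^ v)).
  move=> eps e0; have [d [d0 Hd]] := H (x +^ v) eps e0; exists d; split=> // h hh.
  have -> : x +^ h +^ v = x +^ v +^ h by vring.
  exact: Hd.
have G k : has_grad (fun z => (f (z +^ tau *^ a k) + f (z -^ tau *^ a k)) / 2) x
   ((/2) *^ (Df (x +^ tau *^ a k) +^ Df (x +^ (- tau) *^ a k))).
  apply: has_grad_ext (has_grad_scal (/2) (has_grad_add (tr (tau *^ a k)) (tr ((- tau) *^ a k)))) => // y.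
  have -> : y +^ (- tau) *^ a k = y -^ tau *^ a k by vring.
  by field.
apply: has_grad_ext (has_grad_scal (/ (INR n + 1)) (has_grad_add (H x) (has_grad_rsum G))) => [y|i].
  by rewrite /walk /avg; field; lra.
rewrite /walk /avg.
have -> : rsum (fun k => (Df (x +^ tau *^ a k) i + Df (x -^ tau *^ a k) i) / 2) =
   rsum (fun k => ((/2) *^ (Df (x +^ tau *^ a k) +^ Df (x +^ (- tau) *^ a k))) i).
  apply: rsum_ext => k; have -> : x +^ (- tau) *^ a k = x -^ tau *^ a k by vring.
  by rewrite /vscal /vadd; field.
rewrite -[LHS]/(/ (INR n + 1) * (Df x i + rsum (fun k => ((/2) *^ (Df (x +^ tau *^ a k) +^ Df (x +^ (- tau) *^ a k))) i))).
by field; lra.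
Qed.

Lemma walk_C2 a tau f Df D2f : C2 f Df D2f ->
  C2 (walk a tau f) (fun x i => walk a tau (fun z => Df z i) x) (fun x i j => walk a tau (fun z => D2f z i j) x).
Proof.
move=> [f1 [f2 f3]]; split; [|split].
- exact: walk_has_grad.
- by move=> x i; exact: walk_has_grad (f2^~ i) x.
- by move=> i j; exact: walk_rcont.
Qed.

(** The weight is quadratic because the walk acts on quadratics exactly ([walk_sqdist]): the class
    is stable under [walk], its constant being multiplied by [1 + 2 * dt tau * trsq a] at each step,
    hence bounded over a finite time. *)
Definition smooth C f Df D2f := C2 f Df D2f /\ forall h s i j,
  Rabs (D2f (h +^ s) i j - D2f h i j) <= C * vnorm s * (1 + dot h h + dot s s).

(** The estimate that mollification yields for functions whose Lipschitz constant grows linearly,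
    see [moll_smoothlin]. *)
Definition smoothlin C f Df D2f := C2 f Df D2f /\ forall h s i j,
  Rabs (D2f (h +^ s) i j - D2f h i j) <= C * vnorm s * (1 + vnorm h + vnorm s).

Lemma smoothlin_smooth C f Df D2f : 0 <= C -> smoothlin C f Df D2f -> smooth (2 * C) f Df D2f.
Proof.
move=> C0 [Cf H]; split=> // h s i j; apply: Rle_trans (H h s i j) _.
rewrite -!vnorm_sq; have h0 := vnorm_ge0 h; have s0 := vnorm_ge0 s.
have Cs : 0 <= C * vnorm s by nra.
have E : 1 + vnorm h + vnorm s <= 2 * (1 + vnorm h * vnorm h + vnorm s * vnorm s).
  by have := Rle_0_sqr (vnorm h - 1); have := Rle_0_sqr (vnorm s - 1); rewrite /Rsqr; nra.
by have := Rmult_le_compat_l _ _ _ Cs E; lra.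
Qed.

Lemma lop_diff a X Y e : (forall i j, Rabs (X i j - Y i j) <= e) ->
  Rabs (lop a X - lop a Y) <= INR m * (INR m * e) * trsq a.
Proof.
move=> H; rewrite /lop -rsum_sub /trsq -rsum_scal.
apply: Rle_trans (rsum_abs _) _; apply: rsum_le => k; exact: qf_diff_mat.
Qed.

Lemma walk_smooth a tau C f Df D2f : 0 <= C -> smooth C f Df D2f ->
  smooth (C * (1 + 2 * dt tau * trsq a)) (walk a tau f) (fun x i => walk a tau (fun z => Df z i) x)
    (fun x i j => walk a tau (fun z => D2f z i j) x).
Proof.
move=> C0 [Cf H]; split; first exact: walk_C2.
move=> h s i j; rewrite -walk_shift.
pose g z := D2f (z +^ s) i j - D2f z i j.
have E : walk a tau (fun z => D2f (z +^ s) i j) h - walk a tau (fun z => D2f z i j) h = walk a tau g h.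
  have -> : g = fun z => D2f (z +^ s) i j + (-1) * D2f z i j by apply: functional_extensionality => z; rewrite /g; ring.
  by rewrite walk_add walk_scal; ring.
rewrite E; pose w z := C * vnorm s * ((1 + dot s s) + dot (z -^ @vzero m) (z -^ @vzero m)).
have wE z : z -^ @vzero m = z by vring.
have W : walk a tau w h = C * vnorm s * (1 + dot s s + dot h h + 2 * dt tau * trsq a).
  by rewrite /w walk_scal walk_add walk_const walk_sqdist wE; ring.
have up : walk a tau g h <= walk a tau w h.
  by apply: walk_mono => z; have := H z s i j; rewrite /w wE /g; split_Rabs; lra.
have lo : walk a tau (fun z => (-1) * g z) h <= walk a tau w h.
  by apply: walk_mono => z; have := H z s i j; rewrite /w wE /g; split_Rabs; lra.
move: up lo; rewrite walk_scal W => up lo.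
apply: (Rle_trans _ (C * vnorm s * (1 + dot s s + dot h h + 2 * dt tau * trsq a))).
  by apply: Rabs_le; lra.
have q1 := dot_ge0 s; have q2 := dot_ge0 h.
have x0 : 0 <= 2 * dt tau * trsq a by have := dt_ge0 tau; have := trsq_ge0 a; nra.
have Cs : 0 <= C * vnorm s by have := vnorm_ge0 s; nra.
move: (2 * dt tau * trsq a) x0 => x x0.
have key : 1 + dot s s + dot h h + x <= (1 + x) * (1 + dot h h + dot s s) by nra.
by have := Rmult_le_compat_l _ _ _ Cs key; lra.
Qed.

Lemma walk_expand a tau f Df D2f h e : 0 <= e -> C2 f Df D2f ->
  (forall s k i j, -1 <= s <= 1 -> Rabs (D2f (h +^ (s * tau) *^ a k) i j - D2f h i j) <= e) ->
  Rabs (walk a tau f h - f h - dt tau * lop a (D2f h)) <= 2 * dt tau * (INR m * (INR m * e)) * trsq a.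
Proof.
move=> e0 Cf H.
have K k : Rabs ((f (h +^ tau *^ a k) + f (h -^ tau *^ a k)) / 2 - f h - tau * tau / 2 * qf (D2f h) (a k))
    <= tau * tau * (INR m * (INR m * e)) * dot (a k) (a k).
  have := @second_difference m f Df D2f h (tau *^ a k) (tau * tau * qf (D2f h) (a k)) (tau * tau * (INR m * (INR m * e)) * dot (a k) (a k)) Cf.
  have P s : -1 <= s <= 1 -> Rabs (qf (D2f (h +^ s *^ (tau *^ a k))) (tau *^ a k) - tau * tau * qf (D2f h) (a k)) <= tau * tau * (INR m * (INR m * e)) * dot (a k) (a k).
    move=> hs; rewrite qf_scalv -Rmult_minus_distr_l Rabs_mult Rabs_pos_eq; last by nra.
    have t2 : 0 <= tau * tau by nra.
    have -> : s *^ (tau *^ a k) = (s * tau) *^ a k by vring.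
    have := qf_diff_mat (X := D2f (h +^ (s * tau) *^ a k)) (Y := D2f h) (a k) (fun i j => H s k i j hs).
    by move/(Rmult_le_compat_l _ _ _ t2); lra.
  by move=> /(_ P); split_Rabs; lra.
have -> : walk a tau f h - f h - dt tau * lop a (D2f h) =
   rsum (fun k => (f (h +^ tau *^ a k) + f (h -^ tau *^ a k)) / 2 - f h - tau * tau / 2 * qf (D2f h) (a k)) / (INR n + 1).
  by rewrite !rsum_sub rsum_const rsum_scal -/(lop a (D2f h)) /walk /avg /dt; field; lra.
rewrite /Rdiv Rabs_mult (Rabs_pos_eq (/ _)); last by left; apply: Rinv_0_lt_compat.
apply: (Rle_trans _ ((tau * tau * (INR m * (INR m * e)) * trsq a) * / (INR n + 1))).
  apply: Rmult_le_compat_r; first by left; apply: Rinv_0_lt_compat.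
  by apply: Rle_trans (rsum_abs _) _; rewrite /trsq -rsum_scal; apply: rsum_le.
by rewrite /dt; right; field; lra.
Qed.
End Walk.

(** * Constant coefficient operators *)

Lemma pow_exp_le x j : 0 <= x -> (1 + x) ^ j <= exp (INR j * x).
Proof.
move=> x0; elim: j => [|j IH]; first by rewrite /= Rmult_0_l exp_0; lra.
rewrite S_INR Rmult_plus_distr_r Rmult_1_l exp_plus /= Rmult_comm.
have := exp_ineq1_le x => h.
by apply: Rmult_le_compat => //; [apply: pow_le; lra | lra].
Qed.

(** Viscosity form of [gam <= lop a (D2 U)]. A subsolution of the equation with the supremum gives
    one such inequality for each index. *)
Definition csub m n (a : 'I_n -> pt m) (gam : R) (U : pt m -> R) :=
  forall phi Dphi D2phi, C2 phi Dphi D2phi -> forall h, locmax U phi h -> gam <= lop a (D2phi h).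

Definition semiconvex m K (U : pt m -> R) :=
  forall h s, - K * dot s s <= U (h +^ s) + U (h -^ s) - 2 * U h.

(* [U] is compared with the iterates [w_j] of the walk: at a maximum point of
   [U - w_(j+1) - beta |h|^2] the viscosity inequality bounds [lop a (D2 w_(j+1))] from below,
   and [w_(j+1) = w_j + dt tau * lop a (D2 w_j)] up to higher order terms. *)
Lemma csub_mean_value m n (a : 'I_n -> pt m) U f Df D2f C K gam t beta eps :
  rcont U -> 0 <= K -> semiconvex K U -> csub a gam U ->
  0 <= C -> smooth C f Df D2f -> (forall h, U h <= f h) -> 0 < t -> 0 < beta -> 0 < eps ->
  exists N0, forall N tau, le N0 N -> 0 < tau -> INR N * dt n tau = t ->
  forall h, U h <= iter N (walk a tau) f h + beta * dot h h + t * (- gam + 2 * beta * trsq a + eps).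
Proof.
move=> cU K0 sU vU C0 Sf Uf t0 b0 e0.
set A := trsq a; have A0 : 0 <= A := trsq_ge0 a.
(* [- E0] is below every accumulated error [INR j * e], and [B0] bounds the amount by which [U] can
   exceed an iterate. Beyond the radius [R0] the penalty [beta |h|^2] beats both, which confines the
   maxima. *)
pose E0 := t * (Rabs gam + 2 * beta * A + eps) + 1.
have bA : 0 <= beta * A by nra.
have E00 : 0 < E0 by rewrite /E0; have := Rabs_pos gam; nra.
pose B0 := K * t * A; have B00 : 0 <= B0 by apply: Rmult_le_pos => //; nra.
pose R0 := 1 + (B0 + E0) / beta.
have R1 : 1 <= R0.
  have q : 0 <= (B0 + E0) / beta by apply: Rmult_le_pos; [lra | left; exact: Rinv_0_lt_compat].
  by rewrite /R0; lra.
have bR : B0 + E0 < beta * (R0 * R0).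
  have q : beta * R0 = beta + (B0 + E0) by rewrite /R0; field; lra.
  by nra.
(* Bounds the smoothness constants of all iterates up to time [t], through
   [(1 + x)^j <= exp (j x)]. *)
pose C' := C * exp (2 * t * A).
have C'0 : 0 <= C' by apply: Rmult_le_pos => //; left; exact: exp_pos.
pose Z := C' * (A + 1) * (2 + R0 * R0).
have Z0 : 0 <= Z by apply: Rmult_le_pos; [nra | nra].
pose MM := INR m * INR m; have M0 : 0 <= MM by have := pos_INR m; rewrite /MM; nra.
pose tau0 := Rmin (/ (A + 1)) (eps / (3 * (MM * Z * A) + 1)).
have MZ0 : 0 <= MM * Z * A by apply: Rmult_le_pos => //; nra.
have tau00 : 0 < tau0.
  by apply: Rmin_pos; [apply: Rinv_0_lt_compat; lra | apply: Rdiv_lt_0_compat => //; lra].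
have n1 : 0 < INR n + 1 by have := pos_INR n; lra.
have [N0 HN0] := INR_unbounded (2 * (INR n + 1) * t / (tau0 * tau0)).
exists N0 => N tau NN tp HN.
have Np : 0 < INR N.
  apply: Rlt_le_trans (le_INR _ _ NN); apply: Rlt_trans HN0.
  by apply: Rdiv_lt_0_compat; nra.
(* As [INR N * dt n tau = t], a large [N] forces [tau] below the threshold. *)
have tsm : tau <= tau0.
  apply: Rnot_lt_le => ht.
  have h1 : 2 * (INR n + 1) * t = INR N * (tau * tau) by rewrite -HN /dt; field; lra.
  have h2 : 2 * (INR n + 1) * t < INR N * (tau0 * tau0).
    have h3 := Rlt_le_trans _ _ _ HN0 (le_INR _ _ NN).
    have h4 : 2 * (INR n + 1) * t / (tau0 * tau0) * (tau0 * tau0) = 2 * (INR n + 1) * t by field; lra.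
    have h5 : 0 < tau0 * tau0 by nra.
    by nra.
  have h6 : tau0 * tau0 < tau * tau by nra.
  by nra.
have tA : tau * (A + 1) <= 1.
  have := Rle_trans _ _ _ tsm (Rmin_l _ _).
  by move=> /(Rmult_le_compat_r (A + 1)); rewrite Rinv_l; [apply; lra | lra].
have tE : 3 * (tau * (MM * Z * A)) <= eps.
  have := Rle_trans _ _ _ tsm (Rmin_r _ _) => h.
  have h2 : eps / (3 * (MM * Z * A) + 1) * (3 * (MM * Z * A) + 1) = eps by field; lra.
  by nra.
set d := dt n tau in HN *; have d0 : 0 < d.
  by apply: (Rmult_lt_reg_l (INR N)) => //; rewrite HN; lra.
pose e := d * (- gam + 2 * beta * A + eps).
(* The middle bound, which comes from semiconvexity alone, serves to localize the maximum in the
   proof of the last one. *)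
have main j : le j N -> [/\ exists Dw D2w, smooth (C * (1 + 2 * d * A) ^ j) (iter j (walk a tau) f) Dw D2w,
    forall h, U h - INR j * (K * d * A) <= iter j (walk a tau) f h &
    forall h, U h <= iter j (walk a tau) f h + beta * dot h h + INR j * e].
  elim: j => [_|j IH jN].
    split.
    - by exists Df, D2f; rewrite /= Rmult_1_r.
    - by move=> h; have := Uf h; rewrite /=; lra.
    - by move=> h; have := Uf h; have := dot_ge0 h; rewrite /=; nra.
  have [[Dw [D2w Sw]] lw mw] := IH ltac:(lia).
  set w := iter j (walk a tau) f in Sw lw mw.
  have dA : 0 <= 2 * d * A by nra.
  have Cj0 : 0 <= C * (1 + 2 * d * A) ^ j by apply: Rmult_le_pos => //; apply: pow_le; lra.
  have Sw' := walk_smooth a tau Cj0 Sw.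
  have jN' : INR j.+1 <= INR N by apply: le_INR.
  have jp : 0 <= INR j by exact: pos_INR.
  have Cj : C * (1 + 2 * d * A) ^ j <= C'.
    apply: Rmult_le_compat_l => //; apply: Rle_trans (pow_exp_le j dA) _.
    have q : INR j * (2 * d * A) <= 2 * t * A.
      have q1 : 0 <= d * A by nra.
      by rewrite -HN; rewrite S_INR in jN'; nra.
    by case: q => [h|->]; [left; exact: exp_increasing | lra].
  have low h : U h - INR j.+1 * (K * d * A) <= walk a tau w h.
    rewrite S_INR; have := walk_mono a tau h lw.
    rewrite (_ : walk a tau (fun z => U z - INR j * (K * d * A)) h = walk a tau U h - INR j * (K * d * A)); last first.
      have -> : (fun z => U z - INR j * (K * d * A)) = (fun z => U z + - (INR j * (K * d * A))) by apply: functional_extensionality => z; ring.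
      by rewrite walk_add walk_const; ring.
    by have := walk_semiconvex a tau h sU; rewrite -/d -/A; lra.
  split=> //.
    exists (fun x i => walk a tau (fun z => Dw z i) x), (fun x i k => walk a tau (fun z => D2w z i k) x).
    by move: Sw'; rewrite -/d -/A /= -/w (_ : C * ((1 + 2 * d * A) * (1 + 2 * d * A) ^ j) = C * (1 + 2 * d * A) ^ j * (1 + 2 * d * A)) //; ring.
  move=> h0; rewrite [iter j.+1 _ _]/= -/w.
  apply: Rnot_lt_le => bad.
  pose F h := U h - (walk a tau w h + beta * dot (h -^ @vzero m) (h -^ @vzero m)).
  have cF : rcont F.
    apply: rcont_sub => //; apply: rcont_add; first by exact: C2_rcont (proj1 Sw').
    exact: C2_rcont (C2_sqdist beta (@vzero m)).
  have z0 (h : pt m) : h -^ @vzero m = h by vring.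
  have Bd h : F h <= B0 - beta * dot h h.
    have := low h; rewrite /F z0.
    have q : INR j.+1 * (K * d * A) <= B0.
      have q1 : 0 <= K * d * A by apply: Rmult_le_pos => //; nra.
      by rewrite /B0 -HN; nra.
    by lra.
  have Fh0 : - E0 < F h0.
    have qq : - E0 < INR j.+1 * e.
      have : Rabs (- gam + 2 * beta * A + eps) <= Rabs gam + 2 * beta * A + eps by split_Rabs; lra.
      rewrite /E0 /e; set x := - gam + _ + _; set y := Rabs gam + _ + _ => hx.
      have dj : INR j.+1 * d <= t by rewrite -HN; apply: Rmult_le_compat_r; lra.
      have dj0 : 0 <= INR j.+1 * d by apply: Rmult_le_pos; [exact: pos_INR | lra].
      have h1 : - Rabs x <= x by split_Rabs; lra.
      have h2 : INR j.+1 * d * x >= - (INR j.+1 * d * Rabs x) by nra.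
      have h3 : INR j.+1 * d * Rabs x <= t * y by apply: Rmult_le_compat => //; exact: Rabs_pos.
      lra.
    by rewrite /F z0; lra.
  have [h [hR Hh]] := extreme_value_ball (@vzero m) (r := R0) ltac:(lra) cF.
  rewrite z0 in hR.
  have inball x : - E0 < F x -> vnorm x < R0.
    move=> hx; have := Bd x => hb; apply: vnorm_lt_sq; first lra.
    apply: (Rmult_lt_reg_l beta) => //; lra.
  have Fh : F h0 <= F h by apply: Hh; rewrite z0; left; exact: inball.
  have hlt : vnorm h < R0 by apply: inball; lra.
  have lm : locmax U (fun y => walk a tau w y + beta * dot (y -^ @vzero m) (y -^ @vzero m)) h.
    exists (R0 - vnorm h); split; first lra.
    move=> y hy; apply: Hh; rewrite z0; have := vnorm_le_dist y h; lra.
  have := vU _ _ _ (C2_add (proj1 Sw') (C2_sqdist beta (@vzero m))) h lm.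
  rewrite /lop (rsum_ext (g := fun k => qf (fun i l => walk a tau (fun z => D2w z i l) h) (a k) + 2 * beta * dot (a k) (a k))); last first.
    by move=> k; rewrite qf_madd qf_mscal qf_id.
  rewrite rsum_add rsum_scal -/(trsq a) -/A -/(lop a (fun i l => walk a tau (fun z => D2w z i l) h)) => vis.
  have ent v i l : vnorm v <= tau * (A + 1) -> Rabs (D2w (h +^ v) i l - D2w h i l) <= tau * Z.
    move=> hv; apply: Rle_trans ((proj2 Sw) h v i l) _.
    have v0 := vnorm_ge0 v; have hh := vnorm_ge0 h; rewrite -!vnorm_sq.
    rewrite (_ : tau * Z = C' * (tau * (A + 1)) * (2 + R0 * R0)); last by rewrite /Z; ring.
    apply: Rmult_le_compat; [nra | nra | apply: Rmult_le_compat => // | nra].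
  have nk k : vnorm (a k) <= A + 1 := trsq_norm a k.
  have tZ0 : 0 <= tau * Z by nra.
  have ex := @walk_expand m n a tau w Dw D2w h (tau * Z) tZ0 (proj1 Sw).
  have nst s k : -1 <= s <= 1 -> vnorm ((s * tau) *^ a k) <= tau * (A + 1).
    move=> hs; rewrite vnorm_scal Rabs_mult (Rabs_pos_eq tau); last lra.
    have h1 : Rabs s <= 1 by split_Rabs; lra.
    have q1 := nk k; have q2 := vnorm_ge0 (a k); have q3 := Rabs_pos s.
    apply: (Rle_trans _ (1 * tau * vnorm (a k))); last nra.
    by apply: Rmult_le_compat_r => //; apply: Rmult_le_compat_r; lra.
  have {}ex := ex (fun s k i l hs => ent _ i l (nst s k hs)).
  rewrite -/d -/A in ex.
  have lw2 : lop a (fun i l => walk a tau (fun z => D2w z i l) h) <= lop a (D2w h) + MM * (tau * Z) * A.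
    have -> : MM * (tau * Z) * A = INR m * (INR m * (tau * Z)) * trsq a by rewrite /MM /A; ring.
    have q : Rabs (lop a (fun i l => walk a tau (fun z => D2w z i l) h) - lop a (D2w h)) <= INR m * (INR m * (tau * Z)) * trsq a.
      apply: lop_diff => i l; apply: avg_bound => //; first by rewrite Rminus_diag Rabs_R0.
      move=> k.
      have t1 : vnorm (tau *^ a k) <= tau * (A + 1).
        by rewrite vnorm_scal Rabs_pos_eq; [have := nk k; nra | lra].
      have t2 : vnorm ((- tau) *^ a k) <= tau * (A + 1) by rewrite vnorm_scal Rabs_Ropp -vnorm_scal.
      have := ent _ i l t1; have := ent _ i l t2.
      have -> : h +^ (- tau) *^ a k = h -^ tau *^ a k by vring.
      by split_Rabs; lra.
    by move: q; split_Rabs; lra.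
  have := mw h; move: Fh; rewrite /F !z0.
  have ex' : walk a tau w h >= w h + d * lop a (D2w h) - 2 * d * (MM * (tau * Z)) * A.
    have -> : 2 * d * (MM * (tau * Z)) * A = 2 * d * (INR m * (INR m * (tau * Z))) * A by rewrite /MM; ring.
    by move: ex; split_Rabs; lra.
  have q : d * lop a (D2w h) >= d * (gam - 2 * beta * A - MM * (tau * Z) * A).
    by apply: Rmult_ge_compat_l; lra.
  have q2 : d * (3 * (tau * (MM * Z * A))) <= d * eps by apply: Rmult_le_compat_l; lra.
  move: bad; rewrite S_INR /e; lra.
have [_ _ H] := main N ltac:(lia).
by move=> h; have := H h; rewrite /e -Rmult_assoc HN.
Qed.

(** The regularity of a function with quadratic growth. Blow-up limits, their sup-convolutions and
    the mollifications of both have it. *)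
Definition loclin m K (U : pt m -> R) :=
  forall h h', Rabs (U h - U h') <= K * (1 + vnorm h + vnorm h') * vnorm (h -^ h').

(** * Mollification of functions with linearly growing Lipschitz constant *)

Section MollLin.
Variables (m : nat) (rho : R).
Hypothesis rho0 : 0 < rho.
Hypothesis r1 : jrad m rho <= 1.
Variables (g : pt m -> R) (K : R).
Hypothesis K0 : 0 <= K.
Hypothesis Lg : loclin K g.

Lemma loclin_rcont : rcont g.
Proof.
move=> x eps e0.
have X0 : 0 < K * (2 + 2 * vnorm x) + 1 by have := vnorm_ge0 x; nra.
exists (Rmin 1 (eps / (K * (2 + 2 * vnorm x) + 1))); split.
  by apply: Rmin_pos; [lra | exact: Rdiv_lt_0_compat].
move=> y hy.
have h1 := Rlt_le_trans _ _ _ hy (Rmin_l _ _); have h2 := Rlt_le_trans _ _ _ hy (Rmin_r _ _).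
apply: Rle_lt_trans (Lg y x) _.
have := vnorm_le_dist y x; have := vnorm_ge0 x; have := vnorm_ge0 (y -^ x) => q1 q2 q3.
have h3 : eps / (K * (2 + 2 * vnorm x) + 1) * (K * (2 + 2 * vnorm x) + 1) = eps by field; lra.
have h4 : K * (1 + vnorm y + vnorm x) <= K * (2 + 2 * vnorm x) by apply: Rmult_le_compat_l; lra.
by nra.
Qed.

Lemma moll_near x c : (forall z, vnorm (z -^ x) <= jrad m rho -> Rabs (g z - g x) <= c) ->
  Rabs (moll rho g x - g x) <= c.
Proof.
move=> H; have cg := loclin_rcont.
have h1 : moll rho g x <= moll rho (fun _ => g x + c) x.
  apply: moll_mono => //; first exact: rcont_const.
  by move=> z /H; split_Rabs; lra.
have h2 : moll rho (fun _ => g x - c) x <= moll rho g x.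
  apply: moll_mono => //; first exact: rcont_const.
  by move=> z /H; split_Rabs; lra.
by move: h1 h2; rewrite !moll_const; split_Rabs; lra.
Qed.

Lemma moll_close x : Rabs (moll rho g x - g x) <= 4 * K * jrad m rho * (1 + dot x x).
Proof.
apply: moll_near => z hz; apply: Rle_trans (Lg z x) _.
have := vnorm_le_dist z x; have x0 := vnorm_ge0 x; have z0 := vnorm_ge0 (z -^ x) => h.
have r0 := jrad_ge0 m rho0; rewrite -vnorm_sq.
have e1 : 1 + vnorm z + vnorm x <= 4 * (1 + vnorm x * vnorm x).
  by have := Rle_0_sqr (vnorm x - 1); rewrite /Rsqr; nra.
have e2 : K * (1 + vnorm z + vnorm x) <= K * (4 * (1 + vnorm x * vnorm x)) by apply: Rmult_le_compat_l.
have e3 : 0 <= K * (1 + vnorm z + vnorm x) by have := vnorm_ge0 z; nra.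
have := Rmult_le_compat _ _ _ _ e3 z0 e2 hz; lra.
Qed.

Lemma shift_lin (s x z : pt m) r : 0 <= r -> vnorm (z -^ x) <= r -> r <= 1 ->
  Rabs (g (z +^ s) - g z) <= 3 * K * (1 + vnorm x + vnorm s) * vnorm s.
Proof.
move=> r0 hz hr; have := Lg (z +^ s) z; have -> : z +^ s -^ z = s by vring.
move=> H; apply: Rle_trans H _; apply: Rmult_le_compat_r; first exact: vnorm_ge0.
have := vnorm_tri z s; have := vnorm_le_dist z x; have := vnorm_ge0 x; have := vnorm_ge0 s; nra.
Qed.

Lemma moll_loclin : loclin (3 * K * 2) (moll rho g).
Proof.
move=> h h'; have cg := loclin_rcont.
have -> : h = h' +^ (h -^ h') by vring.
rewrite -moll_shift; set s := h -^ h'.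
have cgs : rcont (fun z => g (z +^ s)) by apply: rcont_ext (rcont_affine 1 s cg) => z; congr g; vring.
have r0 := jrad_ge0 m rho0.
set c := 3 * K * (1 + vnorm h' + vnorm s) * vnorm s.
have h1 : moll rho (fun z => g (z +^ s)) h' <= moll rho (fun z => g z + c) h'.
  apply: moll_mono => //; first by apply: rcont_add => //; exact: rcont_const.
  by move=> z hz; have := shift_lin s r0 hz r1; rewrite -/c; split_Rabs; lra.
have h2 : moll rho g h' <= moll rho (fun z => g (z +^ s) + c) h'.
  apply: moll_mono => //; first by apply: rcont_add => //; exact: rcont_const.
  by move=> z hz; have := shift_lin s r0 hz r1; rewrite -/c; split_Rabs; lra.
move: h1 h2; rewrite !moll_add ?moll_const //; try exact: rcont_const.
move=> h1 h2; apply: (Rle_trans _ c); first by split_Rabs; lra.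
have -> : h' +^ s -^ h' = s by vring.
have -> : h' +^ s = h by rewrite /s; vring.
apply: Rmult_le_compat_r; first exact: vnorm_ge0.
have q : vnorm s <= vnorm h + vnorm h' by exact: vnorm_sub_le.
by have := vnorm_ge0 h; have := vnorm_ge0 h'; nra.
Qed.

Lemma moll_smoothlin : smoothlin (3 * K * jcst m rho) (moll rho g) (Dmoll rho g) (D2moll rho g).
Proof.
have cg := loclin_rcont.
split; first exact: moll_C2.
move=> h s i j; rewrite -D2moll_shift.
have cgs : rcont (fun z => g (z +^ s)) by apply: rcont_ext (rcont_affine 1 s cg) => z; congr g; vring.
apply: Rle_trans (D2moll_diff (e := 3 * K * (1 + vnorm h + vnorm s) * vnorm s) rho0 i j cgs cg _) _.
  move=> z hz; exact: shift_lin (jrad_ge0 m rho0) hz r1.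
right; ring.
Qed.
End MollLin.

Lemma moll_rsum m rho p (F : 'I_p -> pt m -> R) x : 0 < rho -> (forall i, rcont (F i)) ->
  moll rho (fun z => rsum (fun i => F i z)) x = rsum (fun i => moll rho (F i) x) /\ rcont (fun z => rsum (fun i => F i z)).
Proof.
move=> r0; elim: p F => [|p IH] F cF.
  rewrite /rsum big_ord0.
  have -> : (fun z : pt m => \big[Rplus/0]_(i < 0) F i z) = fun _ => 0 by apply: functional_extensionality => z; rewrite big_ord0.
  by split; [exact: moll_const | exact: rcont_const].
have [h1 h2] := IH (fun i => F (lift ord0 i)) (fun i => cF _).
have -> : (fun z => rsum (fun i => F i z)) = fun z => F ord0 z + rsum (fun i => F (lift ord0 i) z).
  by apply: functional_extensionality => z; rewrite rsum_recl.
by split; [rewrite moll_add // h1 rsum_recl | exact: rcont_add].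
Qed.

Lemma moll_walk m n rho (b : 'I_n -> pt m) tau f x : 0 < rho -> rcont f ->
  moll rho (walk b tau f) x = walk b tau (moll rho f) x.
Proof.
move=> r0 cf.
have tr v : rcont (fun z => f (z +^ v)).
  by apply: rcont_ext (rcont_affine 1 v cf) => z; congr f; vring.
pose F k z := (/ 2) * (f (z +^ tau *^ b k) + f (z +^ (- tau) *^ b k)).
have cF k : rcont (F k) by apply: rcont_scal; exact: rcont_add.
have [h1 h2] := moll_rsum x r0 cF.
have -> : walk b tau f = fun z => (/ (INR n + 1)) * (f z + rsum (fun k => F k z)).
  apply: functional_extensionality => z; rewrite /walk /avg (rsum_ext (g := fun k => F k z)); first by rewrite /Rdiv Rmult_comm.
  move=> k; rewrite /F; have -> : z +^ (- tau) *^ b k = z -^ tau *^ b k by vring.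
  by field.
rewrite moll_scal //; last exact: rcont_add.
rewrite moll_add // h1 /walk /avg Rmult_comm; congr ((_ + _) * _); apply: rsum_ext => k.
rewrite /F moll_scal //; last exact: rcont_add.
rewrite moll_add // !moll_shift; have -> : x +^ (- tau) *^ b k = x -^ tau *^ b k by vring.
by field.
Qed.

Lemma iter_walk_rcont m n (b : 'I_n -> pt m) tau f N : rcont f -> rcont (iter N (walk b tau) f).
Proof. by move=> cf; elim: N => //= N IH; exact: walk_rcont. Qed.

Lemma moll_iter_walk m n rho (b : 'I_n -> pt m) tau f x N : 0 < rho -> rcont f ->
  moll rho (iter N (walk b tau) f) x = iter N (walk b tau) (moll rho f) x.
Proof.
move=> r0 cf; elim: N x => //= N IH x; rewrite moll_walk //; last exact: iter_walk_rcont.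
by congr walk; apply: functional_extensionality.
Qed.

(** Along the walk the generator exceeds its value at [k0] by at most [nu] plus a multiple of
    [|z - k0|^2], whose mean is of the order of the elapsed time. The constant [c] depends neither
    on [F] nor on the step, so a time can be fixed before the function is known. *)
Lemma iter_walk_upper m n (b : 'I_n -> pt m) C k0 nu : 0 <= C -> 0 < nu -> exists c, 0 <= c /\
  forall F DF D2F, smoothlin C F DF D2F -> forall N tau, 0 < tau -> tau * (trsq b + 1) <= 1 ->
  iter N (walk b tau) F k0 <= F k0 + INR N * dt n tau * (lop b (D2F k0) + nu + c * tau + c * (INR N * dt n tau)).
Proof.
move=> C0 nu0; set A := trsq b; have A0 : 0 <= A := trsq_ge0 b.
pose MM := INR m * INR m; have M0 : 0 <= MM by have := pos_INR m; rewrite /MM; nra.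
pose C1 := MM * A * C; have C10 : 0 <= C1 by rewrite /C1; apply: Rmult_le_pos => //; nra.
have k00 := vnorm_ge0 k0.
pose X := 1 + vnorm k0.
pose c1 := C1 * C1 * (X * X) / (4 * nu) + C1.
have c10 : 0 <= c1.
  have : 0 <= C1 * C1 * (X * X) / (4 * nu) by apply: Rmult_le_pos; [nra | left; apply: Rinv_0_lt_compat; lra].
  by rewrite /c1; lra.
pose C2 := 2 * (MM * C * (A + 1) * A * (3 + vnorm k0)).
have C20 : 0 <= C2.
  have q1 : 0 <= MM * C by nra.
  have q2 : 0 <= (A + 1) * A by nra.
  have q3 : 0 <= MM * C * ((A + 1) * A) by nra.
  have q4 : 0 <= MM * C * ((A + 1) * A) * (3 + vnorm k0) by nra.
  by rewrite /C2; lra.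
pose c2 := c1 + C2; have c20 : 0 <= c2 by rewrite /c2; lra.
exists (C2 + 2 * c2 * A); split; first nra.
move=> F DF D2F [CF SF] N tau t0 tA.
have t1 : tau <= 1 by nra.
set d := dt n tau; have d0 : 0 <= d := dt_ge0 n tau.
set L0 := lop b (D2F k0).
have Lz z : lop b (D2F z) <= L0 + nu + c1 * dot (z -^ k0) (z -^ k0).
  have H := lop_diff b (X := D2F z) (Y := D2F k0) (e := C * vnorm (z -^ k0) * (1 + vnorm k0 + vnorm (z -^ k0))).
  have {}H : Rabs (lop b (D2F z) - lop b (D2F k0)) <= C1 * (vnorm (z -^ k0) * X) + C1 * (vnorm (z -^ k0) * vnorm (z -^ k0)).
    apply: Rle_trans (H _) _; last by rewrite /C1 /MM /X -/A; right; ring.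
    by move=> i j; have {1}-> : z = k0 +^ (z -^ k0) by vring; exact: SF.
  rewrite -vnorm_sq; move: (vnorm (z -^ k0)) H => s H.
  (* Young's inequality trades the term linear in [s] for [nu] and a quadratic term. *)
  have q : C1 * (s * X) <= nu + C1 * C1 * (X * X) / (4 * nu) * (s * s).
    have q2 : 0 <= (2 * nu - C1 * (s * X)) * (2 * nu - C1 * (s * X)) by exact: Rle_0_sqr.
    apply: (Rmult_le_reg_r (4 * nu)); first lra.
    rewrite (_ : (nu + _) * (4 * nu) = 4 * nu * nu + C1 * C1 * (X * X) * (s * s)); last by field; lra.
    by lra.
  by move: H; rewrite /c1 -/L0; split_Rabs; lra.
have one z : walk b tau F z <= F z + d * (L0 + nu + tau * C2 + c2 * dot (z -^ k0) (z -^ k0)).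
  have zz := vnorm_ge0 z.
  pose e := C * (tau * (A + 1)) * (2 + vnorm z).
  have tA0 : 0 <= tau * (A + 1) by nra.
  have CtA : 0 <= C * (tau * (A + 1)) by exact: Rmult_le_pos.
  have e0 : 0 <= e by rewrite /e; apply: Rmult_le_pos; lra.
  have := @walk_expand m n b tau F DF D2F z e e0 CF.
  have ent s k i j : -1 <= s <= 1 -> Rabs (D2F (z +^ (s * tau) *^ b k) i j - D2F z i j) <= e.
    move=> hs; apply: Rle_trans (SF _ _ _ _) _.
    have nv : vnorm ((s * tau) *^ b k) <= tau * (A + 1).
      rewrite vnorm_scal Rabs_mult (Rabs_pos_eq tau); last lra.
      have h1 : Rabs s <= 1 by split_Rabs; lra.
      have q1 := trsq_norm b k; have q2 := vnorm_ge0 (b k); have q3 := Rabs_pos s.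
      apply: (Rle_trans _ (1 * tau * vnorm (b k))); last by rewrite -/A in q1; nra.
      by apply: Rmult_le_compat_r => //; apply: Rmult_le_compat_r; lra.
    have q4 := vnorm_ge0 ((s * tau) *^ b k).
    by rewrite /e; apply: Rmult_le_compat; [nra | nra | apply: Rmult_le_compat_l => // | nra].
  move=> /(_ ent); rewrite -/d -/A => ex.
  have E : 2 * d * (INR m * (INR m * e)) * A <= d * (tau * C2 * (1 + dot (z -^ k0) (z -^ k0))).
    have q1 : 2 + vnorm z <= (3 + vnorm k0) * (1 + dot (z -^ k0) (z -^ k0)).
      have := vnorm_le_dist z k0; rewrite -vnorm_sq; have := vnorm_ge0 (z -^ k0) => q1 q2.
      by have := Rle_0_sqr (vnorm (z -^ k0) - 1); rewrite /Rsqr; nra.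
    rewrite (_ : 2 * d * _ * A = d * (tau * (2 * (MM * C * (A + 1) * A) * (2 + vnorm z)))); last by rewrite /e /MM; ring.
    apply: Rmult_le_compat_l => //.
    rewrite (_ : tau * C2 * _ = tau * (2 * (MM * C * (A + 1) * A) * ((3 + vnorm k0) * (1 + dot (z -^ k0) (z -^ k0))))); last by rewrite /C2; ring.
    apply: Rmult_le_compat_l; first lra.
    apply: Rmult_le_compat_l => //.
    have q2 : 0 <= MM * C by nra.
    have q3 : 0 <= (A + 1) * A by nra.
    by nra.
  have q5 := dot_ge0 (z -^ k0).
  have q6 := Rmult_le_compat_l _ _ _ d0 (Lz z).
  have q7 : tau * C2 * dot (z -^ k0) (z -^ k0) <= C2 * dot (z -^ k0) (z -^ k0).
    rewrite Rmult_assoc; have : 0 <= C2 * dot (z -^ k0) (z -^ k0) by nra.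
    by nra.
  have q8 := Rmult_le_compat_l _ _ _ d0 q7.
  by move: ex; rewrite /c2; split_Rabs; lra.
have main j z : iter j (walk b tau) F z <= F z + INR j * d * (L0 + nu + tau * C2 + c2 * (dot (z -^ k0) (z -^ k0) + 2 * (INR j * d) * A)).
  elim: j z => [|j IH] z; first by rewrite /=; lra.
  rewrite [iter _ _ _]/=; have jp := pos_INR j.
  apply: Rle_trans (walk_mono b tau z IH) _.
  have -> : (fun z => F z + INR j * d * (L0 + nu + tau * C2 + c2 * (dot (z -^ k0) (z -^ k0) + 2 * (INR j * d) * A))) =
    (fun z => F z + (INR j * d * (L0 + nu + tau * C2 + c2 * (2 * (INR j * d) * A)) + (INR j * d * c2) * dot (z -^ k0) (z -^ k0))).
    by apply: functional_extensionality => y; ring.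
  rewrite !walk_add walk_const walk_scal walk_sqdist -/d -/A S_INR.
  have := one z.
  have q1 : 0 <= d * d * c2 * A by apply: Rmult_le_pos => //; apply: Rmult_le_pos => //; nra.
  have q2 : 0 <= INR j * (d * d * c2 * A) by nra.
  by lra.
apply: Rle_trans (main N k0) _.
have -> : dot (k0 -^ k0) (k0 -^ k0) = 0 by rewrite -vnorm_sq vnorm_subxx; ring.
have q0 : 0 <= INR N * d by have := pos_INR N; nra.
have q1 : 0 <= c2 * A by nra.
have q2 : 0 <= INR N * d * (c2 * A * tau) by apply: Rmult_le_pos => //; nra.
have q3 : 0 <= INR N * d * (C2 * (INR N * d)) by apply: Rmult_le_pos => //; nra.
by lra.
Qed.

Lemma walk_parameters n t zeta N0 : 0 < t -> 0 < zeta ->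
  exists N tau, [/\ le N0 N, 0 < tau, tau <= zeta & INR N * dt n tau = t].
Proof.
move=> t0 z0; have n1 : 0 < INR n + 1 by have := pos_INR n; lra.
have [N1 HN1] := INR_unbounded (2 * (INR n + 1) * t / (zeta * zeta)).
pose N := Nat.max N0 N1; exists N, (sqrt (2 * (INR n + 1) * t / INR N)).
have NN : INR N1 <= INR N by apply: le_INR; rewrite /N; lia.
have X0 : 0 < 2 * (INR n + 1) * t / (zeta * zeta) by apply: Rdiv_lt_0_compat; nra.
have Np : 0 < INR N by lra.
have q0 : 0 < 2 * (INR n + 1) * t / INR N by apply: Rdiv_lt_0_compat => //; nra.
split; first by rewrite /N; lia.
- exact: sqrt_lt_R0.
- rewrite -(sqrt_Rsqr zeta); last lra.
  apply: sqrt_le_1_alt; rewrite /Rsqr.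
  apply: (Rmult_le_reg_r (INR N)) => //.
  rewrite (_ : 2 * (INR n + 1) * t / INR N * INR N = 2 * (INR n + 1) * t); last by field; lra.
  have q1 : 2 * (INR n + 1) * t / (zeta * zeta) * (zeta * zeta) = 2 * (INR n + 1) * t by field; lra.
  have : 0 < zeta * zeta by nra.
  by nra.
- rewrite /dt sqrt_sqrt; last lra.
  by field; lra.
Qed.

Lemma jrad_small m zeta : 0 < zeta -> exists eta, 0 < eta /\ jrad m eta <= zeta.
Proof.
move=> z0; rewrite /jrad; have s0 := pos_INR (size (enum 'I_m)).
exists (zeta / (2 * INR (size (enum 'I_m)) + 1)); split; first by apply: Rdiv_lt_0_compat; lra.
move: (INR _) s0 => s s0.
have q1 : zeta / (2 * s + 1) * (2 * s + 1) = zeta by field; lra.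
have q2 : 0 < zeta / (2 * s + 1) by apply: Rdiv_lt_0_compat; lra.
by nra.
Qed.

(* The mollified sup-convolution [S] of [U] satisfies the differential inequality with the
   matrix of directions [b] in place of [a], at the cost [2 B |a - b|^2]. *)
Lemma moll_supconv_sub m n (a b : 'I_n -> pt m) U S B K gam rho k0 :
  0 <= K -> 0 < B -> loclin K U -> semiconvex K U -> csub a gam U -> loclin K S ->
  (forall h k, U h <= S k + B * dot (h -^ k) (h -^ k)) ->
  (forall k, exists h, S k = U h - B * dot (h -^ k) (h -^ k) /\ vnorm h <= 4 * vnorm k) ->
  0 < rho -> jrad m rho <= 1 ->
  gam - 2 * B * rsum (fun i => dot (a i -^ b i) (a i -^ b i)) <= lop b (D2moll rho S k0).
Proof.
move=> K0 B0 LU sU vU LS US att r0 r1.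
set D := 2 * B * rsum _.
(* Seven errors of size [nu] per unit of time are collected at the end; nine leave some slack. The
   parameters are chosen in the order [nu], [c], [t], [beta], [eta], [tau], while [rho] stays
   fixed. *)
apply: eps_le => nu9 nu90; pose nu := nu9 / 9; have nu0 : 0 < nu by rewrite /nu; lra.
have cU := loclin_rcont K0 LU; have cS := loclin_rcont K0 LS.
have [c [c0 Hc]] := iter_walk_upper b k0 (C := 3 * (3 * K * 2) * jcst m rho) ltac:(have := jcst_gt0 m r0; nra) nu0.
pose t := nu / (c + 1); have t0 : 0 < t by apply: Rdiv_lt_0_compat; lra.
have ct : c * t <= nu.
  have : t * (c + 1) = nu by rewrite /t; field; lra.
  lra.
set Aa := trsq a; have Aa0 : 0 <= Aa := trsq_ge0 a.
set Ab := trsq b; have Ab0 : 0 <= Ab := trsq_ge0 b.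
pose R1 := vnorm k0 + 1; have k00 := vnorm_ge0 k0.
pose R0 := 4 * R1.
have R00 : 0 < R0 by rewrite /R0 /R1; lra.
pose beta := Rmin (nu / (2 * Aa + 1)) (nu * t / (R0 * R0)).
have b0 : 0 < beta.
  by apply: Rmin_pos; apply: Rdiv_lt_0_compat; nra.
have bA : 2 * beta * Aa <= nu.
  have q1 : beta <= nu / (2 * Aa + 1) := Rmin_l _ _.
  have q2 : nu / (2 * Aa + 1) * (2 * Aa + 1) = nu by field; lra.
  by nra.
have bR : beta * (R0 * R0) <= nu * t.
  have q1 : beta <= nu * t / (R0 * R0) := Rmin_r _ _.
  have q2 : nu * t / (R0 * R0) * (R0 * R0) = nu * t by field; lra.
  have : 0 < R0 * R0 by nra.
  by nra.
pose MM := INR m * INR m; have M0 : 0 <= MM by have := pos_INR m; rewrite /MM; nra.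
have jc := jcst_gt0 m r0.
pose X := (1 + R0 * R0 + 2 * t * Aa) + (1 + R1 * R1) + t * (MM * Ab * jcst m rho * (1 + R1 * R1)).
have X1 : 0 <= 2 * t * Aa by nra.
have X2 : 0 <= MM * Ab * jcst m rho * (1 + R1 * R1).
  by apply: Rmult_le_pos; [apply: Rmult_le_pos; nra | nra].
have X0 : 0 < X by rewrite /X; nra.
have [eta [e0 He]] := @jrad_small m (Rmin 1 (nu * t / (X * (4 * K + 1)))) ltac:(apply: Rmin_pos; [lra | apply: Rdiv_lt_0_compat; nra]).
have e1 := Rle_trans _ _ _ He (Rmin_l _ _).
pose kap := 4 * K * jrad m eta.
have kap0 : 0 <= kap by have := jrad_ge0 m e0; rewrite /kap; nra.
have kX : kap * X <= nu * t.
  have q1 := Rle_trans _ _ _ He (Rmin_r _ _).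
  have q2 : nu * t / (X * (4 * K + 1)) * (X * (4 * K + 1)) = nu * t by field; lra.
  have q3 := jrad_ge0 m e0.
  have q4 : jrad m eta * (X * (4 * K + 1)) <= nu * t.
    by rewrite -q2; apply: Rmult_le_compat_r => //; nra.
  rewrite /kap; have : 0 <= jrad m eta * X by nra.
  by lra.
have mclose x := moll_close e0 e1 K0 LU x; have mcloseS x := moll_close e0 e1 K0 LS x.
(* A smooth majorant of [U]: the mollification error is at most [kap (1 + |h|^2)], which is
   added. *)
pose f h := moll eta U h + (kap * dot (h -^ @vzero m) (h -^ @vzero m) + (dot (@vzero m) h + kap)).
have fE h : f h = moll eta U h + kap * (1 + dot h h).
  by rewrite /f (_ : h -^ @vzero m = h); [rewrite dot_0l; ring | vring].
have Uf h : U h <= f h.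
  by rewrite fE; have := mclose h; rewrite -/kap; split_Rabs; lra.
have [Cm Sm] := moll_smoothlin e0 e1 K0 LU.
have Sf : exists Df D2f, smooth (2 * (3 * K * jcst m eta)) f Df D2f.
  have Cf := C2_add Cm (C2_add (C2_sqdist kap (@vzero m)) (C2_lin (@vzero m) kap)).
  eexists; eexists; apply: smoothlin_smooth; first by have := jcst_gt0 m e0; nra.
  split; first exact: Cf.
  move=> h s i j; rewrite /madd.
  by move: (Sm h s i j); split_Rabs; lra.
have [Df [D2f {}Sf]] := Sf.
have CC : 0 <= 2 * (3 * K * jcst m eta) by have := jcst_gt0 m e0; nra.
have [N0 HN0] := csub_mean_value cU K0 sU vU CC Sf Uf t0 b0 nu0.
have [N [tau [NN tp tz HN]]] := walk_parameters n N0 t0 (zeta := Rmin (/ (Ab + 1)) (nu / (c + 1))) ltac:(apply: Rmin_pos; [apply: Rinv_0_lt_compat; lra | exact: t0]).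
have tA : tau * (Ab + 1) <= 1.
  have := Rle_trans _ _ _ tz (Rmin_l _ _).
  by move=> /(Rmult_le_compat_r (Ab + 1)); rewrite Rinv_l; [apply; lra | lra].
have tc : c * tau <= nu.
  have q := Rle_trans _ _ _ tz (Rmin_r _ _); rewrite -/t in q; nra.
have MV := HN0 N tau NN tp HN.
have cmS := moll_rcont e0 cS.
(* Mollification commutes with translations, so the inequality between [U] and [S] passes to the
   mollified functions with the vector [h - k] frozen. *)
have fcmp h k : f h <= moll eta S k + B * dot (h -^ k) (h -^ k) + kap + kap * dot h h.
  rewrite fE.
  have cUs : rcont (fun z => U (z +^ (h -^ k))) by apply: rcont_ext (rcont_affine 1 (h -^ k) cU) => z; congr U; vring.
  have : moll eta U h <= moll eta S k + B * dot (h -^ k) (h -^ k).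
    have {1}-> : h = k +^ (h -^ k) by vring.
    rewrite -moll_shift -[X in _ + X](moll_const eta _ k) -moll_add //; last exact: rcont_const.
    apply: moll_mono => //; first by apply: rcont_add => //; exact: rcont_const.
    by move=> z _; have := US (z +^ (h -^ k)) z; have -> : z +^ (h -^ k) -^ z = h -^ k by vring.
  by lra.
have IC := iter_walk_compare a b tau kap0 fcmp N.
rewrite HN -/D -/Aa in IC.
pose E := t * D + kap * (1 + R0 * R0 + 2 * t * Aa) + beta * (R0 * R0) + t * (- gam + 2 * beta * Aa + nu).
(* At the point [h] realizing [S k], the mean value inequality for [U] with directions [a] is
   transferred by the coupling to [S] at [k] with directions [b]; the terms [B |h - k|^2] cancel. *)
have SE k : vnorm (k -^ k0) <= jrad m rho -> S k <= iter N (walk b tau) (moll eta S) k + E.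
  move=> hk; have [h [-> hh]] := att k.
  have hR : dot h h <= R0 * R0.
    rewrite -vnorm_sq; have q1 : vnorm h <= R0 by have := vnorm_le_dist k k0; rewrite /R0 /R1; lra.
    by have := vnorm_ge0 h; nra.
  have := MV h; have := IC h k; rewrite -/Aa /E.
  have q2 := Rmult_le_compat_l _ _ _ kap0 hR; have q3 := Rmult_le_compat_l _ _ _ (Rlt_le _ _ b0) hR.
  by lra.
have citer := iter_walk_rcont b tau N cmS.
have mE : moll rho S k0 <= moll rho (iter N (walk b tau) (moll eta S)) k0 + E.
  rewrite -[X in _ + X](moll_const rho _ k0) -moll_add //; last exact: rcont_const.
  by apply: moll_mono => //; apply: rcont_add => //; exact: rcont_const.
(* Mollification at the fixed scale [rho] commutes with the walk and makes the short time expansion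
   of [iter_walk_upper] available for [S], which need not have second derivatives. *)
rewrite moll_iter_walk // in mE.
have LmS := moll_loclin e0 e1 K0 LS.
have K60 : 0 <= 3 * K * 2 by lra.
have SF := moll_smoothlin r0 r1 K60 LmS.
have up := Hc _ _ _ SF N tau tp tA; rewrite HN in up.
have near z : vnorm (z -^ k0) <= jrad m rho -> Rabs (moll eta S z - S z) <= kap * (1 + R1 * R1).
  move=> hz; apply: Rle_trans (mcloseS z) _; rewrite -/kap; apply: Rmult_le_compat_l => //.
  rewrite -vnorm_sq; have q1 : vnorm z <= R1 by have := vnorm_le_dist z k0; rewrite /R1; lra.
  by have := vnorm_ge0 z; nra.
have F1 : moll rho (moll eta S) k0 <= moll rho S k0 + kap * (1 + R1 * R1).
  rewrite -[X in _ + X](moll_const rho _ k0) -moll_add //; last exact: rcont_const.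
  apply: moll_mono => //; first by apply: rcont_add => //; exact: rcont_const.
  by move=> z /near; split_Rabs; lra.
have F2 : lop b (D2moll rho (moll eta S) k0) <= lop b (D2moll rho S k0) + kap * (MM * Ab * jcst m rho * (1 + R1 * R1)).
  have := lop_diff b (fun i j => D2moll_diff r0 i j cmS cS near).
  have -> : INR m * (INR m * (jcst m rho * (kap * (1 + R1 * R1)))) * trsq b = kap * (MM * Ab * jcst m rho * (1 + R1 * R1)).
    by rewrite /MM /Ab; ring.
  by split_Rabs; lra.
have F3 := Rmult_le_compat_l _ _ _ (Rlt_le _ _ t0) F2.
have kX' : kap * X = kap * (1 + R0 * R0 + 2 * t * Aa) + kap * (1 + R1 * R1) + t * (kap * (MM * Ab * jcst m rho * (1 + R1 * R1))).
  by rewrite /X; ring.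
apply: (Rmult_le_reg_l t) => //.
have G1 := Rmult_le_compat_l _ _ _ (Rlt_le _ _ t0) tc.
have G2 := Rmult_le_compat_l _ _ _ (Rlt_le _ _ t0) ct.
have G3 := Rmult_le_compat_l _ _ _ (Rlt_le _ _ t0) bA.
have nn : nu9 = 9 * nu by rewrite /nu; field.
rewrite nn; move: mE up; rewrite /E => mE up.
have tnu : 0 < t * nu by exact: Rmult_lt_0_compat.
lra.
Qed.

Lemma lop_madd m n (a : 'I_n -> pt m) X Y : lop a (madd X Y) = lop a X + lop a Y.
Proof. by rewrite /lop -rsum_add; apply: rsum_ext => k; exact: qf_madd. Qed.
Lemma lop_mscal m n (a : 'I_n -> pt m) c X : lop a (mscal c X) = c * lop a X.
Proof. by rewrite /lop -rsum_scal; apply: rsum_ext => k; exact: qf_mscal. Qed.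
Lemma lop_msym m n (a : 'I_n -> pt m) X : lop a (msym X) = lop a X.
Proof. by apply: rsum_ext => k; exact: qf_msym. Qed.
Lemma lop_id m n (a : 'I_n -> pt m) : lop a (@mid m) = trsq a.
Proof. by apply: rsum_ext => k; exact: qf_id. Qed.

Definition supported_below m K (u : pt m -> R) :=
  forall h, exists q, forall h', u h + dot q (h' -^ h) - K * dot (h' -^ h) (h' -^ h) <= u h'.

Lemma supported_semiconvex m K (u : pt m -> R) : supported_below K u -> semiconvex (2 * K) u.
Proof.
move=> H h s; have [q Hq] := H h.
have := Hq (h +^ s); have := Hq (h -^ s).
have -> : h +^ s -^ h = s by vring.
have -> : h -^ s -^ h = (-1) *^ s by vring.
rewrite !dotE; lra.
Qed.

(** Moving by [r + 1] in the direction of a supporting slope [q] raises [u] by at least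
    [(r + 1) |q|] up to quadratic terms, so quadratic growth bounds the slopes. *)
Lemma supported_loclip m K (u : pt m -> R) r : 0 <= K -> supported_below K u -> 0 <= r ->
  (forall h, vnorm h <= 2 * r + 1 -> Rabs (u h) <= K * dot h h) ->
  forall h h', vnorm h <= r -> vnorm h' <= r -> Rabs (u h - u h') <= 8 * K * (1 + r) * vnorm (h -^ h').
Proof.
move=> K0 H r0 bd.
have main h h' : vnorm h <= r -> vnorm h' <= r -> u h - u h' <= 8 * K * (1 + r) * vnorm (h' -^ h).
  move=> hr hr'; have [q Hq] := H h; have h0 := vnorm_ge0 h.
  have uh : - (K * (r * r)) <= u h.
    have := bd h ltac:(lra); rewrite -vnorm_sq.
    have q1 : vnorm h * vnorm h <= r * r by nra.
    have q2 := Rmult_le_compat_l _ _ _ K0 q1.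
    by split_Rabs; lra.
  have qb : vnorm q <= 6 * K * (1 + r).
    case: (Req_dec (vnorm q) 0) => [->|qn]; first by nra.
    have qp : 0 < vnorm q by have := vnorm_ge0 q; lra.
    pose v := ((r + 1) / vnorm q) *^ q.
    have nv : vnorm v = r + 1.
      rewrite /v vnorm_scal Rabs_pos_eq; first by field.
      by apply: Rmult_le_pos; [lra | left; exact: Rinv_0_lt_compat].
    have qv : dot q v = (r + 1) * vnorm q by rewrite /v dot_scalr -vnorm_sq; field.
    have := Hq (h +^ v); have -> : h +^ v -^ h = v by vring.
    rewrite qv -vnorm_sq nv.
    have nhv : vnorm (h +^ v) <= 2 * r + 1 by have := vnorm_tri h v; lra.
    have := bd _ nhv; rewrite -vnorm_sq.
    have q1 : vnorm (h +^ v) * vnorm (h +^ v) <= (2 * r + 1) * (2 * r + 1) by have := vnorm_ge0 (h +^ v); nra.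
    have q2 := Rmult_le_compat_l _ _ _ K0 q1.
    move=> q3 q4.
    have q5 : (r + 1) * vnorm q <= K * ((2 * r + 1) * (2 * r + 1) + r * r + (r + 1) * (r + 1)) by move: q3; split_Rabs; lra.
    have q6 : K * ((2 * r + 1) * (2 * r + 1) + r * r + (r + 1) * (r + 1)) <= K * (6 * (r + 1) * (r + 1)) by apply: Rmult_le_compat_l => //; nra.
    apply: (Rmult_le_reg_l (r + 1)); lra.
  have := Hq h'; have := CS_ge q (h' -^ h); rewrite -vnorm_sq => q1 q2.
  have d0 := vnorm_ge0 (h' -^ h).
  have d1 : vnorm (h' -^ h) <= 2 * r by have := vnorm_sub_le h' h; lra.
  have q3 : vnorm q * vnorm (h' -^ h) <= 6 * K * (1 + r) * vnorm (h' -^ h) by apply: Rmult_le_compat_r.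
  have q4 : K * (vnorm (h' -^ h) * vnorm (h' -^ h)) <= K * (2 * (1 + r)) * vnorm (h' -^ h).
    by rewrite -Rmult_assoc; apply: Rmult_le_compat_r => //; apply: Rmult_le_compat_l => //; lra.
  by lra.
move=> h h' hr hr'; have := main h h' hr hr'; have := main h' h hr' hr.
by rewrite (vnorm_subC h' h); split_Rabs; lra.
Qed.

Lemma loclin_mono m K K' (u : pt m -> R) : K <= K' -> loclin K u -> loclin K' u.
Proof.
move=> KK H h h'; apply: Rle_trans (H h h') _.
apply: Rmult_le_compat_r; first exact: vnorm_ge0.
by apply: Rmult_le_compat_r => //; have := vnorm_ge0 h; have := vnorm_ge0 h'; lra.
Qed.

Lemma semiconvex_mono m K K' (u : pt m -> R) : K <= K' -> semiconvex K u -> semiconvex K' u.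
Proof. by move=> KK H h s; apply: Rle_trans (H h s); have := dot_ge0 s; nra. Qed.

(** The bound with half the opening, [B / 2 |h|^2], makes the maximization coercive. A competitor at
    distance [d > 3 |k|] from [k] loses against [h = 0] because [(d - 3 |k|) (d + |k|) > 0]; so
    maximizers stay within a multiple of [|k|], and the Lipschitz constant of [S] grows linearly. *)
Lemma quadratic_supconv m (U : pt m -> R) B K : 0 < B -> 0 <= K -> loclin K U ->
  U (@vzero m) = 0 -> (forall h, U h <= B / 2 * dot h h) ->
  exists S, [/\ loclin (7 * B) S, forall h k, U h <= S k + B * dot (h -^ k) (h -^ k) &
   forall k, exists h, S k = U h - B * dot (h -^ k) (h -^ k) /\ vnorm h <= 4 * vnorm k].
Proof.
move=> B0 K0 LU U0 UB; have cU := loclin_rcont K0 LU.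
have H k : exists h, vnorm (h -^ k) <= 3 * vnorm k /\
    forall h', U h' - B * dot (h' -^ k) (h' -^ k) <= U h - B * dot (h -^ k) (h -^ k).
  have cF : rcont (fun h => U h - B * dot (h -^ k) (h -^ k)).
    by apply: rcont_sub => //; exact: C2_rcont (C2_sqdist B k).
  have k0 := vnorm_ge0 k.
  have [h [h1 h2]] := extreme_value_ball k (r := 3 * vnorm k) ltac:(lra) cF.
  exists h; split=> // h'.
  case: (Rle_dec (vnorm (h' -^ k)) (3 * vnorm k)) => far; first exact: h2.
  have zz : vnorm (@vzero m -^ k) = vnorm k by rewrite vnorm_subC; congr vnorm; vring.
  have := h2 (@vzero m) ltac:(rewrite zz; lra); rewrite U0 -!vnorm_sq zz.
  have := UB h'; rewrite -vnorm_sq; have := vnorm_le_dist h' k; have := vnorm_ge0 h'.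
  move: (vnorm h') (vnorm (h' -^ k)) far => x d far x0 xd Ux.
  have q : x * x <= (d + vnorm k) * (d + vnorm k) by nra.
  have q2 : B * (x * x) <= B * ((d + vnorm k) * (d + vnorm k)) by apply: Rmult_le_compat_l; lra.
  have q3 : 0 <= B * (d * d - 2 * d * vnorm k - 3 * (vnorm k * vnorm k)) by apply: Rmult_le_pos; nra.
  lra.
have [hh Hh] := fun_choice H.
pose S k := U (hh k) - B * dot (hh k -^ k) (hh k -^ k).
exists S; split.
- have main k k' : S k - S k' <= 7 * B * (1 + vnorm k + vnorm k') * vnorm (k' -^ k).
    have [h1 _] := Hh k; have [_ h2] := Hh k'.
    have := h2 (hh k); rewrite -/(S k').
    have -> : hh k -^ k' = (hh k -^ k) -^ (k' -^ k) by vring.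
    have d1 : vnorm (k' -^ k) <= vnorm k + vnorm k' by have := vnorm_sub_le k' k; lra.
    have k0 := vnorm_ge0 k; have k'0 := vnorm_ge0 k'.
    rewrite -[S k]/(U (hh k) - B * dot (hh k -^ k) (hh k -^ k)).
    move: (hh k -^ k) (k' -^ k) h1 d1 => p v h1 d1.
    have d0 := vnorm_ge0 v; have := CS_ge p v; have := vnorm_sq v.
    rewrite !dotE (dotC v p) => e1 e2 e3.
    have q1 : vnorm p * vnorm v <= 3 * vnorm k * vnorm v by apply: Rmult_le_compat_r.
    have q2 : vnorm v * vnorm v <= (vnorm k + vnorm k') * vnorm v by apply: Rmult_le_compat_r.
    have q3 : dot v v - 2 * dot p v <= 7 * (1 + vnorm k + vnorm k') * vnorm v by nra.
    have := Rmult_le_compat_l _ _ _ (Rlt_le _ _ B0) q3; lra.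
  move=> k k'; have := main k k'; have := main k' k; rewrite (vnorm_subC k' k).
  by split_Rabs; lra.
- by move=> h k; have [_ h2] := Hh k; have := h2 h; rewrite -/(S k); lra.
- move=> k; exists (hh k); split=> //; have [h1 _] := Hh k.
  by have := vnorm_le_dist (hh k) k; lra.
Qed.

(* This replaces the theorem on sums: since the inequalities for [U1] and [U2] hold for every
   [th] and are linear in the Hessian, mollified sup-convolutions of [U1] and [U2] are smooth
   test functions for [V]. *)
Lemma const_coef_comparison m n (Theta : Type) (a1 a2 b : Theta -> 'I_n -> pt m)
  (g1 g2 g3 : Theta -> R) U1 U2 V B K A X eps :
  0 < B -> 0 <= K -> loclin K U1 -> loclin K U2 -> semiconvex K U1 -> semiconvex K U2 ->
  (forall th, csub (a1 th) (g1 th) U1) -> (forall th, csub (a2 th) (g2 th) U2) ->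
  rcont V ->
  (forall phi Dphi D2phi, C2 phi Dphi D2phi -> forall k, locmax phi V k ->
     forall e, 0 < e -> exists th, lop (b th) (D2phi k) <= g3 th + e) ->
  U1 (@vzero m) = 0 -> U2 (@vzero m) = 0 -> V (@vzero m) = 0 ->
  (forall h, U1 h <= B / 2 * dot h h) -> (forall h, U2 h <= B / 2 * dot h h) ->
  (forall h1 h2 k, U1 h1 + U2 h2 - V k <= B / 2 * (dot (h1 -^ k) (h1 -^ k) + dot (h2 -^ k) (h2 -^ k)) + / 2 * qf X k) ->
  (forall th, trsq (b th) <= A) -> 0 < eps ->
  exists th, g1 th + g2 th <= g3 th + lop (b th) X
    + 2 * B * (rsum (fun i => dot (a1 th i -^ b th i) (a1 th i -^ b th i)) + rsum (fun i => dot (a2 th i -^ b th i) (a2 th i -^ b th i))) + eps.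
Proof.
move=> B0 K0 L1 L2 s1 s2 v1 v2 cV vV U10 U20 V0 b1 b2 J bA e0.
have [S1 [LS1 US1 at1]] := quadratic_supconv B0 K0 L1 U10 b1.
have [S2 [LS2 US2 at2]] := quadratic_supconv B0 K0 L2 U20 b2.
pose K' := K + 7 * B; have K'0 : 0 <= K' by rewrite /K'; lra.
have KK : K <= K' by rewrite /K'; lra.
have BK : 7 * B <= K' by rewrite /K'; lra.
have {}L1 := loclin_mono KK L1; have {}L2 := loclin_mono KK L2.
have {}s1 := semiconvex_mono KK s1; have {}s2 := semiconvex_mono KK s2.
have {}LS1 := loclin_mono BK LS1; have {}LS2 := loclin_mono BK LS2.
have cS1 := loclin_rcont K'0 LS1; have cS2 := loclin_rcont K'0 LS2.
pose nu := eps / (4 * (Rabs A + 1)).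
have A0 := Rabs_pos A.
have nu0 : 0 < nu by apply: Rdiv_lt_0_compat; lra.
have nuA : nu * (4 * (Rabs A + 1)) = eps by rewrite /nu; field; lra.
have [rho [r0 hr]] := @jrad_small m (Rmin 1 (nu / (64 * (K' + 1)))) ltac:(apply: Rmin_pos; [lra | apply: Rdiv_lt_0_compat; lra]).
have r1 := Rle_trans _ _ _ hr (Rmin_l _ _).
have r2 : 64 * (K' + 1) * jrad m rho <= nu.
  have q1 := Rle_trans _ _ _ hr (Rmin_r _ _).
  have q2 : nu / (64 * (K' + 1)) * (64 * (K' + 1)) = nu by field; lra.
  by have := jrad_ge0 m r0; nra.
pose z := @vzero m.
have zE (h : pt m) : h -^ z = h by rewrite /z; vring.
have CX := C2_quad X z.
have C1 := moll_C2 r0 cS1; have C2' := moll_C2 r0 cS2.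
have close S x : loclin K' S -> vnorm (x -^ z) <= 1 -> Rabs (moll rho S x - S x) <= nu / 8 - K' * 0.
  move=> LS; rewrite zE => x1; apply: Rle_trans (moll_close r0 r1 K'0 LS x) _.
  have q1 : dot x x <= 1 by rewrite -vnorm_sq; have := vnorm_ge0 x; nra.
  have q2 := jrad_ge0 m r0.
  have q3 : 0 <= K' * jrad m rho by nra.
  have q4 : 4 * K' * jrad m rho * (1 + dot x x) <= 4 * K' * jrad m rho * 2 by apply: Rmult_le_compat_l; nra.
  lra.
(* The joint inequality, whose coefficient is only [B / 2] after rescaling, is inserted at the
   points realizing [S1 k] and [S2 k], where [B] times the same squares is subtracted. At the origin
   [S1] and [S2] are nonnegative and the other terms vanish. *)
have below k : vnorm (k -^ z) <= 1 -> S1 k + S2 k - (V k + / 2 * qf X (k -^ z)) <= S1 z + S2 z - (V z + / 2 * qf X (z -^ z)).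
  move=> _; have [h1 [-> _]] := at1 k; have [h2 [-> _]] := at2 k.
  have := J h1 h2 k; have := US1 z z; have := US2 z z; rewrite U10 U20 V0 !zE.
  have -> : dot z z = 0 by exact: dot_0l.
  have -> : qf X z = 0 by exact: dot_0l.
  have q1 := dot_ge0 (h1 -^ k); have q2 := dot_ge0 (h2 -^ k); nra.
have near k : vnorm (k -^ z) <= 1 -> Rabs (moll rho S1 k + moll rho S2 k - (S1 k + S2 k)) <= nu / 4.
  by move=> hk; have := close S1 k LS1 hk; have := close S2 k LS2 hk; split_Rabs; lra.
(* The position of this contact point does not matter: the Hessian bounds of [moll_supconv_sub] hold
   at every point. *)
have [x [x1 _ x3]] := perturbed_max (rcont_add (C2_rcont C1) (C2_rcont C2')) (rcont_add cV (C2_rcont CX))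
  Rlt_0_1 nu0 below near ltac:(lra).
pose phi k := (moll rho S1 k + moll rho S2 k) + (-1) * (/ 2 * qf X (k -^ z) + nu * dot (k -^ z) (k -^ z)).
have Cphi := C2_add (C2_add C1 C2') (C2_scal (-1) (C2_add CX (C2_sqdist nu z))).
have lm : locmax phi V x.
  have [r [rp Hr]] := x3; exists r; split=> // y hy; have := Hr y hy; rewrite /phi; lra.
have [th Hth] := vV _ _ _ Cphi x lm (eps / 2) ltac:(lra).
exists th; move: Hth; rewrite 2!lop_madd (lop_mscal _ (-1)) lop_madd lop_msym (lop_mscal _ (2 * nu)) lop_id.
have m1 := moll_supconv_sub (b th) x K'0 B0 L1 s1 (v1 th) LS1 US1 at1 r0 r1.
have m2 := moll_supconv_sub (b th) x K'0 B0 L2 s2 (v2 th) LS2 US2 at2 r0 r1.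
have tA := bA th; have tA0 := trsq_ge0 (b th); have AA := Rle_abs A.
have q : nu * trsq (b th) <= nu * Rabs A by apply: Rmult_le_compat_l; lra.
lra.
Qed.

(** * Sup-convolutions and blow-ups *)

Section SupConv.
Variable m : nat.
Implicit Types (f g S : pt m -> R) (x p q : pt m).

(** The function [sel] records a maximizer for each point, since contacts of [S] are later moved to
    that maximizer. *)
Definition is_supconv B f S (sel : pt m -> pt m) :=
  (forall k h, f h - B * dot (h -^ k) (h -^ k) <= S k) /\
  (forall k, S k = f (sel k) - B * dot (sel k -^ k) (sel k -^ k)).

Lemma supconv_exists B f M : 0 < B -> rcont f -> (forall x, Rabs (f x) <= M) ->
  exists S sel, is_supconv B f S sel.
Proof.
move=> B0 cf bf.
have H k : exists h, forall h', f h' - B * dot (h' -^ k) (h' -^ k) <= f h - B * dot (h -^ k) (h -^ k).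
  have cF : rcont (fun h => f h - B * dot (h -^ k) (h -^ k)).
    by apply: rcont_sub => //; exact: C2_rcont (C2_sqdist B k).
  have M0 : 0 <= M by have := bf k; have := Rabs_pos (f k); lra.
  pose r := 1 + 2 * M / B.
  have r1 : 1 <= r by rewrite /r; have q : 0 <= 2 * M / B by [apply: Rmult_le_pos; [lra | left; exact: Rinv_0_lt_compat]]; lra.
  have Br : B * r = B + 2 * M by rewrite /r; field; lra.
  have [h [h1 h2]] := extreme_value_ball k (r := r) ltac:(lra) cF.
  exists h => h'; case: (Rle_dec (vnorm (h' -^ k)) r) => far; first exact: h2.
  have kk : vnorm (k -^ k) <= r by rewrite vnorm_subxx; lra.
  have := h2 k kk; rewrite -!vnorm_sq vnorm_subxx.
  have := bf h'; have := bf k.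
  have q : B * (r * r) <= B * (vnorm (h' -^ k) * vnorm (h' -^ k)) by apply: Rmult_le_compat_l; [lra | nra].
  have q2 : 2 * M <= B * (r * r) by nra.
  by split_Rabs; lra.
have [sel Hs] := fun_choice H.
by exists (fun k => f (sel k) - B * dot (sel k -^ k) (sel k -^ k)), sel; split.
Qed.

Variables (B : R) (f S : pt m -> R) (sel : pt m -> pt m).
Hypotheses (B0 : 0 < B) (HS : is_supconv B f S sel).

Lemma supconv_ge x : f x <= S x.
Proof. by have := (proj1 HS) x x; rewrite -vnorm_sq vnorm_subxx; lra. Qed.

Lemma supconv_support x h :
  S x + dot ((2 * B) *^ (sel x -^ x)) h - B * dot h h <= S (x +^ h).
Proof.
rewrite (proj2 HS x); apply: Rle_trans ((proj1 HS) (x +^ h) (sel x)).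
have -> : sel x -^ (x +^ h) = (sel x -^ x) -^ h by vring.
by move: (sel x -^ x) => v; rewrite !dotE (dotC h v); lra.
Qed.

Lemma supconv_supported : supported_below B S.
Proof.
move=> x; exists ((2 * B) *^ (sel x -^ x)) => h'.
have := supconv_support x (h' -^ x).
by have -> : x +^ (h' -^ x) = h' by vring.
Qed.

Lemma supconv_sel M x : (forall y, Rabs (f y) <= M) -> B * dot (sel x -^ x) (sel x -^ x) <= 2 * M.
Proof.
move=> bf; have := supconv_ge x; rewrite (proj2 HS x).
by have := bf x; have := bf (sel x); split_Rabs; lra.
Qed.

Lemma supconv_rcont M : (forall y, Rabs (f y) <= M) -> rcont S.
Proof.
move=> bf x eps e0.
have M0 : 0 <= M by have := bf x; have := Rabs_pos (f x); lra.
pose Q := 2 * B * (1 + 2 * M / B).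
have selb y : vnorm ((2 * B) *^ (sel y -^ y)) <= Q.
  rewrite vnorm_scal Rabs_pos_eq; last lra.
  apply: Rmult_le_compat_l; first lra.
  have := supconv_sel y bf; rewrite -vnorm_sq; have := vnorm_ge0 (sel y -^ y); move: (vnorm _) => v v0 hv.
  have q : v * v <= 2 * M / B.
    apply: (Rmult_le_reg_l B) => //; apply: Rle_trans hv _; right; field; lra.
  by nra.
have Q0 : 0 <= Q by apply: Rle_trans (vnorm_ge0 _) (selb x).
have QB : 0 < Q + B + 1 by lra.
have low y z : S y - S z <= (Q + B) * vnorm (z -^ y) \/ 1 < vnorm (z -^ y).
  case: (Rle_dec (vnorm (z -^ y)) 1) => h; [left | by right; lra].
  have := supconv_support y (z -^ y); have -> : y +^ (z -^ y) = z by vring.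
  have := CS_ge ((2 * B) *^ (sel y -^ y)) (z -^ y); rewrite -(vnorm_sq (z -^ y)).
  have := selb y; have := vnorm_ge0 (z -^ y); move: (vnorm (z -^ y)) h => d h d0 sb c1 c2.
  have q1 : vnorm ((2 * B) *^ (sel y -^ y)) * d <= Q * d by apply: Rmult_le_compat_r.
  have q2 : B * (d * d) <= B * d by apply: Rmult_le_compat_l; nra.
  by lra.
exists (Rmin 1 (eps / (Q + B + 1))); split.
  by apply: Rmin_pos; [lra | exact: Rdiv_lt_0_compat].
move=> y hy.
have h1 := Rlt_le_trans _ _ _ hy (Rmin_l _ _); have h2 := Rlt_le_trans _ _ _ hy (Rmin_r _ _).
have h3 : eps / (Q + B + 1) * (Q + B + 1) = eps by field; lra.
have h4 : (Q + B) * vnorm (y -^ x) < eps by have := vnorm_ge0 (y -^ x); nra.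
have := low x y; have := low y x; rewrite (vnorm_subC x y).
by split_Rabs; lra.
Qed.

Lemma grad_from_below phi x p q K r : has_grad phi x p -> 0 < r ->
  (forall h, vnorm h < r -> phi x + dot q h - K * dot h h <= phi (x +^ h)) -> p = q.
Proof.
move=> Hg r0 H.
have n0 : vnorm (q -^ p) = 0; last first.
  have := vnorm_eq0 n0 => E; apply: functional_extensionality => i.
  by have := congr1 (fun v => v i) E; rewrite /vsub /vzero; lra.
apply: Rle_antisym; last exact: vnorm_ge0.
apply: eps_le => e e0; rewrite Rplus_0_l.
have e2 : 0 < e / 2 by lra.
have [d [d0 Hd]] := Hg _ e2.
have v0 := vnorm_ge0 (q -^ p).
case: (Req_dec (vnorm (q -^ p)) 0) => [->|vn]; first lra.
have vp : 0 < vnorm (q -^ p) by lra.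
have K0 : 0 < 2 * Rabs K + 1 by have := Rabs_pos K; lra.
pose s := Rmin (Rmin (d / 2) (r / 2)) (e / (2 * Rabs K + 1)) / vnorm (q -^ p).
have m0 : 0 < Rmin (Rmin (d / 2) (r / 2)) (e / (2 * Rabs K + 1)).
  by apply: Rmin_pos; [apply: Rmin_pos; lra | exact: Rdiv_lt_0_compat].
have s0 : 0 < s by exact: Rdiv_lt_0_compat.
have nh : vnorm (s *^ (q -^ p)) = Rmin (Rmin (d / 2) (r / 2)) (e / (2 * Rabs K + 1)).
  by rewrite vnorm_scal Rabs_pos_eq; [rewrite /s; field | lra].
have b1 := Rle_trans _ _ _ (Rmin_l (Rmin (d / 2) (r / 2)) (e / (2 * Rabs K + 1))) (Rmin_l _ _).
have b2 := Rle_trans _ _ _ (Rmin_l (Rmin (d / 2) (r / 2)) (e / (2 * Rabs K + 1))) (Rmin_r _ _).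
have b3 := Rmin_r (Rmin (d / 2) (r / 2)) (e / (2 * Rabs K + 1)).
rewrite -nh in b1 b2 b3 m0.
have := Hd (s *^ (q -^ p)) ltac:(lra); have := H (s *^ (q -^ p)) ltac:(lra).
set h := s *^ (q -^ p) in b1 b2 b3 m0 *; move=> c1 c2.
have c3 : dot q h - dot p h = vnorm (q -^ p) * vnorm h.
  have -> : dot q h - dot p h = s * dot (q -^ p) (q -^ p) by rewrite /h !dotE; ring.
  by rewrite -vnorm_sq /h vnorm_scal Rabs_pos_eq; [ring | lra].
have c4 : K * dot h h <= (e / 2) * vnorm h.
  rewrite -vnorm_sq -Rmult_assoc; apply: Rmult_le_compat_r; first lra.
  have q1 : (2 * Rabs K + 1) * vnorm h <= e.
    have q2 : e / (2 * Rabs K + 1) * (2 * Rabs K + 1) = e by field; lra.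
    by nra.
  by have := Rle_abs K; nra.
apply: (Rmult_le_reg_r (vnorm h)) => //.
by move: c2; split_Rabs; lra.
Qed.

(** The support paraboloid of [S] forces the gradient at the contact to be [2 B (sel x - x)]. The
    translated test function touches [f] at [sel x] with unchanged gradient and Hessian, so the
    inequalities for [f] carry over to [S]. *)
Lemma supconv_touch phi x p : has_grad phi x p -> locmax S phi x ->
  sel x = x +^ (/ (2 * B)) *^ p /\ locmax f (fun y => phi (y -^ (sel x -^ x))) (sel x).
Proof.
move=> Hg [r [r0 H]]; split.
  have E : p = (2 * B) *^ (sel x -^ x).
    apply: (grad_from_below Hg r0 (K := B)) => h hh.
    have := H (x +^ h); have -> : x +^ h -^ x = h by vring.
    by move=> /(_ hh); have := supconv_support x h; lra.
  by rewrite E; vfield; lra.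
exists r; split=> // y hy.
have -> : sel x -^ (sel x -^ x) = x by vring.
have := H (y -^ (sel x -^ x)); have -> : y -^ (sel x -^ x) -^ x = y -^ sel x by vring.
move=> /(_ hy); have := (proj1 HS) (y -^ (sel x -^ x)) y.
have -> : y -^ (y -^ (sel x -^ x)) = sel x -^ x by vring.
by rewrite (proj2 HS x); lra.
Qed.

(** The supremum inherits the Lipschitz bound in the single direction [v]. This matters in
    space-time, where the functions are assumed Lipschitz in the space directions alone. Testing
    along [v] and [-v] bounds the absolute value. *)
Lemma supconv_slope x p v L K r : (forall z c, Rabs (f (z +^ c *^ v) - f z) <= L * Rabs c) -> 0 < r ->
  (forall h, vnorm h < r -> S (x +^ h) <= S x + dot p h + K * dot h h) -> Rabs (dot p v) <= L.
Proof.
move=> Lf r0 H.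
have SL c : S x - L * Rabs c <= S (x +^ c *^ v).
  rewrite (proj2 HS x); apply: Rle_trans ((proj1 HS) (x +^ c *^ v) (sel x +^ c *^ v)).
  have -> : sel x +^ c *^ v -^ (x +^ c *^ v) = sel x -^ x by vring.
  by have := Lf (sel x) c; split_Rabs; lra.
apply: eps_le => e e0.
have v0 := vnorm_ge0 v; have K0 := Rabs_pos K.
have v2 : 0 <= vnorm v * vnorm v by nra.
have X0 : 0 < Rabs K * (vnorm v * vnorm v) + 1 by nra.
pose c := Rmin (r / (2 * (vnorm v + 1))) (e / (Rabs K * (vnorm v * vnorm v) + 1)).
have c0 : 0 < c by apply: Rmin_pos; apply: Rdiv_lt_0_compat; lra.
have c1 : c * (2 * (vnorm v + 1)) <= r.
  have := Rmin_l (r / (2 * (vnorm v + 1))) (e / (Rabs K * (vnorm v * vnorm v) + 1)); rewrite -/c => h.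
  have h2 : r / (2 * (vnorm v + 1)) * (2 * (vnorm v + 1)) = r by field; lra.
  by nra.
have c2 : c * (Rabs K * (vnorm v * vnorm v) + 1) <= e.
  have := Rmin_r (r / (2 * (vnorm v + 1))) (e / (Rabs K * (vnorm v * vnorm v) + 1)); rewrite -/c => h.
  have h2 : e / (Rabs K * (vnorm v * vnorm v) + 1) * (Rabs K * (vnorm v * vnorm v) + 1) = e by field; lra.
  by nra.
have main d : d = c \/ d = - c -> 0 <= L * c + d * dot p v + e * c.
  move=> hd; have ad : Rabs d = c by case: hd => ->; split_Rabs; lra.
  have := SL d; have := H (d *^ v); rewrite vnorm_scal !dotE ad => H1.
  have {}H1 := H1 ltac:(nra).
  have q : K * (d * (d * dot v v)) <= e * c.
    have -> : d * (d * dot v v) = c * c * (vnorm v * vnorm v) by rewrite -vnorm_sq; case: hd => ->; ring.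
    have q1 : K * (c * c * (vnorm v * vnorm v)) <= Rabs K * (c * c * (vnorm v * vnorm v)).
      by apply: Rmult_le_compat_r; [nra | exact: Rle_abs].
    by nra.
  by lra.
have a1 := main c ltac:(by left); have a2 := main (- c) ltac:(by right).
apply: (Rmult_le_reg_r c) => //.
by split_Rabs; lra.
Qed.
End SupConv.

Lemma supconv_close m (f : pt m -> R) M : rcont f -> (forall x, Rabs (f x) <= M) ->
  forall R0 e, 0 < e -> exists B0, 0 < B0 /\ forall B S sel, B0 <= B -> is_supconv B f S sel ->
  forall x, vnorm x <= R0 -> Rabs (S x - f x) <= e /\ vnorm (sel x -^ x) < e.
Proof.
move=> cf bf R0 e e0; have [d [d0 Hd]] := heine cf R0 e0.
have M0 : 0 <= M by have := bf (@vzero m); have := Rabs_pos (f (@vzero m)); lra.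
pose w := Rmin d e; have w0 : 0 < w by exact: Rmin_pos.
exists ((2 * M + 1) / (w * w)); split; first by apply: Rdiv_lt_0_compat; nra.
move=> B S sel hB HS x hx.
have B0 : 0 < B by apply: Rlt_le_trans hB; apply: Rdiv_lt_0_compat; nra.
have sw : vnorm (sel x -^ x) < w.
  apply: vnorm_lt_sq; first lra.
  have := supconv_sel HS x bf => h.
  have h2 : (2 * M + 1) / (w * w) * (w * w) = 2 * M + 1 by field; lra.
  have h3 : 2 * M + 1 <= B * (w * w) by rewrite -h2; apply: Rmult_le_compat_r => //; nra.
  by apply: (Rmult_lt_reg_l B) => //; lra.
have := supconv_ge HS x => ge.
have fd := Hd x (sel x) hx (Rlt_le_trans _ _ _ sw (Rmin_l _ _)).
split; last exact: Rlt_le_trans sw (Rmin_r _ _).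
have : S x <= f (sel x) by rewrite (proj2 HS x); have := dot_ge0 (sel x -^ x); nra.
by move: fd; split_Rabs; lra.
Qed.

(** An argument of Arzela type: bad points would have a [W]-limit, at which pointwise convergence
    contradicts the common Lipschitz bound. *)
Lemma wlim_uniform m (u : nat -> pt m -> R) U r L : 0 <= L ->
  (forall h, vnorm h <= r -> wlim (fun n => u n h) (U h)) ->
  W (fun n => forall h h', vnorm h <= r -> vnorm h' <= r -> Rabs (u n h - u n h') <= L * vnorm (h -^ h')) ->
  forall e, 0 < e -> W (fun n => forall h, vnorm h <= r -> Rabs (u n h - U h) < e).
Proof.
move=> L0 lim lip e e0; apply: W_contra => bad.
have LU h h' : vnorm h <= r -> vnorm h' <= r -> Rabs (U h - U h') <= L * vnorm (h -^ h').
  move=> hr hr'; apply: eps_le => d d0.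
  have [n [a1 [a2 a3]]] := W_ex (W_and lip (W_and (lim h hr (d / 2) ltac:(lra)) (lim h' hr' (d / 2) ltac:(lra)))).
  by have := a1 h h' hr hr'; move: a2 a3; split_Rabs; lra.
(* The second alternative supplies a default value at the indices without bad point. *)
have H n : exists h, vnorm h <= r /\ e <= Rabs (u n h - U h) \/ ((forall h, vnorm h <= r -> Rabs (u n h - U h) < e) /\ h = @vzero m).
  case: (Classical_Prop.classic (forall h, vnorm h <= r -> Rabs (u n h - U h) < e)) => c; first by exists (@vzero m); right.
  apply: Classical_Prop.NNPP => nb; apply: c => h hr; apply: Rnot_le_lt => hh; apply: nb; exists h; by left.
have [h Hh] := fun_choice H.
have Wh : W (fun n => vnorm (h n) <= r /\ e <= Rabs (u n (h n) - U (h n))).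
  by apply: W_mono bad => n nb; case: (Hh n) => [//|[]].
have [l hl] : exists l, vlim h l by apply: (vlim_ex (M := r)); apply: W_mono Wh => n [].
have lr : vnorm l <= r.
  apply: eps_le => d d0; have [n [[a1 _] a2]] := W_ex (W_and Wh (hl d d0)).
  by have := vnorm_le_dist l (h n); rewrite vnorm_subC; lra.
have e4 : 0 < e / 4 by lra.
have d0 : 0 < e / (4 * (L + 1)) by apply: Rdiv_lt_0_compat; lra.
have [n [[a1 a2] [a3 [a4 a5]]]] := W_ex (W_and Wh (W_and (hl _ d0) (W_and (lim l lr _ e4) lip))).
have := a5 (h n) l a1 lr; have := LU (h n) l a1 lr.
have q : e / (4 * (L + 1)) * (4 * (L + 1)) = e by field; lra.
have q2 : L * vnorm (h n -^ l) < e / 4 by have := vnorm_ge0 (h n -^ l); nra.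
by move: a2 a4; split_Rabs; lra.
Qed.

Section BlowUp.
Variables (m : nat) (F : pt m -> R) (x p : pt m).

(** Second order rescaling at a point with slope [p]. Its [W]-limits take the place of a second
    order Taylor expansion at [x], which may not exist. *)
Definition blow (n : nat) (h : pt m) :=
  INR n.+1 * INR n.+1 * (F (x +^ (/ INR n.+1) *^ h) - F x - / INR n.+1 * dot p h).

Lemma INRS_gt0 n : 0 < INR n.+1.
Proof. by apply: lt_0_INR; lia. Qed.

Lemma blow_supported K n : supported_below K F -> supported_below K (blow n).
Proof.
move=> H h; have s0 := INRS_gt0 n; have [q Hq] := H (x +^ (/ INR n.+1) *^ h).
exists (INR n.+1 *^ (q -^ p)) => h'.
have := Hq (x +^ (/ INR n.+1) *^ h').
have -> : x +^ / INR n.+1 *^ h' -^ (x +^ / INR n.+1 *^ h) = (/ INR n.+1) *^ (h' -^ h) by vring.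
rewrite (dot_scalr _ _ q) dot_scall dot_scalr /blow (dot_scall _ (q -^ p)) (dot_subl q p) (dot_subr h' h p).
move: (F (x +^ / INR n.+1 *^ h')) (F (x +^ / INR n.+1 *^ h)) (F x) (dot q (h' -^ h)) (dot (h' -^ h) (h' -^ h)) => A D C u v H1.
move: (INR n.+1) s0 H1 => s s0 H1.
have s2 : 0 <= s * s by nra.
have := Rmult_le_compat_l _ _ _ s2 H1.
have -> : s * s * (D + / s * u - K * (/ s * (/ s * v))) = s * s * D + s * u - K * v by field; lra.
have -> : s * s * (D - C - / s * dot p h) = s * s * (D - C) - s * dot p h by field; lra.
have -> : s * s * (A - C - / s * dot p h') = s * s * (A - C) - s * dot p h' by field; lra.
lra.
Qed.

Lemma blow_bound K r n h : (forall v, vnorm v < r -> Rabs (F (x +^ v) - F x - dot p v) <= K * dot v v) ->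
  vnorm h < r * INR n.+1 -> Rabs (blow n h) <= K * dot h h.
Proof.
move=> H hr; have s0 := INRS_gt0 n.
have nh : vnorm ((/ INR n.+1) *^ h) < r.
  rewrite vnorm_scal Rabs_pos_eq; last by left; exact: Rinv_0_lt_compat.
  apply: (Rmult_lt_reg_l (INR n.+1)) => //; rewrite -Rmult_assoc Rinv_r; lra.
have := H _ nh; rewrite !dotE => H1.
rewrite /blow Rabs_mult Rabs_pos_eq; last nra.
have s2 : 0 <= INR n.+1 * INR n.+1 by nra.
apply: Rle_trans (Rmult_le_compat_l _ _ _ s2 H1) _; right; field; lra.
Qed.

Variables (U : pt m -> R) (B K r : R) (f : pt m -> R) (sel : pt m -> pt m).
Hypotheses (B0 : 0 < B) (K0 : B <= K) (r0 : 0 < r) (cF : rcont F) (HF : is_supconv B f F sel).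
Hypothesis bound : forall v, vnorm v < r -> Rabs (F (x +^ v) - F x - dot p v) <= K * dot v v.
Hypothesis lim : forall h, wlim (fun n => blow n h) (U h).

Lemma blow_bound_eventually R0 : W (fun n => forall h, vnorm h <= R0 -> Rabs (blow n h) <= K * dot h h).
Proof.
have e0 : 0 < r / (Rabs R0 + 1) by apply: Rdiv_lt_0_compat => //; have := Rabs_pos R0; lra.
apply: W_mono (W_inv e0) => n hn h hh; apply: blow_bound bound _.
have s0 := INRS_gt0 n; apply: Rle_lt_trans hh _.
have q1 : r / (Rabs R0 + 1) * (Rabs R0 + 1) = r by field; have := Rabs_pos R0; lra.
have R00 := Rabs_pos R0; have RR := Rle_abs R0.
have : / INR n.+1 * (Rabs R0 + 1) < r by rewrite -q1; apply: Rmult_lt_compat_r; lra.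
move=> /(Rmult_lt_compat_r (INR n.+1) _ _ s0).
rewrite (_ : / INR n.+1 * (Rabs R0 + 1) * INR n.+1 = Rabs R0 + 1); last by field; lra.
by lra.
Qed.

Lemma supported_mono (u : pt m -> R) : supported_below B u -> supported_below K u.
Proof.
move=> H h; have [q Hq] := H h; exists q => h'; have := Hq h'; have := dot_ge0 (h' -^ h); nra.
Qed.

Lemma blow_loclip R0 : 0 <= R0 -> W (fun n => forall h h', vnorm h <= R0 -> vnorm h' <= R0 ->
   Rabs (blow n h - blow n h') <= 8 * K * (1 + R0) * vnorm (h -^ h')).
Proof.
move=> R00; apply: W_mono (blow_bound_eventually (2 * R0 + 1)) => n bn.
apply: supported_loclip => //; first lra.
by apply: supported_mono; apply: blow_supported; exact: supconv_supported HF.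
Qed.

Lemma blow_limit_loclin : loclin (8 * K) U.
Proof.
move=> h h'; have h0 := vnorm_ge0 h; have h'0 := vnorm_ge0 h'.
apply: eps_le => d d0.
have d2 : 0 < d / 2 by lra.
have [n [a1 [a2 a3]]] := W_ex (W_and (@blow_loclip (vnorm h + vnorm h') ltac:(lra)) (W_and (lim h d2) (lim h' d2))).
have := a1 h h' ltac:(lra) ltac:(lra).
rewrite (_ : 1 + (vnorm h + vnorm h') = 1 + vnorm h + vnorm h'); last by ring.
by move: a2 a3; split_Rabs; lra.
Qed.

Lemma blow_limit_semiconvex : semiconvex (2 * K) U.
Proof.
move=> h s; apply: eps_le => d d0.
have d4 : 0 < d / 4 by lra.
have [n [a1 [a2 a3]]] := W_ex (W_and (lim (h +^ s) d4) (W_and (lim (h -^ s) d4) (lim h d4))).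
have := supported_semiconvex (blow_supported n (supconv_supported HF)) h s.
by have := dot_ge0 s; move: a1 a2 a3; split_Rabs; nra.
Qed.

Lemma blow_limit_bound h : Rabs (U h) <= K * dot h h.
Proof.
apply: eps_le => d d0.
have [n [a1 a2]] := W_ex (W_and (blow_bound_eventually (vnorm h)) (lim h d0)).
by have := a1 h (Rle_refl _); move: a2; split_Rabs; lra.
Qed.

(** The test function is carried back in three moves: to [blow n] for a large [n] by uniform
    convergence and a penalty, to [F] by undoing the scaling, and to [f] by [supconv_touch]. At
    scale [1 / n] its gradient hardly differs from [p], while its Hessian is kept. *)
Lemma blow_limit_touch Psi DPsi D2Psi h0 d : C2 Psi DPsi D2Psi -> locmax U Psi h0 -> 0 < d ->
  exists Phi DPhi D2Phi z, [/\ C2 Phi DPhi D2Phi, locmax f Phi z, vnorm (z -^ (x +^ (/ (2 * B)) *^ p)) < d,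
    vnorm (DPhi z -^ p) < d & forall i j, Rabs (D2Phi z i j - D2Psi h0 i j) < d].
Proof.
move=> CP [r1 [r10 Hm]] d0.
have b0 : 0 < d / 4 by lra.
have [rr [rr0 Hrr]] : exists rr, 0 < rr /\ forall i, forall j, forall y, vnorm (y -^ h0) < rr -> Rabs (D2Psi y i j - D2Psi h0 i j) < d / 4.
  apply: fin_delta => [i a a' _ aa H j y hy|i]; first by apply: H; lra.
  apply: fin_delta => [j a a' _ aa H y hy|j]; first by apply: H; lra.
  by case: CP => _ [_ c]; exact: c.
pose rho := Rmin (Rmin (r1 / 2) rr) 1.
have rho0 : 0 < rho by apply: Rmin_pos; [apply: Rmin_pos; lra | lra].
have rho1 : rho <= r1 / 2 by apply: Rle_trans (Rmin_l _ _) (Rmin_l _ _).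
have rho2 : rho <= rr by apply: Rle_trans (Rmin_l _ _) (Rmin_r _ _).
have rho3 : rho <= 1 := Rmin_r _ _.
pose e := d / 4 * (rho * rho) / 4.
have rr2 : 0 < rho * rho by nra.
have Y0 : 0 < d / 4 * (rho * rho) by nra.
have e0 : 0 < e by rewrite /e; lra.
have e2 : 2 * e < d / 4 * (rho * rho) by rewrite /e; lra.
have h00 := vnorm_ge0 h0.
pose R0 := vnorm h0 + 1.
have uni := @wlim_uniform m blow U R0 (8 * K * (1 + R0)) ltac:(rewrite /R0; nra) (fun h _ => lim h)
  (@blow_loclip R0 ltac:(rewrite /R0; lra)) e e0.
pose Psi' y := Psi y + d / 4 * dot (y -^ h0) (y -^ h0).
have CP' := C2_add CP (C2_sqdist (d / 4) h0).
have [G [G0 HG]] : exists G, 0 <= G /\ forall y, vnorm y <= R0 -> vnorm (DPsi y +^ (2 * (d / 4)) *^ (y -^ h0)) <= G.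
  have [Mi HMi] := fun_choice (fun i => rcont_bounded (C2_rcontD CP' i) R0).
  exists (rsum Mi); split; first by apply: rsum_ge0 => i; case: (HMi i).
  by move=> y hy; apply: Rle_trans (vnorm_le_sum _) _; apply: rsum_le => i; apply: (proj2 (HMi i)).
(* Bounds [1 / n] so that the displacement, of size [R0 / n], and the gradient correction, of size
   [G / n], also when divided by [2 * B], stay below [d]. *)
have c0 : 0 < d / (2 * (1 + R0 + G * (1 + / (2 * B)))).
  apply: Rdiv_lt_0_compat => //; have : 0 < / (2 * B) by apply: Rinv_0_lt_compat; lra.
  by rewrite /R0; nra.
have [n [un ninv]] := W_ex (W_and uni (W_inv c0)).
have s0 := INRS_gt0 n.
have cb : rcont (blow n).
  apply: rcont_scal; apply: rcont_sub; last first.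
    by apply: rcont_scal; exact: (C2_rcont (C2_ext (fun x => Rplus_0_r (dot p x)) (fun _ _ => erefl) (fun _ _ _ => erefl) (C2_lin p 0))).
  by apply: rcont_sub; [exact: rcont_affine | exact: rcont_const].
have Hm' y : vnorm (y -^ h0) <= rho -> U y - Psi y <= U h0 - Psi h0 by move=> hy; apply: Hm; lra.
have un' y : vnorm (y -^ h0) <= rho -> Rabs (blow n y - U y) <= e.
  by move=> hy; left; apply: un; have := vnorm_le_dist y h0; rewrite /R0; lra.
have [h [h1 _ h3]] := perturbed_max cb (C2_rcont CP) rho0 b0 Hm' un' e2.
pose s := INR n.+1; have ss : s * / s = 1 by rewrite /s; field; lra.
pose z := x +^ (/ s) *^ h.
(* Undoing the blow-up: [s^-2 Psi' (s (y - x))] plus the affine function of slope [p] through the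
   value of [F] at [x]. *)
have CPhi0 := C2_add (C2_scal (/ s * / s) (C2_affine s x CP')) (C2_lin p (F x - dot p x)).
have lmF : locmax F (fun y => / s * / s * Psi' (s *^ (y -^ x)) + (dot p y + (F x - dot p x))) z.
  have [a [a0 Ha]] := h3.
  exists (a / s); split; first by apply: Rdiv_lt_0_compat.
  move=> y hy; have := Ha (s *^ (y -^ x)).
  have -> : s *^ (y -^ x) -^ h = s *^ (y -^ z).
    by apply: functional_extensionality => i; rewrite /z /vsub /vscal /vadd; field; rewrite /s; lra.
  rewrite vnorm_scal Rabs_pos_eq; last by rewrite /s; lra.
  have hy' : s * vnorm (y -^ z) < a.
    have : a / s * s = a by field; rewrite /s; lra.
    by rewrite /s in hy *; nra.
  move=> /(_ hy').
  have -> : s *^ (z -^ x) = h by apply: functional_extensionality => i; rewrite /z /vsub /vscal /vadd; field; rewrite /s; lra.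
  rewrite /blow -/s.
  have -> : x +^ / s *^ (s *^ (y -^ x)) = y by apply: functional_extensionality => i; rewrite /vsub /vscal /vadd; field; rewrite /s; lra.
  rewrite -/z -/(Psi' h) -/(Psi' (s *^ (y -^ x))) dot_scalr dot_subr.
  have -> : / s * dot p h = dot p z - dot p x by rewrite /z !dotE; ring.
  move=> H2.
  have H3 : s * s * (F y - (dot p y - dot p x)) - Psi' (s *^ (y -^ x)) <= s * s * (F z - (dot p z - dot p x)) - Psi' h.
    by move: H2; rewrite -(Rmult_assoc (/ s)) (Rmult_comm (/ s) s) ss; lra.
  have i2 : 0 <= / s * / s by have : 0 < / s by [exact: Rinv_0_lt_compat]; nra.
  have := Rmult_le_compat_l _ _ _ i2 H3.
  have E c : / s * / s * (s * s * c) = c by field; rewrite /s; lra.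
  by rewrite !Rmult_minus_distr_l !E; lra.
have [selE lmf] := supconv_touch B0 HF (proj1 CPhi0 z) lmF.
(* [x -^ x] stands for the zero vector: the shift is the opposite of [sel z -^ z]. *)
have CPhi := C2_shift (x -^ x -^ (sel z -^ z)) CPhi0.
pose DP0 := (/ s * / s) *^ (s *^ (DPsi h +^ (2 * (d / 4)) *^ (h -^ h0))).
have hz : s *^ (z -^ x) = h by apply: functional_extensionality => i; rewrite /z /vsub /vscal /vadd; field; rewrite /s; lra.
have sz : sel z +^ (x -^ x -^ (sel z -^ z)) = z by vring.
have hR : vnorm h <= R0 by have := vnorm_le_dist h h0; rewrite /R0; lra.
have is0 : 0 < / s by exact: Rinv_0_lt_compat.
have DPn : vnorm DP0 <= / s * G.
  have -> : DP0 = (/ s) *^ (DPsi h +^ (2 * (d / 4)) *^ (h -^ h0)).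
    by apply: functional_extensionality => i; rewrite /DP0 /vscal; field; rewrite /s; lra.
  rewrite vnorm_scal Rabs_pos_eq; last lra.
  by apply: Rmult_le_compat_l; [lra | exact: HG].
have iB : 0 < / (2 * B) by apply: Rinv_0_lt_compat; lra.
have T : / s * (1 + R0 + G * (1 + / (2 * B))) < d.
  have X0 : 0 < 1 + R0 + G * (1 + / (2 * B)) by rewrite /R0; nra.
  have := Rmult_lt_compat_r _ _ _ X0 ninv; rewrite -/s.
  by rewrite (_ : d / (2 * (1 + R0 + G * (1 + / (2 * B)))) * (1 + R0 + G * (1 + / (2 * B))) = d / 2); [lra | field; rewrite /R0; nra].
have GB : 0 <= G * / (2 * B) by nra.
do 3 eexists; exists (sel z); split; first exact: CPhi.
- move: lmf; congr (locmax f _ (sel z)); apply: functional_extensionality => y.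
  by have -> : y +^ (x -^ x -^ (sel z -^ z)) = y -^ (sel z -^ z) by vring.
- rewrite selE; rewrite hz.
  have -> : z +^ / (2 * B) *^ ((/ s * / s) *^ (s *^ (DPsi h +^ (2 * (d / 4)) *^ (h -^ h0))) +^ p) -^ (x +^ / (2 * B) *^ p) = (/ s) *^ h +^ / (2 * B) *^ DP0.
    by rewrite /z /DP0; vring.
  apply: Rle_lt_trans (vnorm_tri _ _) _.
  rewrite (vnorm_scal (/ s) h) (vnorm_scal (/ (2 * B)) DP0) (Rabs_pos_eq (/ s)); last lra.
  rewrite (Rabs_pos_eq (/ (2 * B))); last lra.
  have q1 : / s * vnorm h <= / s * R0 by apply: Rmult_le_compat_l; lra.
  have q2 : / (2 * B) * vnorm DP0 <= / (2 * B) * (/ s * G) by apply: Rmult_le_compat_l; lra.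
  have q3 : 0 <= / s * G by nra.
  by lra.
- cbv beta; rewrite sz hz.
  have -> : (/ s * / s) *^ (s *^ (DPsi h +^ (2 * (d / 4)) *^ (h -^ h0))) +^ p -^ p = DP0 by rewrite /DP0; vring.
  have q3 : 0 <= / s * (G * / (2 * B)) by nra.
  have q4 : 0 < / s * (1 + R0) by rewrite /R0; nra.
  by lra.
- move=> i j; cbv beta; rewrite sz hz /madd /mscal.
  have -> : / s * / s * (s * s * (D2Psi h i j + 2 * (d / 4) * @mid m i j)) + 0 = D2Psi h i j + d / 2 * @mid m i j.
    by field; rewrite /s; lra.
  have := Hrr i j h ltac:(lra).
  by rewrite /mid; case: eqP => _; split_Rabs; lra.
Qed.
End BlowUp.

(** * Doubling of variables *)

Lemma C2_second_order m (f : pt m -> R) Df D2f x e : C2 f Df D2f -> 0 < e ->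
  exists r, 0 < r /\ forall v, vnorm v < r ->
    Rabs (f (x +^ v) - f x - dot (Df x) v - qf (D2f x) v / 2) <= e * dot v v.
Proof.
move=> Cf e0.
have mm : 0 <= INR m * INR m by have := pos_INR m; nra.
have e1 : 0 < e / (INR m * INR m + 1) by apply: Rdiv_lt_0_compat; lra.
have [r [r0 Hr]] : exists r, 0 < r /\ forall i, forall j, forall y, vnorm (y -^ x) < r -> Rabs (D2f y i j - D2f x i j) < e / (INR m * INR m + 1).
  apply: fin_delta => [i a a' _ aa H j y hy|i]; first by apply: H; lra.
  apply: fin_delta => [j a a' _ aa H y hy|j]; first by apply: H; lra.
  by case: Cf => _ [_ c]; exact: c.
exists r; split=> // v hv; apply: taylor2 Cf _ => s hs.
apply: Rle_trans (qf_diff_mat (e := e / (INR m * INR m + 1)) v _) _.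
  move=> i j; left; apply: Hr; have -> : x +^ s *^ v -^ x = s *^ v by vring.
  by rewrite vnorm_scal Rabs_pos_eq; [have := vnorm_ge0 v; nra | lra].
apply: Rmult_le_compat_r; first exact: dot_ge0.
have q : e / (INR m * INR m + 1) * (INR m * INR m + 1) = e by field; lra.
by lra.
Qed.

Lemma trsq_le m n (a : 'I_n -> pt m) r : 0 <= r -> (forall k, vnorm (a k) <= r) -> trsq a <= INR n * (r * r).
Proof.
move=> r0 H; rewrite -rsum_const; apply: rsum_le => k; rewrite -vnorm_sq.
by have := H k; have := vnorm_ge0 (a k); nra.
Qed.

(** The threshold depends on [a] only through the bound [As], hence is uniform over the indices. *)
Lemma lop_close m n (X : mat m) As e : 0 <= As -> 0 < e -> exists d, 0 < d /\
  forall (a b : 'I_n -> pt m) Y, (forall k, vnorm (a k) <= As) -> (forall k, vnorm (b k -^ a k) < d) ->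
  (forall i j, Rabs (Y i j - X i j) < d) -> Rabs (lop b Y - lop a X) <= e.
Proof.
move=> A0 e0.
pose C := INR m * INR m * (INR n * ((As + 1) * (As + 1))) + INR n * (msum X * (2 * As + 1)).
have m0 := pos_INR m; have n0 := pos_INR n; have X0 := msum_ge0 X.
have C1 : 0 <= INR m * INR m * (INR n * ((As + 1) * (As + 1))).
  by apply: Rmult_le_pos; [nra | apply: Rmult_le_pos; nra].
have C2 : 0 <= INR n * (msum X * (2 * As + 1)) by apply: Rmult_le_pos => //; apply: Rmult_le_pos; lra.
have C0 : 0 <= C by rewrite /C; lra.
pose d := Rmin 1 (e / (C + 1)).
have d0 : 0 < d by apply: Rmin_pos; [lra | apply: Rdiv_lt_0_compat; lra].
have d1 : d <= 1 := Rmin_l _ _.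
have dC : d * C <= e.
  have h : d <= e / (C + 1) := Rmin_r _ _.
  have q : e / (C + 1) * (C + 1) = e by field; lra.
  by nra.
exists d; split=> // a b Y ha hab hXY.
have hb k : vnorm (b k) <= As + 1 by have := vnorm_le_dist (b k) (a k); have := hab k; have := ha k; lra.
have q1 : Rabs (lop b Y - lop b X) <= d * (INR m * INR m * (INR n * ((As + 1) * (As + 1)))).
  apply: Rle_trans (lop_diff b (e := d) _) _; first by move=> i j; left; exact: hXY.
  have tb := trsq_le (a := b) (r := As + 1) ltac:(lra) hb.
  have dm : 0 <= d * (INR m * INR m) by nra.
  have := Rmult_le_compat_l _ _ _ dm tb; lra.
have q2 : Rabs (lop b X - lop a X) <= d * (INR n * (msum X * (2 * As + 1))).
  rewrite /lop -rsum_sub; apply: Rle_trans (rsum_abs _) _.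
  rewrite (_ : d * _ = INR n * (msum X * (d * (2 * As + 1)))); last by ring.
  rewrite -rsum_const; apply: rsum_le => k; apply: Rle_trans (qf_diff_vec _ _ _) _.
  apply: Rmult_le_compat_l => //; apply: Rmult_le_compat; [exact: vnorm_ge0 | | left; exact: hab | ].
    by have := vnorm_ge0 (b k); have := vnorm_ge0 (a k); lra.
  by have := ha k; have := hb k; lra.
have : d * C = d * (INR m * INR m * (INR n * ((As + 1) * (As + 1)))) + d * (INR n * (msum X * (2 * As + 1))) by rewrite /C; ring.
by move: q1 q2; split_Rabs; lra.
Qed.

Definition visc_sub m n (Theta : Type) (sg : Theta -> pt m -> 'I_n -> pt m) (G : Theta -> pt m -> pt m -> R)
    (O : pt m -> Prop) f :=
  forall phi Dphi D2phi, C2 phi Dphi D2phi -> forall z, O z -> locmax f phi z ->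
  forall th, G th z (Dphi z) <= lop (sg th z) (D2phi z).

Definition visc_super m n (Theta : Type) (sg : Theta -> pt m -> 'I_n -> pt m) (G : Theta -> pt m -> pt m -> R)
    (O : pt m -> Prop) g :=
  forall phi Dphi D2phi, C2 phi Dphi D2phi -> forall z, O z -> locmax phi g z ->
  forall e, 0 < e -> exists th, lop (sg th z) (D2phi z) <= G th z (Dphi z) + e.

(** Uniformity in [th] is essential on the supersolution side, where the index is produced after the
    test function has been perturbed. *)
Definition equicont m (Theta : Type) (G : Theta -> pt m -> pt m -> R) :=
  forall z P e, 0 < e -> exists d, 0 < d /\ forall th z' P',
    vnorm (z' -^ z) < d -> vnorm (P' -^ P) < d -> Rabs (G th z' P' - G th z P) < e.

Definition equicont_dir m n (Theta : Type) (sg : Theta -> pt m -> 'I_n -> pt m) :=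
  forall z e, 0 < e -> exists d, 0 < d /\ forall th k z',
    vnorm (z' -^ z) < d -> vnorm (sg th z' k -^ sg th z k) < e.

Section BlowEq.
Variables (m n : nat) (Theta : Type) (sg : Theta -> pt m -> 'I_n -> pt m) (As : R).
Hypothesis As0 : 0 <= As.
Hypothesis sgb : forall th z k, vnorm (sg th z k) <= As.
Hypothesis sgc : equicont_dir sg.
Variables (O : pt m -> Prop) (F : pt m -> R) (x p : pt m) (U : pt m -> R) (B K r : R).
Variables (f : pt m -> R) (sel : pt m -> pt m).
Hypotheses (B0 : 0 < B) (K0 : B <= K) (r0 : 0 < r) (cF : rcont F) (HF : is_supconv B f F sel).
Hypothesis bound : forall v, vnorm v < r -> Rabs (F (x +^ v) - F x - dot p v) <= K * dot v v.
Hypothesis lim : forall h, wlim (fun n => blow F x p n h) (U h).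
Let zt := x +^ (/ (2 * B)) *^ p.
Hypothesis Ozt : exists d, 0 < d /\ forall z, vnorm (z -^ zt) < d -> O z.

(** The blow-up freezes the coefficients at [zt], the point of [f] attached to [x] by the
    sup-convolution: the contact points found by [blow_limit_touch] can be taken arbitrarily close
    to [zt], with gradients close to [p]. *)
Lemma blow_csub G th : equicont G -> visc_sub sg G O f -> csub (sg th zt) (G th zt p) U.
Proof.
move=> cG vf Psi DPsi D2Psi CP h0 lm; apply: eps_le => e e0.
have [d1 [d10 H1]] := lop_close n (D2Psi h0) As0 (e := e / 2) ltac:(lra).
have [d2 [d20 H2]] := cG zt p (e / 2) ltac:(lra).
have [d3 [d30 H3]] := sgc zt d10.
have [d4 [d40 H4]] := Ozt.
have d0 : 0 < Rmin (Rmin d1 d2) (Rmin d3 d4) by do 2! (apply: Rmin_pos => //); exact: Rmin_pos.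
have [Phi [DPhi [D2Phi [z [CPhi lmf zz DD DD2]]]]] := blow_limit_touch B0 K0 r0 cF HF bound lim CP lm d0.
move: zz DD DD2; set d := Rmin _ _ => zz DD DD2.
have a1 : d <= d1 by apply: Rle_trans (Rmin_l _ _) (Rmin_l _ _).
have a2 : d <= d2 by apply: Rle_trans (Rmin_l _ _) (Rmin_r _ _).
have a3 : d <= d3 by apply: Rle_trans (Rmin_r _ _) (Rmin_l _ _).
have a4 : d <= d4 by apply: Rle_trans (Rmin_r _ _) (Rmin_r _ _).
rewrite -/zt in zz.
have := vf _ _ _ CPhi z (H4 z ltac:(lra)) lmf th.
have := H2 th z (DPhi z) ltac:(lra) ltac:(lra).
have := H1 (sg th zt) (sg th z) (D2Phi z) (sgb th zt) (fun k => H3 th k z ltac:(lra)) (fun i j => Rlt_le_trans _ _ _ (DD2 i j) a1).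
by split_Rabs; lra.
Qed.

(** The inf-convolution of [g] is minus the sup-convolution of [-g], so [blow_limit_touch] applies
    after a change of sign; the slope attached to [g] is [-p]. *)
Lemma blow_csuper g G : (forall z, f z = - g z) -> equicont G -> visc_super sg G O g ->
  forall phi Dphi D2phi, C2 phi Dphi D2phi -> forall k, locmax phi (fun k => - U k) k ->
  forall e, 0 < e -> exists th, lop (sg th zt) (D2phi k) <= G th zt ((-1) *^ p) + e.
Proof.
move=> fg cG vg phi Dphi D2phi Cphi k [rr [rr0 Hrr]] e e0.
have CP := C2_scal (-1) Cphi.
have lm : locmax U (fun x => -1 * phi x) k.
  by exists rr; split=> // y hy; have := Hrr y hy; lra.
have [d1 [d10 H1]] := lop_close n (mscal (-1) (D2phi k)) As0 (e := e / 4) ltac:(lra).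
have [d2 [d20 H2]] := cG zt ((-1) *^ p) (e / 4) ltac:(lra).
have [d3 [d30 H3]] := sgc zt d10.
have [d4 [d40 H4]] := Ozt.
have d0 : 0 < Rmin (Rmin d1 d2) (Rmin d3 d4) by do 2! (apply: Rmin_pos => //); exact: Rmin_pos.
have [Phi [DPhi [D2Phi [z [CPhi lmf zz DD DD2]]]]] := blow_limit_touch B0 K0 r0 cF HF bound lim CP lm d0.
move: zz DD DD2; set d := Rmin _ _ => zz DD DD2.
have a1 : d <= d1 by apply: Rle_trans (Rmin_l _ _) (Rmin_l _ _).
have a2 : d <= d2 by apply: Rle_trans (Rmin_l _ _) (Rmin_r _ _).
have a3 : d <= d3 by apply: Rle_trans (Rmin_r _ _) (Rmin_l _ _).
have a4 : d <= d4 by apply: Rle_trans (Rmin_r _ _) (Rmin_r _ _).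
rewrite -/zt in zz.
have lmg : locmax (fun y => -1 * Phi y) g z.
  have [r1 [r10 Hr1]] := lmf; exists r1; split=> // y hy; have := Hr1 y hy; rewrite !fg; lra.
have [th Hth] := vg _ _ _ (C2_scal (-1) CPhi) z (H4 z ltac:(lra)) lmg (e / 4) ltac:(lra).
exists th; move: Hth; rewrite (lop_mscal _ (-1)).
have nn : vnorm ((-1) *^ DPhi z -^ (-1) *^ p) < d2.
  have -> : (-1) *^ DPhi z -^ (-1) *^ p = (-1) *^ (DPhi z -^ p) by vring.
  by rewrite vnorm_scal Rabs_Ropp Rabs_R1 Rmult_1_l; lra.
have := H2 th z _ ltac:(lra) nn.
have := H1 (sg th zt) (sg th z) (D2Phi z) (sgb th zt) (fun k => H3 th k z ltac:(lra)) (fun i j => Rlt_le_trans _ _ _ (DD2 i j) a1).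
rewrite (lop_mscal _ (-1)).
by split_Rabs; lra.
Qed.
End BlowEq.

Lemma blow_limit_exists m (F : pt m -> R) x p K r : 0 < r ->
  (forall v, vnorm v < r -> Rabs (F (x +^ v) - F x - dot p v) <= K * dot v v) ->
  exists U, forall h, wlim (fun n => blow F x p n h) (U h).
Proof.
move=> r0 bd.
have H h : exists l, wlim (fun n => blow F x p n h) l.
  apply: (wlim_ex (M := K * dot h h)).
  by apply: W_mono (blow_bound_eventually r0 bd (vnorm h)) => n; apply; lra.
by have [U HU] := fun_choice H; exists U.
Qed.

(* Data of [f] near a point where its double sup-convolution is touched from above: [zeta]
   maximizes [f - B/2 |. - k|^2] and the midpoint of [k] and [zeta] is where [S] is blown up. *)
Lemma midpoint_data m B (f T S : pt m -> R) selT selS k : 0 < B ->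
  is_supconv (B / 2) f T selT -> is_supconv B f S selS ->
  let p := B *^ (selT k -^ k) in let z := k +^ (/ 2) *^ (selT k -^ k) in
  [/\ forall y y', S y <= T y' + B * dot (y -^ y') (y -^ y'),
      T k = S z - B * dot (z -^ k) (z -^ k),
      forall h, Rabs (S (z +^ h) - S z - dot p h) <= B * dot h h &
      forall v, T k + dot p v - B / 2 * dot v v <= T (k +^ v)].
Proof.
move=> B0 HT HS p z.
(* Regularizing twice with parameter [B] amounts to regularizing once with [B / 2], through
   [|v + w|^2 <= 2 |v|^2 + 2 |w|^2]. Equality holds at the midpoint, which gives [T1]. *)
have up y y' : S y <= T y' + B * dot (y -^ y') (y -^ y').
  rewrite (proj2 HS y); have := (proj1 HT) y' (selS y).
  have -> : selS y -^ y' = (selS y -^ y) +^ (y -^ y') by vring.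
  have := dot_ge0 ((selS y -^ y) -^ (y -^ y')).
  move: (selS y -^ y) (y -^ y') => v w; rewrite !dotE (dotC w v) => h1 h2.
  have := Rmult_le_compat_l _ _ _ (Rlt_le _ _ B0) h1; lra.
have zk : z -^ k = (/ 2) *^ (selT k -^ k) by rewrite /z; vring.
have zs : selT k -^ z = (/ 2) *^ (selT k -^ k) by rewrite /z; vfield.
have TE := proj2 HT k.
have Sz : f (selT k) - B / 4 * dot (selT k -^ k) (selT k -^ k) <= S z.
  by have := (proj1 HS) z (selT k); rewrite zs dot_scall dot_scalr; lra.
have T1 : T k = S z - B * dot (z -^ k) (z -^ k).
  have := up z k; rewrite zk dot_scall dot_scalr; lra.
split=> //.
- move=> h.
  (* From below, [selT k] competes in the supremum defining [S]; from above, [S] lies under the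
     paraboloid centred at [k] given by [up], which it touches at [z]. *)
  have lo : S z + dot p h - B * dot h h <= S (z +^ h).
    apply: Rle_trans ((proj1 HS) (z +^ h) (selT k)).
    have -> : selT k -^ (z +^ h) = (/ 2) *^ (selT k -^ k) -^ h by rewrite -zs; vring.
    have := up z k; rewrite zk /p; move: (selT k -^ k) Sz TE T1 => v; rewrite zk => Sz TE T1.
    by move: TE Sz T1; rewrite !dotE (dotC h v); lra.
  have hi : S (z +^ h) <= S z + dot p h + B * dot h h.
    apply: Rle_trans (up (z +^ h) k) _.
    have -> : z +^ h -^ k = (z -^ k) +^ h by vring.
    rewrite T1 /p zk; move: (selT k -^ k) => v; rewrite !dotE (dotC h v); lra.
  by move: lo hi; split_Rabs; lra.
- move=> v; have := supconv_support HT k v.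
  by have -> : (2 * (B / 2)) *^ (selT k -^ k) = p by rewrite /p; vfield.
Qed.

(** The form of the Jensen-Ishii inequality in use, for two subsolutions and one supersolution. With
    bounded slopes the points [z1], [z2], [z3] differ by [O(1 / B)], so for Lipschitz directions the
    errors weighted by [4 * B] are [O(1 / B)]. Slopes are bounded direction by direction, with
    space-time in view. *)
Lemma doubling m n (Theta : Type) (sg : Theta -> pt m -> 'I_n -> pt m) (G1 G2 G3 : Theta -> pt m -> pt m -> R)
    f1 f2 g M As phi Dphi D2phi zb r0 eps :
  rcont f1 -> rcont f2 -> rcont g ->
  (forall x, Rabs (f1 x) <= M) -> (forall x, Rabs (f2 x) <= M) -> (forall x, Rabs (g x) <= M) ->
  0 <= As -> (forall th z k, vnorm (sg th z k) <= As) -> equicont_dir sg ->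
  equicont G1 -> equicont G2 -> equicont G3 -> 0 < r0 -> 0 < eps ->
  visc_sub sg G1 (fun z => vnorm (z -^ zb) < r0) f1 -> visc_sub sg G2 (fun z => vnorm (z -^ zb) < r0) f2 ->
  visc_super sg G3 (fun z => vnorm (z -^ zb) < r0) g ->
  C2 phi Dphi D2phi ->
  (forall y, vnorm (y -^ zb) < r0 -> f1 y + f2 y - g y - phi y <= f1 zb + f2 zb - g zb - phi zb) ->
  exists B k p1 p2,
  let q := (Dphi k +^ (2 * eps) *^ (k -^ zb)) -^ p1 -^ p2 in
  let z1 := k +^ (/ B) *^ p1 in let z2 := k +^ (/ B) *^ p2 in let z3 := k +^ (/ (2 * B)) *^ q in
  [/\ [/\ / eps <= B, vnorm (k -^ zb) < eps, vnorm (z1 -^ zb) < eps, vnorm (z2 -^ zb) < eps & vnorm (z3 -^ zb) < eps],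
   forall v L, (forall z c, Rabs (f1 (z +^ c *^ v) - f1 z) <= L * Rabs c) -> Rabs (dot p1 v) <= L,
   forall v L, (forall z c, Rabs (f2 (z +^ c *^ v) - f2 z) <= L * Rabs c) -> Rabs (dot p2 v) <= L,
   forall v L, (forall z c, Rabs (g (z +^ c *^ v) - g z) <= L * Rabs c) -> Rabs (dot q v) <= L &
   exists th, G1 th z1 p1 + G2 th z2 p2 <= G3 th z3 ((-1) *^ q) + lop (sg th z3) (D2phi k) + 2 * eps * trsq (sg th z3)
    + 4 * B * (rsum (fun i => dot (sg th z1 i -^ sg th z3 i) (sg th z1 i -^ sg th z3 i))
       + rsum (fun i => dot (sg th z2 i -^ sg th z3 i) (sg th z2 i -^ sg th z3 i))) + eps].
Proof.
move=> cf1 cf2 cg bf1 bf2 bg A0 sgb sgc cG1 cG2 cG3 r00 e0 v1 v2 v3 Cphi Hmax.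
pose w := Rmin r0 eps.
have w0 : 0 < w by exact: Rmin_pos.
have wr : w <= r0 := Rmin_l _ _.
have we : w <= eps := Rmin_r _ _.
pose rho := w / 4.
have rho0 : 0 < rho by rewrite /rho; lra.
have rr0 : 0 < rho * rho by nra.
have er0 : 0 < eps * (rho * rho) by nra.
pose e := eps * (rho * rho) / 4.
have ee : 0 < e by rewrite /e; lra.
pose e' := Rmin (e / 3) rho.
have e'0 : 0 < e' by apply: Rmin_pos; lra.
have e'1 : e' <= e / 3 := Rmin_l _ _.
have e'2 : e' <= rho := Rmin_r _ _.
pose g' x := - g x.
have cg' : rcont g' by apply: rcont_ext (rcont_scal (-1) cg) => x; rewrite /g'; ring.
have bg' x : Rabs (g' x) <= M by rewrite /g' Rabs_Ropp.
pose R0 := vnorm zb + r0.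
have [B1 [B10 HB1]] := supconv_close cf1 bf1 R0 e'0.
have [B2 [B20 HB2]] := supconv_close cf2 bf2 R0 e'0.
have [B3 [B30 HB3]] := supconv_close cg' bg' R0 e'0.
have ie0 : 0 < / eps by exact: Rinv_0_lt_compat.
(* Large enough for all the sup-convolutions, including those with [B / 2], to be [e']-close to
   their functions. *)
pose B := 2 * B1 + 2 * B2 + B3 + / eps.
have B0 : 0 < B by rewrite /B; lra.
have Bh : 0 < B / 2 by lra.
have [T1 [t1 HT1]] := supconv_exists Bh cf1 bf1.
have [T2 [t2 HT2]] := supconv_exists Bh cf2 bf2.
have [S1 [s1 HS1]] := supconv_exists B0 cf1 bf1.
have [S2 [s2 HS2]] := supconv_exists B0 cf2 bf2.
have [Sg [sgl HSg]] := supconv_exists B0 cg' bg'.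
have cl1 := HB1 (B / 2) T1 t1 ltac:(rewrite /B; lra) HT1.
have cl2 := HB2 (B / 2) T2 t2 ltac:(rewrite /B; lra) HT2.
have cl3 := HB3 B Sg sgl ltac:(rewrite /B; lra) HSg.
have cT1 := supconv_rcont Bh HT1 bf1; have cT2 := supconv_rcont Bh HT2 bf2.
have cS1 := supconv_rcont B0 HS1 bf1; have cS2 := supconv_rcont B0 HS2 bf2.
have cSg := supconv_rcont B0 HSg bg'.
have inR y : vnorm (y -^ zb) <= rho -> vnorm y <= R0.
  by move=> hy; have := vnorm_le_dist y zb; rewrite /R0 /rho in hy *; lra.
have [k [kr _ lm]] := @perturbed_max m (fun y => f1 y + f2 y + g' y) (fun y => T1 y + T2 y + Sg y) phi zb eps rho e
  (rcont_add (rcont_add cT1 cT2) cSg) (C2_rcont Cphi) rho0 e0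
  (fun y hy => ltac:(have hy2 : vnorm (y -^ zb) < r0 by [rewrite /rho in hy; lra]; have := Hmax y hy2; rewrite /g'; lra))
  (fun y hy => ltac:(have := proj1 (cl1 y (inR y hy)); have := proj1 (cl2 y (inR y hy)); have := proj1 (cl3 y (inR y hy)); split_Rabs; lra))
  ltac:(rewrite /e; lra).
have kR : vnorm k <= R0 by apply: inR; lra.
pose phi' y := phi y + eps * dot (y -^ zb) (y -^ zb).
have Cphi' := C2_add Cphi (C2_sqdist eps zb).
set D := Dphi k +^ (2 * eps) *^ (k -^ zb).
pose X := madd (D2phi k) (mscal (2 * eps) (@mid m)).
have [up1 E1 bd1 lo1] := midpoint_data k B0 HT1 HS1.
have [up2 E2 bd2 lo2] := midpoint_data k B0 HT2 HS2.
pose p1 := B *^ (t1 k -^ k); pose p2 := B *^ (t2 k -^ k).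
pose x1 := k +^ (/ 2) *^ (t1 k -^ k); pose x2 := k +^ (/ 2) *^ (t2 k -^ k).
rewrite -/x1 -/p1 in up1 E1 bd1 lo1; rewrite -/x2 -/p2 in up2 E2 bd2 lo2.
have [r1 [r10 Hlm]] := lm.
pose q := D -^ p1 -^ p2.
(* All three functions have supporting paraboloids at [k] and their sum is touched from above by the
   smooth [phi']; the three slopes must therefore add up to its gradient [D]. *)
have qE : D -^ p1 -^ p2 = (2 * B) *^ (sgl k -^ k).
  have DE : D = (2 * B) *^ (sgl k -^ k) +^ p1 +^ p2; last by rewrite DE; vring.
  apply: (grad_from_below (proj1 Cphi' k) r10 (K := 2 * B)) => h hh.
  have := Hlm (k +^ h); have -> : k +^ h -^ k = h by vring.
  move=> /(_ hh); have := lo1 h; have := lo2 h; have := supconv_support HSg k h.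
  rewrite !(dot_addl _ _ h); lra.
have [r2 [r20 Hso]] := C2_second_order k Cphi' Rlt_0_1.
rewrite -/X -/D -/(phi' k) in Hso.
have X0 := msum_ge0 X.
pose K := 2 * B + msum X + 1.
have BK : B <= K by rewrite /K; lra.
(* Lying under [phi' - T1 - T2] up to a constant, with contact at [k], the third function also gets
   a quadratic bound from above, with the larger constant [K]. *)
have bdg v : vnorm v < Rmin r1 r2 -> Rabs (Sg (k +^ v) - Sg k - dot q v) <= K * dot v v.
  move=> hv; have hv1 := Rlt_le_trans _ _ _ hv (Rmin_l _ _); have hv2 := Rlt_le_trans _ _ _ hv (Rmin_r _ _).
  have := Hlm (k +^ v); have -> : k +^ v -^ k = v by vring.
  move=> /(_ hv1); rewrite -/(phi' (k +^ v)) -/(phi' k).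
  have := Hso v hv2; rewrite -/(phi' (k +^ v)).
  have := lo1 v; have := lo2 v; have := supconv_support HSg k v; rewrite -qE -/q.
  have := qf_bound X v; have dv := dot_ge0 v.
  have qD : dot q v = dot D v - dot p1 v - dot p2 v by rewrite /q !dot_subl.
  have Xv : 0 <= msum X * dot v v by nra.
  have Bv : 0 <= B * dot v v by nra.
  by rewrite /K; split_Rabs; lra.
have rm0 : 0 < Rmin r1 r2 by exact: Rmin_pos.
have bd1' v : vnorm v < 1 -> Rabs (S1 (x1 +^ v) - S1 x1 - dot p1 v) <= B * dot v v by move=> _; exact: bd1.
have bd2' v : vnorm v < 1 -> Rabs (S2 (x2 +^ v) - S2 x2 - dot p2 v) <= B * dot v v by move=> _; exact: bd2.
have [U1 lim1] := blow_limit_exists Rlt_0_1 bd1'.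
have [U2 lim2] := blow_limit_exists Rlt_0_1 bd2'.
have [Ug limg] := blow_limit_exists rm0 bdg.
have BB : B <= B by lra.
have LU1 := blow_limit_loclin B0 BB Rlt_0_1 HS1 bd1' lim1.
have LU2 := blow_limit_loclin B0 BB Rlt_0_1 HS2 bd2' lim2.
have LUg := blow_limit_loclin B0 BK rm0 HSg bdg limg.
have sU1 := blow_limit_semiconvex BB HS1 bd1' lim1.
have sU2 := blow_limit_semiconvex BB HS2 bd2' lim2.
have bU1 := blow_limit_bound Rlt_0_1 bd1' lim1.
have bU2 := blow_limit_bound Rlt_0_1 bd2' lim2.
have bUg := blow_limit_bound rm0 bdg limg.
pose z1 := k +^ (/ B) *^ p1; pose z2 := k +^ (/ B) *^ p2; pose z3 := k +^ (/ (2 * B)) *^ q.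
have z1E : x1 +^ (/ (2 * B)) *^ p1 = z1 by rewrite /x1 /z1 /p1; vfield; lra.
have z2E : x2 +^ (/ (2 * B)) *^ p2 = z2 by rewrite /x2 /z2 /p2; vfield; lra.
have z1t : z1 = t1 k by rewrite /z1 /p1; vfield; lra.
have z2t : z2 = t2 k by rewrite /z2 /p2; vfield; lra.
have z3t : z3 = sgl k by rewrite /z3 /q qE; vfield; lra.
have rw : rho + rho < w by rewrite /rho; lra.
have n1 : vnorm (z1 -^ zb) < rho + rho.
  by rewrite z1t; have := vdist_tri k (t1 k) zb; have := proj2 (cl1 k kR); lra.
have n2 : vnorm (z2 -^ zb) < rho + rho.
  by rewrite z2t; have := vdist_tri k (t2 k) zb; have := proj2 (cl2 k kR); lra.
have n3 : vnorm (z3 -^ zb) < rho + rho.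
  by rewrite z3t; have := vdist_tri k (sgl k) zb; have := proj2 (cl3 k kR); lra.
have near z : vnorm (z -^ zb) < rho + rho -> exists d, 0 < d /\ forall y, vnorm (y -^ z) < d -> vnorm (y -^ zb) < r0.
  move=> hz; exists (r0 - (rho + rho)); split; first lra.
  by move=> y hy; have := vdist_tri z y zb; lra.
have near1 := near z1 n1; have near2 := near z2 n2; have near3 := near z3 n3.
rewrite -z1E in near1; rewrite -z2E in near2.
have cs1 th := blow_csub A0 sgb sgc B0 BB Rlt_0_1 cS1 HS1 bd1' lim1 near1 th cG1 v1.
have cs2 th := blow_csub A0 sgb sgc B0 BB Rlt_0_1 cS2 HS2 bd2' lim2 near2 th cG2 v2.
have cs3 := blow_csuper A0 sgb sgc B0 BK rm0 cSg HSg bdg limg near3 (fun z => erefl) cG3 v3.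
rewrite z1E in cs1; rewrite z2E in cs2.
(* The maximum inequality at [k], taken at distance of order [1 / s] and multiplied by [s^2]. Each
   [T] is bounded from below through [up1] and [up2], and the first order terms cancel by the choice
   of the slopes. *)
have Joint h1 h2 v : U1 h1 + U2 h2 - - Ug v <= 2 * B / 2 * (dot (h1 -^ v) (h1 -^ v) + dot (h2 -^ v) (h2 -^ v)) + / 2 * qf X v.
  apply: eps_le => d d0.
  have dv := dot_ge0 v; have nv := vnorm_ge0 v.
  have dd0 : 0 < d / (4 * (dot v v + 1)) by apply: Rdiv_lt_0_compat; lra.
  have [r3 [r30 Hr3]] := C2_second_order k Cphi' dd0.
  rewrite -/X -/D -/(phi' k) in Hr3.
  have c0 : 0 < Rmin r1 r3 / (vnorm v + 1) by apply: Rdiv_lt_0_compat; [exact: Rmin_pos | lra].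
  have d4 : 0 < d / 4 by lra.
  have [n0 [a1 [a2 [a3 a4]]]] := W_ex (W_and (lim1 h1 _ d4) (W_and (lim2 h2 _ d4) (W_and (limg v _ d4) (W_inv c0)))).
  have s0 := INRS_gt0 n0; move: a1 a2 a3 a4; rewrite /blow; move: (INR n0.+1) s0 => s s0 a1 a2 a3 a4.
  have is0 : 0 < / s by exact: Rinv_0_lt_compat.
  have nvs : vnorm ((/ s) *^ v) < Rmin r1 r3.
    rewrite vnorm_scal Rabs_pos_eq; last lra.
    have h : Rmin r1 r3 / (vnorm v + 1) * (vnorm v + 1) = Rmin r1 r3 by field; lra.
    by nra.
  have := Hlm (k +^ (/ s) *^ v); have -> : k +^ (/ s) *^ v -^ k = (/ s) *^ v by vring.
  move=> /(_ (Rlt_le_trans _ _ _ nvs (Rmin_l _ _))); rewrite -/(phi' (k +^ (/ s) *^ v)) -/(phi' k) => b1.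
  have b2 := Hr3 _ (Rlt_le_trans _ _ _ nvs (Rmin_r _ _)); rewrite -/(phi' (k +^ (/ s) *^ v)) in b2.
  have b3 := up1 (x1 +^ (/ s) *^ h1) (k +^ (/ s) *^ v); have b4 := up2 (x2 +^ (/ s) *^ h2) (k +^ (/ s) *^ v).
  have g1 : x1 +^ (/ s) *^ h1 -^ (k +^ (/ s) *^ v) = (x1 -^ k) +^ (/ s) *^ (h1 -^ v) by vring.
  have g2 : x2 +^ (/ s) *^ h2 -^ (k +^ (/ s) *^ v) = (x2 -^ k) +^ (/ s) *^ (h2 -^ v) by vring.
  have i1 : p1 = (2 * B) *^ (x1 -^ k) by rewrite /p1 /x1; vfield.
  have i2 : p2 = (2 * B) *^ (x2 -^ k) by rewrite /p2 /x2; vfield.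
  have sq (a b : pt m) : dot (a +^ (/ s) *^ b) (a +^ (/ s) *^ b) = dot a a + 2 * / s * dot a b + / s * / s * dot b b.
    by rewrite !dotE (dotC b a); ring.
  have j1 : dot (x1 -^ k) (h1 -^ v) * (2 * B) = dot p1 h1 - dot p1 v by rewrite i1 !dot_scall dot_subr; ring.
  have j2 : dot (x2 -^ k) (h2 -^ v) * (2 * B) = dot p2 h2 - dot p2 v by rewrite i2 !dot_scall dot_subr; ring.
  rewrite g1 sq in b3; rewrite g2 sq in b4.
  have qD : dot q v = dot D v - dot p1 v - dot p2 v by rewrite /q !dot_subl.
  rewrite qf_scalv dot_scalr !dot_scall dot_scalr in b2.
  have b5 : d / (4 * (dot v v + 1)) * dot v v <= d / 4.
    have h : d / (4 * (dot v v + 1)) * (dot v v + 1) = d / 4 by field; lra.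
    have : 0 < d / (4 * (dot v v + 1)) by apply: Rdiv_lt_0_compat; lra.
    by lra.
  have tot : S1 (x1 +^ / s *^ h1) - S1 x1 - / s * dot p1 h1 + (S2 (x2 +^ / s *^ h2) - S2 x2 - / s * dot p2 h2)
      + (Sg (k +^ / s *^ v) - Sg k - / s * dot q v)
    <= B * (/ s * / s * dot (h1 -^ v) (h1 -^ v)) + B * (/ s * / s * dot (h2 -^ v) (h2 -^ v))
       + (/ s * / s * qf X v / 2 + d / (4 * (dot v v + 1)) * (/ s * (/ s * dot v v))).
    have t1' : B * (2 * / s * dot (x1 -^ k) (h1 -^ v)) = / s * (dot p1 h1 - dot p1 v) by rewrite -j1; ring.
    have t2' : B * (2 * / s * dot (x2 -^ k) (h2 -^ v)) = / s * (dot p2 h2 - dot p2 v) by rewrite -j2; ring.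
    have b2' : phi' (k +^ / s *^ v) - phi' k - / s * dot D v <= / s * / s * qf X v / 2 + d / (4 * (dot v v + 1)) * (/ s * (/ s * dot v v)).
      by move: b2; split_Rabs; lra.
    by rewrite qD; lra.
  have ssq : 0 <= s * s by exact: Rle_0_sqr.
  have := Rmult_le_compat_l _ _ _ ssq tot.
  rewrite (_ : s * s * (B * (/ s * / s * dot (h1 -^ v) (h1 -^ v)) + B * (/ s * / s * dot (h2 -^ v) (h2 -^ v))
       + (/ s * / s * qf X v / 2 + d / (4 * (dot v v + 1)) * (/ s * (/ s * dot v v))))
    = B * dot (h1 -^ v) (h1 -^ v) + B * dot (h2 -^ v) (h2 -^ v) + (qf X v / 2 + d / (4 * (dot v v + 1)) * dot v v)); last by field; lra.
  by move: a1 a2 a3; split_Rabs; lra.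
pose z0 := @vzero m.
have zz (U : pt m -> R) c : (forall h, Rabs (U h) <= c * dot h h) -> U z0 = 0.
  by move=> H; have := H z0; rewrite /z0 dot_0l Rmult_0_r; split_Rabs; lra.
have K8 : 0 <= 8 * K by lra.
have M1 : 8 * B <= 8 * K by lra.
have M2 : 2 * B <= 8 * K by lra.
have cV : rcont (fun y => - Ug y).
  by apply: rcont_ext (rcont_scal (-1) (loclin_rcont K8 LUg)) => y; ring.
have half (U : pt m -> R) : (forall h, Rabs (U h) <= B * dot h h) -> forall h, U h <= 2 * B / 2 * dot h h.
  by move=> H h; have := H h; split_Rabs; lra.
have V0 : - Ug z0 = 0 by rewrite (zz _ _ bUg); ring.
have [th Hth] := const_coef_comparison (B := 2 * B) (A := INR n * (As * As)) ltac:(lra) K8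
  (loclin_mono M1 LU1) (loclin_mono M1 LU2) (semiconvex_mono M2 sU1) (semiconvex_mono M2 sU2)
  cs1 cs2 cV cs3 (zz _ _ bU1) (zz _ _ bU2) V0 (half _ bU1) (half _ bU2) Joint
  (fun th => trsq_le A0 (sgb th _)) e0.
exists B, k, p1, p2 => q' z1' z2' z3'; split.
- split; [rewrite /B; lra | lra | | | ].
  + by rewrite -[z1']/z1; lra.
  + by rewrite -[z2']/z2; lra.
  + by rewrite -[z3']/z3; lra.
- move=> v L Lv; apply: (supconv_slope HS1 (x := x1) (K := B) Lv Rlt_0_1) => h hh.
  by have := bd1 h; split_Rabs; lra.
- move=> v L Lv; apply: (supconv_slope HS2 (x := x2) (K := B) Lv Rlt_0_1) => h hh.
  by have := bd2 h; split_Rabs; lra.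
- move=> v L Lv; rewrite -[q']/q; apply: (supconv_slope HSg (x := k) (K := K) _ rm0) => [z c|h hh].
    by rewrite /g'; have := Lv z c; split_Rabs; lra.
  by have := bdg h hh; split_Rabs; lra.
- exists th; move: Hth; rewrite /X lop_madd lop_mscal lop_id -/z1 -/z2 -/z3.
  rewrite -[z3']/z3 -[z1']/z1 -[z2']/z2 -[q']/q -/z3; lra.
Qed.

(** * Parabolic doubling *)

Lemma C2_grad_close m (f : pt m -> R) Df D2f x e : C2 f Df D2f -> 0 < e ->
  exists d, 0 < d /\ forall y, vnorm (y -^ x) < d -> vnorm (Df y -^ Df x) < e.
Proof.
move=> Cf e0; have m0 := pos_INR m.
have e1 : 0 < e / (INR m + 1) by apply: Rdiv_lt_0_compat; lra.
have [d [d0 H]] : exists d, 0 < d /\ forall i, forall y, vnorm (y -^ x) < d -> Rabs (Df y i - Df x i) < e / (INR m + 1).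
  apply: fin_delta => [i a a' _ aa H y hy|i]; first by apply: H; lra.
  exact: C2_rcontD Cf i x _ e1.
exists d; split=> // y hy; apply: Rle_lt_trans (vnorm_coord_bound (fun i => Rlt_le _ _ (H i y hy))) _.
have -> : INR m * (e / (INR m + 1)) = e - e / (INR m + 1) by field; lra.
lra.
Qed.

Lemma C2_hess_close m (f : pt m -> R) Df D2f x e : C2 f Df D2f -> 0 < e ->
  exists d, 0 < d /\ forall y, vnorm (y -^ x) < d -> forall i j, Rabs (D2f y i j - D2f x i j) < e.
Proof.
move=> Cf e0.
have [d [d0 H]] : exists d, 0 < d /\ forall i, forall j, forall y, vnorm (y -^ x) < d -> Rabs (D2f y i j - D2f x i j) < e.
  apply: fin_delta => [i a a' _ aa H j y hy|i]; first by apply: H; lra.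
  apply: fin_delta => [j a a' _ aa H y hy|j]; first by apply: H; lra.
  by case: Cf => _ [_ c]; exact: c.
by exists d; split=> // y hy i j; exact: H.
Qed.

(** * Space-time as a Euclidean space *)

Section SpaceTime.
Variable N : nat.
Implicit Types (x y p : pt N) (z w : pt N.+1) (t s : R).

(** Time is the coordinate [ord0], so that parabolic problems become elliptic ones that are
    degenerate in the time direction. *)
Definition tpart z : R := z ord0.
Definition xpart z : pt N := fun i => z (lift ord0 i).
Definition mk t x : pt N.+1 := fun i => if unlift ord0 i is Some j then x j else t.

Lemma mk_t t x : mk t x ord0 = t.
Proof. by rewrite /mk unlift_none. Qed.
Lemma mk_l t x j : mk t x (lift ord0 j) = x j.
Proof. by rewrite /mk liftK. Qed.
Lemma xpart_mk t x : xpart (mk t x) = x.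
Proof. by apply: functional_extensionality => i; rewrite /xpart mk_l. Qed.

Lemma mk_ext z w : z ord0 = w ord0 -> (forall j, z (lift ord0 j) = w (lift ord0 j)) -> z = w.
Proof.
move=> h0 h; apply: functional_extensionality => i.
by case: (unliftP ord0 i) => [j ->|->].
Qed.

Lemma mk_parts z : mk (tpart z) (xpart z) = z.
Proof. by apply: mk_ext => [|j]; rewrite ?mk_t ?mk_l. Qed.

Lemma dot_parts z w : dot z w = tpart z * tpart w + dot (xpart z) (xpart w).
Proof. exact: rsum_recl. Qed.

Lemma dot_mk z t x : dot z (mk t x) = tpart z * t + dot (xpart z) x.
Proof. by rewrite dot_parts /tpart mk_t xpart_mk. Qed.

Lemma mk_add t x s y : mk t x +^ mk s y = mk (t + s) (x +^ y).
Proof. by apply: mk_ext => [|j]; rewrite /vadd ?mk_t ?mk_l. Qed.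
Lemma mk_sub t x s y : mk t x -^ mk s y = mk (t - s) (x -^ y).
Proof. by apply: mk_ext => [|j]; rewrite /vsub ?mk_t ?mk_l. Qed.
Lemma mk_scal c t x : c *^ mk t x = mk (c * t) (c *^ x).
Proof. by apply: mk_ext => [|j]; rewrite /vscal ?mk_t ?mk_l. Qed.

Lemma xpart_norm z : vnorm (xpart z) <= vnorm z.
Proof.
apply: vnorm_le_sq; first exact: vnorm_ge0.
rewrite vnorm_sq [X in _ <= X]dot_parts; nra.
Qed.
Lemma tpart_norm z : Rabs (tpart z) <= vnorm z.
Proof. exact: coord_le. Qed.
Lemma mk_norm t x : vnorm (mk t x) <= Rabs t + vnorm x.
Proof.
have := vnorm_ge0 x; have := Rabs_pos t => t0 x0; apply: vnorm_le_sq; first lra.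
rewrite dot_mk xpart_mk /tpart mk_t -vnorm_sq.
have -> : t * t = Rabs t * Rabs t by split_Rabs; ring.
by nra.
Qed.
Lemma mk0_norm x : vnorm (mk 0 x) = vnorm x.
Proof. by rewrite /vnorm dot_mk xpart_mk /tpart mk_t Rmult_0_l Rplus_0_l. Qed.

Lemma rcont2_rcont (f : pt N -> R -> R) : rcont2 f -> rcont (fun z => f (xpart z) (tpart z)).
Proof.
move=> cf z eps e0; have [d [d0 H]] := cf (xpart z) (tpart z) eps e0; exists d; split=> // w hw.
apply: H; first exact: Rle_lt_trans (xpart_norm (w -^ z)) hw.
exact: Rle_lt_trans (tpart_norm (w -^ z)) hw.
Qed.

Lemma rcont_rcont2 (f : pt N.+1 -> R) : rcont f -> rcont2 (fun x t => f (mk t x)).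
Proof.
move=> cf x t eps e0; have [d [d0 H]] := cf (mk t x) eps e0; exists (d / 2); split; first lra.
move=> y s hy hs; apply: H; rewrite mk_sub; apply: Rle_lt_trans (mk_norm _ _) _; lra.
Qed.

Lemma C2_C21 (f : pt N.+1 -> R) Df D2f : C2 f Df D2f ->
  C21 (fun x t => f (mk t x)) (fun x t => tpart (Df (mk t x))) (fun x t => xpart (Df (mk t x)))
   (fun x t i j => D2f (mk t x) (lift ord0 i) (lift ord0 j)).
Proof.
move=> Cf; have [f1 [f2 f3]] := Cf.
have sub (F : pt N.+1 -> R) (z p : pt N.+1) : has_grad F z p -> forall x t, z = mk t x -> has_grad (fun y => F (mk t y)) x (xpart p).
  move=> H x t zE eps e0; have [d [d0 Hd]] := H eps e0; exists d; split=> // h hh.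
  have := Hd (mk 0 h); rewrite mk0_norm => /(_ hh); rewrite zE mk_add Rplus_0_r.
  by rewrite dot_mk Rmult_0_r Rplus_0_l.
split; [|split; [|split; [|split; [|split; [|split]]]]].
- move=> x t.
  have E s : mk s x = mk 0 x +^ s *^ mk 1 (@vzero N).
    by rewrite mk_scal mk_add; congr mk; [ring | vring].
  have := @has_grad_line _ f (mk 0 x) (mk 1 (@vzero N)) t (Df (mk t x)).
  rewrite -E => /(_ (f1 _)); rewrite dot_mk dot_0r Rmult_1_r Rplus_0_r.
  have -> : (fun s => f (mk s x)) = (fun s => f (mk 0 x +^ s *^ mk 1 (@vzero N))) by apply: functional_extensionality => s; rewrite E.
  by [].
- by move=> x t; apply: sub (f1 _) _ _ _.
- by move=> x t i; apply: (sub (fun z => Df z (lift ord0 i)) _ _ (f2 _ _)).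
- by apply: rcont_rcont2; exact: C2_rcont Cf.
- by apply: (rcont_rcont2 (f := fun z => Df z ord0)); exact: C2_rcontD Cf ord0.
- by move=> i; apply: (rcont_rcont2 (f := fun z => Df z (lift ord0 i))); exact: C2_rcontD Cf _.
- by move=> i j; apply: (rcont_rcont2 (f := fun z => D2f z (lift ord0 i) (lift ord0 j))); exact: f3.
Qed.

Lemma has_grad_xpart f z p : has_grad f (xpart z) p -> has_grad (fun w => f (xpart w)) z (mk 0 p).
Proof.
move=> H eps e0; have [d [d0 Hd]] := H eps e0; exists d; split=> // h hh.
have xh := xpart_norm h.
have := Hd (xpart h) ltac:(lra).
rewrite (dotC (mk 0 p)) dot_mk Rmult_0_r Rplus_0_l (dotC (xpart h)) => h1.
by apply: Rle_trans h1 _; apply: Rmult_le_compat_l; lra.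
Qed.

Lemma has_grad_tpart chi z l : derivable_pt_lim chi (tpart z) l ->
  has_grad (fun w => chi (tpart w)) z (mk l (@vzero N)).
Proof.
move=> H eps e0; have [d Hd] := H eps e0; exists d; split; first exact: cond_pos.
move=> h hh; have th := tpart_norm h.
rewrite (dotC (mk l _)) dot_mk dot_0r Rplus_0_r.
case: (Req_dec (tpart h) 0) => [e|n].
  rewrite (_ : tpart (z +^ h) = tpart z); last by rewrite /tpart /vadd -/(tpart h) e Rplus_0_r.
  rewrite e Rmult_0_l (_ : _ - _ - _ = 0); last by ring.
  by rewrite Rabs_R0; have := vnorm_ge0 h; nra.
have := Hd _ n ltac:(lra).
have -> : tpart (z +^ h) = tpart z + tpart h by [].
have -> : chi (tpart z + tpart h) - chi (tpart z) - tpart h * l = tpart h * ((chi (tpart z + tpart h) - chi (tpart z)) / tpart h - l) by field.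
rewrite Rabs_mult => h1.
have := Rabs_pos (tpart h); have := Rabs_pos ((chi (tpart z + tpart h) - chi (tpart z)) / tpart h - l) => q1 q2.
have q3 : Rabs (tpart h) * Rabs ((chi (tpart z + tpart h) - chi (tpart z)) / tpart h - l) <= vnorm h * eps by apply: Rmult_le_compat; lra.
lra.
Qed.

Lemma C2_separate Psi DPsi D2Psi chi chi1 chi2 : @C2 N Psi DPsi D2Psi ->
  (forall t, derivable_pt_lim chi t (chi1 t)) -> (forall t, derivable_pt_lim chi1 t (chi2 t)) ->
  (forall t, continuity_pt chi2 t) ->
  C2 (fun z => Psi (xpart z) + chi (tpart z)) (fun z => mk (chi1 (tpart z)) (DPsi (xpart z)))
   (fun z i => if unlift ord0 i is Some j then mk 0 (D2Psi (xpart z) j) else mk (chi2 (tpart z)) (@vzero N)).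
Proof.
move=> [P1 [P2 P3]] c1 c2 c3; split; [|split].
- move=> z; apply: has_grad_ext (has_grad_add (has_grad_xpart (P1 (xpart z))) (has_grad_tpart (c1 (tpart z)))) => // i.
  by rewrite mk_add Rplus_0_l; congr (mk _ _ i); vring.
- move=> z i; case: (unliftP ord0 i) => [j ->|->].
    apply: has_grad_ext (has_grad_xpart (P2 (xpart z) j)) => [w|k].
      by rewrite mk_l.
    by [].
  apply: has_grad_ext (has_grad_tpart (c2 (tpart z))) => [w|k].
    by rewrite mk_t.
  by [].
- have cx (F : pt N -> R) : rcont F -> rcont (fun z => F (xpart z)).
    move=> cF z eps e0; have [d [d0 H]] := cF (xpart z) eps e0; exists d; split=> // w hw.
    by apply: H; exact: Rle_lt_trans (xpart_norm (w -^ z)) hw.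
  have ct : rcont (fun z => chi2 (tpart z)).
    move=> z eps e0; have [d [d0 H]] := c3 (tpart z) eps e0; exists d; split=> // w hw.
    have tw := tpart_norm (w -^ z).
    case: (Req_dec (tpart w) (tpart z)) => [->|ne]; first by rewrite Rminus_diag Rabs_R0.
    apply: H; split; first by split=> //; exact: not_eq_sym.
    by rewrite /= /R_dist; apply: Rle_lt_trans hw.
  move=> i j; case: (unliftP ord0 i) => [i' _|_].
    case: (unliftP ord0 j) => [j' ->|->].
      by apply: rcont_ext (cx _ (P3 i' j')) => z; rewrite mk_l.
    by apply: rcont_ext (@rcont_const N.+1 0) => z; rewrite mk_t.
  case: (unliftP ord0 j) => [j' ->|->].
    by apply: rcont_ext (@rcont_const N.+1 0) => z; rewrite mk_l.
  by apply: rcont_ext ct => z; rewrite mk_t.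
Qed.

Lemma qf_mk0 (X : mat N.+1) x : qf X (mk 0 x) = qf (fun i j => X (lift ord0 i) (lift ord0 j)) x.
Proof.
rewrite /qf dotC dot_mk Rmult_0_r Rplus_0_l dotC; congr dot; apply: functional_extensionality => i.
rewrite /xpart /mulmv rsum_recl mk_t Rmult_0_r Rplus_0_l; apply: rsum_ext => j.
by rewrite mk_l.
Qed.
End SpaceTime.

Section ParabolicDoubling.
Variables (N : nat) (Theta : Type) (C : R) (sigma : Theta -> pt N -> mat N).
Hypothesis HC : 0 < C.
Hypothesis Hsig_bd : forall th x, mnorm (sigma th x) <= C.
Hypothesis Hsig_lip : forall th x y, mnorm (msub (sigma th x) (sigma th y)) <= C * vnorm (vsub x y).
Implicit Types (x y p : pt N) (t s : R).

Definition cols th x : 'I_N -> pt N := fun k i => sigma th x i k.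

Lemma trAX_lop th x X : trAX sigma th x X = lop (cols th x) X.
Proof.
rewrite /trAX /lop /qf /dot /mulmv /Amat /cols rsum_exch.
transitivity (rsum (fun i => rsum (fun j => rsum (fun k => sigma th x i k * (X i j * sigma th x j k))))).
  apply: rsum_ext => i; apply: rsum_ext => j; rewrite Rmult_comm -rsum_scal; apply: rsum_ext => k; ring.
rewrite [RHS]rsum_exch; apply: rsum_ext => i; rewrite rsum_exch; apply: rsum_ext => k.
by rewrite -rsum_scal.
Qed.

Lemma mnorm_cols (X : mat N) : rsum (fun k => dot (fun i => X i k) (fun i => X i k)) = mnorm X * mnorm X.
Proof.
rewrite /mnorm sqrt_sqrt; last by do 2! (apply: rsum_ge0 => ?); nra.
exact: rsum_exch.
Qed.

Lemma cols_trsq th x : trsq (cols th x) <= C * C.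
Proof.
rewrite /trsq (mnorm_cols (sigma th x)); have := Hsig_bd th x.
by have : 0 <= mnorm (sigma th x) by [exact: sqrt_pos]; nra.
Qed.

Lemma cols_diff th x y : rsum (fun k => dot (cols th x k -^ cols th y k) (cols th x k -^ cols th y k)) <= C * C * (vnorm (x -^ y) * vnorm (x -^ y)).
Proof.
have -> : rsum (fun k => dot (cols th x k -^ cols th y k) (cols th x k -^ cols th y k)) =
   mnorm (msub (sigma th x) (sigma th y)) * mnorm (msub (sigma th x) (sigma th y)).
  exact: mnorm_cols (msub (sigma th x) (sigma th y)).
have := Hsig_lip th x y; have : 0 <= mnorm (msub (sigma th x) (sigma th y)) by exact: sqrt_pos.
move: (mnorm _) => a a0 h.
have -> : C * C * (vnorm (x -^ y) * vnorm (x -^ y)) = (C * vnorm (x -^ y)) * (C * vnorm (x -^ y)) by ring.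
by apply: Rmult_le_compat.
Qed.

Lemma cols_norm th x k : vnorm (cols th x k) <= C.
Proof.
apply: vnorm_le_sq; first lra.
apply: Rle_trans (cols_trsq th x).
exact: (rsum_ge1 (f := fun k => dot (cols th x k) (cols th x k)) k (fun k => dot_ge0 _)).
Qed.

Lemma cols_lip th x y k : vnorm (cols th x k -^ cols th y k) <= C * vnorm (x -^ y).
Proof.
apply: vnorm_le_sq; first by have := vnorm_ge0 (x -^ y); nra.
have := cols_diff th x y.
have := rsum_ge1 (f := fun k => dot (cols th x k -^ cols th y k) (cols th x k -^ cols th y k)) k (fun k => dot_ge0 _).
lra.
Qed.

Definition loclip (G : Theta -> pt N -> pt N -> R) := forall R0, 0 < R0 -> exists K, 0 <= K /\
  forall th x y p q, vnorm p <= R0 -> vnorm q <= R0 ->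
  Rabs (G th x p - G th y q) <= K * (vnorm (x -^ y) + vnorm (p -^ q)).

Definition par_sub (G : Theta -> pt N -> pt N -> R) ta tb (f : pt N -> R -> R) :=
  forall phi phit Dphi D2phi, C21 phi phit Dphi D2phi -> forall x0 t0, ta < t0 < tb ->
  (exists r, 0 < r /\ forall y s, vnorm (y -^ x0) < r -> Rabs (s - t0) < r -> f y s - phi y s <= f x0 t0 - phi x0 t0) ->
  forall th, phit x0 t0 + G th x0 (Dphi x0 t0) <= trAX sigma th x0 (D2phi x0 t0).

Definition par_super (G : Theta -> pt N -> pt N -> R) ta tb (g : pt N -> R -> R) :=
  forall phi phit Dphi D2phi, C21 phi phit Dphi D2phi -> forall x0 t0, ta < t0 < tb ->
  (exists r, 0 < r /\ forall y s, vnorm (y -^ x0) < r -> Rabs (s - t0) < r -> phi y s - g y s <= phi x0 t0 - g x0 t0) ->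
  forall e, 0 < e -> exists th, trAX sigma th x0 (D2phi x0 t0) <= phit x0 t0 + G th x0 (Dphi x0 t0) + e.

(** Directions without time component: [lop] then sees the space block of the Hessian only, and the
    time derivative belongs to the first order term [lift_G]. *)
Let sg th (z : pt N.+1) k : pt N.+1 := mk 0 (cols th (xpart z) k).
Let lift_G (G : Theta -> pt N -> pt N -> R) th (z P : pt N.+1) := tpart P + G th (xpart z) (xpart P).
Let lift_f (f : pt N -> R -> R) (z : pt N.+1) := f (xpart z) (tpart z).

Lemma lop_lift th z (X : mat N.+1) :
  lop (sg th z) X = trAX sigma th (xpart z) (fun i j => X (lift ord0 i) (lift ord0 j)).
Proof. by rewrite trAX_lop; apply: rsum_ext => k; exact: qf_mk0. Qed.

Lemma lift_sub G f ta tb zb r : par_sub G ta tb f -> ta + r <= tpart zb <= tb - r ->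
  visc_sub sg (lift_G G) (fun z => vnorm (z -^ zb) < r) (lift_f f).
Proof.
move=> sf hr phi Dphi D2phi Cp z hz [r1 [r10 H]] th.
have tz := Rle_lt_trans _ _ _ (tpart_norm (z -^ zb)) hz; rewrite /tpart /vsub -/(tpart z) -/(tpart zb) in tz.
have := sf _ _ _ _ (C2_C21 Cp) (xpart z) (tpart z) ltac:(move: tz; split_Rabs; lra).
rewrite mk_parts lop_lift; apply.
exists (r1 / 2); split; first lra.
move=> y s hy hs; have := H (mk s y).
have -> : mk s y -^ z = mk (s - tpart z) (y -^ xpart z) by rewrite -{1}(mk_parts z) mk_sub.
have := mk_norm (s - tpart z) (y -^ xpart z) => nn /(_ ltac:(lra)).
by rewrite /lift_f xpart_mk /tpart mk_t.
Qed.

Lemma lift_super G g ta tb zb r : par_super G ta tb g -> ta + r <= tpart zb <= tb - r ->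
  visc_super sg (lift_G G) (fun z => vnorm (z -^ zb) < r) (lift_f g).
Proof.
move=> sf hr phi Dphi D2phi Cp z hz [r1 [r10 H]] e e0.
have tz := Rle_lt_trans _ _ _ (tpart_norm (z -^ zb)) hz; rewrite /tpart /vsub -/(tpart z) -/(tpart zb) in tz.
have := sf _ _ _ _ (C2_C21 Cp) (xpart z) (tpart z) ltac:(move: tz; split_Rabs; lra).
rewrite mk_parts => /(_ _ e e0) []; last first.
  by move=> th Hth; exists th; rewrite lop_lift /lift_G; lra.
exists (r1 / 2); split; first lra.
move=> y s hy hs; have := H (mk s y).
have -> : mk s y -^ z = mk (s - tpart z) (y -^ xpart z) by rewrite -{1}(mk_parts z) mk_sub.
have := mk_norm (s - tpart z) (y -^ xpart z) => nn /(_ ltac:(lra)).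
by rewrite /lift_f xpart_mk /tpart mk_t.
Qed.

Lemma lift_equicont G : loclip G -> equicont (lift_G G).
Proof.
move=> LG z P e e0; have p0 := vnorm_ge0 P.
have [K [K0 HK]] := LG (vnorm P + 1) ltac:(lra).
pose d := Rmin 1 (e / (2 * K + 2)).
have d0 : 0 < d by apply: Rmin_pos; [lra | apply: Rdiv_lt_0_compat; lra].
have d1 : d <= 1 := Rmin_l _ _.
have de : (2 * K + 1) * d < e.
  have h : d <= e / (2 * K + 2) := Rmin_r _ _.
  have q : e / (2 * K + 2) * (2 * K + 2) = e by field; lra.
  by nra.
exists d; split=> // th z' P' hz hP.
have xz := xpart_norm (z' -^ z); have xP := xpart_norm (P' -^ P); have tP := tpart_norm (P' -^ P).
have bP := xpart_norm P; have bP' : vnorm (xpart P') <= vnorm P + 1 by have := xpart_norm P'; have := vnorm_le_dist P' P; lra.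
have := HK th (xpart z') (xpart z) (xpart P') (xpart P) bP' ltac:(lra).
have q : K * (vnorm (xpart z' -^ xpart z) + vnorm (xpart P' -^ xpart P)) <= K * (2 * d).
  apply: Rmult_le_compat_l => //.
  by rewrite -[xpart z' -^ xpart z]/(xpart (z' -^ z)) -[xpart P' -^ xpart P]/(xpart (P' -^ P)); lra.
rewrite /lift_G; have : Rabs (tpart P' - tpart P) < d by exact: Rle_lt_trans tP hP.
by split_Rabs; lra.
Qed.

Lemma lift_equicont_dir : equicont_dir sg.
Proof.
move=> z e e0; exists (e / C); split; first exact: Rdiv_lt_0_compat.
move=> th k z' hz; rewrite /sg mk_sub Rminus_diag mk0_norm.
apply: Rle_lt_trans (cols_lip th (xpart z') (xpart z) k) _.
have := xpart_norm (z' -^ z); have -> : xpart (z' -^ z) = xpart z' -^ xpart z by [].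
have q : e / C * C = e by field; lra.
by nra.
Qed.

(** The directional bound is used along [(0, xpart q)] itself, where the Lipschitz constant is
    [L |xpart q|]. The time component of the slope remains uncontrolled. *)
Lemma lift_slope f L q : 0 <= L -> (forall x y t, Rabs (f x t - f y t) <= L * vnorm (x -^ y)) ->
  (forall v K, (forall z c, Rabs (lift_f f (z +^ c *^ v) - lift_f f z) <= K * Rabs c) -> Rabs (dot q v) <= K) ->
  vnorm (xpart q) <= L.
Proof.
move=> L0 Lf H; have n0 := vnorm_ge0 (xpart q).
have := H (mk 0 (xpart q)) (L * vnorm (xpart q)).
rewrite dot_mk Rmult_0_r Rplus_0_l -vnorm_sq => h.
have : Rabs (vnorm (xpart q) * vnorm (xpart q)) <= L * vnorm (xpart q).
  apply: h => z c; rewrite /lift_f.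
  have -> : xpart (z +^ c *^ mk 0 (xpart q)) = xpart z +^ c *^ xpart q.
    by apply: functional_extensionality => i; rewrite /xpart /vadd /vscal mk_l.
  have -> : tpart (z +^ c *^ mk 0 (xpart q)) = tpart z by rewrite /tpart /vadd /vscal mk_t; ring.
  apply: Rle_trans (Lf _ _ _) _; have -> : xpart z +^ c *^ xpart q -^ xpart z = c *^ xpart q by vring.
  by rewrite vnorm_scal; right; ring.
case: (Req_dec (vnorm (xpart q)) 0) => [->|ne]; first by lra.
by split_Rabs; nra.
Qed.

(** [doubling] at a small scale [e'], with all coefficients brought back to [xb]. The time
    components of the three slopes, for which no bound is available, add up to the time derivative
    of the test function, so that only [chi1 tbar] remains. *)
Lemma parabolic_doubling G1 G2 G3 f1 f2 g M L1 L2 L3 ta tb Psi DPsi D2Psi chi chi1 chi2 xb tbar eps :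
  loclip G1 -> loclip G2 -> loclip G3 -> rcont2 f1 -> rcont2 f2 -> rcont2 g ->
  (forall x t, Rabs (f1 x t) <= M) -> (forall x t, Rabs (f2 x t) <= M) -> (forall x t, Rabs (g x t) <= M) ->
  0 <= L1 -> 0 <= L2 -> 0 <= L3 ->
  (forall x y t, Rabs (f1 x t - f1 y t) <= L1 * vnorm (x -^ y)) ->
  (forall x y t, Rabs (f2 x t - f2 y t) <= L2 * vnorm (x -^ y)) ->
  (forall x y t, Rabs (g x t - g y t) <= L3 * vnorm (x -^ y)) ->
  par_sub G1 ta tb f1 -> par_sub G2 ta tb f2 -> par_super G3 ta tb g ->
  C2 Psi DPsi D2Psi -> (forall t, derivable_pt_lim chi t (chi1 t)) ->
  (forall t, derivable_pt_lim chi1 t (chi2 t)) -> (forall t, continuity_pt chi2 t) ->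
  ta < tbar < tb ->
  (exists r, 0 < r /\ forall y s, vnorm (y -^ xb) < r -> Rabs (s - tbar) < r ->
    f1 y s + f2 y s - g y s - Psi y - chi s <= f1 xb tbar + f2 xb tbar - g xb tbar - Psi xb - chi tbar) ->
  0 < eps ->
  exists th p1 p2, [/\ vnorm p1 <= L1, vnorm p2 <= L2, vnorm ((p1 +^ p2) -^ DPsi xb) <= L3 + eps &
   chi1 tbar + G1 th xb p1 + G2 th xb p2 - G3 th xb ((p1 +^ p2) -^ DPsi xb) <= trAX sigma th xb (D2Psi xb) + eps].
Proof.
move=> lG1 lG2 lG3 cf1 cf2 cg b1 b2 b3 L10 L20 L30 lf1 lf2 lg s1 s2 s3 CP c1 c2 c3 ht [r [r0 lm]] e0.
pose zb := mk tbar xb.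
pose r' := Rmin r (Rmin (tbar - ta) (tb - tbar)).
have r'0 : 0 < r' by apply: Rmin_pos => //; apply: Rmin_pos; lra.
have r'1 : r' <= r := Rmin_l _ _.
have r'2 : r' <= Rmin (tbar - ta) (tb - tbar) := Rmin_r _ _.
have r'3 := Rmin_l (tbar - ta) (tb - tbar). have r'4 := Rmin_r (tbar - ta) (tb - tbar).
have tzb : tpart zb = tbar by exact: mk_t.
have xzb : xpart zb = xb by exact: xpart_mk.
have rr : ta + r' <= tpart zb <= tb - r' by rewrite tzb; lra.
have CPhi := C2_separate CP c1 c2 c3.
have lmz : forall z, vnorm (z -^ zb) < r' -> lift_f f1 z + lift_f f2 z - lift_f g z - (Psi (xpart z) + chi (tpart z))
   <= lift_f f1 zb + lift_f f2 zb - lift_f g zb - (Psi (xpart zb) + chi (tpart zb)).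
  move=> z hz; rewrite /lift_f tzb xzb.
  have := xpart_norm (z -^ zb); have := tpart_norm (z -^ zb).
  have -> : xpart (z -^ zb) = xpart z -^ xb by rewrite -xzb.
  have -> : tpart (z -^ zb) = tpart z - tbar by rewrite -tzb.
  by move=> h1 h2; have := lm (xpart z) (tpart z) ltac:(lra) ltac:(lra); lra.
pose Lm := L1 + L2 + L3 + 1.
have [K1 [K10 hK1]] := lG1 (Lm + 1) ltac:(rewrite /Lm; lra).
have [K2 [K20 hK2]] := lG2 (Lm + 1) ltac:(rewrite /Lm; lra).
have [K3 [K30 hK3]] := lG3 (Lm + vnorm (DPsi xb) + 1) ltac:(have := vnorm_ge0 (DPsi xb); rewrite /Lm; lra).
have [d1 [d10 hlop]] := lop_close N (D2Psi xb) (Rlt_le _ _ HC) (e := eps / 8) ltac:(lra).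
have [d2 [d20 hgrad]] := C2_grad_close xb (e := Rmin (eps / 2) (Rmin 1 (eps / (16 * (K3 + 1))))) CP
  ltac:(apply: Rmin_pos; [lra | apply: Rmin_pos; [lra | apply: Rdiv_lt_0_compat; lra]]).
have [d3 [d30 hhess]] := C2_hess_close xb CP d10.
have [d4 [d40 hchi]] : exists d, 0 < d /\ forall t, Rabs (t - tbar) < d -> Rabs (chi1 t - chi1 tbar) < eps / 8.
  have [d [d0 Hd]] := derivable_continuous_pt chi1 tbar (exist _ _ (c2 tbar)) (eps / 8) ltac:(lra).
  exists d; split=> // t ht'; case: (Req_dec t tbar) => [->|ne]; first by rewrite Rminus_diag Rabs_R0; lra.
  by apply: Hd; split; [split=> //; exact: not_eq_sym | exact: ht'].
(* Collects the terms proportional to [e']: [2 C^2] from the penalty, [8 C^2 Lm^2] from the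
   difference of the directions, [1] from the additive error. *)
have [A AE] : exists A, A = 2 * (C * C) + 8 * (C * C) * (Lm * Lm) + 1 by eexists.
have A0 : 0 < A by rewrite AE; have := Rle_0_sqr Lm; have := Rle_0_sqr C; rewrite /Rsqr; nra.
have [e' [e'0 [he1 [he2 [he3 [he4 [he5 [he6 [he7 [he8 he9]]]]]]]]]] : exists e', 0 < e' /\ e' < 1 /\ e' < d2 /\ e' < d3 /\ e' < d4 /\ e' < d1 / C
    /\ e' < eps / (16 * (K1 + K2 + K3 + 1)) /\ e' < eps / (8 * A) /\ e' < eps / 16 /\ 2 * e' < Rmin (eps / 2) (Rmin 1 (eps / (16 * (K3 + 1)))).
  have mm : 0 < Rmin (eps / 2) (Rmin 1 (eps / (16 * (K3 + 1)))) by apply: Rmin_pos; [lra | apply: Rmin_pos; [lra | apply: Rdiv_lt_0_compat; lra]].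
  have w1 := W_inv Rlt_0_1. have w2 := W_inv d20. have w3 := W_inv d30. have w4 := W_inv d40.
  have w5 := @W_inv (d1 / C) ltac:(apply: Rdiv_lt_0_compat; lra).
  have w6 := @W_inv (eps / (16 * (K1 + K2 + K3 + 1))) ltac:(apply: Rdiv_lt_0_compat; lra).
  have w7 := @W_inv (eps / (8 * A)) ltac:(apply: Rdiv_lt_0_compat; lra).
  have w8 := @W_inv (eps / 16) ltac:(lra).
  have w9 := @W_inv (Rmin (eps / 2) (Rmin 1 (eps / (16 * (K3 + 1)))) / 2) ltac:(lra).
  have [n Hn] := W_ex (W_and w1 (W_and w2 (W_and w3 (W_and w4 (W_and w5 (W_and w6 (W_and w7 (W_and w8 w9)))))))).
  exists (/ INR n.+1); split; first exact: invS_gt0.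
  by intuition lra.
have := @doubling N.+1 N Theta sg (lift_G G1) (lift_G G2) (lift_G G3) (lift_f f1) (lift_f f2) (lift_f g) M C _ _ _ zb r' e'
  (rcont2_rcont cf1) (rcont2_rcont cf2) (rcont2_rcont cg) (fun z => b1 _ _) (fun z => b2 _ _) (fun z => b3 _ _)
  (Rlt_le _ _ HC) _ lift_equicont_dir (lift_equicont lG1) (lift_equicont lG2) (lift_equicont lG3) r'0 e'0
  (lift_sub s1 rr) (lift_sub s2 rr) (lift_super s3 rr) CPhi lmz.
case; first by move=> th z k; rewrite /sg mk0_norm; exact: cols_norm.
move=> B [k [p1 [p2]]] /=; set q := _ -^ p2; set z1 := k +^ _ *^ p1; set z2 := k +^ _ *^ p2; set z3 := k +^ _ *^ q.
case=> [[hB hk hz1 hz2 hz3]] sl1 sl2 sl3 [th Hth].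
have n1 : vnorm (xpart p1) <= L1 := lift_slope L10 lf1 sl1.
have n2 : vnorm (xpart p2) <= L2 := lift_slope L20 lf2 sl2.
have n3 : vnorm (xpart q) <= L3 := lift_slope L30 lg sl3.
have B0 : 0 < B by have := Rinv_0_lt_compat _ e'0; lra.
have iB : / B <= e' by rewrite -(Rinv_inv e'); apply: Rinv_le_contravar => //; exact: Rinv_0_lt_compat.
have iB0 : 0 < / B by exact: Rinv_0_lt_compat.
have xd (z : pt N.+1) : vnorm (z -^ zb) < e' -> vnorm (xpart z -^ xb) < e'.
  by move=> h; apply: Rle_lt_trans h; have := xpart_norm (z -^ zb); rewrite (_ : xpart (z -^ zb) = xpart z -^ xb) // -xzb.
have hkx := xd _ hk. have hx1 := xd _ hz1. have hx2 := xd _ hz2. have hx3 := xd _ hz3.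
have hkt : Rabs (tpart k - tbar) < e'.
  by apply: Rle_lt_trans hk; have := tpart_norm (k -^ zb); rewrite (_ : tpart (k -^ zb) = tpart k - tbar) // -tzb.
have xq : xpart q = (DPsi (xpart k) +^ (2 * e') *^ (xpart k -^ xb)) -^ xpart p1 -^ xpart p2.
  by apply: functional_extensionality => i; rewrite /q /zb /xpart /vsub /vadd /vscal !mk_l.
have tq : tpart q = chi1 (tpart k) + 2 * e' * (tpart k - tbar) - tpart p1 - tpart p2.
  by rewrite /q /zb /tpart /vsub /vadd /vscal !mk_t.
pose R' := (DPsi (xpart k) -^ DPsi xb) +^ (2 * e') *^ (xpart k -^ xb).
set P1 := xpart p1; set P2 := xpart p2; set mn := Rmin (eps / 2) _ in he9 hgrad.
have qR : (P1 +^ P2) -^ DPsi xb = R' -^ xpart q by rewrite xq /R' /P1 /P2; apply: functional_extensionality => i; rewrite /vadd /vsub /vscal; ring.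
have nR : vnorm R' <= 2 * mn.
  apply: Rle_trans (vnorm_tri _ _) _; rewrite vnorm_scal Rabs_pos_eq; last by lra.
  have := hgrad (xpart k) ltac:(lra).
  by have := Rmult_le_compat_l (2 * e') (vnorm (xpart k -^ xb)) 1 ltac:(lra) ltac:(lra); lra.
have mn1 : mn <= eps / 2 := Rmin_l _ _.
have mn2 : mn <= 1 by apply: Rle_trans (Rmin_r _ _) (Rmin_l _ _).
have mn3 : mn <= eps / (16 * (K3 + 1)) by apply: Rle_trans (Rmin_r _ _) (Rmin_r _ _).
exists th, P1, P2; split=> //.
  by rewrite qR; apply: Rle_trans (vnorm_sub_le _ _) _; lra.
have D1 : lop (sg th z3) (fun i => if unlift ord0 i is Some j then mk 0 (D2Psi (xpart k) j) else mk (chi2 (tpart k)) (@vzero N))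
   = lop (cols th (xpart z3)) (D2Psi (xpart k)).
  rewrite lop_lift trAX_lop; congr lop; apply: functional_extensionality => i; apply: functional_extensionality => j.
  by rewrite liftK mk_l.
have D2 : trsq (sg th z3) <= C * C.
  apply: Rle_trans (cols_trsq th (xpart z3)); right; apply: rsum_ext => i.
  by rewrite -!vnorm_sq mk0_norm.
have dd (z w : pt N.+1) b : vnorm (xpart z -^ xpart w) <= b -> rsum (fun i => dot (sg th z i -^ sg th w i) (sg th z i -^ sg th w i)) <= C * C * (b * b).
  move=> hb; apply: Rle_trans (Rle_trans _ _ _ (cols_diff th (xpart z) (xpart w)) _); last first.
    by have v0 := vnorm_ge0 (xpart z -^ xpart w); apply: Rmult_le_compat_l; [exact: Rle_0_sqr | exact: Rmult_le_compat].
  right; apply: rsum_ext => i; rewrite mk_sub Rminus_diag.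
  by rewrite -!vnorm_sq mk0_norm.
have bd (p : pt N.+1) : vnorm (xpart p) <= Lm - L3 -> vnorm (xpart (k +^ / B *^ p) -^ xpart z3) <= Lm * / B.
  move=> hp; have -> : xpart (k +^ / B *^ p) -^ xpart z3 = / B *^ (xpart p) -^ (/ (2 * B)) *^ xpart q.
    by apply: functional_extensionality => i; rewrite /z3 /xpart /vsub /vadd /vscal; ring.
  apply: Rle_trans (vnorm_sub_le _ _) _; rewrite !vnorm_scal !Rabs_pos_eq; try by left; first [exact: iB0 | apply: Rinv_0_lt_compat; lra].
  rewrite Rinv_mult; have a1 := Rmult_le_compat_r _ _ _ (Rlt_le _ _ iB0) hp.
  have a2 := Rmult_le_compat_r _ _ _ (Rlt_le _ _ iB0) n3; have a3 := Rmult_le_pos _ _ L30 (Rlt_le _ _ iB0); lra.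
have D3 := dd z1 z3 _ (bd p1 ltac:(rewrite /Lm; lra)). have D4 := dd z2 z3 _ (bd p2 ltac:(rewrite /Lm; lra)).
(* The points differ by at most [Lm / B], so the weight [4 * B] leaves a term of order [/ B]. *)
have E4 : 4 * B * (C * C * (Lm * / B * (Lm * / B)) + C * C * (Lm * / B * (Lm * / B))) = 8 * (C * C) * (Lm * Lm) * / B by field; lra.
move: Hth; rewrite /lift_G D1 -/q -/P1 -/P2.
set S1 := rsum _ in D3 *; set S2 := rsum _ in D4 *; move=> Hth.
have D5 : 4 * B * (S1 + S2) <= 8 * (C * C) * (Lm * Lm) * e'.
  apply: (Rle_trans _ (8 * (C * C) * (Lm * Lm) * / B)).
    by rewrite -E4; apply: Rmult_le_compat_l; lra.
  apply: Rmult_le_compat_l => //; apply: Rmult_le_pos; last exact: Rle_0_sqr.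
  by apply: Rmult_le_pos; [lra | exact: Rle_0_sqr].
have D6 : e' * A <= eps / 8.
  have h : e' * A <= eps / (8 * A) * A by apply: Rmult_le_compat_r; lra.
  have q' : eps / (8 * A) * A = eps / 8 by field; lra.
  lra.
have D7 : 2 * e' * trsq (sg th z3) <= 2 * (C * C) * e' by have := Rmult_le_compat_l (2 * e') _ _ ltac:(lra) D2; lra.
have e16 : e' * (K1 + K2 + K3 + 1) <= eps / 16.
  have h : e' * (K1 + K2 + K3 + 1) <= eps / (16 * (K1 + K2 + K3 + 1)) * (K1 + K2 + K3 + 1) by apply: Rmult_le_compat_r; lra.
  have q' : eps / (16 * (K1 + K2 + K3 + 1)) * (K1 + K2 + K3 + 1) = eps / 16 by field; lra.
  lra.
have m16 : mn * (K3 + 1) <= eps / 16.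
  have h : mn * (K3 + 1) <= eps / (16 * (K3 + 1)) * (K3 + 1) by apply: Rmult_le_compat_r; lra.
  have q' : eps / (16 * (K3 + 1)) * (K3 + 1) = eps / 16 by field; lra.
  lra.
have H1 := hK1 th (xpart z1) xb P1 P1 ltac:(rewrite /Lm /P1; lra) ltac:(rewrite /Lm /P1; lra).
have H2 := hK2 th (xpart z2) xb P2 P2 ltac:(rewrite /Lm /P2; lra) ltac:(rewrite /Lm /P2; lra).
have mq : xpart ((-1) *^ q) = (-1) *^ xpart q by [].
have gq : vnorm ((P1 +^ P2) -^ DPsi xb) <= Lm + vnorm (DPsi xb) + 1.
  apply: Rle_trans (vnorm_sub_le _ _) _; apply: Rle_trans (Rplus_le_compat_r _ _ _ (vnorm_tri _ _)) _.
  have P0 : vnorm P1 <= L1 by []. have P0' : vnorm P2 <= L2 by [].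
  rewrite /Lm; lra.
have H3 := hK3 th (xpart z3) xb ((-1) *^ xpart q) ((P1 +^ P2) -^ DPsi xb) ltac:(rewrite vnorm_scal Rabs_Ropp Rabs_R1; have := vnorm_ge0 (DPsi xb); rewrite /Lm; lra) gq.
have q3 : (-1) *^ xpart q -^ ((P1 +^ P2) -^ DPsi xb) = (-1) *^ R' by rewrite qR; vring.
rewrite q3 (vnorm_scal (-1)) Rabs_Ropp Rabs_R1 Rmult_1_l in H3.
rewrite !vnorm_subxx Rplus_0_r in H1 H2.
have H4 := hchi (tpart k) ltac:(lra).
have H5 := hlop (cols th xb) (cols th (xpart z3)) (D2Psi (xpart k)) (cols_norm th xb) _ (hhess (xpart k) ltac:(lra)).
have H5' : Rabs (lop (cols th (xpart z3)) (D2Psi (xpart k)) - lop (cols th xb) (D2Psi xb)) <= eps / 8.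
  apply: H5 => i; apply: Rle_lt_trans (cols_lip th _ _ i) _.
  apply: Rlt_trans (Rmult_lt_compat_l C _ _ HC hx3) _.
  have q' : C * (d1 / C) = d1 by field; lra.
  by rewrite -q'; apply: Rmult_lt_compat_l.
rewrite trAX_lop; move: Hth; rewrite mq.
have -> : tpart ((-1) *^ q) = - tpart q by rewrite /tpart /vscal; ring.
rewrite tq.
have x1 : K1 * vnorm (xpart z1 -^ xb) <= K1 * e' by apply: Rmult_le_compat_l; lra.
have x2 : K2 * vnorm (xpart z2 -^ xb) <= K2 * e' by apply: Rmult_le_compat_l; lra.
have x3 : K3 * (vnorm (xpart z3 -^ xb) + vnorm R') <= K3 * (e' + 2 * mn) by apply: Rmult_le_compat_l; lra.
have x4 : Rabs (2 * e' * (tpart k - tbar)) <= 2 * e'.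
  rewrite Rabs_mult Rabs_pos_eq; last lra.
  by have := Rmult_le_compat_l (2 * e') (Rabs (tpart k - tbar)) 1 ltac:(lra) ltac:(lra); lra.
have mn0 : 0 <= mn by lra.
have E5 : K1 * e' + K2 * e' + K3 * (e' + 2 * mn) <= 3 * (eps / 16) by lra.
rewrite AE in D6.
move: H1 H2 H3 H4 H5' x4; rewrite -/P1 -/P2; move: (G1 _ _ _) (G1 _ _ _) (G2 _ _ _) (G2 _ _ _) (G3 _ _ _) (G3 _ _ _) (lop _ _) (lop _ _) (chi1 _) (chi1 _) (2 * e' * (tpart k - tbar)).
move=> g1 g1' g2 g2' g3 g3' l1 l2 ch1 ch2 ee.
split_Rabs; lra.
Qed.
End ParabolicDoubling.

(** * Comparison *)

Section Periodic.
Variable N : nat.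
Implicit Types (x y : pt N) (t s : R).

Lemma cell_repr x : exists k : 'I_N -> Z, forall i, 0 <= x i + IZR (k i) <= 1.
Proof.
exists (fun i => (1 - up (x i))%Z) => i; have := archimed (x i); rewrite minus_IZR; lra.
Qed.

Lemma cell_norm x : (forall i, 0 <= x i <= 1) -> vnorm x <= INR N.
Proof.
move=> H; rewrite -[INR N]Rmult_1_r; apply: vnorm_coord_bound => i.
by have h := H i; rewrite Rabs_pos_eq; lra.
Qed.

Lemma periodic_repr x : exists y, [/\ forall i, 0 <= y i <= 1, vnorm y <= INR N &
  forall T (f : pt N -> T), periodic f -> f y = f x].
Proof.
have [k Hk] := cell_repr x; exists (fun i => x i + IZR (k i)).
by split=> //; exact: cell_norm.
Qed.

(** Freezing time outside [[a, b]] yields functions bounded on the whole space-time, as the doubling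
    lemma asks, without changing the equation inside. *)
Definition clampt a b t := Rmax a (Rmin b t).

Lemma clampt_in a b t : a <= b -> a <= clampt a b t <= b.
Proof.
by rewrite /clampt => h; rewrite /Rmax /Rmin; case: (Rle_dec b t) => ?; case: (Rle_dec a _) => ?; lra.
Qed.
Lemma clampt_id a b t : a <= t <= b -> clampt a b t = t.
Proof.
by rewrite /clampt => h; rewrite /Rmax /Rmin; case: (Rle_dec b t) => ?; case: (Rle_dec a _) => ?; lra.
Qed.
Lemma clampt_lip a b t s : Rabs (clampt a b s - clampt a b t) <= Rabs (s - t).
Proof.
rewrite /clampt /Rmax /Rmin; case: (Rle_dec b t) => ?; case: (Rle_dec b s) => ?;
  case: (Rle_dec a t) => ?; case: (Rle_dec a s) => ?; case: (Rle_dec a b) => ?; by split_Rabs; lra.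
Qed.

Lemma rcont2_clampt (f : pt N -> R -> R) a b : rcont2 f -> rcont2 (fun x t => f x (clampt a b t)).
Proof.
move=> cf x t e e0; have [d [d0 H]] := cf x (clampt a b t) e e0; exists d; split=> // y s hy hs.
by have := clampt_lip a b t s => h; apply: (H y (clampt a b s)) => //; lra.
Qed.

Lemma periodic_max (f : pt N -> R) : rcont f -> periodic f -> exists x, forall y, f y <= f x.
Proof.
move=> cf pf; have [x [_ H]] := extreme_value_ball (@vzero N) (pos_INR N) cf.
exists x => y; have [y' [_ h1 h2]] := periodic_repr y; rewrite -(h2 _ f pf); apply: H.
by rewrite (_ : y' -^ @vzero N = y') //; vring.
Qed.

Lemma periodic2_max (f : pt N -> R -> R) a b : a <= b -> rcont2 f -> (forall t, periodic (f^~ t)) ->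
  exists x t, a <= t <= b /\ forall y s, a <= s <= b -> f y s <= f x t.
Proof.
move=> ab cf pf; have N0 := pos_INR N.
have r0 : 0 <= INR N + (Rabs a + Rabs b) by have := Rabs_pos a; have := Rabs_pos b; lra.
have [z [_ H]] := extreme_value_ball (@vzero N.+1) r0 (rcont2_rcont (rcont2_clampt a b cf)).
exists (xpart z), (clampt a b (tpart z)); split; first exact: clampt_in.
move=> y s hs; have [y' [_ h1 h2]] := periodic_repr y; rewrite -(h2 _ _ (pf s)).
have := H (mk s y'); rewrite xpart_mk /tpart mk_t clampt_id //; apply.
rewrite (_ : mk s y' -^ @vzero N.+1 = mk s y'); last by vring.
by apply: Rle_trans (mk_norm _ _) _; move: hs; split_Rabs; lra.
Qed.

Lemma rcont2_opp (f : pt N -> R -> R) : rcont2 f -> rcont2 (fun x t => - f x t).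
Proof.
move=> cf x t e e0; have [d [d0 H]] := cf x t e e0; exists d; split=> // y s hy hs.
by have := H y s hy hs; split_Rabs; lra.
Qed.

Lemma periodic2_bounded (f : pt N -> R -> R) a b : a <= b -> rcont2 f -> (forall t, periodic (f^~ t)) ->
  exists M, forall x t, a <= t <= b -> Rabs (f x t) <= M.
Proof.
move=> ab cf pf; have [x1 [t1 [h1 H1]]] := periodic2_max ab cf pf.
have [|x2 [t2 [h2 H2]]] := periodic2_max ab (rcont2_opp cf).
  by move=> t x k; rewrite (pf t).
exists (Rabs (f x1 t1) + Rabs (f x2 t2)) => x t ht.
by have := H1 x t ht; have := H2 x t ht; split_Rabs; lra.
Qed.

Lemma rcont2_affine (f : pt N -> R -> R) a h c : rcont2 f -> rcont2 (fun x t => a * f x (t + h) + c * t).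
Proof.
move=> cf x t e e0; have a0 := Rabs_pos a; have c0 := Rabs_pos c.
have e1 : 0 < e / (2 * (Rabs a + 1)) by apply: Rdiv_lt_0_compat; lra.
have e2 : 0 < e / (2 * (Rabs c + 1)) by apply: Rdiv_lt_0_compat; lra.
have [d [d0 H]] := cf x (t + h) _ e1.
exists (Rmin d (e / (2 * (Rabs c + 1)))); split; first exact: Rmin_pos.
have m1 := Rmin_l d (e / (2 * (Rabs c + 1))); have m2 := Rmin_r d (e / (2 * (Rabs c + 1))).
move=> y s hy hs; have := H y (s + h) ltac:(lra); rewrite (_ : s + h - (t + h) = s - t); last by ring.
move=> /(_ ltac:(lra)) h1.
have -> : a * f y (s + h) + c * s - (a * f x (t + h) + c * t) = a * (f y (s + h) - f x (t + h)) + c * (s - t) by ring.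
apply: Rle_lt_trans (Rabs_triang _ _) _; rewrite !Rabs_mult.
have q1 : Rabs a * Rabs (f y (s + h) - f x (t + h)) <= Rabs a * (e / (2 * (Rabs a + 1))) by apply: Rmult_le_compat_l; lra.
have q2 : Rabs c * Rabs (s - t) <= Rabs c * (e / (2 * (Rabs c + 1))) by apply: Rmult_le_compat_l; lra.
have q3 : e / (2 * (Rabs a + 1)) * (Rabs a + 1) = e / 2 by field; lra.
have q4 : e / (2 * (Rabs c + 1)) * (Rabs c + 1) = e / 2 by field; lra.
by lra.
Qed.

Lemma rcont_stationary (f : pt N -> R) : rcont f -> rcont2 (fun x _ => f x).
Proof. by move=> cf x t e e0; have [d [d0 H]] := cf x e e0; exists d; split=> // y s hy _; exact: H. Qed.

Lemma C21_affine phi phit Dphi D2phi a h c : @C21 N phi phit Dphi D2phi ->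
  C21 (fun x t => a * phi x (t + h) + c * t) (fun x t => a * phit x (t + h) + c)
    (fun x t => a *^ Dphi x (t + h)) (fun x t => mscal a (D2phi x (t + h))).
Proof.
move=> [p1 [p2 [p3 [p4 [p5 [p6 p7]]]]]].
have z f : rcont2 f -> rcont2 (fun (x : pt N) t => a * f x (t + h)).
  move=> cf x t e e0; have [d [d0 H]] := @rcont2_affine f a h 0 cf x t e e0; exists d; split=> // y s hy hs.
  by have := H y s hy hs; rewrite !Rmult_0_l !Rplus_0_r.
split; [|split; [|split; [|split; [|split; [|split]]]]].
- move=> x t; have q : derivable_pt_lim (fun s => s + h) t 1.
    by rewrite -[1]Rplus_0_r; apply: derivable_pt_lim_plus; [exact: derivable_pt_lim_id | exact: derivable_pt_lim_const].
  have q1 := derivable_pt_lim_scal _ a _ _ (derivable_pt_lim_comp (fun s => s + h) (phi x) t _ _ q (p1 x (t + h))).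
  have q2 := derivable_pt_lim_plus _ _ _ _ _ q1 (derivable_pt_lim_scal _ c _ _ (derivable_pt_lim_id t)).
  by move: q2; rewrite !Rmult_1_r.
- move=> x t; apply: has_grad_ext (has_grad_add (has_grad_scal a (p2 x (t + h))) (has_grad_const (c * t) x)) => // i.
  by rewrite /vadd /vscal /vzero; ring.
- by move=> x t i; apply: has_grad_ext (has_grad_scal a (p3 x (t + h) i)).
- exact: rcont2_affine.
- move=> x t e e0; have [d [d0 H]] := z _ p5 x t e e0; exists d; split=> // y s hy hs.
  by have := H y s hy hs; rewrite (_ : _ - _ = a * phit y (s + h) + c - (a * phit x (t + h) + c)) //; ring.
- by move=> i; exact: z (fun x t => Dphi x t i) _.
- by move=> i j; exact: z (fun x t => D2phi x t i j) _.
Qed.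

Lemma C21_slice phi phit Dphi D2phi t : @C21 N phi phit Dphi D2phi ->
  C2 (phi^~ t) (Dphi^~ t) (D2phi^~ t).
Proof.
move=> [_ [p2 [p3 [_ [_ [_ p7]]]]]]; split; [|split] => // i j x e e0.
have [d [d0 H]] := p7 i j x t e e0; exists d; split=> // y hy; apply: H => //.
by rewrite Rminus_diag Rabs_R0.
Qed.
End Periodic.

Lemma derivable_local_min f t l r : derivable_pt_lim f t l -> 0 < r ->
  (forall s, Rabs (s - t) < r -> f t <= f s) -> l = 0.
Proof.
move=> D r0 H.
have E : derive_pt f t (exist _ l D) = 0.
  apply: (deriv_minimum f (t - r) (t + r)); try lra.
  by move=> s h1 h2; apply: H; split_Rabs; lra.
by rewrite -E; symmetry; apply/derive_pt_eq.
Qed.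

Lemma locmax_zero_qf m (phi : pt m -> R) Dphi D2phi x v : C2 phi Dphi D2phi -> locmax (fun _ => 0) phi x ->
  0 <= qf (D2phi x) v.
Proof.
move=> Cp [r [r0 H]]; have v0 := vnorm_ge0 v; apply: Rnot_lt_le => neg.
have dv := dot_ge0 v.
pose e := - qf (D2phi x) v / (4 * (dot v v + 1)).
have e0 : 0 < e by apply: Rdiv_lt_0_compat; lra.
have [r1 [r10 H1]] := C2_second_order x Cp e0.
pose s := Rmin r r1 / (2 * (vnorm v + 1)).
have m0 : 0 < Rmin r r1 by exact: Rmin_pos.
have s0 : 0 < s by apply: Rdiv_lt_0_compat; lra.
have sv : vnorm (s *^ v) < Rmin r r1.
  rewrite vnorm_scal Rabs_pos_eq; last by lra.
  have q : s * (2 * (vnorm v + 1)) = Rmin r r1 by rewrite /s; field; lra.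
  by nra.
have l1 := Rmin_l r r1; have l2 := Rmin_r r r1.
have svN : vnorm ((- s) *^ v) = vnorm (s *^ v) by rewrite !vnorm_scal Rabs_Ropp.
have h1 := H1 (s *^ v) ltac:(lra). have h2 := H1 ((- s) *^ v) ltac:(lra).
have h3 := H (x +^ s *^ v); have h4 := H (x +^ (- s) *^ v).
rewrite (_ : x +^ s *^ v -^ x = s *^ v) in h3; last by vring.
rewrite (_ : x +^ (- s) *^ v -^ x = (- s) *^ v) in h4; last by vring.
have {}h3 := h3 ltac:(lra). have {}h4 := h4 ltac:(lra).
move: h1 h2; rewrite !qf_scalv !dot_scalr !dot_scall => h1 h2.
have q : e * (4 * (dot v v + 1)) = - qf (D2phi x) v by rewrite /e; field; lra.
have ss : 0 < s * s by nra.
have q1 : - s * - s * qf (D2phi x) v = s * s * qf (D2phi x) v by ring.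
have : s * s * qf (D2phi x) v >= - (2 * e) * (s * s * dot v v) by move: h1 h2; split_Rabs; lra.
by nra.
Qed.

(** * Transformations of sub- and supersolutions *)

Section Calculus.
Variables (N : nat) (Theta : Type) (C : R) (sigma : Theta -> pt N -> mat N).
Hypothesis HC : 0 < C.
Hypothesis Hsig_bd : forall th x, mnorm (sigma th x) <= C.
Hypothesis Hsig_lip : forall th x y, mnorm (msub (sigma th x) (sigma th y)) <= C * vnorm (vsub x y).
Implicit Types (x y p : pt N) (t s : R) (G : Theta -> pt N -> pt N -> R).

Lemma trAX_mscal th x a X : trAX sigma th x (mscal a X) = a * trAX sigma th x X.
Proof. by rewrite !trAX_lop lop_mscal. Qed.

Lemma par_sub_local G ta tb ta' tb' f f' : ta <= ta' -> tb' <= tb ->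
  (forall x t, ta' < t < tb' -> f' x t = f x t) -> par_sub sigma G ta tb f -> par_sub sigma G ta' tb' f'.
Proof.
move=> h1 h2 E S phi phit Dphi D2phi Cp x0 t0 ht [r [r0 H]]; apply: (S _ _ _ _ Cp); first lra.
exists (Rmin r (Rmin (t0 - ta') (tb' - t0))); split; first by apply: Rmin_pos => //; apply: Rmin_pos; lra.
move=> y s; have := Rmin_l r (Rmin (t0 - ta') (tb' - t0)); have := Rmin_r r (Rmin (t0 - ta') (tb' - t0)).
have := Rmin_l (t0 - ta') (tb' - t0); have := Rmin_r (t0 - ta') (tb' - t0) => a1 a2 a3 a4 b1 b2.
have := H y s ltac:(lra) ltac:(lra); rewrite !E //; move: b2; split_Rabs; lra.
Qed.

Lemma par_super_local G ta tb ta' tb' f f' : ta <= ta' -> tb' <= tb ->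
  (forall x t, ta' < t < tb' -> f' x t = f x t) -> par_super sigma G ta tb f -> par_super sigma G ta' tb' f'.
Proof.
move=> h1 h2 E S phi phit Dphi D2phi Cp x0 t0 ht [r [r0 H]]; apply: (S _ _ _ _ Cp); first lra.
exists (Rmin r (Rmin (t0 - ta') (tb' - t0))); split; first by apply: Rmin_pos => //; apply: Rmin_pos; lra.
move=> y s; have := Rmin_l r (Rmin (t0 - ta') (tb' - t0)); have := Rmin_r r (Rmin (t0 - ta') (tb' - t0)).
have := Rmin_l (t0 - ta') (tb' - t0); have := Rmin_r (t0 - ta') (tb' - t0) => a1 a2 a3 a4 b1 b2.
have := H y s ltac:(lra) ltac:(lra); rewrite !E //; move: b2; split_Rabs; lra.
Qed.

Lemma par_sub_affine G G' ta tb f a h c : 0 < a -> (forall th x p, G' th x p = a * G th x (/ a *^ p) - c) ->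
  par_sub sigma G ta tb f -> par_sub sigma G' (ta - h) (tb - h) (fun x t => a * f x (t + h) + c * t).
Proof.
move=> a0 EG S phi phit Dphi D2phi Cp x0 t0 ht [r [r0 H]] th.
have ia0 : 0 < / a by exact: Rinv_0_lt_compat.
have := S _ _ _ _ (C21_affine (/ a) (- h) (- (c / a)) Cp) x0 (t0 + h) ltac:(lra).
have E : t0 + h + - h = t0 by ring.
rewrite E => K; lapply (fun q => K q th); last first.
  exists r; split=> // y s hy hs; have := H y (s - h) hy.
  rewrite (_ : s - h - t0 = s - (t0 + h)); last by ring.
  move=> /(_ hs); rewrite (_ : s - h + h = s); last by ring.
  rewrite (_ : s + - h = s - h) // => h1.
  apply: (Rmult_le_reg_l a) => //.
  have -> : a * (f y s - (/ a * phi y (s - h) + - (c / a) * s)) = a * f y s + c * s - phi y (s - h) by field; lra.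
  have -> : a * (f x0 (t0 + h) - (/ a * phi x0 t0 + - (c / a) * (t0 + h))) = a * f x0 (t0 + h) + c * (t0 + h) - phi x0 t0 by field; lra.
  lra.
rewrite trAX_mscal EG => h1.
have := Rmult_le_compat_l _ _ _ (Rlt_le _ _ a0) h1.
have -> : a * (/ a * trAX sigma th x0 (D2phi x0 t0)) = trAX sigma th x0 (D2phi x0 t0) by field; lra.
have -> : a * (/ a * phit x0 t0 + - (c / a) + G th x0 (/ a *^ Dphi x0 t0)) = phit x0 t0 + (a * G th x0 (/ a *^ Dphi x0 t0) - c) by field; lra.
by [].
Qed.

Lemma par_super_affine G G' ta tb f h c : (forall th x p, G' th x p = G th x p - c) ->
  par_super sigma G ta tb f -> par_super sigma G' (ta - h) (tb - h) (fun x t => f x (t + h) + c * t).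
Proof.
move=> EG S phi phit Dphi D2phi Cp x0 t0 ht [r [r0 H]] e e0.
have := S _ _ _ _ (C21_affine 1 (- h) (- c) Cp) x0 (t0 + h) ltac:(lra).
have E : t0 + h + - h = t0 by ring.
rewrite E => /(_ _ e e0) [].
  exists r; split=> // y s hy hs; have := H y (s - h) hy.
  rewrite (_ : s - h - t0 = s - (t0 + h)); last by ring.
  move=> /(_ hs); rewrite (_ : s - h + h = s); last by ring.
  rewrite (_ : s + - h = s - h) //; lra.
move=> th; rewrite trAX_mscal (_ : 1 *^ Dphi x0 t0 = Dphi x0 t0); last by vring.
by move=> h1; exists th; rewrite EG; lra.
Qed.

Definition stat_sub G (v : pt N -> R) := forall phi Dphi D2phi, C2 phi Dphi D2phi -> forall x0, locmax v phi x0 ->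
  forall th, G th x0 (Dphi x0) <= trAX sigma th x0 (D2phi x0).
Definition stat_super G (v : pt N -> R) := forall phi Dphi D2phi, C2 phi Dphi D2phi -> forall x0, locmax phi v x0 ->
  forall e, 0 < e -> exists th, trAX sigma th x0 (D2phi x0) <= G th x0 (Dphi x0) + e.

(** The zero function fills the second subsolution slot of the doubling lemma when a single
    subsolution is at hand. *)
Lemma stat_sub_zero : stat_sub (fun _ _ _ => 0) (fun _ => 0).
Proof.
move=> phi Dphi D2phi Cp x0 lm th; rewrite trAX_lop; apply: rsum_ge0 => k.
exact: locmax_zero_qf Cp lm.
Qed.

Lemma stat_par_sub G v ta tb : stat_sub G v -> par_sub sigma G ta tb (fun x _ => v x).
Proof.
move=> S phi phit Dphi D2phi Cp x0 t0 ht [r [r0 H]] th.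
have x00 : vnorm (x0 -^ x0) < r by rewrite vnorm_subxx.
have -> : phit x0 t0 = 0.
  apply: (derivable_local_min (proj1 Cp x0 t0) r0) => s hs.
  by have := H x0 s x00 hs; lra.
rewrite Rplus_0_l; apply: (S _ _ _ (C21_slice t0 Cp)); exists r; split=> // y hy.
by apply: H => //; rewrite Rminus_diag Rabs_R0.
Qed.

Lemma stat_par_super G v ta tb : stat_super G v -> par_super sigma G ta tb (fun x _ => v x).
Proof.
move=> S phi phit Dphi D2phi Cp x0 t0 ht [r [r0 H]] e e0.
have x00 : vnorm (x0 -^ x0) < r by rewrite vnorm_subxx.
have q : - phit x0 t0 = 0.
  apply: (derivable_local_min (derivable_pt_lim_opp _ _ _ (proj1 Cp x0 t0)) r0) => s hs.
  by have := H x0 s x00 hs; rewrite /opp_fct; lra.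
have [|th Hth] := S _ _ _ (C21_slice t0 Cp) x0 _ e e0.
  exists r; split=> // y hy.
  by apply: (H y t0) => //; rewrite Rminus_diag Rabs_R0.
by exists th; lra.
Qed.

(** The global bounds required by [parabolic_doubling] come from periodicity in space and [clampt]
    in time. *)
Lemma par_doubling G1 G2 G3 f1 f2 g L1 L2 L3 ta tb Psi DPsi D2Psi chi chi1 chi2 xb tbar eps :
  loclip G1 -> loclip G2 -> loclip G3 -> rcont2 f1 -> rcont2 f2 -> rcont2 g ->
  (forall t, periodic (f1^~ t)) -> (forall t, periodic (f2^~ t)) -> (forall t, periodic (g^~ t)) ->
  0 <= L1 -> 0 <= L2 -> 0 <= L3 ->
  (forall x y t, Rabs (f1 x t - f1 y t) <= L1 * vnorm (x -^ y)) ->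
  (forall x y t, Rabs (f2 x t - f2 y t) <= L2 * vnorm (x -^ y)) ->
  (forall x y t, Rabs (g x t - g y t) <= L3 * vnorm (x -^ y)) ->
  par_sub sigma G1 ta tb f1 -> par_sub sigma G2 ta tb f2 -> par_super sigma G3 ta tb g ->
  C2 Psi DPsi D2Psi -> (forall t, derivable_pt_lim chi t (chi1 t)) ->
  (forall t, derivable_pt_lim chi1 t (chi2 t)) -> (forall t, continuity_pt chi2 t) ->
  ta < tbar < tb ->
  (exists r, 0 < r /\ forall y s, vnorm (y -^ xb) < r -> Rabs (s - tbar) < r ->
    f1 y s + f2 y s - g y s - Psi y - chi s <= f1 xb tbar + f2 xb tbar - g xb tbar - Psi xb - chi tbar) ->
  0 < eps ->
  exists th p1 p2, [/\ vnorm p1 <= L1, vnorm p2 <= L2, vnorm ((p1 +^ p2) -^ DPsi xb) <= L3 + eps &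
   chi1 tbar + G1 th xb p1 + G2 th xb p2 - G3 th xb ((p1 +^ p2) -^ DPsi xb) <= trAX sigma th xb (D2Psi xb) + eps].
Proof.
move=> lG1 lG2 lG3 cf1 cf2 cg pf1 pf2 pg L10 L20 L30 lf1 lf2 lg s1 s2 s3 CP c1 c2 c3 ht [r [r0 lm]] e0.
have tab : ta <= tb by lra.
have [M1 b1] := periodic2_bounded tab cf1 pf1.
have [M2 b2] := periodic2_bounded tab cf2 pf2.
have [M3 b3] := periodic2_bounded tab cg pg.
pose cl := clampt ta tb.
have clE t : ta < t < tb -> cl t = t by move=> h; apply: clampt_id; lra.
have clin t := clampt_in t tab.
pose M := Rabs M1 + Rabs M2 + Rabs M3.
have B1 x t : Rabs (f1 x (cl t)) <= M by have := b1 x _ (clin t); rewrite /M /cl; split_Rabs; lra.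
have B2 x t : Rabs (f2 x (cl t)) <= M by have := b2 x _ (clin t); rewrite /M /cl; split_Rabs; lra.
have B3 x t : Rabs (g x (cl t)) <= M by have := b3 x _ (clin t); rewrite /M /cl; split_Rabs; lra.
have ht' := ht.
have := parabolic_doubling (sigma := sigma) HC Hsig_bd Hsig_lip lG1 lG2 lG3 (rcont2_clampt ta tb cf1) (rcont2_clampt ta tb cf2) (rcont2_clampt ta tb cg)
  B1 B2 B3 L10 L20 L30 (fun x y t => lf1 x y (cl t)) (fun x y t => lf2 x y (cl t)) (fun x y t => lg x y (cl t)) _ _ _ CP c1 c2 c3 ht _ e0.
apply.
- by apply: (par_sub_local (Rle_refl _) (Rle_refl _) _ s1) => x t h; rewrite -/(cl t) clE.
- by apply: (par_sub_local (Rle_refl _) (Rle_refl _) _ s2) => x t h; rewrite -/(cl t) clE.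
- by apply: (par_super_local (Rle_refl _) (Rle_refl _) _ s3) => x t h; rewrite -/(cl t) clE.
exists (Rmin r (Rmin (tbar - ta) (tb - tbar))); split; first by apply: Rmin_pos => //; apply: Rmin_pos; lra.
move=> y s; have := Rmin_l r (Rmin (tbar - ta) (tb - tbar)); have := Rmin_r r (Rmin (tbar - ta) (tb - tbar)).
have := Rmin_l (tbar - ta) (tb - tbar); have := Rmin_r (tbar - ta) (tb - tbar) => a1 a2 a3 a4 h1 h2.
have h3 : ta < s < tb by move: h2; split_Rabs; lra.
by rewrite -/(cl s) -/(cl tbar) !clE //; apply: lm; lra.
Qed.
End Calculus.

(** A barrier smooth on the whole line, as test functions must be. For large [k] the exponential is
    moderate up to [t1] and large at [t1 + 1], which replaces a barrier blowing up at a final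
    time. *)
Lemma exp_barrier nu a k t1 : let chi t := nu * t + a * exp (k * (t - t1)) in
  let chi1 t := nu + a * k * exp (k * (t - t1)) in let chi2 t := a * k * k * exp (k * (t - t1)) in
  [/\ forall t, derivable_pt_lim chi t (chi1 t), forall t, derivable_pt_lim chi1 t (chi2 t) & forall t, continuity_pt chi2 t].
Proof.
have D b c t : derivable_pt_lim (fun t => c * t + b * exp (k * (t - t1))) t (c + b * k * exp (k * (t - t1))).
  by apply/is_derive_Reals; auto_derive; [| rewrite /Rminus; ring].
split=> t.
- exact: D.
- apply/is_derive_Reals; auto_derive; [done | rewrite /Rminus; ring].
- apply: derivable_continuous_pt; exists (0 + a * k * k * k * exp (k * (t - t1))).
  apply/is_derive_Reals; auto_derive; [done | rewrite /Rminus; ring].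
Qed.

Section Comparison.
Variables (N : nat) (Theta : Type) (C : R) (sigma : Theta -> pt N -> mat N).
Hypothesis HC : 0 < C.
Hypothesis Hsig_bd : forall th x, mnorm (sigma th x) <= C.
Hypothesis Hsig_lip : forall th x y, mnorm (msub (sigma th x) (sigma th y)) <= C * vnorm (vsub x y).
Implicit Types (x y p : pt N) (t s : R) (G : Theta -> pt N -> pt N -> R).

Lemma rcont2_sub (f g : pt N -> R -> R) : rcont2 f -> rcont2 g -> rcont2 (fun x t => f x t - g x t).
Proof.
move=> cf cg x t e e0; have [d [d0 H]] := cf x t (e / 2) ltac:(lra); have [d' [d0' H']] := cg x t (e / 2) ltac:(lra).
exists (Rmin d d'); split; first exact: Rmin_pos.
move=> y s hy hs; have := Rmin_l d d'; have := Rmin_r d d' => a b.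
have := H y s ltac:(lra) ltac:(lra); have := H' y s ltac:(lra) ltac:(lra).
by split_Rabs; lra.
Qed.

Lemma rcont2_time chi : (forall t, continuity_pt chi t) -> rcont2 (fun (_ : pt N) t => chi t).
Proof.
move=> cc x t e e0; have [d [d0 H]] := cc t e e0; exists d; split=> // y s _ hs.
case: (Req_dec s t) => [->|ne]; first by rewrite Rminus_diag Rabs_R0.
by apply: H; split; [split=> //; exact: not_eq_sym | exact: hs].
Qed.

Lemma C2_const c : C2 (fun _ : pt N => c) (fun _ => @vzero N) (fun _ _ _ => 0).
Proof.
split; [|split] => *; [exact: has_grad_const | exact: (has_grad_const 0) | exact: (@rcont_const N 0)].
Qed.

Lemma trAX_zero th x : trAX sigma th x (fun _ _ => 0) = 0.
Proof.
rewrite /trAX -[RHS](@rsum_0 N); apply: rsum_ext => i; rewrite -[RHS](@rsum_0 N); apply: rsum_ext => j; ring.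
Qed.

Lemma loclip_zero : loclip (fun (_ : Theta) (_ _ : pt N) => 0).
Proof. by move=> R0 _; exists 0; split=> [|*]; [lra | rewrite Rminus_diag Rabs_R0; lra]. Qed.

Lemma comparison G w1 w2 L1 L2 M : loclip G -> rcont2 w1 -> rcont2 w2 ->
  (forall t, periodic (w1^~ t)) -> (forall t, periodic (w2^~ t)) -> 0 <= L1 -> 0 <= L2 ->
  (forall x y t, Rabs (w1 x t - w1 y t) <= L1 * vnorm (x -^ y)) ->
  (forall x y t, Rabs (w2 x t - w2 y t) <= L2 * vnorm (x -^ y)) ->
  (forall T, par_sub sigma G 0 T w1) -> (forall T, par_super sigma G 0 T w2) ->
  (forall x, w1 x 0 <= w2 x 0 + M) -> forall x t, 0 <= t -> w1 x t <= w2 x t + M.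
Proof.
move=> lG c1 c2 q1 q2 L10 L20 l1 l2 s1 s2 init x1 t1 t10; apply: Rnot_lt_le => bad.
pose d := w1 x1 t1 - w2 x1 t1 - M; have d0 : 0 < d by rewrite /d; lra.
have {}t10 : 0 < t1 by case: t10 => // e; move: bad (init x1); rewrite -e; lra.
have T0 : 0 <= t1 + 1 by lra.
have [M1 b1] := periodic2_bounded T0 c1 q1.
have [M2 b2] := periodic2_bounded T0 c2 q2.
(* Makes [d / 4 * exp k] exceed the bounds on the functions, so that no maximum lies at the
   artificial final time [t1 + 1]. *)
pose k := 4 * (Rabs M1 + Rabs M2 + Rabs M) / d.
have k0 : 0 <= k by rewrite /k; apply: Rmult_le_pos; [split_Rabs; lra | left; exact: Rinv_0_lt_compat].
have kd : d / 4 * k = Rabs M1 + Rabs M2 + Rabs M by rewrite /k; field; lra.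
pose nu := d / (4 * t1); have nu0 : 0 < nu by apply: Rdiv_lt_0_compat; lra.
have nut : nu * t1 = d / 4 by rewrite /nu; field; lra.
pose chi t := nu * t + d / 4 * exp (k * (t - t1)).
pose chi1 t := nu + d / 4 * k * exp (k * (t - t1)).
have [e1 e2 e3] := exp_barrier nu (d / 4) k t1.
rewrite -/chi -/chi1 in e1 e2.
have cchi t : continuity_pt chi t by apply: derivable_continuous_pt; exists (chi1 t); exact: e1.
have [|xh [th [hth Hm]]] := periodic2_max T0 (rcont2_sub (rcont2_sub c1 c2) (rcont2_time cchi)).
  by move=> t x kk; rewrite (q1 t) (q2 t).
have h1 := Hm x1 t1 ltac:(lra).
have chit1 : chi t1 = d / 2 by rewrite /chi nut Rminus_diag Rmult_0_r exp_0; lra.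
have th0 : 0 < th.
  case: (proj1 hth) => // e; move: h1; rewrite -e chit1; have := init xh.
  by have := exp_pos (k * (0 - t1)); rewrite /chi /d; nra.
have th1 : th < t1 + 1.
  case: (proj2 hth) => // e; move: h1; rewrite e chit1; have := b1 xh (t1 + 1) ltac:(lra); have := b2 xh (t1 + 1) ltac:(lra).
  have := exp_ineq1_le k; rewrite /chi (_ : k * (t1 + 1 - t1) = k); last by ring.
  rewrite (_ : nu * (t1 + 1) = d / 4 + nu); last by rewrite -nut; ring.
  move=> a1 a2 a3; have : d / 4 * (1 + k) <= d / 4 * exp k by apply: Rmult_le_compat_l; lra.
  rewrite /d in kd d0 *; move: a2 a3 kd d0; split_Rabs; lra.
have nu2 : 0 < nu / 2 by lra.
have l0 : forall x y (t : R), Rabs ((fun (_ : pt N) (_ : R) => 0) x t - (fun _ _ => 0) y t) <= 0 * vnorm (x -^ y).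
  by move=> x y t; rewrite Rminus_diag Rabs_R0; lra.
have lmx : exists r, 0 < r /\ forall y s, vnorm (y -^ xh) < r -> Rabs (s - th) < r ->
    w1 y s + 0 - w2 y s - 0 - chi s <= w1 xh th + 0 - w2 xh th - 0 - chi th.
  exists (Rmin th (t1 + 1 - th)); split; first by apply: Rmin_pos; lra.
  move=> y s _ hs; have := Rmin_l th (t1 + 1 - th); have := Rmin_r th (t1 + 1 - th) => a1 a2.
  by have := Hm y s ltac:(move: hs; split_Rabs; lra); lra.
have p0 : forall t : R, periodic ((fun (_ : pt N) (_ : R) => 0)^~ t) by [].
(* With a constant test function in space, both Hamiltonians are taken at the same gradient and
   index and cancel; [chi1 >= nu] is left against the error [nu / 2]. *)
have [ath [p1 [p2 [n1 n2 n3 HH]]]] := par_doubling HC Hsig_bd Hsig_lip lG loclip_zero lG c1 (rcont_stationary (@rcont_const N 0)) c2 q1 p0 q2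
  L10 (Rle_refl 0) L20 l1 l0 l2 (s1 (t1 + 1)) (stat_par_sub (@stat_sub_zero N Theta sigma)) (s2 (t1 + 1)) (C2_const 0) e1 e2 e3 (conj th0 th1) lmx nu2.
have p20 : p2 = @vzero N by apply: vnorm_eq0; have := vnorm_ge0 p2; lra.
move: HH; rewrite p20 trAX_zero (_ : p1 +^ @vzero N -^ @vzero N = p1); last by vring.
have : 0 <= d / 4 * k * exp (k * (th - t1)) by apply: Rmult_le_pos; [nra | left; exact: exp_pos].
by rewrite /chi1; lra.
Qed.
End Comparison.

(** * Contraction, boundedness and time modulus of solutions *)

Section Evolution.
Variables (N : nat) (Theta : Type) (C : R) (sigma : Theta -> pt N -> mat N) (G : Theta -> pt N -> pt N -> R).
Implicit Types (x y p : pt N) (t s : R).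

(** [G] is meant to contain [- c]. Regularity is asked at all real times but the equation only at
    positive ones, which suits a solution frozen at negative times. *)
Record evolution (u : pt N -> R -> R) : Prop := Evolution {
  evo_C : 0 < C;
  evo_bd : forall th x, mnorm (sigma th x) <= C;
  evo_slip : forall th x y, mnorm (msub (sigma th x) (sigma th y)) <= C * vnorm (x -^ y);
  evo_sper : forall th, periodic (sigma th);
  evo_G : loclip G;
  evo_cont : rcont2 u;
  evo_per : forall t, periodic (u^~ t);
  evo_lip : forall x y t, Rabs (u x t - u y t) <= C * vnorm (x -^ y);
  evo_sub : forall T, par_sub sigma G 0 T u;
  evo_super : forall T, par_super sigma G 0 T u }.

Record stationary (v : pt N -> R) (L : R) : Prop := Stationary {
  sta_cont : rcont v;
  sta_per : periodic v;
  sta_L : 0 <= L;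
  sta_lip : forall x y, Rabs (v x - v y) <= L * vnorm (x -^ y);
  sta_sub : stat_sub sigma G v;
  sta_super : stat_super sigma G v }.

Lemma rcont2_shift (f : pt N -> R -> R) h : rcont2 f -> rcont2 (fun x t => f x (t + h)).
Proof.
move=> cf; have := rcont2_affine 1 h 0 cf; congr rcont2.
by apply: functional_extensionality => x; apply: functional_extensionality => t; ring.
Qed.

Lemma par_sub_shift h T (f : pt N -> R -> R) : 0 <= h -> (forall T, par_sub sigma G 0 T f) ->
  par_sub sigma G 0 T (fun x t => f x (t + h)).
Proof.
move=> h0 S; have := par_sub_affine (G' := G) (h := h) (c := 0) Rlt_0_1 _ (S (T + h)).
move=> /(_ _)/par_sub_local; apply; try lra.
by move=> th x p; rewrite (_ : / 1 *^ p = p); [ring | vfield].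
Qed.

Lemma par_super_shift h T (f : pt N -> R -> R) : 0 <= h -> (forall T, par_super sigma G 0 T f) ->
  par_super sigma G 0 T (fun x t => f x (t + h)).
Proof.
move=> h0 S; have := par_super_affine (G' := G) (h := h) (c := 0) _ (S (T + h)).
move=> /(_ _)/par_super_local; apply; lra.
Qed.

Lemma evolution_shift u h : 0 <= h -> evolution u -> evolution (fun x t => u x (t + h)).
Proof.
move=> h0 [HC bd sl sp lG cu pu lu su Su]; split=> //.
- exact: rcont2_shift.
- by move=> T; exact: par_sub_shift.
- by move=> T; exact: par_super_shift.
Qed.

Lemma evolution_contraction u w M : evolution u -> evolution w -> (forall x, Rabs (u x 0 - w x 0) <= M) ->
  forall x t, 0 <= t -> Rabs (u x t - w x t) <= M.
Proof.
have cmp f g : evolution f -> evolution g -> (forall x, f x 0 <= g x 0 + M) ->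
    forall x t, 0 <= t -> f x t <= g x t + M.
  move=> [HC bd sl _ lG cu pu lu su _] [_ _ _ _ _ cw pw lw _ sw].
  exact: (comparison HC bd sl lG cu cw pu pw (Rlt_le _ _ HC) (Rlt_le _ _ HC)).
move=> Eu Ew H x t t0.
have := cmp _ _ Eu Ew _ x t t0; have := cmp _ _ Ew Eu _ x t t0.
move=> /(_ _) h1 /(_ _) h2; apply: Rabs_le.
have := h1 (fun x => ltac:(have := H x; split_Rabs; lra)); have := h2 (fun x => ltac:(have := H x; split_Rabs; lra)); lra.
Qed.

Lemma evolution_stationary_contraction u v L M : evolution u -> stationary v L -> (forall x, Rabs (u x 0 - v x) <= M) ->
  forall x t, 0 <= t -> Rabs (u x t - v x) <= M.
Proof.
move=> [HC bd sl _ lG cu pu lu su Su] [cv pv L0 lv sv Sv] H x t t0.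
have cv2 := rcont_stationary cv.
have h1 := comparison HC bd sl lG cu cv2 pu (fun _ => pv) (Rlt_le _ _ HC) L0 lu (fun x y _ => lv x y) su (fun T => stat_par_super Sv)
  (fun x => ltac:(have := H x; split_Rabs; lra)) x t0 (M := M).
have h2 := comparison HC bd sl lG cv2 cu (fun _ => pv) pu L0 (Rlt_le _ _ HC) (fun x y _ => lv x y) lu (fun T => stat_par_sub sv) Su
  (fun x => ltac:(have := H x; split_Rabs; lra)) x t0 (M := M).
by apply: Rabs_le; lra.
Qed.

(** A time shift of a solution is a solution, so by contraction the modulus of continuity at
    [t = 0], where compactness applies, is valid at all later times. *)
Lemma evolution_modulus u e : evolution u -> 0 < e -> exists d, 0 < d /\
  forall x t h, 0 <= t -> 0 <= h <= d -> Rabs (u x (t + h) - u x t) <= e.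
Proof.
move=> Eu e0; have [d [d0 Hd]] := heine (rcont2_rcont (evo_cont Eu)) (INR N) e0.
exists (d / 2); split; first lra.
move=> x t h t0 hh; have h0 : 0 <= h by lra.
apply: (evolution_contraction (evolution_shift h0 Eu) Eu) => // {}x; rewrite Rplus_0_l; left.
have [y [_ ny Hy]] := periodic_repr x.
rewrite -(Hy _ _ (evo_per Eu h)) -(Hy _ _ (evo_per Eu 0)).
have := Hd (mk 0 y) (mk h y); rewrite !xpart_mk /tpart !mk_t; apply.
  by apply: Rle_trans (mk_norm _ _) _; rewrite Rabs_R0; lra.
rewrite mk_sub; apply: Rle_lt_trans (mk_norm _ _) _; rewrite vnorm_subxx Rabs_pos_eq; lra.
Qed.

Lemma stationary_bounded v L : stationary v L -> exists B, forall x, Rabs (v x) <= B.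
Proof.
move=> [cv pv _ _ _ _]; have [B [B0 HB]] := rcont_bounded cv (INR N).
by exists B => x; have [y [_ ny Hy]] := periodic_repr x; rewrite -(Hy _ _ pv); exact: HB.
Qed.

(** At a minimum of [v], the supersolution property tested with a constant produces an index. *)
Lemma stationary_inhabited v L : stationary v L -> exists th : Theta, True.
Proof.
move=> [cv pv _ _ _ sv].
have [|x Hx] := @periodic_max N (fun x => - v x) _ (fun x k => f_equal Ropp (pv x k)).
  by apply: rcont_ext (rcont_scal (-1) cv) => x; ring.
have [|th _] := sv _ _ _ (@C2_const N 0) x _ 1 Rlt_0_1; last by exists th.
by exists 1; split; [lra | move=> y _; have := Hx y; lra].
Qed.

Lemma evolution_bounded u v L : evolution u -> stationary v L -> exists B, 0 <= B /\ forall x t, 0 <= t -> Rabs (u x t) <= B.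
Proof.
move=> Eu Sv; have [B HB] := stationary_bounded Sv.
have [M HM] := periodic2_bounded (Rle_refl 0) (evo_cont Eu) (evo_per Eu).
have B0 : 0 <= B by have := HB (@vzero N); have := Rabs_pos (v (@vzero N)); lra.
have M0 : 0 <= M by have := HM (@vzero N) 0 ltac:(lra); have := Rabs_pos (u (@vzero N) 0); lra.
exists (M + B + B); split=> [|x t t0]; first lra.
have := evolution_stationary_contraction Eu Sv (M := M + B) _ x t0; move=> /(_ _) h.
have := h (fun x => ltac:(have := HM x 0 ltac:(lra); have := HB x; split_Rabs; lra)).
by have := HB x; split_Rabs; lra.
Qed.
End Evolution.

(** * Relaxed upper limit of the increments *)

(** The value at [h = 0] prevents the limit from being [-oo]. The limit is used only through the two
    properties stated, one for all late times and one for some. *)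
Lemma limsup_exists (F : R -> R -> R) B : (forall t h, 0 <= t -> 0 <= h -> F t h <= B) ->
  (forall t, 0 <= t -> - B <= F t 0) -> exists l,
  (forall e, 0 < e -> exists T, 0 <= T /\ forall t h, T <= t -> 0 <= h -> F t h <= l + e) /\
  (forall e T, 0 < e -> exists t h, [/\ T <= t, 0 <= t, 0 <= h & l - e <= F t h]).
Proof.
move=> ub lb; pose E a := forall T, exists t h, [/\ T <= t, 0 <= t, 0 <= h & a <= F t h].
have bE : bound E.
  by exists B => a Ea; have [t [h [_ t0 h0 le]]] := Ea 0; have := ub t h t0 h0; lra.
have nE : exists a, E a.
  exists (- B) => T; exists (Rmax 0 T), 0; have := Rmax_l 0 T; have := Rmax_r 0 T => a b.
  by split; try lra; apply: lb.
have [l [l1 l2]] := completeness E bE nE; exists l; split.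
- move=> e e0; apply: Classical_Prop.NNPP => nb.
  have : E (l + e).
    move=> T; apply: Classical_Prop.NNPP => n; apply: nb; exists (Rmax 0 T); split; first exact: Rmax_l.
    move=> t h ht h0; have := Rmax_l 0 T; have := Rmax_r 0 T => a b.
    by apply: Rnot_lt_le => lt; apply: n; exists t, h; split; lra.
  by move=> /l1; lra.
- move=> e T e0; apply: Classical_Prop.NNPP => nb.
  have : l <= l - e; last by lra.
  apply: l2 => a Ea; apply: Rnot_lt_le => lt; apply: nb.
  by have [t [h [h1 h2 h3 h4]]] := Ea T; exists t, h; split; lra.
Qed.

Lemma loclip_scale N Theta (G : Theta -> pt N -> pt N -> R) a : 0 < a -> loclip G ->
  loclip (fun th x p => a * G th x (/ a *^ p)).
Proof.
move=> a0 lG R0 R00; have ia : 0 < / a by exact: Rinv_0_lt_compat.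
have [K [K0 HK]] := lG (/ a * R0) ltac:(nra).
exists ((a + 1) * K); split=> [|th x y p q hp hq]; first by nra.
have nb (z : pt N) : vnorm z <= R0 -> vnorm (/ a *^ z) <= / a * R0.
  by move=> h; rewrite vnorm_scal Rabs_pos_eq; nra.
have := HK th x y _ _ (nb p hp) (nb q hq).
rewrite (_ : / a *^ p -^ / a *^ q = / a *^ (p -^ q)); last by vring.
rewrite vnorm_scal (Rabs_pos_eq (/ a)); last lra.
have -> : a * G th x (/ a *^ p) - a * G th y (/ a *^ q) = a * (G th x (/ a *^ p) - G th y (/ a *^ q)) by ring.
rewrite Rabs_mult (Rabs_pos_eq a); last lra.
move=> h; have h1 := Rmult_le_compat_l _ _ _ (Rlt_le _ _ a0) h.
have q1 : a * (K * (vnorm (x -^ y) + / a * vnorm (p -^ q))) = K * (a * vnorm (x -^ y) + vnorm (p -^ q)) by field; lra.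
have n1 := vnorm_ge0 (x -^ y); have n2 := vnorm_ge0 (p -^ q).
have q2 : K * (a * vnorm (x -^ y) + vnorm (p -^ q)) <= K * ((a + 1) * (vnorm (x -^ y) + vnorm (p -^ q))).
  by apply: Rmult_le_compat_l => //; nra.
lra.
Qed.

Section RelaxedLimsup.
Variables (N : nat) (Theta : Type) (C : R) (sigma : Theta -> pt N -> mat N) (G G2 : Theta -> pt N -> pt N -> R).
Variables (u : pt N -> R -> R) (v0 : pt N -> R) (L2 lam eta : R).
Hypothesis Eu : evolution C sigma G u.
Hypotheses (cv0 : rcont v0) (pv0 : periodic v0) (L20 : 0 <= L2).
Hypothesis lv0 : forall x y, Rabs (v0 x - v0 y) <= L2 * vnorm (x -^ y).
Hypotheses (lG2 : loclip G2) (sv0 : stat_sub sigma G2 v0).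
Hypotheses (lam01 : 0 < lam < 1) (eta0 : 0 < eta).
Hypothesis Hconv : forall th x p1 p2, vnorm p2 <= (1 - lam) * L2 ->
  G th x (p1 +^ p2) <= lam * G th x (/ lam *^ p1) + (1 - lam) * G2 th x (/ (1 - lam) *^ p2).

Definition gap x t h := lam * u x (t + h) + (1 - lam) * v0 x - u x t - eta * h.

Variable Fb : pt N -> R.
Hypothesis HF1 : forall x e, 0 < e -> exists T, 0 <= T /\ forall t h, T <= t -> 0 <= h -> gap x t h <= Fb x + e.
Hypothesis HF2 : forall x e T, 0 < e -> exists t h, [/\ T <= t, 0 <= t, 0 <= h & Fb x - e <= gap x t h].

Let LF := lam * C + (1 - lam) * L2 + C.

Lemma LF_pos : 0 < LF.
Proof. by have HC := evo_C Eu; rewrite /LF; nra. Qed.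

Lemma gap_lip x y t h : gap x t h <= gap y t h + LF * vnorm (x -^ y).
Proof.
have := evo_lip Eu x y (t + h); have := evo_lip Eu x y t; have := lv0 x y; rewrite /gap /LF.
have n0 := vnorm_ge0 (x -^ y); have HC := evo_C Eu => h1 h2 h3.
have a1 : lam * (u x (t + h) - u y (t + h)) <= lam * (C * vnorm (x -^ y)).
  by apply: Rmult_le_compat_l; first lra; move: h3; split_Rabs; lra.
have a2 : (1 - lam) * (v0 x - v0 y) <= (1 - lam) * (L2 * vnorm (x -^ y)).
  by apply: Rmult_le_compat_l; first lra; move: h1; split_Rabs; lra.
by move: h2; split_Rabs; lra.
Qed.

Lemma Fb_le x y a : (forall t h, gap x t h <= gap y t h + a) -> Fb x <= Fb y + a.
Proof.
move=> H; apply: eps_le => e e0.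
have [T [T0 HT]] := HF1 y (e := e / 2) ltac:(lra).
have [t [h [ht t0 h0 le]]] := HF2 x (e := e / 2) T ltac:(lra).
by have := HT t h ht h0; have := H t h; lra.
Qed.

Lemma Fb_lip x y : Rabs (Fb x - Fb y) <= LF * vnorm (x -^ y).
Proof.
have := Fb_le (fun t h => gap_lip x y t h); have := Fb_le (fun t h => gap_lip y x t h).
by rewrite (vnorm_subC y x); split_Rabs; lra.
Qed.

Lemma Fb_cont : rcont Fb.
Proof. exact: rcont_lip Fb_lip. Qed.

Lemma Fb_per : periodic Fb.
Proof.
move=> x k.
have e t h : gap (fun i => x i + IZR (k i)) t h = gap x t h.
  by rewrite /gap (evo_per Eu (t + h)) (evo_per Eu t) pv0.
apply: Rle_antisym; rewrite -[X in _ <= X]Rplus_0_r; apply: Fb_le => t h; rewrite e; lra.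
Qed.

(** The gaps are equi-Lipschitz and periodic in space: a sequence of bad points would have a limit
    at which [HF1] is contradicted. *)
Lemma Fb_unif e : 0 < e -> exists T, 0 <= T /\ forall x t h, T <= t -> 0 <= h -> gap x t h <= Fb x + e.
Proof.
move=> e0; apply: Classical_Prop.NNPP => nb.
have H n : exists y, vnorm y <= INR N /\ exists t h, [/\ INR n <= t, 0 <= h & Fb y + e < gap y t h].
  apply: Classical_Prop.NNPP => nn; apply: nb; exists (INR n); split; first exact: pos_INR.
  move=> x t h ht h0; apply: Rnot_lt_le => lt; apply: nn.
  have [y [_ ny Hy]] := periodic_repr x; exists y; split=> //; exists t, h; split=> //.
  by rewrite (Hy _ _ Fb_per) (_ : gap y t h = gap x t h) // /gap (Hy _ _ (evo_per Eu (t + h))) (Hy _ _ (evo_per Eu t)) (Hy _ _ pv0).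
have [y Y] := fun_choice H.
have [y0 ly] := vlim_ex (W_all (fun n => proj1 (Y n))).
have lf := LF_pos.
have [T [T0 HT]] := HF1 y0 (e := e / 4) ltac:(lra).
have d0 : 0 < e / (4 * LF) by apply: Rdiv_lt_0_compat; lra.
have [k [k0 Hk]] := archimed_cor1 (/ (T + 1)) ltac:(apply: Rinv_0_lt_compat; lra).
have [n [hn1 hn2]] := W_ex (W_and (ly _ d0) (W_ge k)).
have [_ [t [h [ht h0 lt]]]] := Y n.
have kT : T <= INR n.
  have kp : 0 < INR k by exact: lt_0_INR.
  have : T + 1 < INR k by apply: Rinv_lt_cancel => //; lra.
  by have := le_INR _ _ hn2; lra.
have := HT t h ltac:(lra) h0; have := gap_lip (y n) y0 t h; have := Fb_lip (y n) y0.
have q : LF * vnorm (y n -^ y0) < e / 4.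
  have q' : e / (4 * LF) * LF = e / 4 by field; lra.
  by rewrite -q'; nra.
by split_Rabs; lra.
Qed.

Variable kap : R.
Hypothesis kap0 : 0 <= kap.
Hypothesis Hkap : forall th x p q, vnorm p <= 2 * C -> vnorm q <= 2 * C -> Rabs (G th x p - G th x q) <= kap * vnorm (p -^ q).

(** The near maximum is taken with [h0] frozen, so the time derivatives of the two copies of [u]
    cancel. [Hconv] merges the two subsolution terms into [G] at [p1 + p2], which is compared with
    [G] at [p1 + p2 - D], where [D] is close to the test gradient; the difference is at most
    [kap |D|]. The bound [C / 2] on the test gradient keeps both arguments in the ball of radius
    [2 C]. *)
Lemma linearized_subsolution Psi DPsi D2Psi xb e : C2 Psi DPsi D2Psi -> locmax Fb Psi xb ->
  vnorm (DPsi xb) <= C / 2 -> 0 < e ->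
  exists th, - trAX sigma th xb (D2Psi xb) - kap * vnorm (DPsi xb) <= e.
Proof.
move=> CP [r [r0 lm]] hD e0.
have [HC bd sl _ lG cu pu lu su Su] := Eu.
have CC : 0 < C * C by nra.
have [d1 [d10 hlop]] := lop_close N (D2Psi xb) (Rlt_le _ _ HC) (e := e / 8) ltac:(lra).
pose gm := Rmin (C / 16) (e / (16 * (kap + 1))).
have gm0 : 0 < gm by apply: Rmin_pos; [lra | apply: Rdiv_lt_0_compat; lra].
have gm1 : gm <= C / 16 := Rmin_l _ _.
have gm2 : gm * (kap + 1) <= e / 16.
  have h : gm * (kap + 1) <= e / (16 * (kap + 1)) * (kap + 1) by apply: Rmult_le_compat_r; [lra | exact: Rmin_r].
  have q : e / (16 * (kap + 1)) * (kap + 1) = e / 16 by field; lra.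
  lra.
have [d2 [d20 hgrad]] := C2_grad_close xb CP gm0.
have [d3 [d30 hhess]] := C2_hess_close xb CP d10.
pose b := Rmin 1 (e / (16 * (C * C))).
have b0 : 0 < b by apply: Rmin_pos; [lra | apply: Rdiv_lt_0_compat; lra].
have b1 : b <= 1 := Rmin_l _ _.
have b2 : b * (C * C) <= e / 16.
  have h : b * (C * C) <= e / (16 * (C * C)) * (C * C) by apply: Rmult_le_compat_r; [lra | exact: Rmin_r].
  have q : e / (16 * (C * C)) * (C * C) = e / 16 by field; lra.
  lra.
have [rho [rho0 [h1 [h2 [h3 [h4 [h5 [h6 h7]]]]]]]] : exists rho, 0 < rho /\ rho < r /\ rho < d2 /\ rho < d3 /\ rho < d1 / C /\ rho < 1 /\ rho < gm / 2 /\ rho < e / 16.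
  have dC : 0 < d1 / C by exact: Rdiv_lt_0_compat.
  have [n Hn] := W_ex (W_and (W_inv r0) (W_and (W_inv d20) (W_and (W_inv d30) (W_and (W_inv dC) (W_and (W_inv Rlt_0_1) (W_and (@W_inv (gm / 2) ltac:(lra)) (@W_inv (e / 16) ltac:(lra)))))))).
  by exists (/ INR n.+1); split; [exact: invS_gt0 | intuition lra].
have br : 0 < b * (rho * rho) by apply: Rmult_lt_0_compat; nra.
pose e1 := b * (rho * rho) / 4; have e10 : 0 < e1 by rewrite /e1; lra.
have [T [T0 HT]] := Fb_unif e10.
(* Times beyond [T + 1] leave a neighbourhood in which the uniform upper bound holds. *)
have [t0 [h0 [ht0 t00 h00 near]]] := HF2 xb (T + 1) e10.
pose f1 x t := lam * u x (t + h0) + 0 * t.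
pose f2 x t := (1 - lam) * v0 x + 0 * t.
have cf1 : rcont2 f1 by exact: rcont2_affine.
have cf2 : rcont2 f2 := rcont2_affine (1 - lam) 0 0 (rcont_stationary cv0).
pose F z := gap (xpart z) (tpart z) h0 - Psi (xpart z).
have cF : rcont F.
  apply: rcont_ext (rcont_sub (rcont_sub (rcont_add (rcont2_rcont cf1) (rcont2_rcont cf2)) (rcont2_rcont cu))
    (rcont_add (rcont2_rcont (rcont_stationary (C2_rcont CP))) (rcont_const (eta * h0)))) => z.
  by rewrite /F /gap /f1 /f2; ring.
pose z0 := mk t0 xb.
have xz0 : xpart z0 = xb by exact: xpart_mk.
have tz0 : tpart z0 = t0 by exact: mk_t.
have xd z : vnorm (xpart z -^ xb) <= vnorm (z -^ z0) by have := xpart_norm (z -^ z0); rewrite (_ : xpart (z -^ z0) = xpart z -^ xb) // -xz0.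
have td z : Rabs (tpart z - t0) <= vnorm (z -^ z0) by have := tpart_norm (z -^ z0); rewrite (_ : tpart (z -^ z0) = tpart z - t0) // -tz0.
have HM z : vnorm (z -^ z0) <= rho -> F z <= Fb xb - Psi xb + e1.
  move=> hz; have := xd z; have := td z => a1 a2.
  have := HT (xpart z) (tpart z) h0 ltac:(move: a1; split_Rabs; lra) h00.
  by have := lm (xpart z) ltac:(lra); rewrite /F; lra.
have [zh [k1 k2 k3]] := penalized_max (e := 2 * e1) cF rho0 b0 HM ltac:(rewrite /F xz0 tz0; lra) ltac:(rewrite /e1; lra).
have hx := xd zh. have htt := td zh.
set xh := xpart zh in hx; set th := tpart zh in htt.
pose Pb x := Psi x + b * dot (x -^ xb) (x -^ xb).
have CPb := C2_add CP (C2_sqdist b xb).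
pose chi t := eta * h0 + b * ((t - t0) * (t - t0)).
have c1 t : derivable_pt_lim chi t (2 * b * (t - t0)) by apply/is_derive_Reals; rewrite /chi; auto_derive => //; ring.
have c2 t : derivable_pt_lim (fun t => 2 * b * (t - t0)) t (2 * b) by apply/is_derive_Reals; auto_derive => //; ring.
have c3 t : continuity_pt (fun _ => 2 * b) t by apply: continuity_pt_const.
have ps1 : par_sub sigma (fun th x p => lam * G th x (/ lam *^ p)) 0 (t0 + 2) f1.
  apply: (par_sub_local _ _ _ (par_sub_affine (h := h0) (c := 0) (proj1 lam01) _ (su (t0 + 2 + h0)))); try lra.
  by [].
have ps2 : par_sub sigma (fun th x p => (1 - lam) * G2 th x (/ (1 - lam) *^ p)) 0 (t0 + 2) f2.
  have l1 : 0 < 1 - lam by lra.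
  apply: (par_sub_local _ _ _ (par_sub_affine (h := 0) (c := 0) l1 _ (stat_par_sub (ta := 0) (tb := t0 + 2) sv0))); try lra.
  by [].
have pf1 t : periodic (f1^~ t) by move=> x k; rewrite /f1 (pu (t + h0)).
have pf2 t : periodic (f2^~ t) by move=> x k; rewrite /f2 pv0.
have lf1 x y t : Rabs (f1 x t - f1 y t) <= lam * C * vnorm (x -^ y).
  rewrite /f1 (_ : _ - _ = lam * (u x (t + h0) - u y (t + h0))); last by ring.
  by rewrite Rabs_mult Rabs_pos_eq ?Rmult_assoc; [apply: Rmult_le_compat_l; [lra | exact: lu] | lra].
have lf2 x y t : Rabs (f2 x t - f2 y t) <= (1 - lam) * L2 * vnorm (x -^ y).
  rewrite /f2 (_ : _ - _ = (1 - lam) * (v0 x - v0 y)); last by ring.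
  by rewrite Rabs_mult Rabs_pos_eq ?Rmult_assoc; [apply: Rmult_le_compat_l; [lra | exact: lv0] | lra].
have htb : 0 < th < t0 + 2 by move: htt; split_Rabs; lra.
have lmx : exists r, 0 < r /\ forall y s, vnorm (y -^ xh) < r -> Rabs (s - th) < r ->
    f1 y s + f2 y s - u y s - Pb y - chi s <= f1 xh th + f2 xh th - u xh th - Pb xh - chi th.
  exists ((rho - vnorm (zh -^ z0)) / 2); split; first lra.
  move=> y s hy hs.
  have inb : vnorm (mk s y -^ z0) <= rho.
    have := vdist_tri zh (mk s y) z0; have := mk_norm (s - th) (y -^ xh).
    rewrite (_ : mk s y -^ zh = mk (s - th) (y -^ xh)); last by rewrite -mk_sub mk_parts.
    lra.
  have := k3 (mk s y) inb; rewrite /F xpart_mk /tpart mk_t -/(tpart zh) -/xh -/th /z0 mk_sub.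
  rewrite (_ : zh -^ mk t0 xb = mk (th - t0) (xh -^ xb)); last by rewrite -mk_sub mk_parts.
  rewrite !dot_mk !xpart_mk /tpart !mk_t /gap /f1 /f2 /Pb /chi; lra.
have [ath [p1 [p2 [n1 n2 n3 HH]]]] := par_doubling HC bd sl (loclip_scale (proj1 lam01) lG) (loclip_scale (a := 1 - lam) ltac:(lra) lG2) lG
  cf1 cf2 cu pf1 pf2 pu (L1 := lam * C) (L2 := (1 - lam) * L2) ltac:(nra) ltac:(nra) (Rlt_le _ _ HC) lf1 lf2 lu ps1 ps2 (Su (t0 + 2)) CPb c1 c2 c3 htb lmx gm0.
have hc := Hconv ath xh p1 n2.
move: HH n3; set D := DPsi xh +^ _ => HH n3.
have dD : vnorm (D -^ DPsi xb) <= 2 * gm.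
  rewrite (_ : D -^ DPsi xb = (DPsi xh -^ DPsi xb) +^ (2 * b) *^ (xh -^ xb)); last by rewrite /D; vring.
  apply: Rle_trans (vnorm_tri _ _) _; rewrite vnorm_scal Rabs_pos_eq; last by lra.
  have := hgrad xh ltac:(lra).
  by have := Rmult_le_compat_r _ (2 * b) 2 (vnorm_ge0 (xh -^ xb)) ltac:(lra); lra.
have nD : vnorm D <= vnorm (DPsi xb) + 2 * gm by have := vnorm_le_dist D (DPsi xb); lra.
have np : vnorm (p1 +^ p2) <= 2 * C.
  rewrite (_ : p1 +^ p2 = (p1 +^ p2 -^ D) +^ D); last by vring.
  by apply: Rle_trans (vnorm_tri _ _) _; lra.
have := Hkap ath xh np (q := p1 +^ p2 -^ D) ltac:(lra).
rewrite (_ : p1 +^ p2 -^ (p1 +^ p2 -^ D) = D); last by vring.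
move=> hk; exists ath.
have tE : trAX sigma ath xh (madd (D2Psi xh) (mscal (2 * b) (@mid N))) <= trAX sigma ath xb (D2Psi xb) + e / 8 + 2 * (e / 16).
  rewrite !trAX_lop lop_madd lop_mscal lop_id.
  have cl k : vnorm (cols sigma ath xh k -^ cols sigma ath xb k) < d1.
    apply: Rle_lt_trans (cols_lip HC sl ath xh xb k) _.
    have q : C * (d1 / C) = d1 by field; lra.
    by rewrite -q; apply: Rmult_lt_compat_l; lra.
  have := hlop _ _ (D2Psi xh) (cols_norm HC bd ath xb) cl (hhess xh ltac:(lra)).
  have t2 := cols_trsq bd ath xh; have t3 : b * trsq (cols sigma ath xh) <= b * (C * C) by apply: Rmult_le_compat_l; lra.
  by split_Rabs; lra.
have kD : kap * vnorm D <= kap * vnorm (DPsi xb) + 2 * (kap * gm) by have := Rmult_le_compat_l _ _ _ kap0 nD; lra.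
have hchi : - (e / 8) <= 2 * b * (th - t0).
  have : Rabs (2 * b * (th - t0)) <= e / 8; last by split_Rabs; lra.
  rewrite Rabs_mult Rabs_pos_eq; last lra.
  by have := Rmult_le_compat_r _ (2 * b) 2 (Rabs_pos (th - t0)) ltac:(lra); lra.
have gme : gm <= e / 16 by have := Rmult_le_pos _ _ kap0 (Rlt_le _ _ gm0); lra.
by move: hk HH tE; split_Rabs; lra.
Qed.
End RelaxedLimsup.

(** * The degenerate set and the location of the maximum *)

Section DegenerateSet.
Variables (N : nat) (Theta : Type) (C : R) (sigma : Theta -> pt N -> mat N).
Hypothesis HC : 0 < C.
Hypothesis Hsig_lip : forall th x y, mnorm (msub (sigma th x) (sigma th y)) <= C * vnorm (vsub x y).
Hypothesis Hsig_per : forall th, periodic (sigma th).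
Implicit Types x y : pt N.

(** The diagonal entries of [A] are sums of squares, so [A = 0] forces [sigma = 0]. *)
Lemma Sigma_cols x : Sigma sigma x <-> forall th k, cols sigma th x k = @vzero N.
Proof.
split=> H th.
- move=> k; apply: functional_extensionality => i; rewrite /cols /vzero.
  have := H th i i; rewrite /Amat => h.
  have := rsum_ge1 (f := fun k => sigma th x i k * sigma th x i k) k (fun k => Rle_0_sqr _); rewrite h; nra.
- move=> i j; rewrite /Amat -[RHS](@rsum_0 N); apply: rsum_ext => k.
  by have := congr1 (fun v => v i) (H th k); rewrite /cols /vzero => ->; ring.
Qed.

Lemma Sigma_shift x (k : 'I_N -> Z) : Sigma sigma x -> Sigma sigma (fun i => x i + IZR (k i)).
Proof. by move=> H th i j; have := H th i j; rewrite /Amat Hsig_per. Qed.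

Lemma Sigma_vlim (y : nat -> pt N) l : vlim y l -> (forall n, Sigma sigma (y n)) -> Sigma sigma l.
Proof.
move=> ly Hy; apply/Sigma_cols => th k; apply: vnorm_eq0; apply: Rle_antisym; last exact: vnorm_ge0.
apply: eps_le => e e0; rewrite Rplus_0_l.
have [n hn] := W_ex (ly (e / C) ltac:(apply: Rdiv_lt_0_compat; lra)).
have := cols_lip HC Hsig_lip th (y n) l k; rewrite (proj1 (Sigma_cols _) (Hy n) th k).
rewrite vnorm_subC (_ : _ -^ @vzero N = cols sigma th l k); last by vring.
have q : e / C * C = e by field; lra.
by nra.
Qed.

(** [psi] is not periodic; its sign, nonpositive in [Om] and nonnegative outside, together with the
    unit cell lying in [Om], makes up for this. A maximum point of [Fb - e psi] in [Om] is near
    [Sigma], by the strict inequality satisfied by [psi]; the Lipschitz bound moves its value to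
    [Sigma], and compactness concludes as [z] tends to zero. *)
Lemma max_on_Sigma kap LF (Fb : pt N -> R) : 0 <= LF -> rcont Fb -> periodic Fb ->
  (forall x y, Rabs (Fb x - Fb y) <= LF * vnorm (x -^ y)) ->
  (forall Psi DPsi D2Psi xb e, C2 Psi DPsi D2Psi -> locmax Fb Psi xb -> vnorm (DPsi xb) <= C / 2 -> 0 < e ->
    exists th, - trAX sigma th xb (D2Psi xb) - kap * vnorm (DPsi xb) <= e) ->
  SS sigma kap -> exists x, Sigma sigma x /\ forall y, Fb y <= Fb x.
Proof.
move=> LF0 cF pF lF LL HSS; have [xm Hm] := periodic_max cF pF.
have key z : 0 < z -> exists y, [/\ Sigma sigma y, vnorm y <= INR N & Fb xm - z <= Fb y].
  move=> z0; have d0 : 0 < z / (4 * (LF + 1)) by apply: Rdiv_lt_0_compat; lra.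
  have [psi [Dpsi [D2psi [Om [Cp [_ [[M HM] [cell [neg [pos str]]]]]]]]]] := HSS _ d0.
  pose R0 := Rmax M (INR N) + 1.
  have R1 : M < R0 by have := Rmax_l M (INR N); rewrite /R0; lra.
  have R2 : INR N < R0 by have := Rmax_r M (INR N); rewrite /R0; lra.
  have Rp : 0 <= R0 by have := pos_INR N; lra.
  have [P [P0 HP]] := rcont_bounded (C2_rcont Cp) R0.
  have [Qi HQi] := fun_choice (fun i => rcont_bounded (C2_rcontD Cp i) R0).
  pose Q := rsum Qi.
  have Q0 : 0 <= Q by apply: rsum_ge0 => i; exact: (proj1 (HQi i)).
  have HQ x : vnorm x <= R0 -> vnorm (Dpsi x) <= Q.
    by move=> hx; apply: Rle_trans (vnorm_le_sum _) _; apply: rsum_le => i; apply: (proj2 (HQi i)).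
  (* Keeps the gradient [e Dpsi] below [C / 2] and lets [e psi] change values by a fraction of [z]
     only. *)
  pose e := Rmin (C / (2 * (Q + 1))) (z / (4 * (P + 1))).
  have e0 : 0 < e by apply: Rmin_pos; apply: Rdiv_lt_0_compat; lra.
  have eQ : e * Q <= C / 2.
    have q1 : e * (Q + 1) <= C / (2 * (Q + 1)) * (Q + 1) by apply: Rmult_le_compat_r; [lra | exact: Rmin_l].
    have q2 : C / (2 * (Q + 1)) * (Q + 1) = C / 2 by field; lra.
    by lra.
  have eP : e * P <= z / 4.
    have q1 : e * (P + 1) <= z / (4 * (P + 1)) * (P + 1) by apply: Rmult_le_compat_r; [lra | exact: Rmin_r].
    have q2 : z / (4 * (P + 1)) * (P + 1) = z / 4 by field; lra.
    by lra.
  have Ce := C2_scal e Cp.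
  have v0 x : x -^ @vzero N = x by vring.
  have [xh [Oxh Hxh]] : exists xh, Om xh /\ forall y, vnorm y <= R0 -> Fb y - e * psi y <= Fb xh - e * psi xh.
    have [x1 [hx1 Hx1]] := extreme_value_ball (@vzero N) Rp (rcont_sub cF (C2_rcont Ce)).
    case: (classic (Om x1)) => O1.
      by exists x1; split=> // y hy; apply: Hx1; rewrite v0.
    (* A maximum point outside [Om] is replaced by its representative in the unit cell: [Fb] is
       unchanged and [psi] does not increase. *)
    have [x2 [c2 _ H2]] := periodic_repr x1.
    exists x2; split=> [|y hy]; first exact: cell.
    have := Hx1 y; rewrite v0 => /(_ hy); rewrite (H2 _ _ pF).
    have := pos _ O1; have := neg _ (cell _ c2); nra.
  have nxh : vnorm xh < R0 by have := HM _ Oxh; lra.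
  have lm : locmax Fb (fun x => e * psi x) xh.
    exists (R0 - vnorm xh); split; first lra.
    by move=> y hy; apply: Hxh; have := vnorm_le_dist y xh; lra.
  have near : dist_le (Sigma sigma) xh (z / (4 * (LF + 1))).
    apply: Classical_Prop.NNPP => far; have [et [et0 Het]] := str _ Oxh far.
    have nD : vnorm (e *^ Dpsi xh) = e * vnorm (Dpsi xh) by rewrite vnorm_scal Rabs_pos_eq; lra.
    have [||th] := LL _ _ _ xh (e * et / 2) Ce lm.
    - by rewrite nD; have := HQ xh ltac:(lra); nra.
    - by nra.
    rewrite nD trAX_mscal; have := Het th; nra.
  have [y [Sy dy]] := near _ d0.
  have [k Hk] := cell_repr y.
  exists (fun i => y i + IZR (k i)); split; [exact: Sigma_shift | exact: cell_norm | rewrite pF].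
  have := lF xh y; have [xm' [cxm nxm Hxm]] := periodic_repr xm.
  have := Hxh xm' ltac:(lra); rewrite (Hxm _ _ pF).
  have := HP xm' ltac:(lra); have := HP xh ltac:(lra) => b1 b2 b3 b4.
  have q1 : LF * vnorm (xh -^ y) <= LF * (2 * (z / (4 * (LF + 1)))) by apply: Rmult_le_compat_l => //; lra.
  have q2 : (LF + 1) * (2 * (z / (4 * (LF + 1)))) = z / 2 by field; lra.
  have q3 : Rabs (e * (psi xm' - psi xh)) <= e * (2 * P).
    by rewrite Rabs_mult (Rabs_pos_eq e); [apply: Rmult_le_compat_l; [lra | move: b1 b2; split_Rabs; lra] | lra].
  by move: q3 b4; split_Rabs; lra.
have [y Hy] := fun_choice (fun n => key _ (invS_gt0 n)).
have [l ly] : exists l, vlim y l by apply: (vlim_ex (M := INR N)); apply: W_all => n; case: (Hy n).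
exists l; split; first by apply: (Sigma_vlim ly) => n; case: (Hy n).
move=> x; apply: Rle_trans (Hm x) _; apply: eps_le => e e0.
have [n [h1 h2]] := W_ex (W_and (rcont_vlim cF ly (eps := e / 2) ltac:(lra)) (W_inv (eps := e / 2) ltac:(lra))).
by have [_ _ h3] := Hy n; move: h1; split_Rabs; lra.
Qed.
End DegenerateSet.

(** * First order doubling on the degenerate set *)

Lemma C21_separate N Psi DPsi D2Psi chi chi1 chi2 : @C2 N Psi DPsi D2Psi ->
  (forall t, derivable_pt_lim chi t (chi1 t)) -> (forall t, derivable_pt_lim chi1 t (chi2 t)) ->
  (forall t, continuity_pt chi2 t) ->
  C21 (fun x t => Psi x + chi t) (fun _ t => chi1 t) (fun x _ => DPsi x) (fun x _ => D2Psi x).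
Proof.
move=> CP c1 c2 c3; have := C2_C21 (C2_separate CP c1 c2 c3).
congr C21; do 2 (apply: functional_extensionality => ?); rewrite ?xpart_mk /tpart ?mk_t //.
by do 2 (apply: functional_extensionality => ?); rewrite liftK mk_l.
Qed.

Lemma quadratic_chi c k s0 : let chi t := c * t + k * ((t - s0) * (t - s0)) in let chi1 t := c + 2 * k * (t - s0) in
  [/\ forall t, derivable_pt_lim chi t (chi1 t), forall t, derivable_pt_lim chi1 t (2 * k) & forall t, continuity_pt (fun _ => 2 * k) t].
Proof.
split=> t.
- by apply/is_derive_Reals; auto_derive => //; ring.
- by apply/is_derive_Reals; auto_derive => //; ring.
- exact: continuity_pt_const.
Qed.

Section Quadratics.
Variables (N : nat) (Theta : Type) (sigma : Theta -> pt N -> mat N).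
Implicit Types (x y p : pt N) (t s : R) (G : Theta -> pt N -> pt N -> R).

Lemma trAX_mid th x b : trAX sigma th x (mscal b (@mid N)) = b * trsq (cols sigma th x).
Proof. by rewrite trAX_mscal trAX_lop lop_id. Qed.

Lemma par_sub_quadratic G ta tb f B y chi chi1 chi2 x0 t0 : par_sub sigma G ta tb f ->
  (forall t, derivable_pt_lim chi t (chi1 t)) -> (forall t, derivable_pt_lim chi1 t (chi2 t)) ->
  (forall t, continuity_pt chi2 t) -> ta < t0 < tb ->
  (exists r, 0 < r /\ forall x t, vnorm (x -^ x0) < r -> Rabs (t - t0) < r ->
    f x t - B * dot (x -^ y) (x -^ y) - chi t <= f x0 t0 - B * dot (x0 -^ y) (x0 -^ y) - chi t0) ->
  forall th, chi1 t0 + G th x0 ((2 * B) *^ (x0 -^ y)) <= 2 * B * trsq (cols sigma th x0).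
Proof.
move=> S c1 c2 c3 ht [r [r0 H]] th; rewrite -trAX_mid.
apply: (S _ _ _ _ (C21_separate (C2_sqdist B y) c1 c2 c3) x0 t0 ht).
by exists r; split=> // x t hx htt; have := H x t hx htt; lra.
Qed.

Lemma stat_sub_quadratic G f B y x0 : stat_sub sigma G f ->
  (exists r, 0 < r /\ forall x, vnorm (x -^ x0) < r ->
    f x - B * dot (x -^ y) (x -^ y) <= f x0 - B * dot (x0 -^ y) (x0 -^ y)) ->
  forall th, G th x0 ((2 * B) *^ (x0 -^ y)) <= 2 * B * trsq (cols sigma th x0).
Proof. by move=> S lm th; rewrite -trAX_mid; apply: (S _ _ _ (C2_sqdist B y)). Qed.

Lemma par_super_quadratic G ta tb f B1 B2 B3 y1 y2 y3 chi chi1 chi2 x0 t0 e : par_super sigma G ta tb f ->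
  (forall t, derivable_pt_lim chi t (chi1 t)) -> (forall t, derivable_pt_lim chi1 t (chi2 t)) ->
  (forall t, continuity_pt chi2 t) -> ta < t0 < tb ->
  let Psi x := B1 * dot (x -^ y1) (x -^ y1) + B2 * dot (x -^ y2) (x -^ y2) + B3 * dot (x -^ y3) (x -^ y3) in
  (exists r, 0 < r /\ forall x t, vnorm (x -^ x0) < r -> Rabs (t - t0) < r ->
    Psi x + chi t - f x t <= Psi x0 + chi t0 - f x0 t0) -> 0 < e ->
  exists th, 2 * (B1 + B2 + B3) * trsq (cols sigma th x0) <=
    chi1 t0 + G th x0 ((2 * B1) *^ (x0 -^ y1) +^ (2 * B2) *^ (x0 -^ y2) +^ (2 * B3) *^ (x0 -^ y3)) + e.
Proof.
move=> S c1 c2 c3 ht Psi lm e0.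
have CP := C2_add (C2_add (C2_sqdist B1 y1) (C2_sqdist B2 y2)) (C2_sqdist B3 y3).
have [th Hth] := S _ _ _ _ (C21_separate CP c1 c2 c3) x0 t0 ht lm e e0.
exists th; move: Hth; rewrite !trAX_lop !lop_madd !lop_mscal !lop_id; lra.
Qed.
End Quadratics.

(** Two of the variables are space-time points and one is a space point; compactness is applied to
    each factor, along the same ultrafilter. *)
Lemma triple_max N (A D : pt N.+1 -> R) (B Q : pt N -> R) c1 c2 c3 r : rcont A -> rcont D -> rcont B -> rcont Q -> 0 <= r ->
  let F z1 x2 z3 := A z1 + B x2 + D z3 + Q (xpart z1 -^ xpart z3) + Q (x2 -^ xpart z3) in
  exists z1 x2 z3, [/\ vnorm (z1 -^ c1) <= r, vnorm (x2 -^ c2) <= r, vnorm (z3 -^ c3) <= r &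
   forall w1 y2 w3, vnorm (w1 -^ c1) <= r -> vnorm (y2 -^ c2) <= r -> vnorm (w3 -^ c3) <= r -> F w1 y2 w3 <= F z1 x2 z3].
Proof.
move=> cA cD cB cQ r0 F.
pose R0 := vnorm c1 + vnorm c2 + vnorm c3 + r.
have n1 := vnorm_ge0 c1; have n2 := vnorm_ge0 c2; have n3 := vnorm_ge0 c3.
have bd m (z c : pt m) : vnorm (z -^ c) <= r -> vnorm c <= R0 - r -> vnorm z <= R0.
  by move=> h1 h2; have := vnorm_le_dist z c; lra.
have b1 (z : pt N.+1) : vnorm (z -^ c1) <= r -> vnorm z <= R0 by move=> h; apply: bd h _; rewrite /R0; lra.
have b2 (z : pt N) : vnorm (z -^ c2) <= r -> vnorm z <= R0 by move=> h; apply: bd h _; rewrite /R0; lra.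
have b3 (z : pt N.+1) : vnorm (z -^ c3) <= r -> vnorm z <= R0 by move=> h; apply: bd h _; rewrite /R0; lra.
have [MA [_ HA]] := rcont_bounded cA R0. have [MD [_ HD]] := rcont_bounded cD R0.
have [MB [_ HB]] := rcont_bounded cB R0. have [MQ [_ HQ]] := rcont_bounded cQ (R0 + R0).
have qb (x : pt N) (z : pt N.+1) : vnorm x <= R0 -> vnorm z <= R0 -> vnorm (x -^ xpart z) <= R0 + R0.
  by move=> h1 h2; apply: Rle_trans (vnorm_sub_le _ _) _; have := xpart_norm z; lra.
pose inb z1 x2 z3 := [/\ vnorm (z1 -^ c1) <= r, vnorm (x2 -^ c2) <= r & vnorm (z3 -^ c3) <= r].
pose E a := exists z1 x2 z3, inb z1 x2 z3 /\ a <= F z1 x2 z3.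
have bE : bound E.
  exists (MA + MB + MD + MQ + MQ) => a [z1 [x2 [z3 [[h1 h2 h3] le]]]].
  apply: Rle_trans le _; rewrite /F.
  apply: Rplus_le_compat; last by apply: Rle_trans (Rle_abs _) (HQ _ (qb _ _ (b2 _ h2) (b3 _ h3))).
  apply: Rplus_le_compat; last by apply: Rle_trans (Rle_abs _) (HQ _ (qb _ _ (Rle_trans _ _ _ (xpart_norm z1) (b1 _ h1)) (b3 _ h3))).
  apply: Rplus_le_compat; last exact: Rle_trans (Rle_abs _) (HD _ (b3 _ h3)).
  apply: Rplus_le_compat; last exact: Rle_trans (Rle_abs _) (HB _ (b2 _ h2)).
  exact: Rle_trans (Rle_abs _) (HA _ (b1 _ h1)).
have nE : exists a, E a by exists (F c1 c2 c3), c1, c2, c3; split; [split; rewrite vnorm_subxx | lra].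
have [l [l1 l2]] := completeness E bE nE.
have H n : exists w : pt N.+1 * (pt N * pt N.+1), inb w.1 w.2.1 w.2.2 /\ l - / INR n.+1 <= F w.1 w.2.1 w.2.2.
  apply: Classical_Prop.NNPP => nb; have : l <= l - / INR n.+1; last by have := invS_gt0 n; lra.
  apply: l2 => a [z1 [x2 [z3 [ib le]]]]; apply: Rnot_lt_le => lt; apply: nb.
  by exists (z1, (x2, z3)); split=> //; exact: Rle_trans (Rlt_le _ _ lt) le.
have [w Hw] := fun_choice H.
have [z1 lz1] : exists z, vlim (fun n => (w n).1) z.
  by apply: (vlim_ex (M := R0)); apply: W_all => n; have [[h1 _ _] _] := Hw n; exact: b1.
have [x2 lx2] : exists z, vlim (fun n => (w n).2.1) z.
  by apply: (vlim_ex (M := R0)); apply: W_all => n; have [[_ h1 _] _] := Hw n; exact: b2.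
have [z3 lz3] : exists z, vlim (fun n => (w n).2.2) z.
  by apply: (vlim_ex (M := R0)); apply: W_all => n; have [[_ _ h1] _] := Hw n; exact: b3.
exists z1, x2, z3; split.
- have := vlim_closed (@closed_ball_closed _ c1 r) lz1; apply; apply: W_all => n; by have [[h1 _ _] _] := Hw n.
- have := vlim_closed (@closed_ball_closed _ c2 r) lx2; apply; apply: W_all => n; by have [[_ h1 _] _] := Hw n.
- have := vlim_closed (@closed_ball_closed _ c3 r) lz3; apply; apply: W_all => n; by have [[_ _ h1] _] := Hw n.
move=> w1 y2 w3 h1 h2 h3; apply: (Rle_trans _ l); first by apply: l1; exists w1, y2, w3; split; [split | lra].
have xl z lz : vlim z lz -> vlim (fun n => xpart (z n)) (@xpart N lz).
  by move=> h e e0; apply: W_mono (h e e0) => n hn; apply: Rle_lt_trans hn; exact: (xpart_norm (z n -^ lz)).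
have dl (z z' : nat -> pt N) lz lz' : vlim z lz -> vlim z' lz' -> vlim (fun n => z n -^ z' n) (lz -^ lz').
  move=> h h' e e0; apply: W_mono (W_and (h (e / 2) ltac:(lra)) (h' (e / 2) ltac:(lra))) => n [a b].
  rewrite (_ : _ -^ (lz -^ lz') = (z n -^ lz) -^ (z' n -^ lz')); last by vring.
  by apply: Rle_lt_trans (vnorm_sub_le _ _) _; lra.
apply: eps_le => e e0; have e6 : 0 < e / 6 by lra.
have a1 := rcont_vlim cA lz1 e6. have a2 := rcont_vlim cB lx2 e6. have a3 := rcont_vlim cD lz3 e6.
have a4 := rcont_vlim cQ (dl _ _ _ _ (xl _ _ lz1) (xl _ _ lz3)) e6.
have a5 := rcont_vlim cQ (dl _ _ _ _ lx2 (xl _ _ lz3)) e6.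
have [n [k1 [k2 [k3 [k4 [k5 k6]]]]]] := W_ex (W_and a1 (W_and a2 (W_and a3 (W_and a4 (W_and a5 (W_inv e6)))))).
have [_ le] := Hw n; move: le k1 k2 k3 k4 k5; rewrite /F; split_Rabs; lra.
Qed.

Lemma sqr_le_le x y : 0 <= y -> x * x <= y * y -> x <= y.
Proof. by move=> y0 H; apply: Rnot_lt_le => lt; nra. Qed.

(** The columns of [sigma] vanish at [xs] and are Lipschitz, so the diffusion is quadratically small
    near [xs]. *)
Lemma trsq_near_Sigma N Theta C (sigma : Theta -> pt N -> mat N) th x xs :
  (forall th x y, mnorm (msub (sigma th x) (sigma th y)) <= C * vnorm (vsub x y)) -> Sigma sigma xs ->
  trsq (cols sigma th x) <= C * C * (vnorm (x -^ xs) * vnorm (x -^ xs)).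
Proof.
move=> sl Sx; have := cols_diff sl th x xs; congr Rle; apply: rsum_ext => k.
by rewrite (proj1 (Sigma_cols _ _) Sx th k) (_ : _ -^ @vzero N = cols sigma th x k) //; vring.
Qed.

Lemma Rmult_le_self x y : 0 <= x -> y <= 1 -> x * y <= x.
Proof. by move=> h1 h2; rewrite -{2}[x]Rmult_1_r; apply: Rmult_le_compat_l. Qed.

Section FirstOrder.
Variables (N : nat) (Theta : Type) (C : R) (sigma : Theta -> pt N -> mat N) (G G2 : Theta -> pt N -> pt N -> R).
Variables (u : pt N -> R -> R) (v0 : pt N -> R) (L2 lam eta : R).
Hypothesis Eu : evolution C sigma G u.
Hypotheses (cv0 : rcont v0) (L20 : 0 <= L2).
Hypothesis lv0 : forall x y, Rabs (v0 x - v0 y) <= L2 * vnorm (x -^ y).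
Hypotheses (lG2 : loclip G2) (sv0 : stat_sub sigma G2 v0).
Hypothesis lam01 : 0 < lam < 1.
Variables (xs : pt N) (Gm hs es : R).
Hypothesis Sxs : Sigma sigma xs.
Hypothesis Ha : forall e, 0 < e -> exists T, 0 <= T /\ forall x t h, T <= t -> 0 <= h -> gap u v0 lam eta x t h <= Gm + e.
Hypothesis Hb : forall e T, 0 < e -> exists t h, [/\ T <= t, 0 <= t, 0 <= h & Gm - e <= gap u v0 lam eta xs t h].
Hypotheses (hs0 : 0 < hs) (es0 : 0 < es).
Hypothesis Hh : forall t h, 0 <= t -> 0 <= h -> Gm - es <= gap u v0 lam eta xs t h -> hs <= h.
Implicit Types (x y p : pt N) (t s : R).

Let LF := lam * C + (1 - lam) * L2 + C.
(** The weights [a^-1] and [a^-2] put the doubled points at distance [O(a^2)] from one another and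
    [O(a^(3/2))] from [xs]. The diffusion there is [O(a^3)] and beats Hessians of order [a^-2]:
    quadratic test functions suffice and the trace terms disappear in the limit. *)
Let Phi a s0 t0 x1 s x2 y t := lam * u x1 s - eta * s - (s - s0) * (s - s0) + (1 - lam) * v0 x2 - u y t + eta * t
  - (t - t0) * (t - t0) - / a * dot (y -^ xs) (y -^ xs) - / (2 * (a * a)) * dot (x1 -^ y) (x1 -^ y)
  - / (2 * (a * a)) * dot (x2 -^ y) (x2 -^ y).

Lemma Phi_max a s0 t0 rho : 0 <= rho -> exists x1 s x2 y t,
  [/\ vnorm (mk s x1 -^ mk s0 xs) <= rho, vnorm (x2 -^ xs) <= rho, vnorm (mk t y -^ mk t0 xs) <= rho &
  forall x1' s' x2' y' t', vnorm (mk s' x1' -^ mk s0 xs) <= rho -> vnorm (x2' -^ xs) <= rho -> vnorm (mk t' y' -^ mk t0 xs) <= rho ->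
   Phi a s0 t0 x1' s' x2' y' t' <= Phi a s0 t0 x1 s x2 y t].
Proof.
move=> rho0; have cu := evo_cont Eu.
have cchi c k tt : forall t, continuity_pt (fun t => c * t + k * ((t - tt) * (t - tt))) t.
  by move=> t; have [c1 _ _] := quadratic_chi c k tt; apply: derivable_continuous_pt; exists (c + 2 * k * (t - tt)); exact: c1.
pose A (z : pt N.+1) := lam * u (xpart z) (tpart z + 0) + 0 * tpart z - (eta * tpart z + 1 * ((tpart z - s0) * (tpart z - s0))).
pose D (z : pt N.+1) := -1 * u (xpart z) (tpart z + 0) + 0 * tpart z - (- eta * tpart z + 1 * ((tpart z - t0) * (tpart z - t0)))
   - / a * dot (xpart z -^ xs) (xpart z -^ xs).
pose B x := (1 - lam) * v0 x.
pose Q (w : pt N) := - / (2 * (a * a)) * dot w w.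
have cA : rcont A := rcont2_rcont (rcont2_sub (rcont2_affine lam 0 0 cu) (rcont2_time (N := N) (cchi eta 1 s0))).
have cD : rcont D := rcont2_rcont (rcont2_sub (rcont2_sub (rcont2_affine (-1) 0 0 cu) (rcont2_time (N := N) (cchi (- eta) 1 t0)))
  (rcont_stationary (C2_rcont (C2_sqdist (/ a) xs)))).
have cB : rcont B := rcont_scal (1 - lam) cv0.
have cQ : rcont Q.
  apply: rcont_ext (C2_rcont (C2_sqdist (- / (2 * (a * a))) (@vzero N))) => w.
  by rewrite (_ : w -^ @vzero N = w) //; vring.
have [z1 [x2 [z3 [h1 h2 h3 Hm]]]] := triple_max (mk s0 xs) xs (mk t0 xs) cA cD cB cQ rho0.
exists (xpart z1), (tpart z1), x2, (xpart z3), (tpart z3); rewrite !mk_parts; split=> // x1' s' x2' y' t' k1 k2 k3.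
have := Hm _ _ _ k1 k2 k3.
by rewrite /A /D /B /Q /Phi !xpart_mk /tpart !mk_t !Rplus_0_r; lra.
Qed.

(** As [h] is at least [hs] near the maximum, the times [s] and [t] vary independently. The term
    [- eta s] gives the time slope [eta] to [lam u], hence [eta / lam] to [u], in the subsolution
    inequality, whereas the supersolution inequality sees [eta]. *)
Lemma first_order_doubling e : 0 < e -> exists p q,
  [/\ vnorm p <= 2 * C /\ vnorm q <= 2 * L2, forall th, eta / lam + G th xs p <= e, forall th, G2 th xs q <= e &
   exists th, - e <= eta + G th xs (lam *^ p +^ (1 - lam) *^ q)].
Proof.
move=> e0; have [HC bd sl _ lG cu pu lu su Su] := Eu.
have LF0 : 0 < LF by rewrite /LF; nra.
have CC : 0 < C * C by nra.
(* Prepared for [key]: [2 a^2] is the defect of the near maximum, and absorbing each of the two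
   Lipschitz terms costs [LF^2 a^2]. *)
pose K := 2 + 2 * (LF * LF); have K2 : 2 <= K by rewrite /K; nra.
have KK2 : 2 * K <= K * K by apply: Rmult_le_compat_r; lra.
pose R0 := 2 * C + 2 * L2 + 2 * K.
have [k1 [k10 Hk1]] := lG R0 ltac:(rewrite /R0; lra).
have [k2 [k20 Hk2]] := @lG2 R0 ltac:(rewrite /R0; lra).
pose E1 := (2 * K + 10 * K * (C * C)) / lam + 3 * K * k1.
pose E2 := 10 * K * (C * C) / (1 - lam) + 3 * K * k2.
pose E3 := 1 + 4 * (C * C) * K + 2 * K + 3 * K * k1.
have KC : 0 <= K * (C * C) by nra.
have E10 : 0 <= E1.
  have : 0 <= (2 * K + 10 * K * (C * C)) / lam by apply: Rmult_le_pos; [lra | left; apply: Rinv_0_lt_compat; lra].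
  by rewrite /E1; nra.
have E20 : 0 <= E2.
  have : 0 <= 10 * K * (C * C) / (1 - lam) by apply: Rmult_le_pos; [lra | left; apply: Rinv_0_lt_compat; lra].
  by rewrite /E2; nra.
have E30 : 0 <= E3 by rewrite /E3; nra.
(* The bound [1 / 2] keeps [t >= T], the bound [hs / 4] keeps [s >= t]. *)
pose rho := Rmin (1 / 2) (hs / 4).
have rho0 : 0 < rho by apply: Rmin_pos; lra.
have rho1 : rho <= 1 / 2 := Rmin_l _ _.
have rho2 : rho <= hs / 4 := Rmin_r _ _.
have [b [b0 [b1 [b2 [b3 b4]]]]] : exists b, 0 < b /\ b < 1 /\ b < es /\ b < rho / (4 * K) /\ b < e / (E1 + E2 + E3 + 1).
  have q1 : 0 < rho / (4 * K) by apply: Rdiv_lt_0_compat; lra.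
  have q2 : 0 < e / (E1 + E2 + E3 + 1) by apply: Rdiv_lt_0_compat; lra.
  have [n Hn] := W_ex (W_and (W_inv Rlt_0_1) (W_and (W_inv es0) (W_and (W_inv q1) (W_inv q2)))).
  by exists (/ INR n.+1); split; [exact: invS_gt0 | intuition lra].
have bE : b * (E1 + E2 + E3 + 1) < e.
  have q : e / (E1 + E2 + E3 + 1) * (E1 + E2 + E3 + 1) = e by field; lra.
  by rewrite -q; apply: Rmult_lt_compat_r; lra.
have bK : 4 * K * b < rho.
  have q : rho / (4 * K) * (4 * K) = rho by field; lra.
  by rewrite -q Rmult_comm; apply: Rmult_lt_compat_r; lra.
(* [a] is a square so that the distance [a^(3/2)] can be written [a * b]. *)
have [a aE] : exists a, a = b * b by exists (b * b).
have a0 : 0 < a by rewrite aE; nra.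
have ab : a <= b by rewrite aE; nra.
have a1 : a < 1 by lra.
have aa0 : 0 < a * a by nra.
have aab : a * a <= b by nra.
have [T [T0 HT]] := Ha aa0.
have [t0 [h0 [ht0 t00 h00 near]]] := Hb (T + 1) aa0.
have hh0 : hs <= h0 by apply: (Hh t00 h00); lra.
pose s0 := t0 + h0.
have [x1 [s [x2 [y [t [i1 i2 i3 Hm]]]]]] := Phi_max a s0 t0 (Rlt_le _ _ rho0).
rewrite !mk_sub in i1 i3.
have j1 : Rabs (s - s0) <= rho by apply: Rle_trans i1; have := tpart_norm (mk (s - s0) (x1 -^ xs)); rewrite /tpart mk_t.
have j3 : Rabs (t - t0) <= rho by apply: Rle_trans i3; have := tpart_norm (mk (t - t0) (y -^ xs)); rewrite /tpart mk_t.
have tT : T <= t by move: j3; split_Rabs; lra.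
have st : 0 <= s - t by move: j1 j3; rewrite /s0; split_Rabs; lra.
pose D1 := vnorm (x1 -^ y). pose D2 := vnorm (x2 -^ y). pose r := vnorm (y -^ xs).
have D10 : 0 <= D1 := vnorm_ge0 _. have D20 : 0 <= D2 := vnorm_ge0 _. have r0 : 0 <= r := vnorm_ge0 _.
have PhiE : Phi a s0 t0 x1 s x2 y t = lam * u x1 s + (1 - lam) * v0 x2 - u y t - eta * (s - t)
   - (s - s0) * (s - s0) - (t - t0) * (t - t0) - / a * (r * r) - / (2 * (a * a)) * (D1 * D1) - / (2 * (a * a)) * (D2 * D2).
  by rewrite /Phi /r /D1 /D2 !vnorm_sq; ring.
(* The maximum of [Phi] is compared with its value at [(xs, s0, xs, xs, t0)], where the gap is
   within [a^2] of its upper bound; the Lipschitz differences are absorbed by half of the doubling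
   penalties. *)
have key : / (4 * (a * a)) * (D1 * D1 + D2 * D2) + / a * (r * r) + (s - s0) * (s - s0) + (t - t0) * (t - t0) <= K * (a * a).
  have := Hm xs s0 xs xs t0; rewrite !mk_sub !vnorm_subxx !Rminus_diag.
  have z0 : vnorm (mk 0 (xs -^ xs)) <= rho by rewrite mk0_norm vnorm_subxx; lra.
  move=> /(_ z0 (Rlt_le _ _ rho0) z0); rewrite PhiE {1}/Phi.
  have -> : dot (xs -^ xs) (xs -^ xs) = 0 by rewrite -vnorm_sq vnorm_subxx; ring.
  move: near; rewrite /gap -/s0 (_ : h0 = s0 - t0); last by rewrite /s0; ring.
  have := HT y t (s - t) tT st; rewrite /gap (_ : t + (s - t) = s); last by ring.
  have l1 : lam * (u x1 s - u y s) <= lam * C * D1.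
    rewrite Rmult_assoc; apply: Rmult_le_compat_l; first lra.
    by have := lu x1 y s; rewrite -/D1; split_Rabs; lra.
  have l2 : (1 - lam) * (v0 x2 - v0 y) <= (1 - lam) * L2 * D2.
    rewrite Rmult_assoc; apply: Rmult_le_compat_l; first lra.
    by have := lv0 x2 y; rewrite -/D2; split_Rabs; lra.
  have yo D : / (2 * (a * a)) * (D * D) = / (4 * (a * a)) * (D * D) + / (4 * (a * a)) * (D * D) by field; lra.
  have am D : LF * D <= / (4 * (a * a)) * (D * D) + LF * LF * (a * a).
    have q : / (4 * (a * a)) * (D * D) + LF * LF * (a * a) - LF * D = (/ (2 * a) * D - LF * a) * (/ (2 * a) * D - LF * a) by field; lra.
    by have := Rle_0_sqr (/ (2 * a) * D - LF * a); rewrite /Rsqr; lra.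
  have m1 : lam * C * D1 <= LF * D1 by apply: Rmult_le_compat_r => //; have := Rmult_le_pos _ _ (Rlt_le 0 (1 - lam) ltac:(lra)) L20; rewrite /LF; lra.
  have m2 : (1 - lam) * L2 * D2 <= LF * D2 by apply: Rmult_le_compat_r => //; have := Rmult_le_pos _ _ (Rlt_le _ _ (proj1 lam01)) (Rlt_le _ _ HC); rewrite /LF; lra.
  have := am D1; have := am D2; rewrite (yo D1) (yo D2) /K; lra.
have sq z : 0 <= z * z by exact: Rle_0_sqr.
have i4 : 0 < / (4 * (a * a)) by apply: Rinv_0_lt_compat; lra.
have ia : 0 < / a by apply: Rinv_0_lt_compat.
have g1 := sq D1. have g2 := sq D2. have g3 := sq r. have g4 := sq (s - s0). have g5 := sq (t - t0).
have g6 : 0 <= / (4 * (a * a)) * (D1 * D1) by apply: Rmult_le_pos; lra.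
have g7 : 0 <= / (4 * (a * a)) * (D2 * D2) by apply: Rmult_le_pos; lra.
have g8 : 0 <= / a * (r * r) by apply: Rmult_le_pos; lra.
have dD D : / (4 * (a * a)) * (D * D) <= K * (a * a) -> D * D <= 4 * K * (a * a * (a * a)).
  move=> h; have := Rmult_le_compat_l (4 * (a * a)) _ _ ltac:(lra) h.
  by rewrite (_ : 4 * (a * a) * (/ (4 * (a * a)) * (D * D)) = D * D); [lra | field; lra].
have e1 : D1 * D1 <= 4 * K * (a * a * (a * a)) by apply: dD; lra.
have e2 : D2 * D2 <= 4 * K * (a * a * (a * a)) by apply: dD; lra.
have e3 : r * r <= K * (a * a * a).
  have h : / a * (r * r) <= K * (a * a) by lra.
  have := Rmult_le_compat_l a _ _ (Rlt_le _ _ a0) h.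
  by rewrite (_ : a * (/ a * (r * r)) = r * r); [lra | field; lra].
have a3 : 0 < a * a * a by exact: Rmult_lt_0_compat.
have a4 : 0 < a * a * (a * a) by exact: Rmult_lt_0_compat.
have Kaa : 0 <= K * (a * a) by apply: Rmult_le_pos; lra.
have Ka : 0 <= K * a by apply: Rmult_le_pos; lra.
have KK4 := Rmult_le_compat_r _ _ _ (Rlt_le _ _ a4) KK2.
have f1 : D1 <= 2 * K * (a * a).
  apply: sqr_le_le; first lra.
  by rewrite (_ : 2 * K * (a * a) * (2 * K * (a * a)) = 4 * (K * K * (a * a * (a * a)))); [lra | ring].
have f2 : D2 <= 2 * K * (a * a).
  apply: sqr_le_le; first lra.
  by rewrite (_ : 2 * K * (a * a) * (2 * K * (a * a)) = 4 * (K * K * (a * a * (a * a)))); [lra | ring].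
have f3 : r <= K * (a * b).
  apply: sqr_le_le; first by apply: Rmult_le_pos; [lra | apply: Rmult_le_pos; lra].
  apply: Rle_trans e3 _; rewrite (_ : K * (a * b) * (K * (a * b)) = K * K * (a * a * a)); last by rewrite aE; ring.
  by apply: Rmult_le_compat_r; lra.
have aba : a * b <= a by apply: Rmult_le_self; lra.
have aaa : a * a <= a by apply: Rmult_le_self; lra.
have f3' : r <= K * a by apply: Rle_trans f3 _; apply: Rmult_le_compat_l; lra.
have tau w : w * w <= K * (a * a) -> Rabs w <= K * a.
  move=> h; apply: sqr_le_le; first by [].
  rewrite -Rabs_mult Rabs_pos_eq //; apply: Rle_trans h _.
  by rewrite (_ : K * a * (K * a) = K * K * (a * a)); [apply: Rmult_le_compat_r; lra | ring].
have f4 : Rabs (s - s0) <= K * a by apply: tau; lra.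
have f5 : Rabs (t - t0) <= K * a by apply: tau; lra.
have w1 : vnorm (x1 -^ xs) <= D1 + r := vdist_tri y x1 xs.
have w2 : vnorm (x2 -^ xs) <= D2 + r := vdist_tri y x2 xs.
have KK : K * (a * a) <= K * a by apply: Rmult_le_compat_l; lra.
have a34 : a * a * (a * a) <= a * a * a by apply: Rmult_le_compat_l; lra.
have wsq w D : 0 <= w -> w <= D + r -> D * D <= 4 * K * (a * a * (a * a)) -> w * w <= 10 * K * (a * a * a).
  move=> w0 h1 h2; have := Rle_0_sqr (D - r); rewrite /Rsqr => h3.
  have h4 : w * w <= (D + r) * (D + r) by apply: Rmult_le_compat.
  have h5 : K * (a * a * (a * a)) <= K * (a * a * a) by apply: Rmult_le_compat_l; lra.
  by lra.
have w1q := wsq _ _ (vnorm_ge0 _) w1 e1. have w2q := wsq _ _ (vnorm_ge0 _) w2 e2.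
have aK : 4 * K * a < rho by apply: Rle_lt_trans bK; apply: Rmult_le_compat_l; lra.
have D1a : D1 <= 2 * K * a by lra. have D2a : D2 <= 2 * K * a by lra.
pose r' := (rho - 4 * K * a) / 2; have r'0 : 0 < r' by rewrite /r'; lra.
have inner x z tt t1 tc : vnorm (x -^ z) < r' -> Rabs (tt - t1) < r' -> vnorm (z -^ xs) <= 3 * K * a -> Rabs (t1 - tc) <= K * a ->
   vnorm (mk tt x -^ mk tc xs) <= rho.
  move=> h1 h2 h3 h4; rewrite mk_sub; apply: Rle_trans (mk_norm _ _) _.
  have := vdist_tri z x xs; have : Rabs (tt - tc) <= Rabs (tt - t1) + Rabs (t1 - tc) by split_Rabs; lra.
  by rewrite /r' in h1 h2; lra.
have in1 x tt : vnorm (x -^ x1) < r' -> Rabs (tt - s) < r' -> vnorm (mk tt x -^ mk s0 xs) <= rho.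
  by move=> h1 h2; apply: inner h1 h2 _ f4; lra.
have in3 x tt : vnorm (x -^ y) < r' -> Rabs (tt - t) < r' -> vnorm (mk tt x -^ mk t0 xs) <= rho.
  by move=> h1 h2; apply: inner h1 h2 _ f5; rewrite -/r; lra.
have in2 x : vnorm (x -^ x2) < r' -> vnorm (x -^ xs) <= rho.
  by move=> h1; have := vdist_tri x2 x xs; rewrite /r' in h1; lra.
have ii1 := in1 x1 s ltac:(rewrite vnorm_subxx; lra) ltac:(rewrite Rminus_diag Rabs_R0; lra).
have ii3 := in3 y t ltac:(rewrite vnorm_subxx; lra) ltac:(rewrite Rminus_diag Rabs_R0; lra).
have ii2 := in2 x2 ltac:(rewrite vnorm_subxx; lra).
have il : 0 < / lam by apply: Rinv_0_lt_compat; lra.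
have iml : 0 < / (1 - lam) by apply: Rinv_0_lt_compat; lra.
pose A1 := / (2 * (a * a)); have A10 : 0 < A1 by apply: Rinv_0_lt_compat; lra.
have sp : 0 < s by have := j1; rewrite /s0; split_Rabs; lra.
have tp : 0 < t by have := j3; split_Rabs; lra.
pose B1 := A1 / lam. pose B2 := A1 / (1 - lam).
have B1l : lam * B1 = A1 by rewrite /B1; field; lra.
have B2l : (1 - lam) * B2 = A1 by rewrite /B2; field; lra.
pose p := (2 * B1) *^ (x1 -^ y). pose q := (2 * B2) *^ (x2 -^ y).
have S1 th : eta / lam + 2 * / lam * (s - s0) + G th x1 p <= 2 * B1 * trsq (cols sigma th x1).
  have [c1 c2 c3] := quadratic_chi (eta / lam) (/ lam) s0.
  apply: (par_sub_quadratic (su (s + 1)) c1 c2 c3 (x0 := x1)); first lra.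
  exists r'; split=> // x tt hx htt; have := Hm x tt x2 y t (in1 _ _ hx htt) ii2 ii3.
  rewrite /Phi -/A1 -B1l => h; apply: (Rmult_le_reg_l lam); first lra.
  have q1 z w D : lam * (w - B1 * D - (eta / lam * z + / lam * ((z - s0) * (z - s0)))) = lam * w - lam * B1 * D - eta * z - (z - s0) * (z - s0) by field; lra.
  by rewrite !q1; lra.
have S2 th : G2 th x2 q <= 2 * B2 * trsq (cols sigma th x2).
  apply: (stat_sub_quadratic sv0 (x0 := x2)).
  exists r'; split=> // x hx; have := Hm x1 s x y t ii1 (in2 _ hx) ii3.
  rewrite /Phi -/A1 -{2 4}B2l => h; apply: (Rmult_le_reg_l (1 - lam)); first lra.
  by lra.
pose grad := (2 * - A1) *^ (y -^ x1) +^ (2 * - A1) *^ (y -^ x2) +^ (2 * - / a) *^ (y -^ xs).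
have [th3 S3] : exists th, 2 * (- A1 + - A1 + - / a) * trsq (cols sigma th y) <= eta + 2 * -1 * (t - t0) + G th y grad + b.
  have [c1 c2 c3] := quadratic_chi eta (-1) t0.
  apply: (par_super_quadratic (Su (t + 1)) c1 c2 c3 (x0 := y)) b0; first lra.
  exists r'; split=> // x tt hx htt; have := Hm x1 s x2 x tt ii1 ii2 (in3 _ _ hx htt).
  rewrite /Phi -/A1 -!vnorm_sq !(vnorm_subC x) !(vnorm_subC y); lra.
(* Turns a comparison of the maximum with the same configuration, one point being moved onto [y],
   into a bound of the momentum by the Lipschitz constant. *)
have div D l L : 0 <= D -> 0 <= l * L -> A1 * (D * D) <= l * (L * D) -> A1 * D <= l * L.
  by move=> h1 h2 h3; case: (Rle_lt_or_eq_dec _ _ h1) => [h|<-]; [apply: (Rmult_le_reg_r D); lra | lra].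
have np : vnorm p <= 2 * C.
  have iy : vnorm (mk s y -^ mk s0 xs) <= rho.
    by rewrite mk_sub; apply: Rle_trans (mk_norm _ _) _; rewrite -/r; lra.
  have h := Hm y s x2 y t iy ii2 ii3; have : A1 * D1 <= lam * C.
    apply: div => //; first by apply: Rmult_le_pos; lra.
    move: h; rewrite /Phi -/A1 -!vnorm_sq -/D1 vnorm_subxx => h.
    have : lam * (u x1 s - u y s) <= lam * (C * D1); last by lra.
    by apply: Rmult_le_compat_l; [lra | have := lu x1 y s; rewrite -/D1; split_Rabs; lra].
  rewrite -B1l Rmult_assoc => /(Rmult_le_reg_l _ _ _ (proj1 lam01)) h1.
  rewrite /p vnorm_scal Rabs_pos_eq -/D1; first by lra.
  by rewrite /B1; apply: Rmult_le_pos; [lra | apply: Rmult_le_pos; lra].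
have nq : vnorm q <= 2 * L2.
  have iy : vnorm (y -^ xs) <= rho by rewrite -/r; lra.
  have h := Hm x1 s y y t ii1 iy ii3; have : A1 * D2 <= (1 - lam) * L2.
    apply: div => //; first by apply: Rmult_le_pos; lra.
    move: h; rewrite /Phi -/A1 -!vnorm_sq -/D2 vnorm_subxx => h.
    have : (1 - lam) * (v0 x2 - v0 y) <= (1 - lam) * (L2 * D2); last by lra.
    by apply: Rmult_le_compat_l; [lra | have := lv0 x2 y; rewrite -/D2; split_Rabs; lra].
  rewrite -B2l Rmult_assoc => h1; have {}h1 : B2 * D2 <= L2 by apply: (Rmult_le_reg_l (1 - lam)); lra.
  rewrite /q vnorm_scal Rabs_pos_eq -/D2; first by lra.
  by rewrite /B2; apply: Rmult_le_pos; [lra | apply: Rmult_le_pos; lra].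
have bE1 : a * E1 <= b * E1 by apply: Rmult_le_compat_r.
have bE2 : a * E2 <= b * E2 by apply: Rmult_le_compat_r.
have bE' : 0 <= b * E1 /\ 0 <= b * E2 /\ 0 <= b * E3 by split; [|split]; apply: Rmult_le_pos; lra.
have tx th x (w : R) : vnorm (x -^ xs) * vnorm (x -^ xs) <= w -> trsq (cols sigma th x) <= C * C * w.
  by move=> h; apply: Rle_trans (trsq_near_Sigma th x sl Sxs) _; apply: Rmult_le_compat_l; lra.
have k1a : k1 * vnorm (xs -^ x1) <= 3 * K * k1 * a.
  by rewrite vnorm_subC; have : k1 * vnorm (x1 -^ xs) <= k1 * (3 * K * a) by [apply: Rmult_le_compat_l; lra]; lra.
have k2a : k2 * vnorm (xs -^ x2) <= 3 * K * k2 * a.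
  by rewrite vnorm_subC; have : k2 * vnorm (x2 -^ xs) <= k2 * (3 * K * a) by [apply: Rmult_le_compat_l; lra]; lra.
exists p, q; split=> // [th|th|].
- have h1 := S1 th; have h2 := Hk1 th xs x1 p p ltac:(rewrite /R0; lra) ltac:(rewrite /R0; lra).
  rewrite vnorm_subxx Rplus_0_r in h2.
  have h3 : 2 * B1 * trsq (cols sigma th x1) <= 2 * B1 * (C * C * (10 * K * (a * a * a))).
    by apply: Rmult_le_compat_l; [rewrite /B1; apply: Rmult_le_pos; [lra | apply: Rmult_le_pos; lra] | exact: tx].
  have h4 : 2 * B1 * (C * C * (10 * K * (a * a * a))) = 10 * K * (C * C) / lam * a by rewrite /B1 /A1; field; lra.
  have h5 : - (2 * / lam * (s - s0)) <= 2 * K / lam * a.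
    have : 2 * / lam * (s0 - s) <= 2 * / lam * (K * a) by apply: Rmult_le_compat_l; [lra | move: f4; split_Rabs; lra].
    by rewrite /Rdiv; lra.
  have h6 : a * E1 = 2 * K / lam * a + 10 * K * (C * C) / lam * a + 3 * K * k1 * a by rewrite /E1; field; lra.
  by move: h2; split_Rabs; lra.
- have h1 := S2 th; have h2 := Hk2 th xs x2 q q ltac:(rewrite /R0; lra) ltac:(rewrite /R0; lra).
  rewrite vnorm_subxx Rplus_0_r in h2.
  have h3 : 2 * B2 * trsq (cols sigma th x2) <= 2 * B2 * (C * C * (10 * K * (a * a * a))).
    by apply: Rmult_le_compat_l; [rewrite /B2; apply: Rmult_le_pos; [lra | apply: Rmult_le_pos; lra] | exact: tx].
  have h4 : 2 * B2 * (C * C * (10 * K * (a * a * a))) = 10 * K * (C * C) / (1 - lam) * a by rewrite /B2 /A1; field; lra.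
  have h6 : a * E2 = 10 * K * (C * C) / (1 - lam) * a + 3 * K * k2 * a by rewrite /E2; field; lra.
  by move: h2; split_Rabs; lra.
exists th3.
have gE : grad = lam *^ p +^ (1 - lam) *^ q -^ (2 * / a) *^ (y -^ xs).
  apply: functional_extensionality => i; rewrite /grad /p /q /vadd /vsub /vscal.
  have -> : lam * (2 * B1 * (x1 i - y i)) = 2 * (lam * B1) * (x1 i - y i) by ring.
  have -> : (1 - lam) * (2 * B2 * (x2 i - y i)) = 2 * ((1 - lam) * B2) * (x2 i - y i) by ring.
  by rewrite B1l B2l; ring.
set cmb := _ +^ _ in gE *.
have ncmb : vnorm cmb <= 2 * C + 2 * L2.
  apply: Rle_trans (vnorm_tri _ _) _; rewrite (vnorm_scal lam) (vnorm_scal (1 - lam)) !Rabs_pos_eq; try lra.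
  have l1 := Rmult_le_compat_l lam _ _ ltac:(lra) np.
  have l2 := Rmult_le_compat_l (1 - lam) _ _ ltac:(lra) nq.
  have l3 : 0 <= (1 - lam) * (2 * C) by apply: Rmult_le_pos; lra.
  have l4 : 0 <= lam * (2 * L2) by apply: Rmult_le_pos; lra.
  by lra.
have dg : vnorm (cmb -^ grad) <= 2 * K * b.
  rewrite gE (_ : _ -^ _ = (2 * / a) *^ (y -^ xs)); last by vring.
  rewrite vnorm_scal Rabs_pos_eq -/r; last by lra.
  have : 2 * / a * r <= 2 * / a * (K * (a * b)) by apply: Rmult_le_compat_l; lra.
  by rewrite (_ : 2 * / a * (K * (a * b)) = 2 * K * b); [lra | field; lra].
have ngr : vnorm grad <= R0 by have := vnorm_le_dist grad cmb; have : K * b <= K by [apply: Rmult_le_self; lra]; rewrite (vnorm_subC grad) /R0; lra.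
have h2 := Hk1 th3 xs y cmb grad ltac:(rewrite /R0; lra) ngr.
have h3 : k1 * (vnorm (xs -^ y) + vnorm (cmb -^ grad)) <= k1 * (3 * K * b).
  by apply: Rmult_le_compat_l => //; rewrite vnorm_subC -/r; have := Rmult_le_compat_l K _ _ ltac:(lra) ab; lra.
have h4 : 2 * (A1 + A1 + / a) * trsq (cols sigma th3 y) <= 2 * (A1 + A1 + / a) * (C * C * (K * (a * a * a))).
  by apply: Rmult_le_compat_l; [lra | exact: tx].
have h5 : 2 * (A1 + A1 + / a) * (C * C * (K * (a * a * a))) = 2 * (C * C) * K * a + 2 * (C * C) * K * (a * a) by rewrite /A1; field; lra.
have h6 : K * (C * C) * (a * a) <= K * (C * C) * b by apply: Rmult_le_compat_l; lra.
have h7 : K * (C * C) * a <= K * (C * C) * b by apply: Rmult_le_compat_l; lra.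
have h8 : K * a <= K * b by apply: Rmult_le_compat_l; lra.
have h9 : b * E3 = b + 4 * (C * C) * K * b + 2 * K * b + k1 * (3 * K * b) by rewrite /E3; ring.
by move: h2 f5; split_Rabs; lra.
Qed.
End FirstOrder.

(** * Bound on the increments *)

Section GapBound.
Variables (N : nat) (Theta : Type) (C : R) (sigma : Theta -> pt N -> mat N) (G G2 : Theta -> pt N -> pt N -> R).
Variables (u : pt N -> R -> R) (v0 : pt N -> R) (L2 lam eta kap Bu Bv : R).
Hypothesis Eu : evolution C sigma G u.
Hypotheses (cv0 : rcont v0) (pv0 : periodic v0) (L20 : 0 <= L2).
Hypothesis lv0 : forall x y, Rabs (v0 x - v0 y) <= L2 * vnorm (x -^ y).
Hypotheses (lG2 : loclip G2) (sv0 : stat_sub sigma G2 v0).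
Hypotheses (lam01 : 0 < lam < 1) (eta0 : 0 < eta).
Hypothesis Hconv : forall th x p1 p2, vnorm p2 <= (1 - lam) * L2 ->
  G th x (p1 +^ p2) <= lam * G th x (/ lam *^ p1) + (1 - lam) * G2 th x (/ (1 - lam) *^ p2).
Hypothesis kap0 : 0 <= kap.
Hypothesis Hkap : forall th x p q, vnorm p <= 2 * C -> vnorm q <= 2 * C -> Rabs (G th x p - G th x q) <= kap * vnorm (p -^ q).
Hypothesis HSS : SS sigma kap.
Hypothesis HBu : forall x t, 0 <= t -> Rabs (u x t) <= Bu.
Hypothesis HBv : forall x, Rabs (v0 x) <= Bv.

(** The bounded momenta converge along [W]. The last condition keeps its [e] because the index there
    may vary with [e], and [Theta] need not be compact. *)
Lemma first_order_limit xs : (forall e, 0 < e -> exists p q,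
  [/\ vnorm p <= 2 * C /\ vnorm q <= 2 * L2, forall th, eta / lam + G th xs p <= e, forall th, G2 th xs q <= e &
   exists th, - e <= eta + G th xs (lam *^ p +^ (1 - lam) *^ q)]) ->
  exists p q, [/\ vnorm q <= 2 * L2, forall th, eta / lam + G th xs p <= 0, forall th, G2 th xs q <= 0 &
   forall e, 0 < e -> exists th, - e <= eta + G th xs (lam *^ p +^ (1 - lam) *^ q)].
Proof.
move=> H; have HC := evo_C Eu.
have H' n : exists w : pt N * pt N, [/\ vnorm w.1 <= 2 * C /\ vnorm w.2 <= 2 * L2, forall th, eta / lam + G th xs w.1 <= / INR n.+1,
   forall th, G2 th xs w.2 <= / INR n.+1 & exists th, - / INR n.+1 <= eta + G th xs (lam *^ w.1 +^ (1 - lam) *^ w.2)].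
  by have [p [q h]] := H _ (invS_gt0 n); exists (p, q).
have [w Hw] := fun_choice H'.
have [p lp] : exists p, vlim (fun n => (w n).1) p.
  by apply: (vlim_ex (M := 2 * C)); apply: W_all => n; case: (Hw n) => -[].
have [q lq] : exists q, vlim (fun n => (w n).2) q.
  by apply: (vlim_ex (M := 2 * L2)); apply: W_all => n; case: (Hw n) => -[].
pose R0 := 2 * C + 2 * L2 + 2.
have lim (F : Theta -> pt N -> pt N -> R) e : loclip F -> 0 < e -> exists d, 0 < d /\ forall th p q, vnorm p <= R0 -> vnorm q <= R0 ->
    vnorm (p -^ q) < d -> Rabs (F th xs p - F th xs q) <= e.
  move=> lF e0; have [K [K0 HK]] := lF R0 ltac:(rewrite /R0; lra).
  exists (e / (K + 1)); split; first by apply: Rdiv_lt_0_compat; lra.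
  move=> th p' q' h1 h2 h3; apply: Rle_trans (HK th xs xs _ _ h1 h2) _; rewrite vnorm_subxx Rplus_0_l.
  have e1 : e / (K + 1) * (K + 1) = e by field; lra.
  by have := vnorm_ge0 (p' -^ q'); nra.
have nq : vnorm q <= 2 * L2.
  apply: eps_le => e e0; have [n hn] := W_ex (lq e e0); have [[_ b] _ _ _] := Hw n.
  by have := vnorm_le_dist q (w n).2; rewrite vnorm_subC; lra.
have np : vnorm p <= 2 * C.
  apply: eps_le => e e0; have [n hn] := W_ex (lp e e0); have [[b _] _ _ _] := Hw n.
  by have := vnorm_le_dist p (w n).1; rewrite vnorm_subC; lra.
exists p, q; split=> // [th|th|e e0].
- apply: eps_le => e e0; have [d [d0 Hd]] := lim G (e / 2) (evo_G Eu) ltac:(lra).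
  have [n [h1 h2]] := W_ex (W_and (lp d d0) (W_inv (eps := e / 2) ltac:(lra))); have [[b _] h3 _ _] := Hw n.
  have := Hd th (w n).1 p ltac:(rewrite /R0; lra) ltac:(rewrite /R0; lra) h1; have := h3 th; split_Rabs; lra.
- apply: eps_le => e e0; have [d [d0 Hd]] := lim G2 (e / 2) lG2 ltac:(lra).
  have [n [h1 h2]] := W_ex (W_and (lq d d0) (W_inv (eps := e / 2) ltac:(lra))); have [[_ b] _ h3 _] := Hw n.
  have := Hd th (w n).2 q ltac:(rewrite /R0; lra) ltac:(rewrite /R0; lra) h1; have := h3 th; split_Rabs; lra.
- have [d [d0 Hd]] := lim G (e / 2) (evo_G Eu) ltac:(lra).
  have [n [h1 [h2 h3]]] := W_ex (W_and (lp d d0) (W_and (lq d d0) (W_inv (eps := e / 2) ltac:(lra)))).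
  have [[b1 b2] _ _ [th h4]] := Hw n; exists th.
  have nc (p' q' : pt N) : vnorm p' <= 2 * C -> vnorm q' <= 2 * L2 -> vnorm (lam *^ p' +^ (1 - lam) *^ q') <= R0.
    move=> h h'; apply: Rle_trans (vnorm_tri _ _) _; rewrite !vnorm_scal !Rabs_pos_eq; try lra.
    by have := @vnorm_ge0 N p'; have := @vnorm_ge0 N q'; rewrite /R0; nra.
  have : Rabs (G th xs (lam *^ (w n).1 +^ (1 - lam) *^ (w n).2) - G th xs (lam *^ p +^ (1 - lam) *^ q)) <= e / 2.
    apply: (Hd th _ _ (nc _ _ b1 b2) (nc _ _ np nq)); rewrite (_ : _ -^ _ = lam *^ ((w n).1 -^ p) +^ (1 - lam) *^ ((w n).2 -^ q)); last by vring.
    apply: Rle_lt_trans (vnorm_tri _ _) _; rewrite !vnorm_scal !Rabs_pos_eq; try lra.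
    have k1 := Rmult_lt_compat_l lam _ _ (proj1 lam01) h1.
    by have k2 := Rmult_lt_compat_l (1 - lam) _ _ ltac:(lra) h2; lra.
  by split_Rabs; lra.
Qed.

(** Suppose the maximum, attained at [xs] in [Sigma], exceeds what [h = 0] allows. By the time
    modulus of [u], nearly maximal gaps have [h >= hs], and the first order system follows at [xs],
    which the second alternative forbids. Under the first alternative the gap is bounded
    directly. *)
Lemma gap_bound :
  (forall xs, Sigma sigma xs -> (forall t h, 0 <= t -> 0 <= h -> u xs (t + h) <= u xs t) \/
    ~ exists p q, [/\ vnorm q <= 2 * L2, forall th, eta / lam + G th xs p <= 0, forall th, G2 th xs q <= 0 &
      forall e, 0 < e -> exists th, - e <= eta + G th xs (lam *^ p +^ (1 - lam) *^ q)]) ->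
  forall e, 0 < e -> exists T, 0 <= T /\
    forall x t h, T <= t -> 0 <= h -> gap u v0 lam eta x t h <= (1 - lam) * (Bu + Bv) + e.
Proof.
move=> strict.
have bw x t w : 0 <= t -> 0 <= w -> 0 <= w * (Bu - u x t) /\ 0 <= w * (Bu + u x t).
  by move=> h1 h2; have hb := HBu x h1; split; apply: Rmult_le_pos => //; move: hb; split_Rabs; lra.
have bv x w : 0 <= w -> 0 <= w * (Bv - v0 x) /\ 0 <= w * (Bv + v0 x).
  by move=> h2; have hb := HBv x; split; apply: Rmult_le_pos => //; move: hb; split_Rabs; lra.
have ex x : exists l, (forall e, 0 < e -> exists T, 0 <= T /\ forall t h, T <= t -> 0 <= h -> gap u v0 lam eta x t h <= l + e) /\
   (forall e T, 0 < e -> exists t h, [/\ T <= t, 0 <= t, 0 <= h & l - e <= gap u v0 lam eta x t h]).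
  apply: (limsup_exists (B := lam * Bu + (1 - lam) * Bv + Bu)) => [t h t0 h0|t t0]; rewrite /gap.
    have := bw x (t + h) lam ltac:(lra) ltac:(lra); have := bw x t 1 t0 ltac:(lra); have := bv x (1 - lam) ltac:(lra).
    by have : 0 <= eta * h by [nra]; lra.
  have := bw x (t + 0) lam ltac:(lra) ltac:(lra); have := bw x t 1 t0 ltac:(lra); have := bv x (1 - lam) ltac:(lra); lra.
have [Fb HFb] := fun_choice ex.
have HF1 x e : 0 < e -> exists T, 0 <= T /\ forall t h, T <= t -> 0 <= h -> gap u v0 lam eta x t h <= Fb x + e by apply: (proj1 (HFb x)).
have HF2 x e T : 0 < e -> exists t h, [/\ T <= t, 0 <= t, 0 <= h & Fb x - e <= gap u v0 lam eta x t h] by apply: (proj2 (HFb x)).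
have LFp := LF_pos Eu L20 lam01.
have [xs [Sx Hm]] := max_on_Sigma (evo_C Eu) (evo_slip Eu) (evo_sper Eu) (Rlt_le _ _ LFp) (Fb_cont Eu lv0 lam01 HF1 HF2)
  (Fb_per Eu pv0 HF1 HF2) (Fb_lip Eu lv0 lam01 HF1 HF2)
  (linearized_subsolution Eu cv0 pv0 L20 lv0 lG2 sv0 lam01 Hconv HF1 HF2 kap0 Hkap) HSS.
have unif e : 0 < e -> exists T, 0 <= T /\ forall x t h, T <= t -> 0 <= h -> gap u v0 lam eta x t h <= Fb xs + e.
  move=> e0; have [T [T0 HT]] := Fb_unif Eu pv0 L20 lv0 lam01 HF1 HF2 e0.
  by exists T; split=> // x t h a b; have := HT x t h a b; have := Hm x; lra.
suff key : Fb xs <= (1 - lam) * (Bu + Bv).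
  move=> e e0; have [T [T0 HT]] := unif e e0.
  by exists T; split=> // x t h a b; have := HT x t h a b; lra.
apply: Rnot_lt_le => bad; set g0 := Fb xs - (1 - lam) * (Bu + Bv); have g00 : 0 < g0 by rewrite /g0; lra.
case: (strict xs Sx) => [mono|nostrict].
  have [t [h [_ t0 h0 le]]] := HF2 xs (g0 / 2) 0 ltac:(lra); move: le; rewrite /gap /g0.
  have := mono t h t0 h0; have := bw xs t (1 - lam) t0 ltac:(lra); have := bv xs (1 - lam) ltac:(lra).
  move=> h1 h2 h3; have : lam * u xs (t + h) <= lam * u xs t by apply: Rmult_le_compat_l; lra.
  have : 0 <= eta * h by [nra].
  by rewrite /g0 in g00; lra.
have [hs [hs0 Hhs]] := evolution_modulus Eu (e := g0 / 4) ltac:(lra).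
apply: nostrict; apply: first_order_limit => e e0.
apply: (first_order_doubling Eu cv0 L20 lv0 lG2 sv0 lam01 Sx unif (HF2 xs) hs0 (es := g0 / 2)) => //; first lra.
move=> t h t0 h0 le; apply: Rnot_lt_le => hh; move: le; rewrite /gap.
have h1 := Hhs xs t h t0 ltac:(lra).
have := bw xs t (1 - lam) t0 ltac:(lra); have := bv xs (1 - lam) ltac:(lra).
have : lam * (u xs (t + h) - u xs t) <= lam * (g0 / 4) by apply: Rmult_le_compat_l; [lra | move: h1; split_Rabs; lra].
have : 0 <= eta * h by [nra].
by rewrite /g0; rewrite /g0 in g00; nra.
Qed.
End GapBound.

(** * Asymptotic monotonicity *)

Section NonincreasingPoints.
Variables (N : nat) (Theta : Type) (C : R) (sigma : Theta -> pt N -> mat N) (G : Theta -> pt N -> pt N -> R).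
Variables (u : pt N -> R -> R).
Hypothesis Eu : evolution C sigma G u.
Variable th0 : Theta.
Implicit Types (x y p : pt N) (t s : R).

(** Formally [u_t <= - G <= 0] at [xs], where the diffusion vanishes. The localization
    [|x - xs|^2 / b] and the Lipschitz bound hold the contact point within [C b] of [xs], so the
    trace term, [/ b] times [O(b^2)], is negligible. *)
Lemma nonincreasing_at xs : Sigma sigma xs -> (forall th p, 0 <= G th xs p) ->
  forall t h, 0 <= t -> 0 <= h -> u xs (t + h) <= u xs t.
Proof.
move=> Sx Gpos t0 h t00 h0; apply: Rnot_lt_le => bad.
have [HC bd sl sp lG cu pu lu su Su] := Eu.
have {}h0 : 0 < h by case: h0 => // e; move: bad; rewrite -e Rplus_0_r; lra.
pose t1 := t0 + h; pose T := t1 + 1.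
pose d := u xs t1 - u xs t0; have d0 : 0 < d by rewrite /d /t1; lra.
have T0 : 0 <= T by rewrite /T /t1; lra.
have [M HM] := periodic2_bounded T0 cu pu.
have M0 : 0 <= M by have := HM xs 0 ltac:(lra); have := Rabs_pos (u xs 0); lra.
pose nu := d / (4 * h); have nu0 : 0 < nu by apply: Rdiv_lt_0_compat; lra.
have nuh : nu * h = d / 4 by rewrite /nu; field; lra.
pose k := 8 * M / d.
have k0 : 0 <= k by apply: Rmult_le_pos; [lra | left; exact: Rinv_0_lt_compat].
have kd : d / 4 * k = 2 * M by rewrite /k; field; lra.
pose chi t := nu * t + d / 4 * exp (k * (t - t1)).
pose chi1 t := nu + d / 4 * k * exp (k * (t - t1)).
have [e1 e2 e3] := exp_barrier nu (d / 4) k t1.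
rewrite -/chi -/chi1 in e1 e2.
have cchi t : continuity_pt chi t by apply: derivable_continuous_pt; exists (chi1 t); exact: e1.
have [k1 [k10 Hk1]] := lG (2 * C) ltac:(lra).
have C2 : 0 < C * C by exact: Rmult_lt_0_compat.
have C4 : 0 < C * C * (C * C) by exact: Rmult_lt_0_compat.
have kC : 0 <= k1 * C by apply: Rmult_le_pos; lra.
(* Per unit of [b]: the trace term, the cost of replacing [xh] by [xs] in [G], and slack. *)
pose A := 2 * (C * C * (C * C)) + k1 * C + 1.
have [b [b0 [b1 [b2 b3]]]] : exists b, 0 < b /\ b < / C /\ b < d / (2 * (C * C)) /\ b < nu / A.
  have q1 : 0 < / C by exact: Rinv_0_lt_compat.
  have q2 : 0 < d / (2 * (C * C)) by apply: Rdiv_lt_0_compat; lra.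
  have q3 : 0 < nu / A by apply: Rdiv_lt_0_compat; rewrite /A; lra.
  have [n Hn] := W_ex (W_and (W_inv q1) (W_and (W_inv q2) (W_inv q3))).
  by exists (/ INR n.+1); split; [exact: invS_gt0 | intuition lra].
have bC : C * b < 1.
  by rewrite -(Rinv_r C); [apply: Rmult_lt_compat_l | lra].
have bd2 : C * C * b < d / 2.
  have q : C * C * (d / (2 * (C * C))) = d / 2 by field; lra.
  by rewrite -q; apply: Rmult_lt_compat_l.
have bnu : A * b < nu.
  have A0 : 0 < A by rewrite /A; lra.
  have q : A * (nu / A) = nu by field; lra.
  by rewrite -[X in _ < X]q; apply: Rmult_lt_compat_l.
have ib : 0 < / b by exact: Rinv_0_lt_compat.
have t0T : t0 <= T by rewrite /T /t1; lra.
have cF := rcont2_rcont (rcont2_clampt t0 T (rcont2_sub (rcont2_sub cu (rcont_stationary (C2_rcont (C2_sqdist (/ b) xs)))) (rcont2_time (N := N) cchi))).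
have R0 : 0 <= T + 1 by lra.
have [z [_ Hz]] := extreme_value_ball (mk t1 xs) R0 cF.
set xh := xpart z in Hz; pose th := clampt t0 T (tpart z).
have hth : t0 <= th <= T := clampt_in _ t0T.
pose F x t := u x t - / b * dot (x -^ xs) (x -^ xs) - chi t.
have Hm x t : vnorm (x -^ xs) <= 1 -> t0 <= t <= T -> F x t <= F xh th.
  move=> hx ht; have := Hz (mk t x); rewrite xpart_mk /tpart mk_t (clampt_id ht); apply.
  rewrite mk_sub; apply: Rle_trans (mk_norm _ _) _.
  have : Rabs (t - t1) <= T by rewrite /T /t1 in ht *; split_Rabs; lra.
  by lra.
have xs0 : dot (xs -^ xs) (xs -^ xs) = 0 by rewrite -vnorm_sq vnorm_subxx; ring.
pose D := vnorm (xh -^ xs); have D0 : 0 <= D := vnorm_ge0 _.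
have DD : dot (xh -^ xs) (xh -^ xs) = D * D by rewrite -vnorm_sq.
have DC : D <= C * b.
  have := Hm xs th ltac:(rewrite vnorm_subxx; lra) hth; rewrite /F xs0 DD.
  have := lu xh xs th; rewrite -/D => h1 h2.
  have h3 : / b * (D * D) <= C * D by move: h1; split_Rabs; lra.
  case: (Rle_lt_or_eq_dec _ _ D0) => [Dp|<-]; last by apply: Rmult_le_pos; lra.
  have h4 := Rmult_le_compat_l b _ _ (Rlt_le _ _ b0) h3.
  rewrite (_ : b * (/ b * (D * D)) = D * D) in h4; last by field; lra.
  by apply: (Rmult_le_reg_r D) => //; lra.
have hx1 := Hm xs t1 ltac:(rewrite vnorm_subxx; lra) ltac:(rewrite /T /t1; lra).
have chit1 : chi t1 = nu * t1 + d / 4 by rewrite /chi Rminus_diag Rmult_0_r exp_0; ring.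
rewrite /F xs0 DD chit1 in hx1.
have bDD : 0 <= / b * (D * D) by apply: Rmult_le_pos; [lra | exact: Rle_0_sqr].
have thl : t0 < th.
  case: (proj1 hth) => // e; move: hx1; rewrite -e /chi.
  have := exp_pos (k * (t0 - t1)) => ep; have : 0 <= d / 4 * exp (k * (t0 - t1)) by apply: Rmult_le_pos; lra.
  have := lu xh xs t0; rewrite -/D => h1; have : C * D <= C * (C * b) by apply: Rmult_le_compat_l; lra.
  rewrite (_ : nu * t1 = nu * t0 + d / 4); last by rewrite /t1 -nuh; ring.
  by rewrite /d in bd2 *; move: h1; split_Rabs; lra.
have thr : th < T.
  case: (proj2 hth) => // e; move: hx1; rewrite e /chi.
  have := HM xh T ltac:(lra); have := HM xs t1 ltac:(rewrite /T /t1; lra).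
  have := exp_ineq1_le k; rewrite (_ : k * (T - t1) = k); last by rewrite /T; ring.
  rewrite (_ : nu * T = nu * t1 + nu); last by rewrite /T; ring.
  move=> a1 a2 a3; have : d / 4 * (1 + k) <= d / 4 * exp k by apply: Rmult_le_compat_l; lra.
  by move: a2 a3 kd; split_Rabs; lra.
have := par_sub_quadratic (su T) e1 e2 e3 (x0 := xh) (t0 := th) (B := / b) (y := xs) ltac:(lra).
move=> /(_ _ th0) ineq.
have {}ineq : chi1 th + G th0 xh (2 * / b *^ (xh -^ xs)) <= 2 * / b * trsq (cols sigma th0 xh).
  apply: ineq; exists (Rmin (1 - D) (Rmin (th - t0) (T - th))); split.
    by apply: Rmin_pos; [lra | apply: Rmin_pos; lra].
  move=> x t; have := Rmin_l (1 - D) (Rmin (th - t0) (T - th)); have := Rmin_r (1 - D) (Rmin (th - t0) (T - th)).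
  have := Rmin_l (th - t0) (T - th); have := Rmin_r (th - t0) (T - th) => a1 a2 a3 a4 b4 b5.
  by apply: Hm; [have := vdist_tri xh x xs; rewrite -/D; lra | split_Rabs; lra].
set p := 2 * / b *^ _ in ineq.
have np : vnorm p <= 2 * C.
  rewrite /p vnorm_scal Rabs_pos_eq -/D; last by lra.
  have : 2 * / b * D <= 2 * / b * (C * b) by apply: Rmult_le_compat_l; lra.
  by rewrite (_ : 2 * / b * (C * b) = 2 * C); [lra | field; lra].
have := Hk1 th0 xs xh p p np np; rewrite vnorm_subxx Rplus_0_r vnorm_subC -/D => h1.
have h2 : k1 * D <= k1 * (C * b) by apply: Rmult_le_compat_l.
have h3 := trsq_near_Sigma th0 xh sl Sx; rewrite -/D in h3.
have h4 : D * D <= C * b * (C * b) by apply: Rmult_le_compat.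
have h5 : C * C * (D * D) <= C * C * (C * b * (C * b)) by apply: Rmult_le_compat_l; lra.
have h6 : 2 * / b * trsq (cols sigma th0 xh) <= 2 * / b * (C * C * (C * b * (C * b))) by apply: Rmult_le_compat_l; lra.
rewrite (_ : 2 * / b * (C * C * (C * b * (C * b))) = 2 * (C * C * (C * C)) * b) in h6; last by field; lra.
have h7 : 0 <= d / 4 * k * exp (k * (th - t1)) by apply: Rmult_le_pos; [lra | left; exact: exp_pos].
have := Gpos th0 p; rewrite /chi1 in ineq; rewrite /A in bnu; move: h1; split_Rabs; lra.
Qed.
End NonincreasingPoints.

Section AsymptoticDecrease.
Variables (N : nat) (Theta : Type) (C : R) (sigma : Theta -> pt N -> mat N) (H : Theta -> pt N -> pt N -> R) (c : R).
Let G th x p := H th x p - c.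
Variables (u : pt N -> R -> R) (v : pt N -> R) (L kap : R).
Hypothesis Eu : evolution C sigma G u.
Hypothesis Sv : stationary sigma G v L.
Hypothesis kap0 : 0 <= kap.
Hypothesis Hkap : forall th x p q, vnorm p <= 2 * C -> vnorm q <= 2 * C -> Rabs (G th x p - G th x q) <= kap * vnorm (p -^ q).
Hypothesis HSS : SS sigma kap.
Implicit Types (x y p q : pt N).

Definition asymptotically_decreasing := forall e Hm, 0 < e -> 0 <= Hm -> exists T, 0 <= T /\
  forall x t h, T <= t -> 0 <= h <= Hm -> u x (t + h) <= u x t + e.

(** With [1 - lam = mu] small, [lam u + (1 - lam) v0] differs little from [u], and [eta h] is small
    for [h] up to the horizon [Hm]; this is why only bounded [h] are considered. *)
Lemma decreasing_of_gap_bounds v0 B lam0 : 0 <= lam0 < 1 -> (forall x, Rabs (v0 x) <= B) ->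
  (forall x t, 0 <= t -> Rabs (u x t) <= B) ->
  (forall lam eta, lam0 < lam < 1 -> 0 < eta -> forall e, 0 < e -> exists T, 0 <= T /\
    forall x t h, T <= t -> 0 <= h -> gap u v0 lam eta x t h <= (1 - lam) * (B + B) + e) ->
  asymptotically_decreasing.
Proof.
move=> l0 Hv Hu K e Hm e0 Hm0.
have B0 : 0 <= B by have := Hv (@vzero N); have := Rabs_pos (v0 (@vzero N)); lra.
pose mu := Rmin ((1 - lam0) / 2) (e / (16 * (B + 1))).
have mu0 : 0 < mu by apply: Rmin_pos; [lra | apply: Rdiv_lt_0_compat; lra].
have mu1 : mu <= (1 - lam0) / 2 := Rmin_l _ _.
have mu2 : mu * (B + 1) <= e / 16.
  have h : mu * (B + 1) <= e / (16 * (B + 1)) * (B + 1) by apply: Rmult_le_compat_r; [lra | exact: Rmin_r].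
  have q : e / (16 * (B + 1)) * (B + 1) = e / 16 by field; lra.
  lra.
pose eta := e / (4 * (Hm + 1)).
have eta0 : 0 < eta by apply: Rdiv_lt_0_compat; lra.
have etaH : eta * (Hm + 1) = e / 4 by rewrite /eta; field; lra.
have [T [T0 HT]] := K (1 - mu) eta ltac:(lra) eta0 (e / 4) ltac:(lra).
exists T; split=> // x t h tT hh; have := HT x t h tT (proj1 hh); rewrite /gap.
have h1 : eta * h <= eta * Hm by apply: Rmult_le_compat_l; lra.
have h2 : Rabs (mu * (u x (t + h) - v0 x)) <= mu * (2 * B).
  rewrite Rabs_mult Rabs_pos_eq; last lra.
  apply: Rmult_le_compat_l; first lra.
  by have := Hu x (t + h) ltac:(lra); have := Hv x; split_Rabs; lra.
by move: h2; split_Rabs; lra.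
Qed.

(** The case of equal momenta: [eta / lam > eta], so the inequality for all indices contradicts the
    one for some index. *)
Lemma degenerate_contradiction lam eta xs p : 0 < lam < 1 -> 0 < eta -> (forall th, eta / lam + G th xs p <= 0) ->
  (forall e, 0 < e -> exists th, - e <= eta + G th xs p) -> False.
Proof.
move=> l e h1 h2; have : 0 < / lam * (1 - lam) by apply: Rmult_lt_0_compat; [apply: Rinv_0_lt_compat | ]; lra.
rewrite (_ : / lam * (1 - lam) = / lam - 1); last by field; lra.
move=> h3; have h4 : 0 < eta * (/ lam - 1) by exact: Rmult_lt_0_compat.
have [th h5] := h2 (eta * (/ lam - 1) / 2) ltac:(lra).
by have := h1 th; rewrite /Rdiv in h5 *; lra.
Qed.

(** If [p <> q], strict convexity makes the combination of the two subsolution inequalities, with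
    weights [lam] and [1 - lam], incompatible with the supersolution inequality at the convex
    combination, by a margin uniform in the index. *)
Lemma asymptotically_decreasing_A : hypA sigma H -> asymptotically_decreasing.
Proof.
move=> [cvx strict]; have [cv pv L0 lv sv _] := Sv.
have [Bv HBv] := stationary_bounded Sv. have [Bu [Bu0 HBu]] := evolution_bounded Eu Sv.
have Bv0 : 0 <= Bv by have := HBv (@vzero N); have := Rabs_pos (v (@vzero N)); lra.
apply: (decreasing_of_gap_bounds (v0 := v) (B := Bu + Bv) (lam0 := 0)) => [||x t t0|lam eta l01 eta0]; first lra.
- by move=> x; have := HBv x; lra.
- by have := HBu x t t0; lra.
apply: (gap_bound Eu cv pv L0 lv (evo_G Eu) sv l01 eta0 _ kap0 Hkap HSS) => [th x p1 p2 _|x t t0|x|xs Sx].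
- have := cvx th x (/ lam *^ p1) (/ (1 - lam) *^ p2) lam ltac:(lra).
  rewrite (_ : vadd _ _ = p1 +^ p2); last by vfield; lra.
  by rewrite /G; lra.
- by have := HBu x t t0; lra.
- by have := HBv x; lra.
right=> -[p [q [nq h1 h2 h3]]]; case: (classic (p = q)) => [e|ne].
  apply: (degenerate_contradiction l01 eta0 h1) => e' e'0; have [th h] := h3 e' e'0; exists th.
  by move: h; rewrite -e (_ : _ +^ _ = p) //; vring.
have [et [et0 het]] := strict xs p q lam Sx l01 ne.
have [th h] := h3 (et / 2) ltac:(lra).
have := het th; rewrite /G in h1 h2 h *; have := Rmult_le_compat_l lam _ _ ltac:(lra) (h1 th).
have := Rmult_le_compat_l (1 - lam) _ _ ltac:(lra) (h2 th).
rewrite (_ : lam * (eta / lam + (H th xs p - c)) = eta + lam * (H th xs p - c)); last by field; lra.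
lra.
Qed.

(** With [v0 = 0], [G2 = 0] and [L2 = 0] the momentum [q] vanishes; the scaling condition is used
    with [mu = / lam], whence [lam > / mu0], and its strict form at the momentum [lam p]. *)
Lemma asymptotically_decreasing_B : hypB sigma H c -> asymptotically_decreasing.
Proof.
move=> [mu0 [mu01 [sc [K [perK [cK [KS [HK strict]]]]]]]].
have [th0 _] := stationary_inhabited Sv.
have [Bu [Bu0 HBu]] := evolution_bounded Eu Sv.
have im : 0 < / mu0 by apply: Rinv_0_lt_compat; lra.
have im1 : / mu0 < 1 by rewrite -Rinv_1; apply: Rinv_lt_contravar; lra.
have z0 : forall x : pt N, Rabs 0 <= Bu by move=> _; rewrite Rabs_R0.
apply: (decreasing_of_gap_bounds (v0 := fun _ => 0) (B := Bu) (lam0 := / mu0)) => //; first lra.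
move=> lam eta l01 eta0; have l : 0 < lam < 1 by lra.
have lip0 : forall x y : pt N, Rabs ((fun _ => 0) x - (fun _ => 0) y) <= 0 * vnorm (x -^ y).
  by move=> x y; rewrite Rminus_diag Rabs_R0; lra.
have ilam : 1 < / lam < mu0.
  split; first by rewrite -Rinv_1; apply: Rinv_lt_contravar; lra.
  by rewrite -(Rinv_inv mu0); apply: Rinv_lt_contravar; [apply: Rmult_lt_0_compat | ]; lra.
have per0 : periodic (fun _ : pt N => 0) by [].
apply: (gap_bound Eu (@rcont_const N 0) per0 (Rle_refl 0) lip0 (@loclip_zero N Theta) (@stat_sub_zero N Theta sigma) l eta0 _ kap0 Hkap HSS HBu z0).
- move=> th x p1 p2 hp.
  have p20 : p2 = @vzero N by apply: vnorm_eq0; have := vnorm_ge0 p2; lra.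
  rewrite p20 (_ : p1 +^ @vzero N = p1); last by vring.
  have h := sc th x p1 (/ lam) ilam; rewrite /G.
  have := Rmult_le_compat_l lam _ _ ltac:(lra) (Rge_le _ _ h).
  have -> : lam * ((1 - / lam) * c) = lam * c - c by field; lra.
  have -> : lam * (H th x (vscal (/ lam) p1) - / lam * H th x p1) = lam * H th x (/ lam *^ p1) - H th x p1 by field; lra.
  lra.
move=> xs Sx; case: (classic (K xs)) => [Kx|nK].
  by left; apply: (nonincreasing_at Eu th0 Sx) => th p; have := HK th xs p Kx; rewrite /G; lra.
right=> -[p [q [nq h1 _ h3]]].
have q0 : q = @vzero N by apply: vnorm_eq0; have := vnorm_ge0 q; lra.
have qE : lam *^ p +^ (1 - lam) *^ q = lam *^ p by rewrite q0; vring.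
rewrite qE in h3.
case: (classic (p = @vzero N)) => [pz|pz].
  apply: (degenerate_contradiction l eta0 h1); rewrite pz.
  by move: h3; rewrite pz (_ : lam *^ @vzero N = @vzero N) //; vring.
(* [K] is closed, so a point outside it is at positive distance. *)
have far : dist_neq0 K xs by move=> D; apply: nK; exact: cK.
have lp0 : lam *^ p <> @vzero N.
  move=> e; apply: pz; rewrite (_ : p = / lam *^ (lam *^ p)); last by vfield; lra.
  by rewrite e; vring.
have [et [et0 het]] := strict xs (lam *^ p) (/ lam) Sx far lp0 ltac:(lra).
have [th h] := h3 (lam * et / 2) ltac:(have := Rmult_lt_0_compat lam et; lra).
have := Rmult_le_compat_l lam _ _ ltac:(lra) (Rge_le _ _ (het th)).
rewrite (_ : vscal (/ lam) (lam *^ p) = p); last by vfield; lra.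
rewrite (_ : lam * ((1 - / lam) * c + et) = lam * c - c + lam * et); last by field; lra.
rewrite (_ : lam * (H th xs p - / lam * H th xs (lam *^ p)) = lam * H th xs p - H th xs (lam *^ p)); last by field; lra.
have := Rmult_le_compat_l lam _ _ ltac:(lra) (h1 th); rewrite /G in h *.
rewrite (_ : lam * (eta / lam + (H th xs p - c)) = eta + lam * (H th xs p - c)); last by field; lra.
have : 0 < lam * et by apply: Rmult_lt_0_compat; lra.
lra.
Qed.
End AsymptoticDecrease.

(** * Long time limit *)

Section LongTimeLimit.
Variables (N : nat) (Theta : Type) (C : R) (sigma : Theta -> pt N -> mat N) (G : Theta -> pt N -> pt N -> R).
Variables (u : pt N -> R -> R) (B : R).
Hypothesis Eu : evolution C sigma G u.
Hypothesis HB : forall x t, 0 <= t -> Rabs (u x t) <= B.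
Hypothesis Dec : asymptotically_decreasing u.
Implicit Types (x y p : pt N) (t s : R).

(** The integer translates have [W]-limits [w x m], nonincreasing in [m] by asymptotic decrease,
    hence convergent. At two consecutive times [n + m] and [n + m + 1] the solution is then close to
    the limit, and almost monotonicity squeezes it in between. *)
Lemma limit_profile : exists w : pt N -> R, [/\ periodic w, forall x y, Rabs (w x - w y) <= C * vnorm (x -^ y) &
  forall e, 0 < e -> exists tau, 0 <= tau /\ forall x t, 0 <= t <= 1 -> Rabs (u x (tau + t) - w x) <= e].
Proof.
have C0 := Rlt_le _ _ (evo_C Eu); have lu := evo_lip Eu.
have nn n m : 0 <= INR n + INR m by have := pos_INR n; have := pos_INR m; lra.
have ex (xm : pt N * nat) : exists l, wlim (fun n => u xm.1 (INR n + INR xm.2)) l.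
  by apply: (wlim_ex (M := B)); apply: W_all => n; exact: HB.
have [w0 Hw0] := fun_choice ex; pose w x m := w0 (x, m).
have Hw x m : wlim (fun n => u x (INR n + INR m)) (w x m) := Hw0 (x, m).
have wB x m : Rabs (w x m) <= B.
  apply: Rabs_le; split.
    by apply: (wlim_ge (Hw x m)); apply: W_all => n; have := HB x (nn n m); split_Rabs; lra.
  by apply: (wlim_le (Hw x m)); apply: W_all => n; have := HB x (nn n m); split_Rabs; lra.
have wL x y m : Rabs (w x m - w y m) <= C * vnorm (x -^ y).
  apply: eps_le => e e0; have [n [h1 h2]] := W_ex (W_and (Hw x m (e / 2) ltac:(lra)) (Hw y m (e / 2) ltac:(lra))).
  by have := lu x y (INR n + INR m); move: h1 h2; split_Rabs; lra.
have wmono x m m' : le m m' -> w x m' <= w x m.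
  move=> mm; apply: eps_le => e e0; have := le_INR _ _ mm => mmR.
  have [T [T0 HT]] := Dec (e := e / 3) (Hm := INR m' - INR m) ltac:(lra) ltac:(lra).
  have [k [k0 Hk]] := archimed_cor1 (/ (T + 1)) ltac:(apply: Rinv_0_lt_compat; lra).
  have [n [h1 [h2 h3]]] := W_ex (W_and (Hw x m (e / 3) ltac:(lra)) (W_and (Hw x m' (e / 3) ltac:(lra)) (W_ge k))).
  have kT : T <= INR n + INR m.
    have kp : 0 < INR k by exact: lt_0_INR.
    have : T + 1 < INR k by apply: Rinv_lt_cancel => //; lra.
    by have := le_INR _ _ h3; have := pos_INR m; lra.
  have := HT x _ (INR m' - INR m) kT ltac:(lra); rewrite (_ : _ + (INR m' - INR m) = INR n + INR m'); last by ring.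
  by move: h1 h2; split_Rabs; lra.
have [v Hv] := fun_choice (fun x => wlim_ex (W_all (wB x))).
have vw x m : v x <= w x m.
  by apply: (wlim_le (Hv x)); apply: W_mono (W_ge m) => n; exact: wmono.
have vL x y : Rabs (v x - v y) <= C * vnorm (x -^ y).
  apply: eps_le => e e0; have [n [h1 h2]] := W_ex (W_and (Hv x (e / 2) ltac:(lra)) (Hv y (e / 2) ltac:(lra))).
  by have := wL x y n; move: h1 h2; split_Rabs; lra.
have wper m : periodic (w^~ m).
  move=> x k; apply: cond_eq => e e0.
  have [n [h1 h2]] := W_ex (W_and (Hw x m (e / 2) ltac:(lra)) (Hw (fun i => x i + IZR (k i)) m (e / 2) ltac:(lra))).
  by move: h2; rewrite (evo_per Eu); move: h1; split_Rabs; lra.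
have vper : periodic v.
  move=> x k; apply: cond_eq => e e0.
  have [n [h1 h2]] := W_ex (W_and (Hv x (e / 2) ltac:(lra)) (Hv (fun i => x i + IZR (k i)) (e / 2) ltac:(lra))).
  by move: h2; rewrite (wper n); move: h1; split_Rabs; lra.
exists v; split=> // e e0; have e4 : 0 < e / 4 by lra.
have [T [T0 HT]] := Dec (e := e / 4) (Hm := 1) ltac:(lra) ltac:(lra).
have [m Hm] := W_ex (wlim_uniform C0 (fun h (_ : vnorm h <= INR N) => Hv h) (W_all (fun n h h' _ _ => wL h h' n)) e4).
have U1 := wlim_uniform C0 (fun h (_ : vnorm h <= INR N) => Hw h m) (W_all (fun n h h' _ _ => lu h h' _)) e4.
have U2 := wlim_uniform C0 (fun h (_ : vnorm h <= INR N) => Hw h m.+1) (W_all (fun n h h' _ _ => lu h h' _)) e4.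
have [k [k0 Hk]] := archimed_cor1 (/ (T + 1)) ltac:(apply: Rinv_0_lt_compat; lra).
have [n [h1 [h2 h3]]] := W_ex (W_and U1 (W_and U2 (W_ge k))).
have nT : T <= INR n + INR m.
  have kp : 0 < INR k by exact: lt_0_INR.
  have : T + 1 < INR k by apply: Rinv_lt_cancel => //; lra.
  by have := le_INR _ _ h3; have := pos_INR m; lra.
exists (INR n + INR m); split; first exact: nn.
move=> x t ht; have [y [_ ny Hy]] := periodic_repr x.
rewrite -(Hy _ _ vper) -(Hy _ _ (evo_per Eu (INR n + INR m + t))).
have a1 : Rabs (u y (INR n + INR m) - w y m) < e / 4 := h1 y ny.
have a2 : Rabs (u y (INR n + INR m.+1) - w y m.+1) < e / 4 := h2 y ny.
have a3 : Rabs (w y m - v y) < e / 4 := Hm y ny.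
have a4 := vw y m.+1.
have a5 := HT y (INR n + INR m) t nT ht.
have := HT y (INR n + INR m + t) (1 - t) ltac:(lra) ltac:(lra).
rewrite (_ : INR n + INR m + t + (1 - t) = INR n + INR m.+1); last by rewrite S_INR; ring.
by move=> a6; move: a1 a2 a3; split_Rabs; lra.
Qed.

Lemma perturbed_test_close phi Dphi D2phi x0 e : C2 phi Dphi D2phi -> 0 < e -> exists d, [/\ 0 < d, d <= 1 &
  forall th x b, Rabs b <= d -> vnorm (x -^ x0) < d ->
   Rabs (trAX sigma th x (madd (D2phi x) (mscal (2 * b) (@mid N))) - trAX sigma th x0 (D2phi x0)) <= e /\
   Rabs (G th x (Dphi x +^ (2 * b) *^ (x -^ x0)) - G th x0 (Dphi x0)) <= e].
Proof.
move=> CP e0; have [HC bd sl _ lG _ _ _ _ _] := Eu.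
have CC : 0 < C * C by exact: Rmult_lt_0_compat.
have [d1 [d10 hlop]] := lop_close N (D2phi x0) (Rlt_le _ _ HC) (e := e / 2) ltac:(lra).
have n0 := vnorm_ge0 (Dphi x0).
have [K [K0 HK]] := lG (vnorm (Dphi x0) + 3) ltac:(lra).
pose g := Rmin 1 (e / (4 * (K + 1))).
have g0 : 0 < g by apply: Rmin_pos; [lra | apply: Rdiv_lt_0_compat; lra].
have g1 : g <= 1 := Rmin_l _ _.
have g2 : g * (K + 1) <= e / 4.
  have h : g * (K + 1) <= e / (4 * (K + 1)) * (K + 1) by apply: Rmult_le_compat_r; [lra | exact: Rmin_r].
  have q : e / (4 * (K + 1)) * (K + 1) = e / 4 by field; lra.
  lra.
have [d2 [d20 hgrad]] := C2_grad_close x0 CP g0.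
have [d3 [d30 hhess]] := C2_hess_close x0 CP d10.
have q1 : 0 < d1 / C by exact: Rdiv_lt_0_compat.
have q2 : 0 < e / (4 * (C * C)) by apply: Rdiv_lt_0_compat; lra.
have [n [h1 [h2 [h3 [h4 [h5 h6]]]]]] := W_ex (W_and (W_inv d20) (W_and (W_inv d30) (W_and (W_inv q1) (W_and (W_inv q2) (W_and (W_inv Rlt_0_1) (@W_inv (g / 2) ltac:(lra))))))).
have d0 := invS_gt0 n; set d := / INR n.+1 in h1 h2 h3 h4 h5 h6 d0.
exists d; split=> // [|th x b hb hx]; first lra.
have b0 := Rabs_pos b; have x00 := vnorm_ge0 (x -^ x0).
split.
  rewrite !trAX_lop lop_madd lop_mscal lop_id.
  have cl k : vnorm (cols sigma th x k -^ cols sigma th x0 k) < d1.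
    apply: Rle_lt_trans (cols_lip HC sl th x x0 k) _.
    have q : C * (d1 / C) = d1 by field; lra.
    by rewrite -q; apply: Rmult_lt_compat_l; lra.
  have := hlop _ _ (D2phi x) (cols_norm HC bd th x0) cl (hhess x ltac:(lra)).
  have t2 := cols_trsq bd th x; have t20 := trsq_ge0 (cols sigma th x).
  have : Rabs (2 * b * trsq (cols sigma th x)) <= e / 2.
    rewrite !Rabs_mult (Rabs_pos_eq (trsq _)) // (Rabs_pos_eq 2); last lra.
    have a1 : 2 * Rabs b * trsq (cols sigma th x) <= 2 * Rabs b * (C * C) by apply: Rmult_le_compat_l; lra.
    have a2 : Rabs b * (C * C) <= e / (4 * (C * C)) * (C * C) by apply: Rmult_le_compat_r; lra.
    have a3 : e / (4 * (C * C)) * (C * C) = e / 4 by field; lra.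
    lra.
  by split_Rabs; lra.
have bx : Rabs b * vnorm (x -^ x0) <= d by rewrite -[d]Rmult_1_r; apply: Rmult_le_compat; lra.
set P := Dphi x +^ _.
have dP : vnorm (P -^ Dphi x0) <= 2 * g.
  rewrite (_ : P -^ Dphi x0 = (Dphi x -^ Dphi x0) +^ (2 * b) *^ (x -^ x0)); last by rewrite /P; vring.
  apply: Rle_trans (vnorm_tri _ _) _; rewrite vnorm_scal Rabs_mult (Rabs_pos_eq 2); last lra.
  by have := hgrad x ltac:(lra); lra.
have nP : vnorm P <= vnorm (Dphi x0) + 3 by have := vnorm_le_dist P (Dphi x0); lra.
apply: Rle_trans (HK th x x0 P (Dphi x0) nP ltac:(lra)) _.
have : K * (vnorm (x -^ x0) + vnorm (P -^ Dphi x0)) <= K * (3 * g) by apply: Rmult_le_compat_l; lra.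
lra.
Qed.

(** On a unit time interval [u] is uniformly close to the time-independent [w]. A contact of [w],
    penalized in space and around the time [1 / 2], becomes a contact of [u] with a small time
    derivative. *)
Lemma limit_stationary w : (forall x y, Rabs (w x - w y) <= C * vnorm (x -^ y)) ->
  (forall e, 0 < e -> exists tau, 0 <= tau /\ forall x t, 0 <= t <= 1 -> Rabs (u x (tau + t) - w x) <= e) ->
  stat_sub sigma G w /\ stat_super sigma G w.
Proof.
move=> wL Hw.
(* The sign treats contacts from above and from below at once. *)
have touch sgn phi Dphi D2phi x0 d : Rabs sgn = 1 -> C2 phi Dphi D2phi -> 0 < d ->
  locmax (fun x => sgn * w x) (fun x => sgn * phi x) x0 ->
  exists tau x1 t1 b, [/\ 0 <= tau, 0 < t1 < 1, vnorm (x1 -^ x0) < d, 0 < b <= d &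
    2 * b * Rabs (t1 - 1 / 2) <= d /\
    exists r, 0 < r /\ forall x t, vnorm (x -^ x1) < r -> Rabs (t - t1) < r ->
     sgn * (u x (t + tau) - phi x) - b * dot (x -^ x0) (x -^ x0) - b * ((t - 1 / 2) * (t - 1 / 2)) <=
     sgn * (u x1 (t1 + tau) - phi x1) - b * dot (x1 -^ x0) (x1 -^ x0) - b * ((t1 - 1 / 2) * (t1 - 1 / 2))].
  move=> sg1 CP d0 [r [r0 lm]].
  have [n [h1 [h2 h3]]] := W_ex (W_and (W_inv d0) (W_and (W_inv r0) (@W_inv (1 / 2) ltac:(lra)))).
  have rho0 := invS_gt0 n; set rho := / INR n.+1 in h1 h2 h3 rho0.
  have rr : 0 < rho * rho by exact: Rmult_lt_0_compat.
  (* With penalty coefficient [rho] on a ball of radius [rho], an approximation error below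
     [rho^3 / 2] keeps the maximum interior. *)
  pose e := rho * (rho * rho) / 4.
  have e0 : 0 < e by have := Rmult_lt_0_compat _ _ rho0 rr; rewrite /e; lra.
  have [tau [tau0 Ht]] := Hw e e0.
  have cu := evo_cont (evolution_shift tau0 Eu).
  have cF := rcont_scal sgn (rcont_sub (rcont2_rcont cu) (rcont2_rcont (rcont_stationary (C2_rcont CP)))).
  pose z0 := mk (1 / 2) x0.
  have xd z : vnorm (xpart z -^ x0) <= vnorm (z -^ z0).
    by have := xpart_norm (z -^ z0); rewrite (_ : xpart (z -^ z0) = xpart z -^ x0) // -[x0 in RHS](xpart_mk (1 / 2)).
  have td z : Rabs (tpart z - 1 / 2) <= vnorm (z -^ z0).
    by have := tpart_norm (z -^ z0); rewrite (_ : tpart (z -^ z0) = tpart z - 1 / 2) // /tpart /vsub /z0 mk_t.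
  have cl x t : 0 <= t <= 1 -> Rabs (sgn * (u x (t + tau) - phi x) - (sgn * w x - sgn * phi x)) <= e.
    move=> ht; rewrite (_ : _ - _ = sgn * (u x (tau + t) - w x)); last by rewrite (Rplus_comm t); ring.
    by rewrite Rabs_mult sg1 Rmult_1_l; exact: Ht.
  have HM z : vnorm (z -^ z0) <= rho -> sgn * (u (xpart z) (tpart z + tau) - phi (xpart z)) <= sgn * w x0 - sgn * phi x0 + e.
    move=> hz; have a1 := xd z; have a2 := td z.
    have := cl (xpart z) (tpart z) ltac:(move: a2; split_Rabs; lra); have := lm (xpart z) ltac:(lra).
    by split_Rabs; lra.
  have Hz0 : sgn * w x0 - sgn * phi x0 + e - 2 * e <= sgn * (u (xpart z0) (tpart z0 + tau) - phi (xpart z0)).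
    by rewrite /z0 xpart_mk /tpart mk_t; have := cl x0 (1 / 2) ltac:(lra); split_Rabs; lra.
  have [z [k1 _ k3]] := penalized_max cF rho0 rho0 HM Hz0 ltac:(have := Rmult_lt_0_compat _ _ rho0 rr; rewrite /e; lra).
  have a1 := xd z; have a2 := td z.
  exists tau, (xpart z), (tpart z), rho; split=> //; try lra.
    by move: a2; split_Rabs; lra.
  split.
    have : 2 * rho * Rabs (tpart z - 1 / 2) <= 2 * rho * (1 / 2) by apply: Rmult_le_compat_l; lra.
    lra.
  exists ((rho - vnorm (z -^ z0)) / 2); split; first lra.
  move=> x t hx ht.
  have inb : vnorm (mk t x -^ z0) <= rho.
    have := vdist_tri z (mk t x) z0; have := mk_norm (t - tpart z) (x -^ xpart z).
    rewrite (_ : mk t x -^ z = mk (t - tpart z) (x -^ xpart z)); last by rewrite -mk_sub mk_parts.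
    lra.
  have := k3 _ inb; rewrite /z0 mk_sub (_ : z -^ mk (1 / 2) x0 = mk (tpart z - 1 / 2) (xpart z -^ x0)); last by rewrite -mk_sub mk_parts.
  rewrite !dot_mk !xpart_mk /tpart !mk_t; lra.
split=> phi Dphi D2phi CP x0 lm.
- move=> th; apply: eps_le => e e0.
  have [d [d0 d1 Hd]] := perturbed_test_close x0 CP (e := e / 3) ltac:(lra).
  have dm : 0 < Rmin d (e / 3) by apply: Rmin_pos; lra.
  have dm1 := Rmin_l d (e / 3); have dm2 := Rmin_r d (e / 3).
  have lm' : locmax (fun x => 1 * w x) (fun x => 1 * phi x) x0.
    by case: lm => r [r0 lm]; exists r; split=> // y hy; have := lm y hy; lra.
  have [tau [x1 [t1 [b [tau0 ht hx hb [hbt [r [r0 Hm]]]]]]]] := touch 1 _ _ _ _ _ Rabs_R1 CP dm lm'.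
  have [c1 c2 c3] := quadratic_chi 0 b (1 / 2).
  have lmx : exists r, 0 < r /\ forall y s, vnorm (y -^ x1) < r -> Rabs (s - t1) < r ->
      u y (s + tau) - (phi y + b * dot (y -^ x0) (y -^ x0) + (0 * s + b * ((s - 1 / 2) * (s - 1 / 2)))) <=
      u x1 (t1 + tau) - (phi x1 + b * dot (x1 -^ x0) (x1 -^ x0) + (0 * t1 + b * ((t1 - 1 / 2) * (t1 - 1 / 2)))).
    by exists r; split=> // y s hy hs; have := Hm y s hy hs; lra.
  have := evo_sub (evolution_shift tau0 Eu) (C21_separate (C2_add CP (C2_sqdist b x0)) c1 c2 c3) (T := 1) (x0 := x1) (t0 := t1) ltac:(lra).
  move=> S; have {}S := S lmx th.
  have [k1 k2] := Hd th x1 b ltac:(rewrite Rabs_pos_eq; lra) ltac:(lra).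
  have k3 : Rabs (2 * b * (t1 - 1 / 2)) <= e / 3 by rewrite Rabs_mult Rabs_pos_eq; lra.
  by move: k1 k2 k3; split_Rabs; lra.
- move=> e e0.
  have [d [d0 d1 Hd]] := perturbed_test_close x0 CP (e := e / 4) ltac:(lra).
  have dm : 0 < Rmin d (e / 4) by apply: Rmin_pos; lra.
  have dm1 := Rmin_l d (e / 4); have dm2 := Rmin_r d (e / 4).
  have lm' : locmax (fun x => -1 * w x) (fun x => -1 * phi x) x0.
    by case: lm => r [r0 lm]; exists r; split=> // y hy; have := lm y hy; lra.
  have m1 : Rabs (-1) = 1 by rewrite Rabs_Ropp Rabs_R1.
  have [tau [x1 [t1 [b [tau0 ht hx hb [hbt [r [r0 Hm]]]]]]]] := touch (-1) _ _ _ _ _ m1 CP dm lm'.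
  have [c1 c2 c3] := quadratic_chi 0 (- b) (1 / 2).
  have lmx : exists r, 0 < r /\ forall y s, vnorm (y -^ x1) < r -> Rabs (s - t1) < r ->
      (phi y + - b * dot (y -^ x0) (y -^ x0) + (0 * s + - b * ((s - 1 / 2) * (s - 1 / 2)))) - u y (s + tau) <=
      (phi x1 + - b * dot (x1 -^ x0) (x1 -^ x0) + (0 * t1 + - b * ((t1 - 1 / 2) * (t1 - 1 / 2)))) - u x1 (t1 + tau).
    by exists r; split=> // y s hy hs; have := Hm y s hy hs; lra.
  have := evo_super (evolution_shift tau0 Eu) (C21_separate (C2_add CP (C2_sqdist (- b) x0)) c1 c2 c3) (T := 1) (x0 := x1) (t0 := t1) ltac:(lra).
  move=> S; have [th Hth] := S lmx (e / 4) ltac:(lra).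
  exists th.
  have [k1 k2] := Hd th x1 (- b) ltac:(rewrite Rabs_Ropp Rabs_pos_eq; lra) ltac:(lra).
  have k3 : Rabs (2 * - b * (t1 - 1 / 2)) <= e / 4 
    by rewrite (_ : 2 * - b * (t1 - 1 / 2) = - (2 * b * (t1 - 1 / 2))); [rewrite Rabs_Ropp Rabs_mult (Rabs_pos_eq (2 * b)); lra | ring].
  by move: k1 k2 k3; split_Rabs; lra.
Qed.

(** Closeness at one time suffices: by contraction, a bound on the distance to the stationary [w]
    persists afterwards. *)
Lemma evolution_convergence : exists w, [/\ periodic w, stationary sigma G w C &
  forall e, 0 < e -> exists T, forall t, T <= t -> forall x, Rabs (u x t - w x) < e].
Proof.
have [w [pw wL Hw]] := limit_profile; have [Sw Sw'] := limit_stationary wL Hw.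
have Stw : stationary sigma G w C.
  by split=> //; [exact: rcont_lip wL | have := evo_C Eu; lra].
exists w; split=> // e e0; have [tau [tau0 H]] := Hw (e / 2) ltac:(lra).
exists tau => t ht x.
have init y : Rabs (u y (0 + tau) - w y) <= e / 2.
  by have := H y 0 ltac:(lra); rewrite Rplus_comm.
have := evolution_stationary_contraction (evolution_shift tau0 Eu) Stw init x (t := t - tau) ltac:(lra).
by rewrite (_ : t - tau + tau = t); [lra | ring].
Qed.
End LongTimeLimit.

(** * From the given notions of viscosity solution to the renormalized evolution *)

Section ViscositySolutions.
Variables (N : nat) (Theta : Type) (sigma : Theta -> pt N -> mat N) (H : Theta -> pt N -> pt N -> R) (c : R).
Let G th x p := H th x p - c.

Lemma stat_visc_solP v : stat_visc_sol sigma H 0 c v <-> [/\ rcont v, stat_sub sigma G v & stat_super sigma G v].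
Proof.
split=> [[cv [s S]]|[cv s S]]; split=> //.
- move=> phi Dphi D2phi CP x0 lm th; have := s _ _ _ CP x0 lm th; rewrite /opterm /G; lra.
- move=> phi Dphi D2phi CP x0 [r [r0 lm]] e e0.
  have [|th Hth] := S _ _ _ CP x0 _ e e0.
    by exists r; split=> // y hy; have := lm y hy; lra.
  by exists th; move: Hth; rewrite /opterm /G; lra.
split=> phi Dphi D2phi CP x0.
- by move=> lm th; have := s _ _ _ CP x0 lm th; rewrite /opterm /G; lra.
- move=> [r [r0 lm]] e e0.
  have [|th Hth] := S _ _ _ CP x0 _ e e0.
    by exists r; split=> // y hy; have := lm y hy; lra.
  by exists th; move: Hth; rewrite /opterm /G; lra.
Qed.

(* The solution is frozen at negative times, which makes it continuous on the whole space-time. *)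
Definition renormalized (u : pt N -> R -> R) x t := u x (Rmax 0 t) + c * Rmax 0 t.

Lemma renormalized_pos u x t : 0 <= t -> renormalized u x t = u x t + c * t.
Proof. by move=> t0; rewrite /renormalized Rmax_right. Qed.

Lemma renormalized_cont u : rcont2_nonneg u -> rcont2 (renormalized u).
Proof.
move=> cu x t e e0.
have [d [d0 Hd]] := cu x (Rmax 0 t) (e / 2) (Rmax_l _ _) ltac:(lra).
have e1 : 0 < e / (2 * (Rabs c + 1)) by apply: Rdiv_lt_0_compat; have := Rabs_pos c; lra.
have m1 := Rmin_l d (e / (2 * (Rabs c + 1))); have m2 := Rmin_r d (e / (2 * (Rabs c + 1))).
exists (Rmin d (e / (2 * (Rabs c + 1)))); split; first exact: Rmin_pos.
move=> y s hy hs.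
have lip : Rabs (Rmax 0 s - Rmax 0 t) <= Rabs (s - t).
  by rewrite /Rmax; case: (Rle_dec 0 s) => ?; case: (Rle_dec 0 t) => ?; split_Rabs; lra.
have h := Hd y (Rmax 0 s) (Rmax_l _ _) ltac:(lra) ltac:(lra).
rewrite /renormalized (_ : _ - _ = u y (Rmax 0 s) - u x (Rmax 0 t) + c * (Rmax 0 s - Rmax 0 t)); last by ring.
apply: Rle_lt_trans (Rabs_triang _ _) _; rewrite Rabs_mult.
have q1 : Rabs c * Rabs (Rmax 0 s - Rmax 0 t) <= Rabs c * (e / (2 * (Rabs c + 1))).
  by apply: Rmult_le_compat_l; [exact: Rabs_pos | lra].
have q2 : e / (2 * (Rabs c + 1)) * (Rabs c + 1) = e / 2 by field; have := Rabs_pos c; lra.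
by lra.
Qed.

Lemma par_visc_sol_sub u T : par_visc_sol sigma H u -> par_sub sigma G 0 T (renormalized u).
Proof.
move=> [_ [s _]] phi phit Dphi D2phi CP x0 t0 ht [r [r0 lm]] th.
have := s _ _ _ _ (C21_affine 1 0 (- c) CP) x0 t0 (proj1 ht); rewrite !Rplus_0_r => K.
lapply (fun q => K q th); last first.
  exists r; split=> // y t tp hy htt; have := lm y t hy htt.
  by rewrite !renormalized_pos ?Rplus_0_r; lra.
by rewrite /opterm trAX_mscal (_ : 1 *^ Dphi x0 t0 = Dphi x0 t0) /G; [lra | vring].
Qed.

Lemma par_visc_sol_super u T : par_visc_sol sigma H u -> par_super sigma G 0 T (renormalized u).
Proof.
move=> [_ [_ s]] phi phit Dphi D2phi CP x0 t0 ht [r [r0 lm]] e e0.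
have := s _ _ _ _ (C21_affine 1 0 (- c) CP) x0 t0 (proj1 ht); rewrite !Rplus_0_r => K.
case: (K _ e e0).
  exists r; split=> // y t tp hy htt; have := lm y t hy htt.
  by rewrite !renormalized_pos ?Rplus_0_r; lra.
move=> th; rewrite /opterm trAX_mscal (_ : 1 *^ Dphi x0 t0 = Dphi x0 t0); last by vring.
by move=> h; exists th; rewrite /G; lra.
Qed.
End ViscositySolutions.

Theorem theorem2p4
  (N : nat) (Theta : Type) (C : R)
  (sigma : Theta -> pt N -> mat N) (H : Theta -> pt N -> pt N -> R)
  (CR : R -> R) (kappa : R)
  (u : pt N -> R -> R) (u0 : pt N -> R) (c : R)
  (HC : 0 < C)
  (* sigma_theta in W^{1,oo}(T^N; M_N), |sigma_theta| <= C, |D sigma_theta| <= C *)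
  (Hsig_per : forall th, periodic (sigma th))
  (Hsig_bd : forall th x, mnorm (sigma th x) <= C)
  (Hsig_lip : forall th x y, mnorm (msub (sigma th x) (sigma th y)) <= C * vnorm (vsub x y))
  (* H_theta : periodic in x, |H_theta(x,0)| <= C, locally Lipschitz uniformly in theta *)
  (HH_per : forall th p, periodic (fun x => H th x p))
  (HH_0 : forall th x, Rabs (H th x ((@vzero N))) <= C)
  (HCR_pos : forall R0, 0 < R0 -> 0 < CR R0)
  (HH_lip : forall R0, 0 < R0 -> forall th x y p q,
      vnorm p <= R0 -> vnorm q <= R0 ->
      Rabs (H th x p - H th y q) <= CR R0 * (vnorm (vsub x y) + vnorm (vsub p q)))
  (* u : viscosity solution of (E), Lipschitz in x with constant C *)
  (Hu_per : forall t, periodic (fun x => u x t))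
  (Hu_sol : par_visc_sol sigma H u)
  (Hu_init : forall x, u x 0 = u0 x)
  (Hu_lip : forall x y t, 0 <= t -> Rabs (u x t - u y t) <= C * vnorm (vsub x y))
  (* existence of Lipschitz viscosity solutions of (E_lambda) *)
  (Hvlam : forall lam, 0 < lam -> exists v : pt N -> R,
      periodic v /\ (forall x y, Rabs (v x - v y) <= C * vnorm (vsub x y)) /\
      stat_visc_sol sigma H lam 0 v)
  (* c is the ergodic constant *)
  (Hc : ergodic_constant sigma H c)
  (* (SS_kappa) with kappa >= C_{2C} *)
  (Hkappa : kappa >= CR (2 * C))
  (HSS : SS sigma kappa)
  (HAB : hypA sigma H \/ hypB sigma H c) :
  exists v : pt N -> R,
    periodic v /\ stat_visc_sol sigma H 0 c v /\
    (forall eps, 0 < eps -> exists T, forall t, T <= t -> forall x,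
        Rabs (u x t + c * t - v x) < eps).
Proof.
(* Subtracting [c] turns (S) into an equation with right-hand side [0], whose evolution is solved by
   [u + c t]. *)
pose G th x p := H th x p - c.
have cp2 : 0 < 2 * C by lra.
have lG : loclip G.
  move=> R0 R00; exists (CR R0); split=> [|th x y p q hp hq]; first exact: Rlt_le (HCR_pos _ R00).
  by rewrite (_ : G th x p - G th y q = H th x p - H th y q); [exact: HH_lip | rewrite /G; ring].
have kap0 : 0 <= kappa by have := HCR_pos _ cp2; lra.
have Hkap th x p q : vnorm p <= 2 * C -> vnorm q <= 2 * C -> Rabs (G th x p - G th x q) <= kappa * vnorm (p -^ q).
  move=> hp hq; rewrite (_ : G th x p - G th x q = H th x p - H th x q); last by rewrite /G; ring.
  apply: Rle_trans (HH_lip _ cp2 th x x p q hp hq) _; rewrite vnorm_subxx Rplus_0_l.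
  by apply: Rmult_le_compat_r; [exact: vnorm_ge0 | lra].
have Eu : evolution C sigma G (renormalized c u).
  split=> //.
  - by apply: renormalized_cont; case: Hu_sol.
  - by move=> t x k; rewrite /renormalized Hu_per.
  - move=> x y t; rewrite /renormalized (_ : _ - _ = u x (Rmax 0 t) - u y (Rmax 0 t)); last by ring.
    exact: Hu_lip (Rmax_l _ _).
  - by move=> T; exact: par_visc_sol_sub.
  - by move=> T; exact: par_visc_sol_super.
have [v [pv [[L HL] /stat_visc_solP [cv sv Sv]]]] := Hc.
have Stv : stationary sigma G v (Rabs L).
  split=> //; first exact: Rabs_pos.
  move=> x y; apply: Rle_trans (HL x y) _; apply: Rmult_le_compat_r; [exact: vnorm_ge0 | exact: Rle_abs].
have dec : asymptotically_decreasing (renormalized c u).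
  case: HAB => [hA|hB].
  - exact: (asymptotically_decreasing_A Eu Stv kap0 Hkap HSS hA).
  - exact: (asymptotically_decreasing_B Eu Stv kap0 Hkap HSS hB).
have [B [_ HB]] := evolution_bounded Eu Stv.
have [w [pw [cw _ _ _ sw Sw] Hw]] := evolution_convergence Eu HB dec.
exists w; split=> //; split; first exact/stat_visc_solP.
move=> e e0; have [T HT] := Hw e e0.
(* The renormalized solution coincides with [u + c t] only from time [0] on. *)
exists (Rmax 0 T) => t ht x; have := Rmax_l 0 T; have := Rmax_r 0 T => h1 h2.
by have := HT t ltac:(lra) x; rewrite renormalized_pos; lra.
Qed.
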